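(* Let $H_n$ be the height of a tree chosen uniformly at random from $\mathcal Y_n$. For $x$ ranging over a compact subset of $(0,\infty)$ and $h=x\sqrt n$ an integer, as $n\to\infty$, \[ \mathbb{P}(H_n=h)\sim\frac{1}{2x\sqrt{n}}\sum_{k\ge1} (k^4\lambda^4 x^4-6k^2\lambda^2 x^2)\,e^{-k^2\lambda^2 x^2/4}, \qquad \lambda:=\sqrt{2\rho+2\rho^2y'(\rho^2)}. \]
   Context: A tree in $\mathcal Y$ is a rooted, non-plane (children unordered), unlabelled binary tree: every node has either $0$ or $2$ children, trees being counted up to isomorphism; the one-node tree is included. The size of a tree is its number of external nodes (nodes with no children), and $\mathcal Y_n$ is the set of trees of size $n$. Let $y(z)=\sum_{n\ge1} |\mathcal Y_n| z^n$; it satisfies $y(z)=z+\frac12 y(z)^2+\frac12 y(z^2)$. Let $\rho$ be its radius of convergence (one has $2\rho+y(\rho^2)=1$, $y(\rho)=1$). The height of a tree is the maximum number of edges on a path from the root to an external node. *)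

(* Defs.v *)
From HB Require Import structures.
From mathcomp Require Import all_boot generic_quotient finmap.
From mathcomp Require Import boolp classical_sets functions cardinality.
From Stdlib Require Import Reals.
From Coquelicot Require Import Coquelicot.

Set Implicit Arguments.
Unset Strict Implicit.
Unset Printing Implicit Defensive.

(* The combinatorial part uses MathComp, the analytic part uses the Stdlib
   real numbers with Coquelicot's power series. *)

Local Open Scope nat_scope.

Inductive plane_tree : Type :=
  | Leaf : plane_tree
  | Node : plane_tree -> plane_tree -> plane_tree.

Fixpoint plane_tree_encode (t : plane_tree) : GenTree.tree unit :=
  match t with
  | Leaf => GenTree.Leaf tt
  | Node l r => GenTree.Node 0 [:: plane_tree_encode l; plane_tree_encode r]
  end.

Fixpoint plane_tree_decode (g : GenTree.tree unit) : option plane_tree :=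
  match g with
  | GenTree.Leaf _ => Some Leaf
  | GenTree.Node _ [:: g1; g2] =>
      match plane_tree_decode g1, plane_tree_decode g2 with
      | Some l, Some r => Some (Node l r)
      | _, _ => None
      end
  | _ => None
  end.

Lemma plane_tree_encodeK : pcancel plane_tree_encode plane_tree_decode.
Proof. by elim=> [//|l IHl r IHr] /=; rewrite IHl IHr. Qed.

HB.instance Definition _ :=
  Countable.copy plane_tree (pcan_type plane_tree_encodeK).

Fixpoint plane_size (t : plane_tree) : nat :=
  match t with
  | Leaf => 1
  | Node l r => plane_size l + plane_size r
  end.

Fixpoint plane_height (t : plane_tree) : nat :=
  match t with
  | Leaf => 0
  | Node l r => (maxn (plane_height l) (plane_height r)).+1
  end.

(* Isomorphism of rooted trees: the two children of any node may be swapped. *)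
Fixpoint iso (s t : plane_tree) : bool :=
  match s, t with
  | Leaf, Leaf => true
  | Node s1 s2, Node t1 t2 =>
      (iso s1 t1 && iso s2 t2) || (iso s1 t2 && iso s2 t1)
  | _, _ => false
  end.

Lemma iso_refl : reflexive iso.
Proof. by elim=> [//|l IHl r IHr] /=; rewrite IHl IHr. Qed.

Lemma iso_sym : symmetric iso.
Proof.
elim=> [|s1 IH1 s2 IH2] [|t1 t2] //=.
by rewrite !IH1 !IH2 (andbC (iso t1 s2)).
Qed.

Lemma iso_trans : transitive iso.
Proof.
move=> t s; elim: s t => [|s1 IH1 s2 IH2] [|t1 t2] [|u1 u2] //=.
by case/orP=> /andP[a b] /orP[] /andP[c d]; apply/orP;
  [left|right|right|left]; rewrite (IH1 _ _ a) // (IH2 _ _ b).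
Qed.

Canonical iso_equiv := EquivRel iso iso_refl iso_sym iso_trans.

(* The class of rooted, non-plane, unlabelled binary trees. *)
Definition ytree : choiceType := {eq_quot iso}%qT.

Definition ysize (t : ytree) : nat := plane_size (repr t).

Definition yheight (t : ytree) : nat := plane_height (repr t).

Lemma iso_size (s t : plane_tree) : iso s t -> plane_size s = plane_size t.
Proof.
elim: s t => [|s1 IH1 s2 IH2] [|t1 t2] //=.
by case/orP=> /andP[/IH1-> /IH2->] //; rewrite addnC.
Qed.

Lemma iso_height (s t : plane_tree) :
  iso s t -> plane_height s = plane_height t.
Proof.
elim: s t => [|s1 IH1 s2 IH2] [|t1 t2] //=.
by case/orP=> /andP[/IH1-> /IH2->] //; rewrite maxnC.
Qed.

Lemma ysize_pi (t : plane_tree) : ysize (\pi_ytree t)%qT = plane_size t.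
Proof. by apply/iso_size/eqmodP; rewrite reprK. Qed.

Lemma yheight_pi (t : plane_tree) : yheight (\pi_ytree t)%qT = plane_height t.
Proof. by apply/iso_height/eqmodP; rewrite reprK. Qed.

Definition Y (n : nat) : set ytree := [set t | ysize t = n]%classic.

(* Cardinals below are taken with [fset_set], which is meaningful only on
   finite sets. *)
Lemma Y_finite (n : nat) : finite_set (Y n).
Proof.
have size_gt0 t : 0 < plane_size t by elim: t => //= l Hl r _; rewrite addn_gt0 Hl.
suff [L HL] : exists L : seq plane_tree, forall t, plane_size t <= n -> t \in L.
  apply: (sub_finite_set _ (finite_seq [seq \pi_ytree t | t <- L]%qT)).
  move=> t /= Ht; rewrite -[t]reprK; apply: map_f.
  by apply: HL; rewrite -Ht.
elim: n => [|n [L HL]]; first by exists [::] => t; rewrite leqNgt size_gt0.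
exists (Leaf :: [seq Node l r | l <- L, r <- L]) => -[|l r] //= Hlr.
rewrite in_cons; apply/orP; right; apply: allpairs_f; apply: HL.
  by rewrite -ltnS (leq_trans _ Hlr) // -addn1 leq_add2l.
by rewrite -ltnS (leq_trans _ Hlr) // -add1n leq_add2r.
Qed.

Definition card_Y (n : nat) : nat := #|` fset_set (Y n)|%fset.

Definition card_Y_height (n h : nat) : nat :=
  #|` fset_set (Y n `&` [set t | yheight t = h])%classic|%fset.

Local Open Scope R_scope.

(* P(H_n = h) for the uniform distribution on Y n. *)
Definition prob_height (n h : nat) : R :=
  INR (card_Y_height n h) / INR (card_Y n).

(* The coefficient of index 0 is 0, since a tree has at least one leaf. *)
Definition y_coef (n : nat) : R := INR (card_Y n).

Definition y (z : R) : R := PSeries y_coef z.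

(* [real] is harmless here: the radius of convergence is finite. *)
Definition rho : R := real (CV_radius y_coef).

Definition lambda : R := sqrt (2 * rho + 2 * rho ^ 2 * Derive y (rho ^ 2)).

(* Main.v *)
(* Let y_h(z) count the trees of height at most h, e_h = y - y_h and w = 1 - y. Then
     w(z)^2 = 1 - 2 z - y(z^2),   e_(h+1) = e_h (1 - w - e_h / 2) + e_h(z^2) / 2,
   and |e_h(z^2)| <= rho^h e_h(rho), so that u_h = 1 / e_h satisfies u_(h+1) = (1 + w) u_h + 1/2 up to a small error. On the
   circle z = rho exp(-(1 + i t) / n) one has sqrt n w -> kappa = lambda sqrt(1 + i t), and for h ~ x sqrt n
     n (e_h - e_(h+1)) -> 2 kappa^2 exp(kappa x) / (exp(kappa x) - 1)^2,
   with a domination by (1 + |t|)^(-3/2) that holds on the whole circle. Hence the coefficients are obtained by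
   integrating over this circle, inside the disc of convergence: no analytic continuation beyond rho is needed.
   The limit is expanded in powers of exp(- kappa x), and each resulting integral is a Gaussian in k lambda x,
   identified by a linear differential equation in the parameter. The number of trees of size n is treated in the same
   way through (z d/dz)^2 y, which scales like the integrable (1 + i t)^(-3/2), with the same constant.
   A relative error further requires the theta series of the theorem to be bounded below on compact sets. It is positive
   termwise for large x, and the functional equation of the theta function, here in the form
   theta(t) = d / sqrt t * theta(pi^2 / t) with an unspecified d > 0, exchanges small and large x. *)

Require Import Defs.
From HB Require Import structures.
From mathcomp Require all_boot generic_quotient finmap boolp classical_sets functions cardinality zify.
From Stdlib Require Import Reals Lra Lia Psatz Arith ZArith Classical ClassicalEpsilon.
From Coquelicot Require Import Coquelicot.

(** * Counting trees by size and height *)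

(** The constant [Cg] of the limiting integrals is never evaluated: it occurs in the asymptotics of
    both counts and cancels in their quotient, so that only [Cg > 0] is needed. Passing to [1 / e_h]
    makes the quadratic recursion affine, but a step is controlled only once [e_h] is small and
    [1 / e_h] has an a priori linear bound. Hence the comparison starts at a height [J] fixed before
    [n] grows; there [e_J(z)] tends to [e_J(rho) > 0] and stays away from zero. The initial
    discrepancy is bounded, and the accumulated error has at most the order of the square root of
    the main term. Domination on the whole circle has two sources. Near [rho], the inequality
    [Re w >= 0], valid because [|y(z)| <= 1] on the closed disc, selects the square root and gives
    [|y(z)| <= exp(-c sqrt|1 - z / rho|)]. Away from [rho], the consecutive exponents in [z + z^2]
    keep [|y(z)|] below 1 by a fixed amount. The differences [e_h - e_(h+1)] inherit this decay from
    the last [h / 2] steps of the recursion. *)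

Module TreeCount.
Import all_boot generic_quotient finmap boolp classical_sets functions cardinality zify.
Local Open Scope nat_scope.
Local Set Implicit Arguments.
Local Unset Strict Implicit.

(** Unordered pairs with repetition: for a duplicate-free list every pair, diagonal included,
    appears in exactly one of its two orders, as befits the children of a non-plane node. *)
Fixpoint upairs (T : Type) (s : seq T) : seq (T * T) :=
  if s is x :: s' then [seq (x, y) | y <- s] ++ upairs s' else [::].

(* One plane representative for each tree of height at most [h]. *)
Fixpoint reps (h : nat) : seq plane_tree :=
  if h is h'.+1 then Leaf :: [seq Node p.1 p.2 | p <- upairs (reps h')]
  else [:: Leaf].

Lemma upairs_cons (T : Type) (x : T) (s : seq T) :
  upairs (x :: s) = [seq (x, y) | y <- x :: s] ++ upairs s.
Proof. by []. Qed.

Lemma upairs_sub (T : eqType) (s : seq T) (p : T * T) :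
  p \in upairs s -> (p.1 \in s) && (p.2 \in s).
Proof.
elim: s => [//|x s IH]; rewrite upairs_cons mem_cat => /orP[/mapP[y ys -> /=]|].
  by rewrite ys mem_head.
by move/IH => /andP[p1 p2]; rewrite !in_cons p1 p2 !orbT.
Qed.

Lemma upairs_total (T : eqType) (s : seq T) (x y : T) :
  x \in s -> y \in s -> ((x, y) \in upairs s) || ((y, x) \in upairs s).
Proof.
elim: s => [//|z s IH]; rewrite upairs_cons !mem_cat.
rewrite in_cons => /orP[/eqP -> ys|xs]; first by rewrite (map_f (pair z) ys).
rewrite in_cons => /orP[/eqP ->|ys].
  by rewrite [X in _ || (X || _)]map_f ?orbT // in_cons xs orbT.
by case/orP: (IH xs ys) => ->; rewrite !orbT.
Qed.

Lemma upairs_uniq (T : eqType) (s : seq T) : uniq s -> uniq (upairs s).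
Proof.
elim: s => [//|x s IH] /[dup] us' /andP[xs us].
rewrite upairs_cons cat_uniq IH // andbT map_inj_uniq; last by move=> a b [].
rewrite us' andTb; apply/hasPn => p /upairs_sub /andP[p1 _].
apply/negP => /mapP[y _ E]; move: p1; rewrite E /= => p1.
by rewrite p1 in xs.
Qed.

(** In a duplicate-free list the first component of a listed pair never comes after the second, so
    only diagonal pairs can appear in both orders. *)
Lemma upairs_asym (T : eqType) (s : seq T) (x y : T) : uniq s ->
  (x, y) \in upairs s -> (y, x) \in upairs s -> x = y.
Proof.
elim: s => [//|z s IH] /andP[zs us].
rewrite upairs_cons !mem_cat => /orP[/mapP[a _ [-> ->]]|H] /orP[/mapP[b _ [E1 E2]]|H'] //.
- by move/upairs_sub: H' => /andP[_ /= H']; rewrite H' in zs.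
- by move/upairs_sub: H => /andP[_ /= H]; rewrite E1 in H; rewrite H in zs.
- exact: IH.
Qed.

Lemma reps_complete (h : nat) (t : plane_tree) :
  plane_height t <= h -> exists2 s, s \in reps h & iso t s.
Proof.
elim: h t => [|h IH] [|l r] Ht //.
- by exists Leaf.
- by exists Leaf; rewrite // in_cons.
- move: Ht; rewrite /= ltnS geq_max => /andP[/IH[l' l1 l2] /IH[r' r1 r2]].
  case/orP: (upairs_total l1 r1) => H.
    exists (Node l' r'); last by rewrite /= l2 r2.
    by rewrite in_cons (map_f (fun p => Node p.1 p.2) H).
  exists (Node r' l'); last by rewrite /= l2 r2 orbT.
  by rewrite in_cons (map_f (fun p => Node p.1 p.2) H).
Qed.

Lemma reps_uniq (h : nat) : uniq (reps h).
Proof.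
elim: h => [//|h IH] /=; apply/andP; split.
  by apply/negP => /mapP[p _].
by rewrite map_inj_uniq ?upairs_uniq // => -[a b] [c d] /= [-> ->].
Qed.

Lemma reps_inj (h : nat) (s t : plane_tree) :
  s \in reps h -> t \in reps h -> iso s t -> s = t.
Proof.
elim: h s t => [|h IH] s t; first by rewrite !inE => /eqP -> /eqP ->.
rewrite !in_cons => /orP[/eqP ->|/mapP[[a b] p ->]]
  /orP[/eqP ->|/mapP[[c d] q ->]] //=.
have /andP[/= a1 b1] := upairs_sub p.
have /andP[/= c1 d1] := upairs_sub q.
case/orP => /andP[i j].
  by rewrite (IH _ _ a1 c1 i) (IH _ _ b1 d1 j).
(* The children are matched crosswise, so a pair and its swap are both listed; this forces the two
   children to be equal. *)
have E1 := IH _ _ a1 d1 i; have E2 := IH _ _ b1 c1 j; subst.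
by rewrite (upairs_asym (reps_uniq h) p q).
Qed.

(** Transfers cardinals of sets of isomorphism classes to counting in a list: the classes of the
    selected representatives are distinct by [reps_inj] and exhaust the set by [reps_complete].
    Invariance of [P] makes the choice made by [repr] irrelevant. *)
Lemma card_reps (P : pred plane_tree) (h : nat) :
  (forall s t, iso s t -> P s = P t) ->
  (forall t, P t -> plane_height t <= h) ->
  #|` fset_set [set t : ytree | P (repr t)]%classic |%fset = count P (reps h).
Proof.
move=> Pinv Ph.
pose s := [seq \pi_ytree t | t <- reps h & P t]%qT.
have sE t : (t \in s) = P (repr t).
  apply/mapP/idP => [[u]|Pt].
    rewrite mem_filter => /andP[Pu _] ->; rewrite (Pinv _ u) //.
    by apply/eqmodP; rewrite reprK.
  have [u uh iu] := reps_complete (Ph _ Pt).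
  exists u; first by rewrite mem_filter uh -(Pinv _ _ iu) Pt.
  by rewrite -[t]reprK; apply/eqmodP.
have us : uniq s.
  rewrite map_inj_in_uniq ?filter_uniq ?reps_uniq //.
  move=> a b; rewrite !mem_filter => /andP[_ a1] /andP[_ b1] /eqmodP i.
  exact: (reps_inj a1 b1 i).
have -> : [set t : ytree | P (repr t)]%classic = [set` s]%classic.
  by apply/seteqP; split => t /=; rewrite sE.
rewrite -size_filter -(size_map (fun t => \pi_ytree t)%qT) -/s.
have -> : fset_set [set` s]%classic = [fset x in s]%fset.
  apply/fsetP => x; rewrite in_fset_set; last exact: finite_seq.
  by rewrite !inE; apply/idP/idP; rewrite inE.
by rewrite card_fseq undup_id.
Qed.

Definition hcount (h n : nat) : nat := count (fun t => plane_size t == n) (reps h).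

Lemma hcount0 (n : nat) : hcount 0 n = (n == 1).
Proof. by rewrite /hcount /= addn0 eq_sym. Qed.

(** Each off-diagonal unordered pair comes from two ordered pairs, each diagonal one from a single
    ordered pair; adding the diagonal once more evens this out. This is the origin of the term
    [y(z^2) / 2]. *)
Lemma count_upairs (s : seq plane_tree) (n : nat) :
  2 * count (fun p => plane_size p.1 + plane_size p.2 == n) (upairs s) =
  \sum_(t <- s) \sum_(u <- s) (plane_size t + plane_size u == n)
  + count (fun t => 2 * plane_size t == n) s.
Proof.
elim: s => [|x s IH]; first by rewrite !big_nil.
pose f t u : nat := plane_size t + plane_size u == n.
have E1 : \sum_(u <- s) f x u = count (fun u => plane_size x + plane_size u == n) s.
  by rewrite -sum1_count [RHS]big_mkcond; apply: eq_bigr => u _; rewrite /f; case: eqP.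
have E2 : \sum_(t <- s) f t x = \sum_(u <- s) f x u.
  by apply: eq_bigr => u _; rewrite /f addnC.
have E3 : \sum_(t <- s) \sum_(u <- x :: s) f t u =
          \sum_(t <- s) f t x + \sum_(t <- s) \sum_(u <- s) f t u.
  by rewrite -big_split; apply: eq_bigr => t _; rewrite big_cons.
rewrite upairs_cons map_cons cat_cons /= count_cat count_map /=.
rewrite !mulnDr {}IH big_cons big_cons -/(f x x) {}E3 {}E2 {}E1.
have -> : (2 * plane_size x == n) = f x x :> nat by rewrite /f mul2n addnn.
rewrite /preim /= /f.
rewrite -[count [pred _ | _] s]/(count (fun u => plane_size x + plane_size u == n) s).
lia.
Qed.

Lemma sum_size_pairs (s : seq plane_tree) (n : nat) :
  \sum_(t <- s) \sum_(u <- s) (plane_size t + plane_size u == n) =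
  \sum_(i < n.+1) count (fun t => plane_size t == i) s *
                  count (fun t => plane_size t == n - i) s.
Proof.
rewrite (eq_bigr (fun t => \sum_(i < n.+1) (plane_size t == i) *
    count (fun t => plane_size t == n - i) s)); last first.
  move=> t _.
  have [tn|nt] := leqP (plane_size t) n.
    rewrite (bigD1 (inord (plane_size t))) //= inordK ?ltnS // eqxx mul1n.
    rewrite [X in _ = _ + X]big1 ?addn0; last first.
      move=> i ne; case: eqP => // e; case/eqP: ne; apply: val_inj.
      by rewrite /= inordK ?ltnS.
    rewrite -sum1_count [RHS]big_mkcond; apply: eq_bigr => u _.
    have -> : (plane_size t + plane_size u == n) = (plane_size u == n - plane_size t).
      by apply/eqP/eqP; lia.
    by case: eqP.
  rewrite !big1 // => u _.
    by case: eqP => // e; have := ltn_ord u; rewrite -e ltnS leqNgt nt.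
  by case: eqP => // e; move: nt; rewrite -e ltnNge leq_addr.
rewrite exchange_big /=; apply: eq_bigr => i _.
rewrite -big_distrl /=; congr (_ * _).
by rewrite -sum1_count [RHS]big_mkcond; apply: eq_bigr => u _; case: eqP.
Qed.

(** Coefficient form of [y_(h+1) = z + y_h^2 / 2 + y_h(z^2) / 2], doubled in order to stay in the
    natural numbers. A diagonal pair has two halves of equal size, hence an even [n]. *)
Lemma hcountS (h n : nat) :
  2 * hcount h.+1 n = 2 * (n == 1) + \sum_(i < n.+1) hcount h i * hcount h (n - i)
    + (if odd n then 0 else hcount h n./2).
Proof.
rewrite /hcount [reps _.+1]/= [count _ (_ :: _)]/= count_map.
rewrite -sum_size_pairs mulnDr -addnA; congr (2 * _ + _).
  by rewrite eq_sym.
rewrite [LHS]count_upairs; congr (_ + _).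
case: ifP => on.
  apply/eqP; rewrite -leqn0 leqNgt -has_count; apply/hasPn => t _.
  by apply/eqP => e; rewrite -e mul2n odd_double in on.
apply: eq_count => t /=; rewrite mul2n; apply/eqP/eqP => [<-|->].
  by rewrite doubleK.
by rewrite -[RHS]odd_double_half on.
Qed.

Lemma size_height (t : plane_tree) : plane_height t < plane_size t.
Proof. by elim: t => //= l Hl r Hr; lia. Qed.

Lemma hcount_card (h n : nat) :
  hcount h n = #|` fset_set (Y n `&` [set t | yheight t <= h])%classic |%fset.
Proof.
have := @card_reps (fun t => (plane_size t == n) && (plane_height t <= h)) h.
have -> : [set t : ytree | (plane_size (repr t) == n) && (plane_height (repr t) <= h)]%classic
  = (Y n `&` [set t | yheight t <= h])%classic.
  apply/seteqP; split => t /=; rewrite /Y /ysize /yheight /=.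
    by case/andP => /eqP.
  by case=> -> H; rewrite eqxx.
move=> ->; first last.
- by move=> t /andP[].
- by move=> s t /[dup] /iso_size -> /iso_height ->.
apply: eq_in_count => t th.
have -> : plane_height t <= h; last by rewrite andbT.
elim: h t th => [|h IH] t; first by rewrite inE => /eqP ->.
rewrite in_cons => /orP[/eqP -> //|/mapP[[l r] /upairs_sub /andP[/= a b] ->]] /=.
by rewrite ltnS geq_max !IH.
Qed.

(** The height is smaller than the size ([size_height]), so the bound [h] excludes no tree of size
    [n]. *)
Lemma card_Y_hcount (h n : nat) : n <= h.+1 -> card_Y n = hcount h n.
Proof.
move=> nh; rewrite hcount_card /card_Y; congr (#|` fset_set _|)%fset.
apply/seteqP; split => t /=; last by case.
move=> H; split => //; rewrite -ltnS (leq_trans _ nh) //.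
by rewrite -H; apply: size_height.
Qed.

Lemma card_Y_heightS (n h : nat) :
  card_Y_height n h.+1 + hcount h n = hcount h.+1 n.
Proof.
have E : card_Y_height n h.+1 =
    count (fun t => (plane_size t == n) && (plane_height t == h.+1)) (reps h.+1).
  rewrite -card_reps /card_Y_height; first last.
  - by move=> t /andP[_ /eqP ->].
  - by move=> s t /[dup] /iso_size -> /iso_height ->.
  congr (#|` fset_set _|)%fset; apply/seteqP; split => t /=; rewrite /Y /ysize /yheight /=.
    by case=> -> ->; rewrite !eqxx.
  by case/andP => /eqP ? /eqP.
have E' : hcount h n =
    count (fun t => (plane_size t == n) && (plane_height t <= h)) (reps h.+1).
  rewrite hcount_card -card_reps; first last.
  - by move=> t /andP[_ /leq_trans]; apply.
  - by move=> s t /[dup] /iso_size -> /iso_height ->.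
  congr (#|` fset_set _|)%fset; apply/seteqP; split => t /=; rewrite /Y /ysize /yheight /=.
    by case=> -> ->; rewrite eqxx.
  by case/andP => /eqP.
have E2 : hcount h.+1 n =
    count (fun t => (plane_size t == n) && (plane_height t <= h.+1)) (reps h.+1).
  rewrite hcount_card -card_reps; first last.
  - by move=> t /andP[_].
  - by move=> s t /[dup] /iso_size -> /iso_height ->.
  congr (#|` fset_set _|)%fset; apply/seteqP; split => t /=; rewrite /Y /ysize /yheight /=.
    by case=> -> ->; rewrite eqxx.
  by case/andP => /eqP.
rewrite E E' E2 -count_predUI [X in _ + X](_ : _ = 0) ?addn0.
  apply: eq_count => t /=; rewrite -andb_orr; congr (_ && _).
  by rewrite [RHS]leq_eqVlt ltnS.
apply/eqP; rewrite -leqn0 leqNgt -has_count; apply/hasPn => t _ /=.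
by apply/negP => /andP[/andP[_ /eqP ->]]; rewrite ltnn andbF.
Qed.

Lemma INR_sum (f : nat -> nat) (n : nat) :
  INR (\sum_(i < n.+1) f i) = sum_f_R0 (fun i => INR (f i)) n.
Proof.
elim: n => [|n IH]; first by rewrite big_ord_recl big_ord0 addn0.
by rewrite big_ord_recr /= -IH plus_INR.
Qed.

End TreeCount.

Open Scope R_scope.

Definition ind1 (n : nat) : R := if Nat.eqb n 1 then 1 else 0.

Definition conv (a b : nat -> R) (n : nat) : R :=
  sum_f_R0 (fun k => a k * b (n - k)%nat) n.

(* Coefficients of [A(z^2)]. *)
Definition dil (a : nat -> R) (n : nat) : R :=
  if Nat.even n then a (Nat.div2 n) else 0.

(* Number of trees of size [n] and height at most [h]. *)
Definition ycoef_le (h n : nat) : R := INR (TreeCount.hcount h n).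

Lemma ycoef_le_0 (n : nat) : ycoef_le 0 n = ind1 n.
Proof.
unfold ycoef_le, ind1; rewrite TreeCount.hcount0.
change (eqtype.eq_op n 1%nat) with (ssrnat.eqn n 1).
replace (ssrnat.eqn n 1) with (Nat.eqb n 1); [now case (Nat.eqb n 1)|].
destruct n as [|[|n]]; reflexivity.
Qed.

Lemma ycoef_le_S (h n : nat) :
  2 * ycoef_le (S h) n =
  2 * ind1 n + conv (ycoef_le h) (ycoef_le h) n + dil (ycoef_le h) n.
Proof.
unfold ycoef_le at 1.
change 2 with (INR 2); rewrite <- mult_INR.
change (2 * TreeCount.hcount (S h) n)%nat with (ssrnat.muln 2 (TreeCount.hcount (S h) n)).
rewrite TreeCount.hcountS.
rewrite !plus_INR; f_equal; [f_equal|].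
- rewrite mult_INR; f_equal; rewrite <- ycoef_le_0.
  unfold ycoef_le; now rewrite TreeCount.hcount0.
- rewrite (TreeCount.INR_sum
    (fun i => ssrnat.muln (TreeCount.hcount h i) (TreeCount.hcount h (ssrnat.subn n i)))).
  unfold conv; apply sum_eq; intros i Hi.
  now rewrite mult_INR.
- unfold dil, ycoef_le.
  assert (E : ssrnat.half n = Nat.div2 n /\ ssrnat.odd n = negb (Nat.even n)).
  { clear; induction n as [n IH] using Wf_nat.lt_wf_ind.
    destruct n as [|[|n]]; [easy|easy|].
    destruct (IH n) as [E1 E2]; [lia|].
    simpl; rewrite E1, E2; split; [reflexivity|].
    destruct (Nat.even n); reflexivity. }
  destruct E as [-> ->]; destruct (Nat.even n); reflexivity.
Qed.

Lemma ycoef_le_eq (h n : nat) : (n <= S h)%nat -> ycoef_le h n = y_coef n.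
Proof.
intros H; unfold ycoef_le, y_coef; f_equal; symmetry.
apply TreeCount.card_Y_hcount; now apply (ssrbool.introT ssrnat.leP).
Qed.

Lemma card_Y_height_ycoef (n h : nat) :
  INR (card_Y_height n (S h)) = ycoef_le (S h) n - ycoef_le h n.
Proof.
unfold ycoef_le; rewrite <- TreeCount.card_Y_heightS, plus_INR; ring.
Qed.

(** * Complex power series with real coefficients *)

(** Convergence is split into real and imaginary parts so that the theory of real series applies
    directly. *)
Definition is_CS (a : nat -> C) (l : C) : Prop :=
  is_series (fun n => Re (a n)) (Re l) /\ is_series (fun n => Im (a n)) (Im l).

Definition CS (a : nat -> C) : C :=
  (Series (fun n => Re (a n)), Series (fun n => Im (a n))).

Lemma C_ext (u v : C) : Re u = Re v -> Im u = Im v -> u = v.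
Proof. destruct u, v; simpl; intros -> ->; reflexivity. Qed.

Lemma is_CS_unique (a : nat -> C) (l : C) : is_CS a l -> CS a = l.
Proof.
intros [H1 H2]; apply C_ext; unfold CS; simpl;
  [rewrite <- (is_series_unique _ _ H1)|rewrite <- (is_series_unique _ _ H2)]; reflexivity.
Qed.

Lemma im_le_Cmod (c : C) : Rabs (Im c) <= Cmod c.
Proof. eapply Rle_trans; [apply Rmax_r|apply (Rmax_Cmod c)]. Qed.

Lemma ex_series_Rle (a b : nat -> R) :
  (forall n, Rabs (a n) <= b n) -> ex_series b -> ex_series a.
Proof. exact (@ex_series_le R_AbsRing R_CompleteNormedModule a b). Qed.

Lemma CS_correct (a : nat -> C) : ex_series (fun n => Cmod (a n)) -> is_CS a (CS a).
Proof.
intros H; split; apply Series_correct;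
  apply (ex_series_Rle _ (fun n => Cmod (a n))); try exact H; intros n.
- apply re_le_Cmod.
- apply im_le_Cmod.
Qed.

Lemma is_CS_ext (a b : nat -> C) (l : C) : (forall n, a n = b n) -> is_CS a l -> is_CS b l.
Proof.
intros H [H1 H2]; split; (eapply is_series_ext; [|eassumption]); intros n; simpl; now rewrite H.
Qed.

Lemma is_CS_plus (a b : nat -> C) (la lb : C) :
  is_CS a la -> is_CS b lb -> is_CS (fun n => a n + b n)%C (la + lb)%C.
Proof.
intros [H1 H2] [H3 H4]; split; simpl.
- exact (is_series_plus _ _ _ _ H1 H3).
- exact (is_series_plus _ _ _ _ H2 H4).
Qed.

Lemma is_CS_scal (k : C) (a : nat -> C) (l : C) :
  is_CS a l -> is_CS (fun n => k * a n)%C (k * l)%C.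
Proof.
intros [H1 H2]; split; simpl.
- apply (is_series_minus (fun n => fst k * fst (a n)) (fun n => snd k * snd (a n)));
    apply (is_series_scal (K := R_AbsRing) (V := R_NormedModule)); assumption.
- apply (is_series_plus (fun n => fst k * snd (a n)) (fun n => snd k * fst (a n)));
    apply (is_series_scal (K := R_AbsRing) (V := R_NormedModule)); assumption.
Qed.

(** Multiplying by the conjugate of the sum [l] turns the claim into a comparison of real series:
    the real part of [Cconj l * l] is [|l|^2], and each term contributes at most [|l| * b n]. *)
Lemma is_CS_Cmod_le (a : nat -> C) (b : nat -> R) (l : C) (B : R) :
  is_CS a l -> is_series b B -> (forall n, Cmod (a n) <= b n) -> Cmod l <= B.
Proof.
intros H HB Hab.
assert (B0 : 0 <= B).
{ rewrite <- (is_series_unique _ _ HB).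
  rewrite <- (Rmult_0_l (Series b)).
  rewrite <- Series_scal_l; apply Series_le.
  - intros n; split; [lra|]. rewrite Rmult_0_l.
    eapply Rle_trans; [apply Cmod_ge_0|apply Hab].
  - now exists B. }
destruct (Req_dec (Cmod l) 0) as [E|E]; [now rewrite E|].
assert (L0 : 0 < Cmod l) by (pose proof (Cmod_ge_0 l); lra).
destruct (is_CS_scal (Cconj l) _ _ H) as [H1 _].
assert (S1 : Re (Cconj l * l)%C = Cmod l * Cmod l).
{ replace (Cmod l * Cmod l) with (Cmod l ^ 2) by ring.
  rewrite Cmod2_alt; destruct l; simpl; ring. }
rewrite S1 in H1.
apply Rmult_le_reg_l with (Cmod l); [exact L0|].
apply (is_series_scal (K := R_AbsRing) (V := R_NormedModule) (Cmod l)) in HB.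
apply (is_lim_seq_le (sum_n (fun n => Re (Cconj l * a n)%C)) (sum_n (fun n => Cmod l * b n))
  (Cmod l * Cmod l) (Cmod l * B)); [|exact H1|exact HB].
intros n; unfold sum_n; apply sum_n_m_le; intros k; simpl.
eapply Rle_trans; [apply Rle_abs|].
eapply Rle_trans; [apply (re_le_Cmod (Cconj l * a k)%C)|].
rewrite Cmod_mult, Cmod_conj.
apply Rmult_le_compat_l; [lra|apply Hab].
Qed.

Definition pterm (a : nat -> R) (z : C) (n : nat) : C := (RtoC (a n) * z ^ n)%C.

Definition CPS (a : nat -> R) (z : C) : C := CS (pterm a z).

Lemma Cmod_pterm (a : nat -> R) (z : C) (n : nat) :
  Cmod (pterm a z n) = Rabs (a n) * Cmod z ^ n.
Proof. unfold pterm; now rewrite Cmod_mult, Cmod_R, Cmod_pow. Qed.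

(** Absolute convergence on the whole closed disc of radius [r], stated at the radius only. *)
Definition acv (a : nat -> R) (r : R) : Prop := ex_series (fun n => Rabs (a n) * r ^ n).

Lemma acv_le (a : nat -> R) (r s : R) : 0 <= s <= r -> acv a r -> acv a s.
Proof.
intros Hrs H; unfold acv; apply (ex_series_Rle _ (fun n => Rabs (a n) * r ^ n)); [|exact H].
intros n; rewrite Rabs_pos_eq.
- apply Rmult_le_compat_l; [apply Rabs_pos|now apply pow_incr].
- apply Rmult_le_pos; [apply Rabs_pos|now apply pow_le].
Qed.

Lemma acv_dom (a b : nat -> R) (r : R) : 0 <= r -> (forall n, Rabs (a n) <= Rabs (b n)) ->
  acv b r -> acv a r.
Proof.
intros Hr Hab H; unfold acv; apply (ex_series_Rle _ (fun n => Rabs (b n) * r ^ n)); [|exact H].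
intros n; rewrite Rabs_pos_eq.
- apply Rmult_le_compat_r; [now apply pow_le|apply Hab].
- apply Rmult_le_pos; [apply Rabs_pos|now apply pow_le].
Qed.

Lemma acv_pterm (a : nat -> R) (z : C) : acv a (Cmod z) <-> ex_series (fun n => Cmod (pterm a z n)).
Proof.
unfold acv; split; apply ex_series_ext; intros n; now rewrite Cmod_pterm.
Qed.

Lemma CPS_correct (a : nat -> R) (z : C) : acv a (Cmod z) -> is_CS (pterm a z) (CPS a z).
Proof. intros H; apply CS_correct; now apply acv_pterm. Qed.

Lemma CPS_Cmod_le (a : nat -> R) (z : C) (r : R) : acv a r -> Cmod z <= r ->
  Cmod (CPS a z) <= Series (fun n => Rabs (a n) * r ^ n).
Proof.
intros H Hz.
apply is_CS_Cmod_le with (a := pterm a z) (b := fun n => Rabs (a n) * r ^ n).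
- apply CPS_correct; apply acv_le with r; [split; [apply Cmod_ge_0|exact Hz]|exact H].
- now apply Series_correct.
- intros n; rewrite Cmod_pterm; apply Rmult_le_compat_l; [apply Rabs_pos|].
  apply pow_incr; split; [apply Cmod_ge_0|exact Hz].
Qed.

Lemma CPS_ext (a b : nat -> R) (z : C) : (forall n, a n = b n) -> CPS a z = CPS b z.
Proof.
intros H; unfold CPS, CS, pterm; f_equal; apply Series_ext; intros n; now rewrite H.
Qed.

Lemma CPS_minus (a b : nat -> R) (z : C) : acv a (Cmod z) -> acv b (Cmod z) ->
  CPS (fun n => a n - b n) z = (CPS a z - CPS b z)%C.
Proof.
intros Ha Hb; apply is_CS_unique.
apply is_CS_ext with (fun n => pterm a z n + (RtoC (- (1))) * pterm b z n)%C.
- intros n; unfold pterm; rewrite RtoC_minus, RtoC_opp; ring.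
- replace (CPS a z - CPS b z)%C with (CPS a z + RtoC (- (1)) * CPS b z)%C by (rewrite RtoC_opp; ring).
  apply is_CS_plus; [|apply is_CS_scal]; now apply CPS_correct.
Qed.

Lemma CPS_plus (a b : nat -> R) (z : C) : acv a (Cmod z) -> acv b (Cmod z) ->
  CPS (fun n => a n + b n) z = (CPS a z + CPS b z)%C.
Proof.
intros Ha Hb; apply is_CS_unique.
apply is_CS_ext with (fun n => pterm a z n + pterm b z n)%C.
- intros n; unfold pterm; rewrite RtoC_plus; ring.
- apply is_CS_plus; now apply CPS_correct.
Qed.

Lemma CPS_scal (k : R) (a : nat -> R) (z : C) : acv a (Cmod z) ->
  CPS (fun n => k * a n) z = (RtoC k * CPS a z)%C.
Proof.
intros Ha; apply is_CS_unique.
apply is_CS_ext with (fun n => RtoC k * pterm a z n)%C.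
- intros n; unfold pterm; rewrite RtoC_mult; ring.
- apply is_CS_scal; now apply CPS_correct.
Qed.

(** The theorem on products of series is applied to the four products of real and imaginary parts,
    each of them absolutely convergent. *)
Lemma CPS_conv (a b : nat -> R) (z : C) : acv a (Cmod z) -> acv b (Cmod z) ->
  CPS (conv a b) z = (CPS a z * CPS b z)%C.
Proof.
intros Ha Hb; apply is_CS_unique.
assert (ab : forall (c : nat -> R), acv c (Cmod z) ->
  ex_series (fun n => Rabs (Re (pterm c z n))) /\ ex_series (fun n => Rabs (Im (pterm c z n)))).
{ intros c Hc; apply acv_pterm in Hc; split;
    apply (ex_series_Rle _ (fun n => Cmod (pterm c z n))); try exact Hc; intros n;
    rewrite Rabs_Rabsolu.
  - apply re_le_Cmod.
  - apply im_le_Cmod. }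
destruct (ab a Ha) as [a1 a2]; destruct (ab b Hb) as [b1 b2].
destruct (CPS_correct a z Ha) as [Sa1 Sa2]; destruct (CPS_correct b z Hb) as [Sb1 Sb2].
split.
- pose proof (is_series_minus _ _ _ _ (is_series_mult _ _ _ _ Sa1 Sb1 a1 b1)
    (is_series_mult _ _ _ _ Sa2 Sb2 a2 b2)) as H.
  eapply is_series_ext; [|exact H].
  intros n; cbv beta.
  match goal with |- plus ?A (opp ?B) = _ => change (A - B = Re (pterm (conv a b) z n)) end.
  rewrite <- minus_sum.
  unfold pterm, conv; rewrite re_scal_l, Rmult_comm, scal_sum; apply sum_eq; intros k Hk.
  rewrite !re_scal_l, !im_scal_l.
  replace (z ^ n)%C with (z ^ k * z ^ (n - k))%C
    by (rewrite <- Cpow_add_r; f_equal; lia).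
  rewrite re_mult; ring.
- pose proof (is_series_plus _ _ _ _ (is_series_mult _ _ _ _ Sa1 Sb2 a1 b2)
    (is_series_mult _ _ _ _ Sa2 Sb1 a2 b1)) as H.
  eapply is_series_ext; [|exact H].
  intros n; cbv beta.
  match goal with |- plus ?A ?B = _ => change (A + B = Im (pterm (conv a b) z n)) end.
  rewrite <- plus_sum.
  unfold pterm, conv; rewrite im_scal_l, Rmult_comm, scal_sum; apply sum_eq; intros k Hk.
  rewrite !re_scal_l, !im_scal_l.
  replace (z ^ n)%C with (z ^ k * z ^ (n - k))%C
    by (rewrite <- Cpow_add_r; f_equal; lia).
  rewrite im_mult; ring.
Qed.

Lemma sum_dil (a : nat -> R) (N : nat) :
  sum_f_R0 (dil a) N = sum_f_R0 a (Nat.div2 N).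
Proof.
induction N as [N IH] using Wf_nat.lt_wf_ind.
destruct N as [|[|N]]; [reflexivity|unfold dil; simpl; ring|].
rewrite !tech5, IH by lia.
change (Nat.div2 (S (S N))) with (S (Nat.div2 N)); rewrite tech5.
unfold dil.
destruct (Nat.even N) eqn:E; pose proof (Nat.even_succ N) as E1;
  rewrite <- Nat.negb_even, E in E1; rewrite E1; simpl Nat.even; rewrite E; cbv iota beta delta [negb].
- simpl; ring.
- replace (Nat.div2 (S N)) with (S (Nat.div2 N)); [ring|].
  pose proof (Nat.div2_odd N) as E2; pose proof (Nat.div2_odd (S N)) as E3.
  rewrite <- Nat.negb_even, E in E2; rewrite <- Nat.negb_even, E1 in E3; simpl in *; lia.
Qed.

Lemma is_series_dil (a : nat -> R) (l : R) : is_series a l -> is_series (dil a) l.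
Proof.
intros H; apply is_series_Reals in H; apply is_series_Reals.
intros eps He; destruct (H eps He) as [N HN]; exists (2 * N)%nat; intros n Hn.
rewrite sum_dil; apply HN.
pose proof (Nat.div2_odd n); destruct (Nat.odd n); simpl in *; lia.
Qed.

Lemma dil_mult (a : nat -> R) (f g : nat -> R) (n : nat) :
  (forall m, f (2 * m)%nat = g m) -> dil a n * f n = dil (fun m => a m * g m) n.
Proof.
intros H; unfold dil; destruct (Nat.even n) eqn:E; [|ring].
rewrite <- H; do 2 f_equal; pose proof (Nat.div2_odd n) as E2.
rewrite <- Nat.negb_even, E in E2; simpl in E2; lia.
Qed.

Lemma CPS_dil (a : nat -> R) (z : C) : acv a (Cmod (z ^ 2)) -> CPS (dil a) z = CPS a (z ^ 2)%C.
Proof.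
intros H; apply is_CS_unique; destruct (CPS_correct _ _ H) as [H1 H2]; split.
- apply is_series_dil in H1; eapply is_series_ext; [|exact H1].
  intros n; unfold pterm; simpl; rewrite !Rmult_0_l, Rminus_0_r; symmetry.
  rewrite (dil_mult a (fun n => fst (z ^ n)%C) (fun n => fst ((z ^ 2) ^ n)%C)).
  + unfold dil; destruct (Nat.even n); [|reflexivity].
    simpl; rewrite ?Rmult_0_l, ?Rminus_0_r; reflexivity.
  + intros m; now rewrite <- Cpow_mult_r.
- apply is_series_dil in H2; eapply is_series_ext; [|exact H2].
  intros n; unfold pterm; simpl; rewrite !Rmult_0_l, Rplus_0_r; symmetry.
  rewrite (dil_mult a (fun n => snd (z ^ n)%C) (fun n => snd ((z ^ 2) ^ n)%C)).
  + unfold dil; destruct (Nat.even n); [|reflexivity].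
    simpl; rewrite ?Rmult_0_l, ?Rplus_0_r; reflexivity.
  + intros m; now rewrite <- Cpow_mult_r.
Qed.

Lemma acv_dil (a : nat -> R) (r : R) : acv a (r ^ 2) -> acv (dil a) r.
Proof.
intros [l H]; exists l; apply is_series_dil in H; eapply is_series_ext; [|exact H].
intros n; cbv beta.
rewrite <- (dil_mult (fun n => Rabs (a n)) (fun n => r ^ n) (fun m => (r ^ 2) ^ m)).
- f_equal; unfold dil; destruct (Nat.even n); [reflexivity|now rewrite Rabs_R0].
- intros m; now rewrite pow_mult.
Qed.

Lemma CPS_RtoC (a : nat -> R) (r : R) : CPS a (RtoC r) = RtoC (PSeries a r).
Proof.
assert (E : forall n, (RtoC r ^ n)%C = RtoC (r ^ n)).
{ induction n; [reflexivity|rewrite Cpow_S, IHn, <- RtoC_mult; reflexivity]. }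
unfold CPS, CS, PSeries; apply C_ext; simpl.
- apply Series_ext; intros n; unfold pterm; rewrite E; simpl; ring.
- apply is_series_unique.
  apply is_series_ext with (fun _ => 0).
  + intros n; unfold pterm; rewrite E; simpl; ring.
  + apply is_series_Reals; intros eps He; exists 0%nat; intros.
    rewrite sum_cte; unfold Rdist; rewrite Rmult_0_l, Rminus_0_r, Rabs_R0; exact He.
Qed.

(** * The dominant singularity *)

Lemma ycoef_le_ge0 (h n : nat) : 0 <= ycoef_le h n.
Proof. apply pos_INR. Qed.

Lemma y_coef_ge0 (n : nat) : 0 <= y_coef n.
Proof. apply pos_INR. Qed.

Lemma ycoef_le_incr (h n : nat) : ycoef_le h n <= ycoef_le (S h) n.
Proof. pose proof (card_Y_height_ycoef n h); pose proof (pos_INR (card_Y_height n (S h))); lra. Qed.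

Lemma ycoef_le_mono (h k n : nat) : (h <= k)%nat -> ycoef_le h n <= ycoef_le k n.
Proof.
induction 1; [lra|]. eapply Rle_trans; [exact IHle|apply ycoef_le_incr].
Qed.

Lemma ycoef_le_y_coef (h n : nat) : ycoef_le h n <= y_coef n.
Proof.
rewrite <- (ycoef_le_eq (h + n) n) by lia; apply ycoef_le_mono; lia.
Qed.

Lemma y_coef_rec (n : nat) :
  2 * y_coef n = 2 * ind1 n + conv y_coef y_coef n + dil y_coef n.
Proof.
rewrite <- (ycoef_le_eq (S n) n) by lia.
rewrite ycoef_le_S; f_equal; [f_equal|].
- unfold conv; apply sum_eq; intros k Hk; now rewrite !ycoef_le_eq by lia.
- unfold dil; destruct (Nat.even n); [|reflexivity].
  apply ycoef_le_eq; pose proof (Nat.div2_decr n n); lia.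
Qed.

Lemma y_coef_0 : y_coef 0 = 0.
Proof. rewrite <- (ycoef_le_eq 0 0), ycoef_le_0 by lia; reflexivity. Qed.

Lemma y_coef_1 : y_coef 1 = 1.
Proof. rewrite <- (ycoef_le_eq 0 1), ycoef_le_0 by lia; reflexivity. Qed.

Lemma y_coef_2 : y_coef 2 = 1.
Proof.
pose proof (y_coef_rec 2) as H; unfold conv, dil, ind1 in H; simpl in H.
rewrite y_coef_0, y_coef_1 in H; lra.
Qed.

(** Since [a 0 = 0], the Cauchy product up to index [N + 1] involves only [a 1, ..., a N]; all its
    terms occur in the expanded square, whose other terms are nonnegative. The gain of one index is
    what makes [psum_step] an induction step. *)
Lemma sum_conv_le (a : nat -> R) (N : nat) : (forall n, 0 <= a n) -> a 0%nat = 0 ->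
  sum_f_R0 (conv a a) (S N) <= sum_f_R0 a N ^ 2.
Proof.
intros a_ge0 a0.
pose (b := fun k => if Nat.leb k N then a k else 0).
assert (bg : forall k, 0 <= b k) by (intros k; unfold b; destruct (Nat.leb k N); [apply a_ge0|lra]).
assert (E : sum_f_R0 b (S N) = sum_f_R0 a N).
{ rewrite tech5; unfold b at 2.
  replace (Nat.leb (S N) N) with false by (symmetry; apply Nat.leb_gt; lia).
  rewrite Rplus_0_r; apply sum_eq; intros k Hk; unfold b.
  now replace (Nat.leb k N) with true by (symmetry; apply Nat.leb_le; lia). }
assert (E2 : sum_f_R0 (conv a a) (S N) = sum_f_R0 (conv b b) (S N)).
{ apply sum_eq; intros n Hn; apply sum_eq; intros k Hk; unfold b.
  destruct (Nat.leb k N) eqn:K1; destruct (Nat.leb (n - k) N) eqn:K2;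
    try reflexivity; rewrite ?Nat.leb_gt, ?Nat.leb_le in *.
  - replace k with 0%nat by lia; rewrite a0; ring.
  - replace (n - k)%nat with 0%nat by lia; rewrite a0; ring.
  - lia. }
pose proof (cauchy_finite b b (S N)) as H.
rewrite E in H; rewrite E2.
replace (sum_f_R0 a N ^ 2) with (sum_f_R0 a N * sum_f_R0 a N) by ring.
rewrite H by lia; fold (conv b b).
match goal with |- ?X <= ?Y + ?Z => change X with Y; assert (0 <= Z) end; [|lra].
apply cond_pos_sum; intros k; apply cond_pos_sum; intros l.
apply Rmult_le_pos; apply bg.
Qed.

Definition psum (r : R) (N : nat) : R := sum_f_R0 (fun n => y_coef n * r ^ n) N.

Lemma psum_ge0 (r : R) (N : nat) : 0 <= r -> 0 <= psum r N.
Proof.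
intros H; apply cond_pos_sum; intros n; apply Rmult_le_pos; [apply y_coef_ge0|now apply pow_le].
Qed.

Lemma psum_step (r : R) (N : nat) : 0 <= r ->
  psum r (S N) <= r + psum r N ^ 2 / 2 + psum (r ^ 2) N / 2.
Proof.
intros Hr.
assert (E : 2 * psum r (S N) = 2 * r +
  sum_f_R0 (conv (fun n => y_coef n * r ^ n) (fun n => y_coef n * r ^ n)) (S N) +
  sum_f_R0 (dil (fun n => y_coef n * (r ^ 2) ^ n)) (S N)).
{ unfold psum; rewrite scal_sum.
  assert (Hi : sum_f_R0 (fun n => 2 * (ind1 n * r ^ n)) (S N) = 2 * r).
  { clear; induction N; [unfold ind1; simpl; ring|].
    rewrite tech5, IHN; unfold ind1; simpl; ring. }
  rewrite <- Hi, <- !plus_sum; apply sum_eq; intros n _.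
  rewrite <- (dil_mult y_coef (fun n => r ^ n) (fun n => (r ^ 2) ^ n))
    by (intros; now rewrite pow_mult).
  replace (conv (fun n => y_coef n * r ^ n) (fun n => y_coef n * r ^ n) n)
    with (conv y_coef y_coef n * r ^ n).
  - replace (y_coef n * r ^ n * 2) with (2 * y_coef n * r ^ n) by ring.
    rewrite y_coef_rec; ring.
  - unfold conv; rewrite Rmult_comm, scal_sum; apply sum_eq; intros k Hk.
    replace (r ^ n) with (r ^ k * r ^ (n - k)); [ring|].
    rewrite <- pow_add; f_equal; lia. }
assert (H1 : sum_f_R0 (conv (fun n => y_coef n * r ^ n) (fun n => y_coef n * r ^ n)) (S N)
  <= psum r N ^ 2).
{ apply sum_conv_le; [|rewrite y_coef_0; ring].
  intros n; apply Rmult_le_pos; [apply y_coef_ge0|now apply pow_le]. }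
assert (H2 : sum_f_R0 (dil (fun n => y_coef n * (r ^ 2) ^ n)) (S N) <= psum (r ^ 2) N).
{ rewrite sum_dil; fold (psum (r ^ 2) (Nat.div2 (S N))).
  assert (Hd : (Nat.div2 (S N) <= N)%nat).
  { pose proof (Nat.div2_odd (S N)); lia. }
  clear E H1; revert Hd; generalize (Nat.div2 (S N)); induction 1; [lra|].
  eapply Rle_trans; [exact IHHd|]; unfold psum; rewrite tech5.
  assert (0 <= y_coef (S m) * (r ^ 2) ^ S m); [|lra].
  apply Rmult_le_pos; [apply y_coef_ge0|]. apply pow_le; apply pow2_ge_0. }
lra.
Qed.

(** Induction on the truncation through [psum_step]: a supersolution of the functional equation
    bounds the partial sums before any convergence is known. *)
Lemma psum_le_fixpoint (r q t : R) : 0 <= r -> 0 <= t ->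
  (forall N, psum (r ^ 2) N <= q) -> r + t ^ 2 / 2 + q / 2 <= t -> forall N, psum r N <= t.
Proof.
intros Hr Ht Hq Hf N; induction N.
- unfold psum; simpl; rewrite y_coef_0; lra.
- eapply Rle_trans; [now apply psum_step|].
  specialize (Hq N). pose proof (psum_ge0 r N Hr).
  assert (psum r N ^ 2 <= t ^ 2) by (apply pow_incr; lra). lra.
Qed.

(** The term at [r^2] is at most a quarter of the sum at [r = 1/4], and [1/4 + 1/8 + 1/16 < 1/2].
    This yields [rho >= 1/4]. *)
Lemma psum_quarter (N : nat) : psum (/ 4) N <= / 2.
Proof.
induction N.
- unfold psum; simpl; rewrite y_coef_0; lra.
- eapply Rle_trans; [apply psum_step; lra|].
  assert (psum ((/ 4) ^ 2) N <= / 4 * psum (/ 4) N).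
  { unfold psum; rewrite scal_sum; apply sum_Rle; intros n _.
    destruct n; [rewrite y_coef_0; lra|].
    rewrite Rmult_assoc; apply Rmult_le_compat_l; [apply y_coef_ge0|].
    rewrite <- pow_mult.
    replace (2 * S n)%nat with (S n + 1 + n)%nat by lia; rewrite pow_add, pow_add.
    assert (0 <= (/ 4) ^ S n) by (apply pow_le; lra).
    assert ((/ 4) ^ n <= 1 ^ n) by (apply pow_incr; lra); rewrite pow1 in *.
    rewrite pow_1; nra. }
  pose proof (psum_ge0 (/ 4) N ltac:(lra)).
  assert (psum (/ 4) N ^ 2 <= (/ 2) ^ 2) by (apply pow_incr; lra). lra.
Qed.

Lemma acv_psum (r t : R) : 0 <= r -> (forall N, psum r N <= t) -> acv y_coef r.
Proof.
intros Hr H; unfold acv.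
apply ex_series_ext with (fun n => y_coef n * r ^ n).
{ intros n; rewrite Rabs_pos_eq; [reflexivity|apply y_coef_ge0]. }
destruct (ex_finite_lim_seq_incr (sum_n (fun n => y_coef n * r ^ n)) t) as [l Hl].
- intros n; rewrite sum_Sn.
  assert (0 <= y_coef (S n) * r ^ S n); [|unfold plus; simpl in *; lra].
  apply Rmult_le_pos; [apply y_coef_ge0|now apply pow_le].
- intros n; rewrite sum_n_Reals; apply H.
- now exists l.
Qed.

Lemma acv_CV_radius (a : nat -> R) (r : R) : 0 <= r -> acv a r -> Rbar_le r (CV_radius a).
Proof.
intros Hr H; apply (proj1 (CV_radius_bounded a)).
destruct H as [l Hl]; exists l; intros n.
rewrite Rabs_mult, (Rabs_pos_eq (r ^ n)) by now apply pow_le.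
apply (is_lim_seq_incr_compare (sum_n (fun n => Rabs (a n) * r ^ n)) l) with (n := n) in Hl.
- eapply Rle_trans; [|exact Hl].
  destruct n; [rewrite sum_O; lra|].
  rewrite sum_Sn; unfold plus; simpl.
  assert (0 <= sum_n (fun n => Rabs (a n) * r ^ n) n); [|simpl in *; lra].
  rewrite sum_n_Reals; apply cond_pos_sum; intros k.
  apply Rmult_le_pos; [apply Rabs_pos|now apply pow_le].
- intros m; rewrite sum_Sn.
  assert (0 <= Rabs (a (S m)) * r ^ S m); [|unfold plus; simpl in *; lra].
  apply Rmult_le_pos; [apply Rabs_pos|now apply pow_le].
Qed.

Lemma CV_radius_acv (a : nat -> R) (r : R) : 0 <= r -> (forall n, 0 <= a n) ->
  Rbar_lt r (CV_radius a) -> acv a r.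
Proof.
intros Hr Ha H; rewrite <- (Rabs_pos_eq r Hr) in H; apply CV_radius_inside in H.
apply ex_pseries_R in H.
unfold acv; eapply ex_series_ext; [|exact H]; intros n; cbv beta.
rewrite Rabs_pos_eq; [reflexivity|apply Ha].
Qed.

Lemma is_series_psum (r : R) : 0 <= r -> acv y_coef r ->
  is_series (fun n => y_coef n * r ^ n) (y r).
Proof.
intros Hr H; apply Series_correct; unfold acv in H.
eapply ex_series_ext; [|exact H]; intros n; cbv beta.
rewrite Rabs_pos_eq; [reflexivity|apply y_coef_ge0].
Qed.

Lemma psum_le_y (r : R) (N : nat) : 0 <= r -> acv y_coef r -> psum r N <= y r.
Proof.
intros Hr H; pose proof (is_series_psum r Hr H) as S.
apply (is_lim_seq_incr_compare (sum_n (fun n => y_coef n * r ^ n)) (y r)) with (n := N) in S.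
- now rewrite sum_n_Reals in S.
- intros n; rewrite sum_Sn.
  assert (0 <= y_coef (Datatypes.S n) * r ^ Datatypes.S n); [|unfold plus; simpl in *; lra].
  apply Rmult_le_pos; [apply y_coef_ge0|now apply pow_le].
Qed.

Lemma acv_ind1 (r : R) : acv ind1 r.
Proof.
exists r; apply is_series_Reals; intros eps He; exists 1%nat; intros n Hn.
assert (E : sum_f_R0 (fun n => Rabs (ind1 n) * r ^ n) n = r).
{ induction Hn; [unfold ind1; simpl; rewrite Rabs_R0, Rabs_R1; ring|].
  rewrite tech5, IHHn; unfold ind1.
  replace (Nat.eqb (S m) 1) with false by (symmetry; apply Nat.eqb_neq; lia).
  rewrite Rabs_R0; ring. }
rewrite E; unfold Rdist; rewrite Rminus_diag, Rabs_R0; exact He.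
Qed.

Lemma CPS_ind1 (z : C) : CPS ind1 z = z.
Proof.
assert (K : forall f : nat -> R, is_series (fun n => ind1 n * f n) (f 1%nat)).
{ intros f; apply is_series_Reals; intros eps He; exists 1%nat; intros n Hn.
  assert (E : sum_f_R0 (fun n => ind1 n * f n) n = f 1%nat).
  { induction Hn; [unfold ind1; simpl; ring|].
    rewrite tech5, IHHn; unfold ind1.
    replace (Nat.eqb (S m) 1) with false by (symmetry; apply Nat.eqb_neq; lia); ring. }
  rewrite E; unfold Rdist; rewrite Rminus_diag, Rabs_R0; exact He. }
apply is_CS_unique; split.
- generalize (K (fun n => Re (z ^ n)%C)); rewrite Cpow_1_r; apply is_series_ext.
  intros n; unfold pterm; now rewrite re_scal_l.
- generalize (K (fun n => Im (z ^ n)%C)); rewrite Cpow_1_r; apply is_series_ext.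
  intros n; unfold pterm; now rewrite im_scal_l.
Qed.

Lemma acv_conv (a b : nat -> R) (r : R) : 0 <= r -> acv a r -> acv b r -> acv (conv a b) r.
Proof.
intros Hr [la Ha] [lb Hb].
apply ex_series_Rle with (fun n => sum_f_R0 (fun k =>
  (Rabs (a k) * r ^ k) * (Rabs (b (n - k)%nat) * r ^ (n - k))) n).
- intros n; rewrite Rabs_mult, Rabs_Rabsolu.
  rewrite (Rabs_pos_eq (r ^ n)) by now apply pow_le.
  unfold conv; eapply Rle_trans.
  + apply Rmult_le_compat_r; [now apply pow_le|apply Rsum_abs].
  + rewrite Rmult_comm, scal_sum; right; apply sum_eq; intros k Hk.
    rewrite Rabs_mult; replace (r ^ n) with (r ^ k * r ^ (n - k)); [ring|].
    rewrite <- pow_add; f_equal; lia.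
- exists (la * lb); apply (is_series_mult_pos _ _ _ _ Ha Hb);
    intros n; apply Rmult_le_pos; try apply Rabs_pos; now apply pow_le.
Qed.

Lemma CPS_y_rec (z : C) : acv y_coef (Cmod z) -> acv y_coef (Cmod (z ^ 2)) ->
  (2 * CPS y_coef z = 2 * z + CPS y_coef z * CPS y_coef z + CPS y_coef (z ^ 2))%C.
Proof.
intros H1 H2.
assert (Hd : acv (dil y_coef) (Cmod z)) by (apply acv_dil; now rewrite <- Cmod_pow).
assert (Hc := acv_conv _ _ _ (Cmod_ge_0 z) H1 H1).
transitivity (CPS (fun n => 2 * y_coef n) z); [symmetry; now apply CPS_scal|].
rewrite (CPS_ext _ (fun n => (2 * ind1 n + conv y_coef y_coef n) + dil y_coef n))
  by apply y_coef_rec.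
assert (Hi : acv (fun n => 2 * ind1 n) (Cmod z)).
{ destruct (acv_ind1 (Cmod z)) as [l Hl]; exists (2 * l).
  eapply is_series_ext; [|exact (is_series_scal (K := R_AbsRing) (V := R_NormedModule) 2 _ _ Hl)].
  intros n; unfold scal; simpl; unfold mult; simpl.
  rewrite Rabs_mult, (Rabs_pos_eq 2) by lra; ring. }
rewrite CPS_plus, CPS_plus, CPS_conv, CPS_dil, CPS_scal, CPS_ind1; auto using acv_ind1.
unfold acv in *.
apply ex_series_Rle with (fun n => Rabs (2 * ind1 n) * Cmod z ^ n
   + Rabs (conv y_coef y_coef n) * Cmod z ^ n).
- intros n; rewrite Rabs_mult, Rabs_Rabsolu, (Rabs_pos_eq (Cmod z ^ n))
    by (apply pow_le, Cmod_ge_0).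
  rewrite <- Rmult_plus_distr_r; apply Rmult_le_compat_r; [apply pow_le, Cmod_ge_0|].
  apply Rabs_triang.
- exact (ex_series_plus _ _ Hi Hc).
Qed.

Lemma CPS_y_RtoC (r : R) : CPS y_coef (RtoC r) = RtoC (y r).
Proof. apply CPS_RtoC. Qed.

Lemma y_quadratic (r : R) : 0 <= r -> acv y_coef r -> acv y_coef (r ^ 2) ->
  (1 - y r) ^ 2 = 1 - 2 * r - y (r ^ 2).
Proof.
intros Hr H1 H2.
assert (E : (RtoC r ^ 2)%C = RtoC (r ^ 2)).
{ simpl; rewrite RtoC_mult, RtoC_mult; reflexivity. }
pose proof (CPS_y_rec (RtoC r)) as H.
rewrite E, !CPS_y_RtoC, !Cmod_R, (Rabs_pos_eq r), (Rabs_pos_eq (r ^ 2)) in H by (auto using pow2_ge_0).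
specialize (H H1 H2); apply (f_equal Re) in H.
rewrite <- !RtoC_mult, <- !RtoC_plus in H.
change (2 * y r = 2 * r + y r * y r + y (r ^ 2)) in H.
nra.
Qed.

(** With [q = y (r^2)], the number [1 - d] is the smaller root of [t = r + t^2 / 2 + q / 2], so
    [psum_le_fixpoint] applies with equality. *)
Lemma psum_le_of_discr (r : R) : 0 <= r -> acv y_coef (r ^ 2) ->
  0 <= 1 - 2 * r - y (r ^ 2) -> forall N, psum r N <= 1.
Proof.
intros Hr H2 HD N.
set (d := sqrt (1 - 2 * r - y (r ^ 2))).
assert (Hd : d * d = 1 - 2 * r - y (r ^ 2)) by now apply sqrt_sqrt.
assert (d0 : 0 <= d) by apply sqrt_pos.
assert (y0 : 0 <= y (r ^ 2)).
{ eapply Rle_trans; [|apply (psum_le_y (r ^ 2) 0); [apply pow2_ge_0|exact H2]].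
  apply psum_ge0, pow2_ge_0. }
assert (d1 : d <= 1) by nra.
enough (psum r N <= 1 - d) by lra.
apply psum_le_fixpoint with (y (r ^ 2)); [exact Hr|lra| |nra].
intros M; apply psum_le_y; [apply pow2_ge_0|exact H2].
Qed.

Lemma psum_le_1_inside (r : R) (N : nat) : 0 <= r < 1 ->
  Rbar_lt r (CV_radius y_coef) -> psum r N <= 1.
Proof.
intros Hr H.
assert (H1 : acv y_coef r) by (apply CV_radius_acv; [lra|apply y_coef_ge0|exact H]).
assert (H2 : acv y_coef (r ^ 2)) by (apply acv_le with r; [nra|exact H1]).
apply psum_le_of_discr; [lra|exact H2|].
rewrite <- y_quadratic; [apply pow2_ge_0|lra|exact H1|exact H2].
Qed.

Lemma rho_finite : CV_radius y_coef = Finite rho /\ / 4 <= rho < / 10 * 7.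
Proof.
assert (H1 : Rbar_le (/ 4) (CV_radius y_coef)).
{ apply acv_CV_radius; [lra|]; apply acv_psum with (/ 2); [lra|apply psum_quarter]. }
assert (H2 : Rbar_lt (CV_radius y_coef) (/ 10 * 7)).
{ apply Rbar_not_le_lt; intros H.
  (* Already [z + z^2] exceeds 1 at [z = 0.65], against the bound valid inside the disc of
     convergence. *)
  assert (H3 : psum (/ 100 * 65) 2 <= 1).
  { apply psum_le_1_inside; [lra|].
    apply Rbar_lt_le_trans with (Finite (/ 10 * 7)); [simpl; lra|exact H]. }
  unfold psum in H3; simpl in H3; rewrite y_coef_0, y_coef_1, y_coef_2 in H3; lra. }
unfold rho; destruct (CV_radius y_coef); simpl in *; easy.
Qed.

Lemma rho_pos : 0 < rho. Proof. destruct rho_finite; lra. Qed.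
Lemma rho_lt1 : rho < 1. Proof. destruct rho_finite; lra. Qed.

Lemma acv_le_rho (r : R) : 0 <= r -> acv y_coef r -> r <= rho.
Proof.
intros Hr H; apply acv_CV_radius in H; [|exact Hr].
rewrite (proj1 rho_finite) in H; exact H.
Qed.

Lemma rho_sqr : 0 < rho ^ 2 < rho.
Proof. pose proof rho_pos; pose proof rho_lt1; nra. Qed.

(** A partial sum is a polynomial, so the bound inside the disc passes to the boundary point by
    continuity. *)
Lemma psum_rho (N : nat) : psum rho N <= 1.
Proof.
pose proof rho_pos as R0; pose proof rho_lt1 as R1.
apply (is_lim_seq_le (fun k => psum (rho * (1 - / INR (S k))) N) (fun _ => 1)
  (psum rho N) 1); [| |apply is_lim_seq_const].
- intros k.
  assert (0 < / INR (S k) <= 1).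
  { pose proof (lt_0_INR (S k) ltac:(lia)).
    split; [now apply Rinv_0_lt_compat|].
    rewrite <- Rinv_1; apply Rinv_le_contravar; [lra|].
    change 1 with (INR 1); apply le_INR; lia. }
  apply psum_le_1_inside; [nra|]; rewrite (proj1 rho_finite).
  change (rho * (1 - / INR (S k)) < rho); nra.
- assert (Hc : continuity_pt (fun r => psum r N) rho).
  { unfold psum; apply continuity_pt_finite_SF; intros k _.
    apply continuity_pt_mult; [apply continuity_pt_const; intros ??; reflexivity|].
    apply derivable_continuous_pt, derivable_pt_pow. }
  assert (Hl : is_lim_seq (fun k => rho * (1 - / INR (S k))) rho).
  { replace (Finite rho) with (Finite (rho * (1 - 0))) by (f_equal; ring).
    apply is_lim_seq_mult'; [apply is_lim_seq_const|].
    apply is_lim_seq_minus'; [apply is_lim_seq_const|].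
    apply (is_lim_seq_inv _ p_infty); [|discriminate].
    apply (is_lim_seq_incr_1 INR), is_lim_seq_INR. }
  exact (is_lim_seq_continuous _ _ _ Hc Hl).
Qed.

Lemma acv_rho : acv y_coef rho.
Proof. apply acv_psum with 1; [pose proof rho_pos; lra|apply psum_rho]. Qed.

Lemma acv_upto_rho (r : R) : 0 <= r <= rho -> acv y_coef r.
Proof. intros H; exact (acv_le _ _ _ H acv_rho). Qed.

(** At [rho] the discriminant [D] is the square of [1 - y rho]. If it were positive, it would remain
    so slightly beyond [rho], being continuous there because [rho^2 < rho]; then [psum_le_of_discr]
    would give convergence past the radius. *)
Lemma y_rho : y rho = 1.
Proof.
pose proof rho_pos as R0; pose proof rho_lt1 as R1; pose proof rho_sqr as R2.
pose proof (y_quadratic rho ltac:(lra) acv_rho (acv_upto_rho (rho ^ 2) ltac:(lra))) as E.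
destruct (Req_dec (y rho) 1) as [H|H]; [exact H|exfalso].
set (D := fun r => 1 - 2 * r - y (r ^ 2)).
assert (D0 : 0 < D rho).
{ unfold D; rewrite <- E; assert (1 - y rho <> 0) by lra; nra. }
assert (Hc : continuity_pt D rho).
{ unfold D.
  apply (continuity_pt_minus (fun r => 1 - 2 * r) (fun r => y (r ^ 2))).
  - apply derivable_continuous_pt; reg.
  - apply (continuity_pt_comp (fun r => r ^ 2) y).
    + apply derivable_continuous_pt, derivable_pt_pow.
    + apply PSeries_continuity; rewrite (proj1 rho_finite); simpl Rbar_lt.
      rewrite Rabs_pos_eq; lra. }
destruct (Hc (D rho) D0) as [d [d0 Hd]].
(* The first bound keeps [D r] positive, the second keeps [r^2 <= rho], where [y] converges. *)
set (r := Rmin (rho + d / 2) (sqrt rho)).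
assert (sr : rho < sqrt rho).
{ rewrite <- (sqrt_pow2 rho) at 1 by lra; apply sqrt_lt_1; lra. }
assert (r1 : rho < r) by (unfold r; apply Rmin_glb_lt; lra).
assert (r2 : r <= rho + d / 2) by apply Rmin_l.
assert (r3 : r ^ 2 <= rho).
{ assert (r <= sqrt rho) by apply Rmin_r.
  rewrite <- (pow2_sqrt rho) by lra; apply pow_incr; lra. }
assert (Dr : Rabs (D r - D rho) < D rho).
{ apply Hd; split; [split; [exact I|lra]|].
  simpl; unfold Rdist; rewrite Rabs_pos_eq; lra. }
apply Rabs_def2 in Dr.
assert (acv y_coef r); [|pose proof (acv_le_rho r ltac:(lra) H0); lra].
apply acv_psum with 1; [lra|].
apply psum_le_of_discr; [lra|apply acv_upto_rho; split; [apply pow2_ge_0|exact r3]|].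
change (0 <= D r); lra.
Qed.

Lemma rho_eq : 2 * rho + y (rho ^ 2) = 1.
Proof.
pose proof rho_pos as R0; pose proof rho_sqr as R2.
pose proof (y_quadratic rho ltac:(lra) acv_rho (acv_upto_rho (rho ^ 2) ltac:(lra))) as E.
rewrite y_rho in E; nra.
Qed.

(** * Remainders beyond a given height, at the critical point *)

Definition ecoef (h n : nat) : R := y_coef n - ycoef_le h n.

Lemma ecoef_ge0 (h n : nat) : 0 <= ecoef h n.
Proof. pose proof (ycoef_le_y_coef h n); unfold ecoef; lra. Qed.

Lemma ecoef_le (h n : nat) : ecoef h n <= y_coef n.
Proof. pose proof (ycoef_le_ge0 h n); unfold ecoef; lra. Qed.

Lemma ecoef_small (h n : nat) : (n <= S h)%nat -> ecoef h n = 0.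
Proof. intros H; unfold ecoef; rewrite ycoef_le_eq by exact H; ring. Qed.

Lemma acv_ecoef (h : nat) (r : R) : 0 <= r <= rho -> acv (ecoef h) r.
Proof.
intros Hr; apply acv_dom with y_coef; [lra| |now apply acv_upto_rho].
intros n; rewrite !Rabs_pos_eq by (apply ecoef_ge0 || apply y_coef_ge0); apply ecoef_le.
Qed.

Lemma acv_ycoef_le (h : nat) (r : R) : 0 <= r <= rho -> acv (ycoef_le h) r.
Proof.
intros Hr; apply acv_dom with y_coef; [lra| |now apply acv_upto_rho].
intros n; rewrite !Rabs_pos_eq by (apply ycoef_le_ge0 || apply y_coef_ge0); apply ycoef_le_y_coef.
Qed.

Definition Yf (z : C) : C := CPS y_coef z.
Definition wf (z : C) : C := (1 - Yf z)%C.
Definition Ef (h : nat) (z : C) : C := CPS (ecoef h) z.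
Definition eh (h : nat) : R := PSeries (ecoef h) rho.

Lemma Cmod_sqr_le (z : C) : Cmod z <= rho -> 0 <= Cmod z <= rho /\ 0 <= Cmod (z ^ 2) <= rho.
Proof.
intros H; pose proof (Cmod_ge_0 z); pose proof rho_lt1.
rewrite Cmod_pow; split; [lra|nra].
Qed.

Lemma wf_sqr (z : C) : Cmod z <= rho -> (wf z * wf z = 1 - 2 * z - Yf (z ^ 2))%C.
Proof.
intros H; destruct (Cmod_sqr_le z H) as [H1 H2].
pose proof (CPS_y_rec z (acv_upto_rho _ H1) (acv_upto_rho _ H2)) as E.
unfold wf, Yf.
replace ((1 - CPS y_coef z) * (1 - CPS y_coef z))%C
  with (1 - 2 * CPS y_coef z + CPS y_coef z * CPS y_coef z)%C by ring.
rewrite E; ring.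
Qed.

Lemma CPS_ycoef_le_rec (h : nat) (z : C) : Cmod z <= rho ->
  (2 * CPS (ycoef_le (S h)) z = 2 * z + CPS (ycoef_le h) z * CPS (ycoef_le h) z
     + CPS (ycoef_le h) (z ^ 2))%C.
Proof.
intros H; destruct (Cmod_sqr_le z H) as [H1 H2].
assert (A1 := acv_ycoef_le h _ H1); assert (A2 := acv_ycoef_le h _ H2).
assert (Hd : acv (dil (ycoef_le h)) (Cmod z)) by (apply acv_dil; now rewrite <- Cmod_pow).
assert (Hc := acv_conv _ _ _ (Cmod_ge_0 z) A1 A1).
transitivity (CPS (fun n => 2 * ycoef_le (S h) n) z);
  [symmetry; apply CPS_scal, acv_ycoef_le, H1|].
rewrite (CPS_ext _ (fun n => (2 * ind1 n + conv (ycoef_le h) (ycoef_le h) n) + dil (ycoef_le h) n))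
  by apply ycoef_le_S.
assert (Hi : acv (fun n => 2 * ind1 n) (Cmod z)).
{ destruct (acv_ind1 (Cmod z)) as [l Hl]; exists (2 * l).
  eapply is_series_ext; [|exact (is_series_scal (K := R_AbsRing) (V := R_NormedModule) 2 _ _ Hl)].
  intros n; unfold scal; simpl; unfold mult; simpl.
  rewrite Rabs_mult, (Rabs_pos_eq 2) by lra; ring. }
rewrite CPS_plus, CPS_plus, CPS_conv, CPS_dil, CPS_scal, CPS_ind1; auto using acv_ind1.
apply ex_series_Rle with (fun n => Rabs (2 * ind1 n) * Cmod z ^ n
   + Rabs (conv (ycoef_le h) (ycoef_le h) n) * Cmod z ^ n).
- intros n; rewrite Rabs_mult, Rabs_Rabsolu, (Rabs_pos_eq (Cmod z ^ n))
    by (apply pow_le, Cmod_ge_0).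
  rewrite <- Rmult_plus_distr_r; apply Rmult_le_compat_r; [apply pow_le, Cmod_ge_0|].
  apply Rabs_triang.
- exact (ex_series_plus _ _ Hi Hc).
Qed.

Lemma Ef_minus (h : nat) (z : C) : Cmod z <= rho ->
  (Ef h z = Yf z - CPS (ycoef_le h) z)%C.
Proof.
intros H; destruct (Cmod_sqr_le z H) as [H1 H2].
apply (CPS_minus y_coef (ycoef_le h)); [now apply acv_upto_rho|now apply acv_ycoef_le].
Qed.

Lemma Ef_S (h : nat) (z : C) : Cmod z <= rho ->
  (Ef (S h) z = Ef h z * (1 - wf z - Ef h z / 2) + Ef h (z ^ 2) / 2)%C.
Proof.
intros H; destruct (Cmod_sqr_le z H) as [H1 H2].
rewrite !Ef_minus by (exact H || apply H2).
pose proof (CPS_y_rec z (acv_upto_rho _ H1) (acv_upto_rho _ H2)) as E1.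
pose proof (CPS_ycoef_le_rec h z H) as E2.
unfold wf, Yf in *.
set (a := CPS y_coef z) in *; set (b := CPS (ycoef_le h) z) in *.
set (b' := CPS (ycoef_le (S h)) z) in *; set (a2 := CPS y_coef (z ^ 2)) in *.
set (b2 := CPS (ycoef_le h) (z ^ 2)) in *.
assert (E3 : (a - b' = (2 * a - 2 * b') / 2)%C).
{ field; intros E0; apply RtoC_inj in E0; lra. }
rewrite E3, E1, E2; field; intros E0; apply RtoC_inj in E0; lra.
Qed.

Lemma Ef_Cmod_le (h : nat) (z : C) : Cmod z <= rho -> Cmod (Ef h z) <= eh h.
Proof.
intros H; pose proof rho_pos.
eapply Rle_trans; [apply CPS_Cmod_le with (r := rho); [apply acv_ecoef; lra|exact H]|].
right; apply Series_ext; intros n; rewrite Rabs_pos_eq; [reflexivity|apply ecoef_ge0].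
Qed.

Lemma ex_series_ecoef (h : nat) (r : R) : 0 <= r <= rho -> ex_series (fun n => ecoef h n * r ^ n).
Proof.
intros H; eapply ex_series_ext; [|exact (acv_ecoef h r H)].
intros n; cbv beta; rewrite Rabs_pos_eq; [reflexivity|apply ecoef_ge0].
Qed.

(** Nonzero coefficients have index [n > h], so squaring the radius gains [rho^n <= rho^h] in every
    term. This makes the term [e_h(z^2)] of the recursion exponentially small. *)
Lemma eh_rho2 (h : nat) : 0 <= PSeries (ecoef h) (rho ^ 2) <= rho ^ h * eh h.
Proof.
pose proof rho_pos; pose proof rho_sqr; pose proof rho_lt1.
split.
- rewrite <- (Rmult_0_l (PSeries (ecoef h) (rho ^ 2))).
  unfold PSeries; rewrite <- Series_scal_l; apply Series_le; [|apply ex_series_ecoef; lra].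
  intros n; rewrite Rmult_0_l; split; [lra|].
  apply Rmult_le_pos; [apply ecoef_ge0|apply pow_le; lra].
- unfold eh, PSeries; rewrite <- Series_scal_l; apply Series_le.
  + intros n; split.
    * apply Rmult_le_pos; [apply ecoef_ge0|apply pow_le; lra].
    * destruct (le_lt_dec n h) as [Hn|Hn].
      { rewrite ecoef_small by lia; lra. }
      replace (rho ^ h * (ecoef h n * rho ^ n)) with (ecoef h n * (rho ^ h * rho ^ n)) by ring.
      apply Rmult_le_compat_l; [apply ecoef_ge0|].
      rewrite <- pow_mult, <- pow_add.
      replace (2 * n)%nat with (h + n + (n - h))%nat by lia.
      rewrite pow_add.
      assert (rho ^ (n - h) <= 1 ^ (n - h)) by (apply pow_incr; lra).
      rewrite pow1 in *.
      assert (0 <= rho ^ (h + n)) by (apply pow_le; lra); nra.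
  + apply (ex_series_scal (K := R_AbsRing) (V := R_NormedModule) (rho ^ h) (fun n => ecoef h n * rho ^ n)).
    apply ex_series_ecoef; lra.
Qed.

Lemma Ef_sqr_Cmod_le (h : nat) (z : C) : Cmod z <= rho -> Cmod (Ef h (z ^ 2)) <= rho ^ h * eh h.
Proof.
intros H; pose proof rho_pos; pose proof rho_sqr; pose proof (Cmod_ge_0 z).
eapply Rle_trans; [apply CPS_Cmod_le with (r := rho ^ 2); [apply acv_ecoef; lra|]|].
- rewrite Cmod_pow; apply pow_incr; lra.
- eapply Rle_trans; [|apply eh_rho2].
  right; apply Series_ext; intros n; rewrite Rabs_pos_eq; [reflexivity|apply ecoef_ge0].
Qed.

Lemma Cpow_RtoC (r : R) (n : nat) : (RtoC r ^ n)%C = RtoC (r ^ n).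
Proof. induction n; [reflexivity|rewrite Cpow_S, IHn, <- RtoC_mult; reflexivity]. Qed.

Lemma eh_S (h : nat) :
  eh (S h) = eh h * (1 - eh h / 2) + PSeries (ecoef h) (rho ^ 2) / 2.
Proof.
pose proof rho_pos.
pose proof (Ef_S h (RtoC rho)) as E.
unfold wf, Yf, Ef in E; rewrite Cpow_RtoC, !CPS_RtoC in E.
specialize (E ltac:(rewrite Cmod_R, Rabs_pos_eq; lra)).
change (PSeries y_coef rho) with (y rho) in E; rewrite y_rho in E.
fold (eh h) (eh (S h)) in E.
apply (f_equal Re) in E.
rewrite <- RtoC_minus, <- !RtoC_div, <- !RtoC_minus, <- !RtoC_mult, <- RtoC_plus in E by lra.
rewrite !re_RtoC in E; lra.
Qed.

Lemma eh_le_1 (h : nat) : 0 <= eh h <= 1.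
Proof.
pose proof rho_pos; split.
- eapply Rle_trans; [apply (Cmod_ge_0 (Ef h (RtoC rho)))|].
  apply Ef_Cmod_le; rewrite Cmod_R, Rabs_pos_eq; lra.
- rewrite <- y_rho; unfold eh, y, PSeries; apply Series_le.
  + intros n; split.
    * apply Rmult_le_pos; [apply ecoef_ge0|apply pow_le; lra].
    * apply Rmult_le_compat_r; [apply pow_le; lra|apply ecoef_le].
  + exists (y rho); apply is_series_psum; [lra|apply acv_rho].
Qed.

(** At [h = 0] the tree with two leaves contributes [rho^2]; afterwards the factor [1 - e_h / 2] is
    at least [1/2]. *)
Lemma eh_pos (h : nat) : 0 < eh h.
Proof.
pose proof rho_pos.
induction h.
- apply Rlt_le_trans with (rho ^ 2); [nra|].
  pose proof (Series_correct _ (ex_series_ecoef 0 rho ltac:(lra))) as S.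
  apply (is_lim_seq_incr_compare (sum_n (fun n => ecoef 0 n * rho ^ n)) (eh 0)) with (n := 2%nat) in S.
  + rewrite sum_n_Reals in S; simpl in S.
    unfold ecoef in S; rewrite !ycoef_le_0, y_coef_0, y_coef_1, y_coef_2 in S.
    unfold ind1 in S; simpl in S; simpl; lra.
  + intros n; rewrite sum_Sn.
    assert (0 <= ecoef 0 (Datatypes.S n) * rho ^ Datatypes.S n); [|unfold plus; simpl in *; lra].
    apply Rmult_le_pos; [apply ecoef_ge0|apply pow_le; lra].
- rewrite eh_S; pose proof (eh_rho2 h); pose proof (eh_le_1 h); nra.
Qed.

(** After the nonnegative term at [rho^2] is dropped, the recursion gives [e_(h+1) (1 + e_h) >= e_h]
    because [e_h <= 1]: each step adds at most 1 to the reciprocal. *)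
Lemma eh_inv_le (h : nat) : / eh h <= / eh 0 + INR h.
Proof.
induction h; [simpl; lra|].
rewrite S_INR.
enough (/ eh (S h) <= / eh h + 1) by lra.
pose proof (eh_pos h); pose proof (eh_pos (S h)); pose proof (eh_le_1 h).
pose proof (eh_rho2 h); pose proof (eh_S h).
assert (E : / eh h + 1 = (1 + eh h) / eh h) by (field; lra).
rewrite E; apply Rmult_le_reg_l with (eh (S h) * eh h); [nra|].
replace (eh (S h) * eh h * / eh (S h)) with (eh h) by (field; lra).
replace (eh (S h) * eh h * ((1 + eh h) / eh h)) with (eh (S h) * (1 + eh h)) by (field; lra).
nra.
Qed.

(** Each of the [h + 1] terms of the geometric sum up to [q^h] is at least [q^h]. *)
Lemma succ_mul_pow_le (q : R) (h : nat) : 0 <= q < 1 -> INR (S h) * q ^ h <= / (1 - q).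
Proof.
intros Hq.
assert (H : INR (S h) * q ^ h <= (1 - q ^ S h) / (1 - q)).
{ rewrite <- tech3 by lra.
  induction h; [simpl; lra|].
  rewrite S_INR, tech5, Rmult_plus_distr_r.
  assert (INR (S h) * q ^ S h <= INR (S h) * q ^ h).
  { apply Rmult_le_compat_l; [apply pos_INR|]; simpl.
    assert (0 <= q ^ h) by (apply pow_le; lra); nra. }
  lra. }
eapply Rle_trans; [exact H|].
unfold Rdiv; rewrite <- (Rmult_1_l (/ (1 - q))) at 2; apply Rmult_le_compat_r.
- left; apply Rinv_0_lt_compat; lra.
- assert (0 <= q ^ S h) by (apply pow_le; lra); lra.
Qed.

(** The term at [rho^2] perturbs the recursion by a relative error of order [B / (h + 1)], which the
    quadratic term absorbs as soon as the constant exceeds [B + 2]; for indices below the constant,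
    [e_h <= 1] is enough. *)
Lemma eh_le : exists A, 0 < A /\ forall h, eh h <= A / INR (S h).
Proof.
pose proof rho_pos; pose proof rho_lt1.
set (B := / (1 - rho)).
assert (HB : 0 < B) by (apply Rinv_0_lt_compat; lra).
destruct (INR_unbounded (B + 2)) as [m Hm].
exists (INR m); split; [lra|].
induction h.
- simpl INR; pose proof (eh_le_1 0); lra.
- assert (s1 : 0 < INR (S h)) by (apply lt_0_INR; lia).
  assert (s2 : INR (S (S h)) = INR (S h) + 1) by apply S_INR.
  destruct (le_lt_dec (S (S h)) m) as [Hh|Hh].
  + eapply Rle_trans; [apply eh_le_1|].
    apply Rmult_le_reg_r with (INR (S (S h))); [lra|].
    replace (INR m / INR (S (S h)) * INR (S (S h))) with (INR m) by (field; lra).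
    rewrite Rmult_1_l; now apply le_INR.
  + assert (Hm' : INR m <= INR (S h)) by (apply le_INR; lia).
    rewrite eh_S; pose proof (eh_rho2 h) as E2; pose proof (eh_pos h).
    assert (Hr : rho ^ h <= B / INR (S h)).
    { apply Rmult_le_reg_l with (INR (S h)); [lra|].
      replace (INR (S h) * (B / INR (S h))) with B by (field; lra).
      apply succ_mul_pow_le; lra. }
    set (x := INR m / INR (S h)) in *.
    assert (Hx : x <= 1).
    { unfold x; apply Rmult_le_reg_r with (INR (S h)); [lra|].
      replace (INR m / INR (S h) * INR (S h)) with (INR m) by (field; lra); lra. }
    set (b := B / INR (S h)) in *.
    assert (b0 : 0 < b) by (apply Rdiv_lt_0_compat; lra).
    assert (Hxb : b + 2 / INR (S h) <= x).
    { unfold x, b, Rdiv; rewrite <- Rmult_plus_distr_r.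
      apply Rmult_le_compat_r; [left; now apply Rinv_0_lt_compat|lra]. }
    assert (H3 : eh h * (1 - eh h / 2) + PSeries (ecoef h) (rho ^ 2) / 2
      <= x * (1 + b / 2 - x / 2)).
    { assert (rho ^ h * eh h <= b * eh h) by nra.
      (* Monotonicity of [e (1 + b / 2 - e / 2)] between [e_h] and [x]: this product is twice the
         difference of the two values. *)
      assert (0 <= (x - eh h) * (2 + b - x - eh h)).
      { apply Rmult_le_pos; lra. }
      nra. }
    eapply Rle_trans; [exact H3|].
    assert (x0 : 0 < x).
    { assert (0 < 2 / INR (S h)) by (apply Rdiv_lt_0_compat; lra); lra. }
    assert (E4 : INR m / INR (S (S h)) = x * (1 - / INR (S (S h)))).
    { unfold x; rewrite s2; field; lra. }
    rewrite E4; apply Rmult_le_compat_l; [lra|].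
    assert (/ INR (S (S h)) <= / INR (S h)) by (apply Rinv_le_contravar; lra).
    unfold Rdiv in Hxb; lra.
Qed.

(** [succ_mul_pow_le] for the fourth root of [q], raised to the fourth power. The exponent 4 is
    large enough for all later uses. *)
Lemma poly_geom (q : R) : 0 <= q < 1 ->
  exists K, 0 < K /\ forall n, INR (S n) ^ 4 * q ^ n <= K.
Proof.
intros Hq.
set (s := sqrt (sqrt q)).
assert (Hs : 0 <= s < 1).
{ split; [apply sqrt_pos|]; unfold s; rewrite <- sqrt_1.
  apply sqrt_lt_1_alt; split; [apply sqrt_pos|].
  rewrite <- sqrt_1; apply sqrt_lt_1_alt; lra. }
assert (E : q = s ^ 4).
{ replace (s ^ 4) with ((s ^ 2) ^ 2) by ring.
  unfold s; rewrite pow2_sqrt by apply sqrt_pos; rewrite pow2_sqrt; lra. }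
exists ((/ (1 - s)) ^ 4); split; [apply pow_lt, Rinv_0_lt_compat; lra|].
intros n; rewrite E, <- pow_mult, Nat.mul_comm, pow_mult, <- Rpow_mult_distr.
apply pow_incr; split; [|now apply succ_mul_pow_le].
apply Rmult_le_pos; [apply pos_INR|apply pow_le; lra].
Qed.

(** * The series [z y'] and [(z d/dz)^2 y], and the expansion of [w^2] at [rho] *)

Definition ycoef1 (n : nat) : R := INR n * y_coef n.
Definition ycoef2 (n : nat) : R := INR n * ycoef1 n.

Lemma ycoef1_ge0 (n : nat) : 0 <= ycoef1 n.
Proof. apply Rmult_le_pos; [apply pos_INR|apply y_coef_ge0]. Qed.

Lemma ycoef2_ge0 (n : nat) : 0 <= ycoef2 n.
Proof. apply Rmult_le_pos; [apply pos_INR|apply ycoef1_ge0]. Qed.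

Lemma acv_ycoef2 (r : R) : 0 <= r < rho -> acv ycoef2 r.
Proof.
intros Hr; pose proof rho_pos.
assert (Hq : 0 <= r / rho < 1).
{ split; [apply Rmult_le_pos; [lra|left; now apply Rinv_0_lt_compat]|].
  apply Rmult_lt_reg_r with rho; [lra|]; unfold Rdiv; rewrite Rmult_assoc, Rinv_l; lra. }
destruct (poly_geom _ Hq) as [K [K0 HK]].
apply ex_series_Rle with (fun n => K * (Rabs (y_coef n) * rho ^ n)).
- intros n; rewrite Rabs_mult, Rabs_Rabsolu, (Rabs_pos_eq (r ^ n)) by (apply pow_le; lra).
  rewrite (Rabs_pos_eq (ycoef2 n)) by apply ycoef2_ge0.
  rewrite (Rabs_pos_eq (y_coef n)) by apply y_coef_ge0.
  unfold ycoef2, ycoef1.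
  replace (r ^ n) with ((r / rho) ^ n * rho ^ n)
    by (rewrite <- Rpow_mult_distr; f_equal; field; lra).
  replace (INR n * (INR n * y_coef n) * ((r / rho) ^ n * rho ^ n))
    with ((INR n ^ 2 * (r / rho) ^ n) * (y_coef n * rho ^ n)) by ring.
  apply Rmult_le_compat_r.
  + apply Rmult_le_pos; [apply y_coef_ge0|apply pow_le; lra].
  + eapply Rle_trans; [|apply (HK n)].
    apply Rmult_le_compat_r; [apply pow_le; lra|].
    rewrite S_INR; pose proof (pos_INR n); nra.
- apply (ex_series_scal (K := R_AbsRing) (V := R_NormedModule) K (fun n => Rabs (y_coef n) * rho ^ n)).
  apply acv_rho.
Qed.

Lemma acv_ycoef1 (r : R) : 0 <= r < rho -> acv ycoef1 r.
Proof.
intros Hr; apply acv_dom with ycoef2; [lra| |now apply acv_ycoef2].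
intros n; rewrite !Rabs_pos_eq by (apply ycoef1_ge0 || apply ycoef2_ge0).
unfold ycoef2; destruct n; [unfold ycoef1; simpl; lra|].
rewrite <- (Rmult_1_l (ycoef1 (S n))) at 1.
apply Rmult_le_compat_r; [apply ycoef1_ge0|].
change 1 with (INR 1); apply le_INR; lia.
Qed.

(** [lambda^2] equals [2 (rho + s1)], while [s2] controls the second-order remainders at [rho^2]. *)
Definition s1 : R := PSeries ycoef1 (rho ^ 2).
Definition s2 : R := PSeries ycoef2 (rho ^ 2).

Lemma PSeries_ge0 (a : nat -> R) (r : R) : 0 <= r -> (forall n, 0 <= a n) -> acv a r ->
  0 <= PSeries a r.
Proof.
intros Hr Ha H.
rewrite <- (Rmult_0_l (PSeries a r)).
unfold PSeries; rewrite <- Series_scal_l; apply Series_le.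
- intros n; rewrite Rmult_0_l; split; [lra|].
  apply Rmult_le_pos; [apply Ha|now apply pow_le].
- eapply ex_series_ext; [|exact H]; intros n; cbv beta; now rewrite Rabs_pos_eq.
Qed.

Lemma s1_ge0 : 0 <= s1.
Proof.
pose proof rho_sqr; apply PSeries_ge0; [lra|apply ycoef1_ge0|apply acv_ycoef1; lra].
Qed.

Lemma s2_ge0 : 0 <= s2.
Proof.
pose proof rho_sqr; apply PSeries_ge0; [lra|apply ycoef2_ge0|apply acv_ycoef2; lra].
Qed.

Lemma s1_eq : s1 = rho ^ 2 * Derive y (rho ^ 2).
Proof.
pose proof rho_sqr.
change y with (PSeries y_coef); rewrite Derive_PSeries.
- rewrite <- PSeries_incr_1; apply PSeries_ext; intros [|n]; [|reflexivity].
  unfold ycoef1, PS_incr_1; simpl; rewrite Rmult_0_l; reflexivity.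
- rewrite (proj1 rho_finite), Rabs_pos_eq by lra; simpl; lra.
Qed.

Lemma lambda_sqr : lambda ^ 2 = 2 * rho + 2 * s1.
Proof.
unfold lambda; rewrite Rmult_assoc, <- s1_eq, pow2_sqrt; [ring|].
pose proof rho_pos; pose proof s1_ge0; lra.
Qed.

Lemma lambda_pos : 0 < lambda.
Proof.
unfold lambda; rewrite Rmult_assoc, <- s1_eq; apply sqrt_lt_R0.
pose proof rho_pos; pose proof s1_ge0; lra.
Qed.

(** Multiplying the Taylor formula at [rho] by [rho^2] avoids negative powers. In the induction the
    remainder for [m + 1] is [z] times the one for [m], plus [m rho^(m+1) (z - rho)^2]. *)
Lemma pow_taylor2 (z : C) (m : nat) : Cmod z <= rho ->
  Cmod (RtoC (rho ^ 2) * (z ^ m - RtoC (rho ^ m)) - RtoC (INR m * rho ^ S m) * (z - RtoC rho))%C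
  <= INR m ^ 2 * rho ^ m * Cmod (z - RtoC rho)%C ^ 2.
Proof.
intros H; pose proof rho_pos; induction m.
- simpl; rewrite Rmult_0_l.
  match goal with |- Cmod ?u <= _ => replace u with (RtoC 0) by ring end.
  rewrite Cmod_0; lra.
- set (T := (RtoC (rho ^ 2) * (z ^ m - RtoC (rho ^ m))
      - RtoC (INR m * rho ^ S m) * (z - RtoC rho))%C) in *.
  match goal with |- Cmod ?u <= _ =>
    replace u with (z * T + RtoC (INR m * rho ^ S m) * (z - RtoC rho) ^ 2)%C end.
  2:{ unfold T; rewrite S_INR.
      change (rho ^ S (S m)) with (rho * (rho * rho ^ m)).
      change (rho ^ S m) with (rho * rho ^ m).
      replace (rho ^ 2) with (rho * rho) by ring.
      rewrite !RtoC_mult, !RtoC_plus, (Cpow_S z m); ring. }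
  eapply Rle_trans; [apply Cmod_triangle|]; rewrite !Cmod_mult, Cmod_pow, Cmod_R.
  set (u := Cmod (z - RtoC rho)%C) in *.
  assert (r0 : 0 <= rho ^ m) by (apply pow_le; lra).
  assert (m0 := pos_INR m).
  rewrite Rabs_pos_eq by (apply Rmult_le_pos; [exact m0|apply pow_le; lra]).
  assert (Cmod z * Cmod T <= rho * (INR m ^ 2 * rho ^ m * u ^ 2)).
  { apply Rmult_le_compat; auto using Cmod_ge_0. }
  rewrite S_INR; simpl (rho ^ S m).
  assert (0 <= rho * rho ^ m * u ^ 2).
  { apply Rmult_le_pos; [nra|apply pow2_ge_0]. }
  nra.
Qed.

(** Relative distance to the singularity, the natural variable of the expansion of [w^2]. *)
Definition delta (z : C) : R := Cmod (1 - z / RtoC rho)%C.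

Lemma RtoC_rho_neq0 : RtoC rho <> RtoC 0.
Proof. intros E; apply RtoC_inj in E; pose proof rho_pos; lra. Qed.

Lemma Cmod_minus_rho (z : C) : Cmod (z - RtoC rho)%C = rho * delta z.
Proof.
pose proof rho_pos; unfold delta.
replace (z - RtoC rho)%C with (- (RtoC rho * (1 - z / RtoC rho)))%C.
- rewrite Cmod_opp, Cmod_mult, Cmod_R, Rabs_pos_eq by lra; reflexivity.
- field; exact RtoC_rho_neq0.
Qed.

(** Although [y] is singular at [rho], [w^2 = 1 - 2 z - y(z^2)] is smooth there because [z^2] stays
    inside the disc. Its value at [rho] is 0 by [rho_eq] and its linear term is
    [lambda^2 (1 - z / rho)]; the constant [4 s2] sums the errors of [pow_taylor2] at the exponents
    [2 n]. *)
Lemma wf_sqr_expansion (z : C) : Cmod z <= rho ->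
  Cmod (wf z * wf z - RtoC (lambda ^ 2) * (1 - z / RtoC rho))%C <= 4 * s2 * delta z ^ 2.
Proof.
intros Hz; pose proof rho_pos; pose proof rho_sqr as R2.
destruct (Cmod_sqr_le z Hz) as [H1 H2].
set (u := (z - RtoC rho)%C).
set (X := (RtoC (rho ^ 2) * (Yf (z ^ 2) - RtoC (y (rho ^ 2))) - RtoC (2 * rho * s1) * u)%C).
assert (HX : Cmod X <= (4 * Cmod u ^ 2) * s2).
{ apply is_CS_Cmod_le with
    (a := fun n => (RtoC (y_coef n) * (RtoC (rho ^ 2) * (z ^ (2 * n) - RtoC (rho ^ (2 * n)))
      - RtoC (INR (2 * n) * rho ^ S (2 * n)) * (z - RtoC rho)))%C)
    (b := fun n => (4 * Cmod u ^ 2) * (ycoef2 n * (rho ^ 2) ^ n)).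
  - assert (Hr : Cmod (RtoC (rho ^ 2)) = rho ^ 2) by (rewrite Cmod_R, Rabs_pos_eq; lra).
    pose proof (CPS_correct y_coef (z ^ 2) (acv_upto_rho _ H2)) as L1.
    pose proof (CPS_correct y_coef (RtoC (rho ^ 2))
      ltac:(rewrite Hr; apply acv_upto_rho; lra)) as L2.
    pose proof (CPS_correct ycoef1 (RtoC (rho ^ 2))
      ltac:(rewrite Hr; apply acv_ycoef1; lra)) as L3.
    rewrite CPS_RtoC in L2, L3.
    change (PSeries ycoef1 (rho ^ 2)) with s1 in L3.
    change (PSeries y_coef (rho ^ 2)) with (y (rho ^ 2)) in L2.
    apply (is_CS_scal (RtoC (rho ^ 2))) in L1.
    apply (is_CS_scal (- RtoC (rho ^ 2))%C) in L2.
    apply (is_CS_scal (- (RtoC (2 * rho) * u))%C) in L3.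
    pose proof (is_CS_plus _ _ _ _ (is_CS_plus _ _ _ _ L1 L2) L3) as L.
    match type of L with is_CS _ ?v => replace X with v end.
    2:{ unfold X, Yf; rewrite !RtoC_mult; ring. }
    eapply is_CS_ext; [|exact L]; intros n; cbv beta; unfold pterm, ycoef1, u.
    rewrite <- Cpow_mult_r, Cpow_RtoC, <- pow_mult, mult_INR.
    change (rho ^ S (2 * n)) with (rho * rho ^ (2 * n)); change (INR 2) with (1 + 1).
    rewrite !RtoC_mult, RtoC_plus. ring.
  - apply (is_series_scal (K := R_AbsRing) (V := R_NormedModule) (4 * Cmod u ^ 2)).
    apply Series_correct; eapply ex_series_ext; [|exact (acv_ycoef2 (rho ^ 2) ltac:(lra))].
    intros n; cbv beta; rewrite Rabs_pos_eq; [reflexivity|apply ycoef2_ge0].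
  - intros n; rewrite Cmod_mult, Cmod_R, Rabs_pos_eq by apply y_coef_ge0.
    eapply Rle_trans; [apply Rmult_le_compat_l; [apply y_coef_ge0|now apply pow_taylor2]|].
    right; rewrite mult_INR, <- pow_mult; unfold ycoef2, ycoef1, u; simpl (INR 2); ring. }
assert (E : (wf z * wf z - RtoC (lambda ^ 2) * (1 - z / RtoC rho) = - (X / RtoC (rho ^ 2)))%C).
{ rewrite wf_sqr, lambda_sqr by exact Hz.
  assert (E1 : RtoC 1 = (2 * RtoC rho + RtoC (y (rho ^ 2)))%C).
  { rewrite <- RtoC_mult, <- RtoC_plus, rho_eq; reflexivity. }
  rewrite E1 at 1; unfold X, u; simpl (rho ^ 2); rewrite !RtoC_plus, !RtoC_mult.
  field; exact RtoC_rho_neq0. }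
rewrite E, Cmod_opp, Cmod_div, Cmod_R, Rabs_pos_eq; [| lra|intros E0; apply RtoC_inj in E0; lra].
apply Rmult_le_reg_r with (rho ^ 2); [lra|].
unfold Rdiv; rewrite Rmult_assoc, Rinv_l, Rmult_1_r by lra.
unfold u in HX; rewrite Cmod_minus_rho in HX; nra.
Qed.

(** * Bounds for [y] and [w] near the critical circle *)

Lemma Yf_Cmod_le1 (z : C) : Cmod z <= rho -> Cmod (Yf z) <= 1.
Proof.
intros H; rewrite <- y_rho.
eapply Rle_trans; [apply CPS_Cmod_le with (r := rho); [apply acv_rho|exact H]|].
right; apply Series_ext; intros n; rewrite Rabs_pos_eq; [reflexivity|apply y_coef_ge0].
Qed.

(** Follows from [|y(z)| <= 1]. It decides which square root of [w^2] is meant, both in the bounds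
    and in the limits. *)
Lemma Re_wf_ge0 (z : C) : Cmod z <= rho -> 0 <= Re (wf z).
Proof.
intros H; pose proof (Yf_Cmod_le1 z H); pose proof (re_le_Cmod (Yf z)) as H1.
apply Rabs_le_between in H1; unfold wf; destruct (Yf z); simpl in *; lra.
Qed.

(** Splitting off [z + z^2 = z (1 + z)] keeps the cancellation in [|1 + z|]; the rest is bounded by
    its value at [|z|], its coefficients being nonnegative since [y_1 = y_2 = 1]. *)
Lemma Yf_split (z : C) : Cmod z <= rho ->
  Cmod (Yf z) <= Cmod z * Cmod (1 + z) + (y (Cmod z) - Cmod z - Cmod z ^ 2).
Proof.
intros H; destruct (Cmod_sqr_le z H) as [H1 H2].
set (b := fun n => y_coef n - (ind1 n + conv ind1 ind1 n)).
assert (A1 : forall u, 0 <= u -> acv (conv ind1 ind1) u)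
  by (intros; apply acv_conv; auto using acv_ind1).
assert (A12 : forall u, 0 <= u -> acv (fun n => ind1 n + conv ind1 ind1 n) u).
{ intros u Hu; apply ex_series_Rle with
    (fun n => Rabs (ind1 n) * u ^ n + Rabs (conv ind1 ind1 n) * u ^ n).
  - intros n; rewrite Rabs_mult, Rabs_Rabsolu, (Rabs_pos_eq (u ^ n)) by now apply pow_le.
    rewrite <- Rmult_plus_distr_r; apply Rmult_le_compat_r; [now apply pow_le|apply Rabs_triang].
  - exact (ex_series_plus _ _ (acv_ind1 u) (A1 u Hu)). }
assert (E : forall u : C, Cmod u <= rho -> (Yf u = u + u * u + CPS b u)%C).
{ intros u Hu; pose proof (Cmod_ge_0 u); unfold b.
  rewrite CPS_minus by (try apply acv_upto_rho; auto; lra).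
  rewrite CPS_plus, CPS_conv, CPS_ind1 by auto using acv_ind1.
  unfold Yf; ring. }
assert (b0 : forall n, 0 <= b n).
{ intros n; unfold b.
  destruct n as [|[|[|n]]].
  - unfold conv, ind1; simpl; rewrite y_coef_0; lra.
  - unfold conv, ind1; simpl; rewrite y_coef_1; lra.
  - unfold conv, ind1; simpl; rewrite y_coef_2; lra.
  - assert (E0 : conv ind1 ind1 (S (S (S n))) = 0).
    { unfold conv; rewrite <- (sum_eq_R0 (fun _ => 0) (S (S (S n)))) by auto.
      apply sum_eq; intros k Hk; unfold ind1.
      destruct (Nat.eqb k 1) eqn:K; [|ring].
      apply Nat.eqb_eq in K; subst k; simpl; ring. }
    rewrite E0; unfold ind1; simpl Nat.eqb; cbv iota.
    pose proof (y_coef_ge0 (S (S (S n)))); lra. }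
assert (Hb : acv b (Cmod z)).
{ apply ex_series_Rle with (fun n => Rabs (y_coef n) * Cmod z ^ n
    + Rabs (ind1 n + conv ind1 ind1 n) * Cmod z ^ n).
  - intros n; rewrite Rabs_mult, Rabs_Rabsolu, (Rabs_pos_eq (Cmod z ^ n)) by now apply pow_le.
    rewrite <- Rmult_plus_distr_r; apply Rmult_le_compat_r; [now apply pow_le|].
    unfold b; eapply Rle_trans; [apply Rabs_triang|]; rewrite Rabs_Ropp; lra.
  - exact (ex_series_plus _ _ (acv_upto_rho _ H1) (A12 _ (proj1 H1))). }
assert (E2 : PSeries b (Cmod z) = y (Cmod z) - Cmod z - Cmod z ^ 2).
{ pose proof (E (RtoC (Cmod z))) as E1.
  rewrite Cmod_R, Rabs_pos_eq in E1 by apply Cmod_ge_0; specialize (E1 H).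
  unfold Yf in E1; rewrite !CPS_RtoC, <- RtoC_mult, <- !RtoC_plus in E1.
  apply RtoC_inj in E1; change (PSeries y_coef (Cmod z)) with (y (Cmod z)) in E1.
  rewrite E1; ring. }
rewrite E by exact H.
replace (z + z * z + CPS b z)%C with (z * (1 + z) + CPS b z)%C by ring.
eapply Rle_trans; [apply Cmod_triangle|]; rewrite Cmod_mult.
apply Rplus_le_compat_l; rewrite <- E2.
eapply Rle_trans; [apply CPS_Cmod_le with (r := Cmod z); [exact Hb|lra]|].
right; apply Series_ext; intros n; rewrite Rabs_pos_eq; auto.
Qed.

Lemma y_le_1 (r : R) : 0 <= r <= rho -> y r <= 1.
Proof.
intros H; pose proof (Yf_Cmod_le1 (RtoC r)) as H1.
unfold Yf in H1; rewrite CPS_RtoC, !Cmod_R, (Rabs_pos_eq r) in H1 by lra.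
specialize (H1 ltac:(lra)); eapply Rle_trans; [apply Rle_abs|exact H1].
Qed.

Lemma Cmod_sqr (z : C) : Cmod z ^ 2 = Re z ^ 2 + Im z ^ 2.
Proof. apply Cmod2_alt. Qed.

Lemma exp_pow (u : R) (j : nat) : exp u ^ j = exp (INR j * u).
Proof.
induction j; [simpl; rewrite Rmult_0_l, exp_0; reflexivity|].
rewrite S_INR; simpl; rewrite IHj, <- exp_plus; f_equal; ring.
Qed.

Lemma exp_ge_1_plus (x : R) : 1 + x <= exp x.
Proof.
destruct (Req_dec x 0) as [->|H]; [rewrite exp_0; lra|].
left; now apply exp_ineq1.
Qed.

Lemma delta_sqr (z : C) :
  rho ^ 2 * delta z ^ 2 = (rho - Cmod z) ^ 2 + 2 * rho * (Cmod z - Re z).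
Proof.
rewrite <- Rpow_mult_distr, <- Cmod_minus_rho, Cmod_sqr.
replace ((rho - Cmod z) ^ 2) with (rho ^ 2 - 2 * rho * Cmod z + Cmod z ^ 2) by ring.
rewrite (Cmod_sqr z); destruct z; simpl; ring.
Qed.

(** Aperiodicity: if [z] is near the critical circle but not near [rho], its argument is bounded
    away from 0, so [|1 + z|] is smaller than [1 + |z|] by a definite amount. *)
Lemma Yf_far (d0 : R) : 0 < d0 <= 1 -> exists k, 0 < k < 1 /\ forall z,
  rho * (1 - d0 / 2) <= Cmod z <= rho -> d0 <= delta z -> Cmod (Yf z) <= 1 - k.
Proof.
intros Hd; pose proof rho_pos; pose proof rho_lt1.
exists (rho * rho * d0 ^ 2 / 16); split.
{ assert (0 < d0 ^ 2 <= 1) by nra. assert (0 < rho * rho < 1) by nra. nra. }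
intros z Hz Hdz; pose proof (Yf_split z ltac:(lra)) as H1.
pose proof (y_le_1 (Cmod z) ltac:(split; [apply Cmod_ge_0|lra])) as H2.
pose proof (delta_sqr z) as H3.
assert (H4 : (rho - Cmod z) ^ 2 <= (rho * (d0 / 2)) ^ 2) by (apply pow_incr; lra).
assert (H5 : rho ^ 2 * d0 ^ 2 <= rho ^ 2 * delta z ^ 2).
{ apply Rmult_le_compat_l; [apply pow2_ge_0|]; apply pow_incr; lra. }
(* In [delta_sqr] the radial part accounts for at most a quarter of [d0^2]; the remaining three
   quarters are angular. *)
assert (H6 : rho * d0 ^ 2 * (3 / 8) <= Cmod z - Re z).
{ apply Rmult_le_reg_l with (2 * rho); [lra|]; nra. }
assert (H7 : Cmod (1 + z)%C ^ 2 = (1 + Cmod z) ^ 2 - 2 * (Cmod z - Re z)).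
{ replace ((1 + Cmod z) ^ 2) with (1 + 2 * Cmod z + Cmod z ^ 2) by ring.
  rewrite !Cmod_sqr; destruct z; simpl; ring. }
assert (H8 : Cmod (1 + z)%C <= 1 + Cmod z - (Cmod z - Re z) / 2).
{ pose proof (re_le_Cmod z) as H8; apply Rabs_le_between in H8.
  pose proof (Cmod_ge_0 z).
  assert (0 <= 1 + Cmod z - (Cmod z - Re z) / 2) by lra.
  apply Rsqr_incr_0_var; [|assumption]; unfold Rsqr.
  replace (Cmod (1 + z)%C * Cmod (1 + z)%C) with (Cmod (1 + z)%C ^ 2) by ring.
  rewrite H7; nra. }
assert (H9 : rho / 2 <= Cmod z) by nra.
assert (Cmod z * Cmod (1 + z)%C <= Cmod z * (1 + Cmod z - (Cmod z - Re z) / 2))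
  by (apply Rmult_le_compat_l; lra).
assert (rho / 2 * (rho * d0 ^ 2 * (3 / 8) / 2) <= Cmod z * ((Cmod z - Re z) / 2)).
{ apply Rmult_le_compat; try lra. assert (0 <= d0 ^ 2) by nra; nra. }
nra.
Qed.

Lemma delta_le_2 (z : C) : Cmod z <= rho -> delta z <= 2.
Proof.
intros H; pose proof rho_pos; unfold delta.
replace (1 - z / RtoC rho)%C with (1 + - (z / RtoC rho))%C by ring.
eapply Rle_trans; [apply Cmod_triangle|].
rewrite Cmod_1, Cmod_opp, Cmod_div, Cmod_R, Rabs_pos_eq by (try exact RtoC_rho_neq0; lra).
enough (Cmod z / rho <= 1) by lra.
apply Rmult_le_reg_r with rho; [lra|]; unfold Rdiv; rewrite Rmult_assoc, Rinv_l; lra.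
Qed.

(** Based on [2 (Re w)^2 = |w|^2 + Re (w^2)]: since [w^2] is close to [lambda^2 (1 - z / rho)],
    whose real part is nonnegative, [Re w] is comparable to [|w|]; then [|y|^2 = 1 - 2 Re w + |w|^2]
    is below 1 by that order. *)
Lemma wf_near : exists d0, 0 < d0 <= 1 /\ forall z, Cmod z <= rho -> delta z <= d0 ->
  Cmod (Yf z) <= 1 - lambda / 12 * sqrt (delta z) /\
  lambda ^ 2 / 2 * delta z <= Cmod (wf z) ^ 2.
Proof.
pose proof rho_pos; pose proof lambda_pos as L0; pose proof s2_ge0 as S0.
assert (L2 : 0 < lambda ^ 2) by nra.
(* Makes the error of the expansion at most a sixth of its main term, and [|w|] at most [1/3]. *)
set (K := 24 * (s2 + 1) + 9 * lambda ^ 2 + 9 * 4 * (s2 + 1)).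
assert (K0 : 0 < K) by (unfold K; lra).
exists (Rmin 1 (Rmin (lambda ^ 2 / K) (1 / K))).
assert (M : 0 < Rmin 1 (Rmin (lambda ^ 2 / K) (1 / K))).
{ repeat apply Rmin_glb_lt; [lra|apply Rdiv_lt_0_compat; lra|apply Rdiv_lt_0_compat; lra]. }
split; [split; [exact M|apply Rmin_l]|].
intros z Hz Hd.
assert (D1 : delta z <= 1) by (eapply Rle_trans; [exact Hd|apply Rmin_l]).
assert (D2 : K * delta z <= lambda ^ 2).
{ replace (lambda ^ 2) with (K * (lambda ^ 2 / K)) by (field; lra).
  apply Rmult_le_compat_l; [lra|].
  eapply Rle_trans; [exact Hd|]; eapply Rle_trans; [apply Rmin_r|apply Rmin_l]. }
assert (D3 : K * delta z <= 1).
{ replace 1 with (K * (1 / K)) by (field; lra).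
  apply Rmult_le_compat_l; [lra|].
  eapply Rle_trans; [exact Hd|]; eapply Rle_trans; [apply Rmin_r|apply Rmin_r]. }
assert (D0 : 0 <= delta z) by apply Cmod_ge_0.
pose proof (wf_sqr_expansion z Hz) as E.
set (v := (1 - z / RtoC rho)%C) in *.
set (X := (wf z * wf z - RtoC (lambda ^ 2) * v)%C) in *.
assert (EX : (wf z * wf z = RtoC (lambda ^ 2) * v + X)%C) by (unfold X; ring).
assert (Hv : Cmod v = delta z) by reflexivity.
assert (Rv : 0 <= Re v).
{ unfold v; assert (Cmod (z / RtoC rho)%C <= 1).
  { rewrite Cmod_div, Cmod_R, Rabs_pos_eq by (try exact RtoC_rho_neq0; lra).
    apply Rmult_le_reg_r with rho; [lra|]; unfold Rdiv; rewrite Rmult_assoc, Rinv_l; lra. }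
  pose proof (re_le_Cmod (z / RtoC rho)%C) as H1; apply Rabs_le_between in H1.
  destruct (z / RtoC rho)%C; simpl in *; lra. }
set (W := Cmod (wf z) ^ 2).
assert (EW : W = Cmod (wf z * wf z)%C) by (rewrite Cmod_mult; unfold W; ring).
assert (X1 : Cmod X <= 4 * (s2 + 1) * delta z ^ 2) by nra.
assert (X2 : 6 * Cmod X <= lambda ^ 2 * delta z).
{ assert (24 * (s2 + 1) * delta z <= lambda ^ 2) by (unfold K in D2; nra). nra. }
assert (W1 : lambda ^ 2 * delta z <= W + Cmod X).
{ rewrite EW, <- Hv; replace (lambda ^ 2 * Cmod v) with (Cmod (RtoC (lambda ^ 2) * v)%C)
    by (rewrite Cmod_mult, Cmod_R, Rabs_pos_eq; lra).
  replace (RtoC (lambda ^ 2) * v)%C with (wf z * wf z + - X)%C by (rewrite EX; ring).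
  eapply Rle_trans; [apply Cmod_triangle|]; rewrite Cmod_opp; lra. }
assert (W2 : W <= lambda ^ 2 * delta z + Cmod X).
{ rewrite EW, EX, <- Hv; eapply Rle_trans; [apply Cmod_triangle|].
  rewrite Cmod_mult, Cmod_R, Rabs_pos_eq; lra. }
assert (R1 : - Cmod X <= Re (wf z * wf z)%C).
{ rewrite EX; pose proof (re_le_Cmod X) as H1; apply Rabs_le_between in H1.
  assert (0 <= Re (RtoC (lambda ^ 2) * v)%C) by (rewrite re_scal_l; nra).
  rewrite re_plus; lra. }
assert (A0 : 0 <= Re (wf z)) by now apply Re_wf_ge0.
assert (A1 : 2 * Re (wf z) ^ 2 = W + Re (wf z * wf z)%C).
{ unfold W; rewrite Cmod_sqr, re_mult; ring. }
set (a := Re (wf z)) in *.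
assert (A2 : W <= 3 * a ^ 2) by lra.
assert (A3 : lambda ^ 2 / 36 * delta z <= a ^ 2) by lra.
assert (A4 : a <= / 3).
{ assert (9 * W <= 1).
  { assert (9 * lambda ^ 2 * delta z + 9 * 4 * (s2 + 1) * delta z ^ 2 <= K * delta z).
    { unfold K; assert (delta z ^ 2 <= delta z) by nra; nra. }
    lra. }
  assert (a ^ 2 <= W) by (unfold W; rewrite Cmod_sqr; fold a; pose proof (pow2_ge_0 (Im (wf z))); lra).
  nra. }
split.
- assert (B1 : lambda / 6 * sqrt (delta z) <= a).
  { apply Rsqr_incr_0_var; [|exact A0]; unfold Rsqr.
    replace (lambda / 6 * sqrt (delta z) * (lambda / 6 * sqrt (delta z)))
      with (lambda ^ 2 / 36 * (sqrt (delta z) * sqrt (delta z))) by field.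
    rewrite sqrt_sqrt by exact D0; lra. }
  assert (B2 : Cmod (Yf z) ^ 2 = 1 - 2 * a + W).
  { unfold W, a; replace (Yf z) with (1 - wf z)%C by (unfold wf; ring).
    rewrite !Cmod_sqr; destruct (wf z); simpl; ring. }
  assert (B3 : Cmod (Yf z) <= 1 - a / 2).
  { apply Rsqr_incr_0_var; [|lra]; unfold Rsqr.
    replace (Cmod (Yf z) * Cmod (Yf z)) with (Cmod (Yf z) ^ 2) by ring; nra. }
  lra.
- fold W; lra.
Qed.

(** Joins the regimes near and away from [rho]. The exponential form is chosen because the bound
    will be iterated over a number of steps of order [h]. *)
Lemma Yf_wf_bounds : exists c K r0, 0 < c /\ 0 < K /\ 0 < r0 < 1 /\
  forall z, rho * r0 <= Cmod z <= rho ->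
    Cmod (Yf z) <= exp (- c * sqrt (delta z)) /\
    c * delta z <= Cmod (wf z) ^ 2 <= K * delta z.
Proof.
pose proof rho_pos; pose proof lambda_pos as L0; pose proof s2_ge0 as S0.
destruct wf_near as [d0 [Hd Hn]].
destruct (Yf_far d0 Hd) as [k [Hk Hf]].
set (c := Rmin (Rmin (lambda / 12) (k / 2)) (Rmin (lambda ^ 2 / 2) (k ^ 2 / 2))).
assert (C0 : 0 < c).
{ unfold c; repeat apply Rmin_glb_lt; nra. }
assert (C1 : c <= lambda / 12) by (eapply Rle_trans; [apply Rmin_l|apply Rmin_l]).
assert (C2 : c <= k / 2) by (eapply Rle_trans; [apply Rmin_l|apply Rmin_r]).
assert (C3 : c <= lambda ^ 2 / 2) by (eapply Rle_trans; [apply Rmin_r|apply Rmin_l]).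
assert (C4 : c <= k ^ 2 / 2) by (eapply Rle_trans; [apply Rmin_r|apply Rmin_r]).
exists c, (lambda ^ 2 + 8 * s2), (1 - d0 / 2).
split; [exact C0|split; [nra|split; [lra|]]].
intros z Hz.
assert (D0 : 0 <= delta z) by apply Cmod_ge_0.
assert (D2 := delta_le_2 z (proj2 Hz)).
assert (Q0 := sqrt_pos (delta z)).
assert (U : Cmod (wf z) ^ 2 <= (lambda ^ 2 + 8 * s2) * delta z).
{ replace (Cmod (wf z) ^ 2) with (Cmod (wf z * wf z)%C) by (rewrite Cmod_mult; ring).
  pose proof (wf_sqr_expansion z (proj2 Hz)) as E.
  replace (wf z * wf z)%C with
    (RtoC (lambda ^ 2) * (1 - z / RtoC rho)
     + (wf z * wf z - RtoC (lambda ^ 2) * (1 - z / RtoC rho)))%C by ring.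
  eapply Rle_trans; [apply Cmod_triangle|].
  rewrite Cmod_mult, Cmod_R, Rabs_pos_eq by nra.
  change (Cmod (1 - z / RtoC rho)%C) with (delta z).
  assert (delta z ^ 2 <= 2 * delta z) by nra. nra. }
destruct (Rle_lt_dec (delta z) d0) as [Hnear|Hfar].
- destruct (Hn z (proj2 Hz) Hnear) as [H1 H2]; split; [|split; [nra|exact U]].
  eapply Rle_trans; [exact H1|].
  eapply Rle_trans; [|apply exp_ge_1_plus]; nra.
- assert (H1 := Hf z Hz ltac:(lra)); split; [|split; [|exact U]].
  + eapply Rle_trans; [exact H1|].
    eapply Rle_trans; [|apply exp_ge_1_plus].
    assert (sqrt (delta z) <= 2).
    { rewrite <- (sqrt_pow2 2) by lra; apply sqrt_le_1_alt; lra. }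
    nra.
  + assert (H2 : k <= Cmod (wf z)).
    { assert (1 <= Cmod (wf z) + Cmod (Yf z)); [|lra].
      rewrite <- Cmod_1; replace (RtoC 1) with (wf z + Yf z)%C at 1 by (unfold wf; ring).
      apply Cmod_triangle. }
    assert (k ^ 2 <= Cmod (wf z) ^ 2) by (apply pow_incr; lra).
    nra.
Qed.

(** * The complex exponential and limits along a filter *)

Definition cexp (z : C) : C := (exp (Re z) * cos (Im z), exp (Re z) * sin (Im z)).

Lemma cexp_plus (a b : C) : cexp (a + b) = (cexp a * cexp b)%C.
Proof.
unfold cexp; rewrite re_plus, im_plus, exp_plus, cos_plus, sin_plus.
unfold Cmult; simpl; f_equal; ring.
Qed.

Lemma cexp_0 : cexp 0 = 1.
Proof. unfold cexp; simpl; rewrite exp_0, cos_0, sin_0; unfold RtoC; f_equal; ring. Qed.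

Lemma Cmod_cexp (z : C) : Cmod (cexp z) = exp (Re z).
Proof.
unfold Cmod, cexp; simpl.
replace (_ + _) with (exp (Re z) ^ 2 * (Rsqr (sin (Im z)) + Rsqr (cos (Im z))))
  by (unfold Rsqr; ring).
rewrite sin2_cos2, Rmult_1_r; apply sqrt_pow2; left; apply exp_pos.
Qed.

Lemma cexp_neq0 (z : C) : cexp z <> 0.
Proof. apply Cmod_gt_0; rewrite Cmod_cexp; apply exp_pos. Qed.

Lemma cexp_opp (z : C) : cexp (- z) = (/ cexp z)%C.
Proof.
assert (H : (cexp (- z) * cexp z)%C = 1).
{ rewrite <- cexp_plus; replace (- z + z)%C with (RtoC 0) by ring; apply cexp_0. }
rewrite <- (Cmult_1_l (/ cexp z)%C), <- H; field; apply cexp_neq0.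
Qed.

Lemma cexp_INR (n : nat) (z : C) : cexp (RtoC (INR n) * z) = (cexp z ^ n)%C.
Proof.
induction n; [simpl; rewrite Cmult_0_l; apply cexp_0|].
rewrite S_INR, Cpow_S, <- IHn, <- cexp_plus, RtoC_plus; f_equal; ring.
Qed.

Lemma exp_sub1_bound (x : R) : Rabs (exp x - 1) <= Rabs x * exp (Rabs x).
Proof.
pose proof (exp_ineq1_le x) as H1; pose proof (exp_ineq1_le (- x)) as H2.
pose proof (exp_pos x) as H3.
assert (E : exp x * exp (- x) = 1) by (rewrite <- exp_plus, Rplus_opp_r; apply exp_0).
destruct (Rle_lt_dec 0 x) as [Hx|Hx].
- rewrite (Rabs_pos_eq x), Rabs_pos_eq by lra; nra.
- rewrite (Rabs_left x), Rabs_left1 by (try apply Rminus_le; try nra; lra).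
  assert (1 <= exp (- x)) by lra. nra.
Qed.

Lemma exp_taylor2 (x : R) : Rabs (exp x - 1 - x) <= x ^ 2 * exp (Rabs x).
Proof.
pose proof (exp_ineq1_le x) as H1; pose proof (exp_sub1_bound x) as H2.
rewrite Rabs_pos_eq by lra.
pose proof (exp_ineq1_le (- x)) as H3; pose proof (exp_pos x) as H4.
assert (E : exp x * exp (- x) = 1) by (rewrite <- exp_plus, Rplus_opp_r; apply exp_0).
destruct (Rle_lt_dec 0 x) as [Hx|Hx].
- rewrite (Rabs_pos_eq x) in * by lra.
  assert (exp x - 1 <= x * exp x) by nra. nra.
- rewrite (Rabs_left x) by lra. nra.
Qed.

Lemma Rabs_sin_le (x : R) : Rabs (sin x) <= Rabs x.
Proof.
assert (P : forall u, 0 < u -> Rabs (sin u) <= u).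
{ intros u Hu; apply Rabs_le; split; [|left; now apply sin_lt_x].
  destruct (Rle_lt_dec u PI) as [H|H].
  - pose proof (sin_ge_0 u ltac:(lra) H); lra.
  - pose proof (SIN_bound u); pose proof PI2_1; lra. }
destruct (Rtotal_order x 0) as [H|[->|H]].
- replace (sin x) with (- sin (- x)) by (rewrite sin_neg; ring).
  rewrite Rabs_Ropp, (Rabs_left x) by lra; apply P; lra.
- rewrite sin_0, Rabs_R0; lra.
- rewrite (Rabs_pos_eq x) by lra; now apply P.
Qed.

Lemma cos_ge_quad (x : R) : 1 - x ^ 2 / 2 <= cos x <= 1.
Proof.
split; [|apply COS_bound].
replace x with (2 * (x / 2)) at 2 by field; rewrite cos_2a_sin.
pose proof (Rabs_sin_le (x / 2)) as H.
apply Rsqr_le_abs_1 in H; unfold Rsqr in H; nra.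
Qed.

Lemma sin_sub_bound (x : R) : Rabs (sin x - x) <= x ^ 2.
Proof.
assert (P : forall u, 0 < u -> Rabs (sin u - u) <= u ^ 2).
{ intros u Hu.
  destruct (MVT_cor2 (fun v => sin v - v) (fun v => cos v - 1) 0 u Hu) as [c [E Hc]].
  { intros c _; apply derivable_pt_lim_minus; [apply derivable_pt_lim_sin|apply derivable_pt_lim_id]. }
  rewrite sin_0 in E; replace (sin u - u) with (sin u - u - (0 - 0)) by ring.
  rewrite E, Rminus_0_r, Rabs_mult, (Rabs_pos_eq u) by lra.
  simpl; rewrite Rmult_1_r; apply Rmult_le_compat_r; [lra|].
  pose proof (cos_ge_quad c) as H; pose proof (COS_bound c).
  rewrite Rabs_left1 by lra.
  destruct (Rle_lt_dec 2 c); [lra|nra]. }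
destruct (Rtotal_order x 0) as [H|[->|H]].
- replace (sin x - x) with (- (sin (- x) - - x)) by (rewrite sin_neg; ring).
  rewrite Rabs_Ropp; replace (x ^ 2) with ((- x) ^ 2) by ring; apply P; lra.
- rewrite sin_0, Rminus_0_r, Rabs_R0; lra.
- now apply P.
Qed.

Lemma Cmod_le_abs (a b : R) : Cmod (a, b) <= Rabs a + Rabs b.
Proof.
replace (a, b) with (RtoC a + RtoC b * Ci)%C
  by (unfold RtoC, Ci, Cplus, Cmult; simpl; f_equal; ring).
eapply Rle_trans; [apply Cmod_triangle|].
rewrite Cmod_mult, Cmod_Ci, !Cmod_R; lra.
Qed.

Lemma abs_re_im_le (z : C) : Rabs (Re z) <= Cmod z /\ Rabs (Im z) <= Cmod z.
Proof.
split; [apply re_le_Cmod|].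
eapply Rle_trans; [apply Rmax_r|apply (Rmax_Cmod z)].
Qed.

Lemma cexp_taylor2 (z : C) : Cmod (cexp z - 1 - z)%C <= 5 * Cmod z ^ 2 * exp (Rabs (Re z)).
Proof.
destruct z as [x v].
destruct (abs_re_im_le (x, v)) as [Hx Hv]; simpl in Hx, Hv |- *.
set (m := Cmod (x, v)) in *.
assert (E : (cexp (x, v) - 1 - (x, v))%C =
  (RtoC (exp x) * ((cos v - 1)%R, (sin v - v)%R) + (RtoC (exp x - 1 - x) + (0%R, (v * (exp x - 1))%R)))%C).
{ unfold cexp, RtoC, Cminus, Cplus, Copp, Cmult; simpl; f_equal; ring. }
rewrite E; clear E.
pose proof (exp_taylor2 x) as H1; pose proof (exp_sub1_bound x) as H2.
pose proof (exp_pos x) as H3; pose proof (cos_ge_quad v) as H4; pose proof (sin_sub_bound v) as H5.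
assert (H6 : 1 <= exp (Rabs x)) by (pose proof (exp_ineq1_le (Rabs x)); pose proof (Rabs_pos x); lra).
assert (H7 : exp x <= exp (Rabs x)).
{ destruct (Rle_abs x) as [H|H]; [left; now apply exp_increasing|right; now rewrite <- H]. }
eapply Rle_trans; [apply Cmod_triangle|].
eapply Rle_trans; [apply Rplus_le_compat_l, Cmod_triangle|].
rewrite Cmod_mult, !Cmod_R, (Rabs_pos_eq (exp x)) by lra.
assert (Xm : x ^ 2 <= m ^ 2) by (apply pow_maj_Rabs; exact Hx).
assert (Vm : v ^ 2 <= m ^ 2) by (apply pow_maj_Rabs; exact Hv).
assert (M0 : 0 <= m) by apply Cmod_ge_0.
assert (K1 : Cmod (cos v - 1, sin v - v) <= 2 * m ^ 2).
{ eapply Rle_trans; [apply Cmod_le_abs|].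
  rewrite (Rabs_left1 (cos v - 1)) by lra. nra. }
assert (K2 : Cmod (0, v * (exp x - 1)) <= m ^ 2 * exp (Rabs x)).
{ eapply Rle_trans; [apply Cmod_le_abs|]; rewrite Rabs_R0, Rplus_0_l, Rabs_mult.
  apply Rle_trans with (m * (m * exp (Rabs x))); [|right; ring].
  apply Rmult_le_compat; try apply Rabs_pos; [exact Hv|].
  eapply Rle_trans; [exact H2|]; apply Rmult_le_compat_r; [lra|exact Hx]. }
assert (K3 : exp x * Cmod (cos v - 1, sin v - v) <= exp (Rabs x) * (2 * m ^ 2)).
{ apply Rmult_le_compat; auto using Cmod_ge_0; lra. }
assert (x ^ 2 * exp (Rabs x) <= m ^ 2 * exp (Rabs x)) by (apply Rmult_le_compat_r; lra).
assert (0 <= m ^ 2 * exp (Rabs x)) by (apply Rmult_le_pos; [apply pow2_ge_0|lra]).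
lra.
Qed.

Section Limits.
Context {T : Type} (F : (T -> Prop) -> Prop) {FF : Filter F}.

(** Limits along an arbitrary filter, since the same lemmas are applied to sequences and to joint
    limits in size, height, [x] and [t]. *)
Definition Clim (f : T -> C) (l : C) : Prop :=
  forall eps : R, 0 < eps -> F (fun i => Cmod (f i - l)%C < eps).

Lemma Clim_ext_loc (f g : T -> C) (l : C) :
  F (fun i => f i = g i) -> Clim f l -> Clim g l.
Proof.
intros E H eps He; specialize (H eps He).
generalize (filter_and _ _ E H); apply filter_imp; intros i [-> H1]; exact H1.
Qed.

Lemma Clim_ext (f g : T -> C) (l : C) : (forall i, f i = g i) -> Clim f l -> Clim g l.
Proof. intros E; apply Clim_ext_loc; now apply filter_forall. Qed.

Lemma Clim_const (l : C) : Clim (fun _ => l) l.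
Proof.
intros eps He; apply filter_forall; intros _.
replace (l - l)%C with (RtoC 0) by ring; now rewrite Cmod_0.
Qed.

Lemma Clim_plus (f g : T -> C) (l m : C) :
  Clim f l -> Clim g m -> Clim (fun i => f i + g i)%C (l + m)%C.
Proof.
intros Hf Hg eps He.
assert (H2 : 0 < eps / 2) by lra.
generalize (filter_and _ _ (Hf _ H2) (Hg _ H2)); clear H2.
apply filter_imp; intros i [H1 H2].
replace (f i + g i - (l + m))%C with ((f i - l) + (g i - m))%C by ring.
eapply Rle_lt_trans; [apply Cmod_triangle|lra].
Qed.

Lemma Clim_mult (f g : T -> C) (l m : C) :
  Clim f l -> Clim g m -> Clim (fun i => f i * g i)%C (l * m)%C.
Proof.
intros Hf Hg eps He.
set (B := 1 + Cmod l + Cmod m).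
assert (B1 : 1 <= B) by (unfold B; pose proof (Cmod_ge_0 l); pose proof (Cmod_ge_0 m); lra).
set (d := Rmin 1 (eps / (3 * B))).
assert (d0 : 0 < d) by (apply Rmin_glb_lt; [lra|apply Rdiv_lt_0_compat; lra]).
assert (d1 : d <= 1) by apply Rmin_l.
assert (d2 : 3 * B * d <= eps).
{ replace eps with (3 * B * (eps / (3 * B))) by (field; lra).
  apply Rmult_le_compat_l; [lra|apply Rmin_r]. }
generalize (filter_and _ _ (Hf d d0) (Hg d d0)).
apply filter_imp; intros i [H1 H2].
replace (f i * g i - l * m)%C with ((f i - l) * (g i - m) + ((f i - l) * m + l * (g i - m)))%C by ring.
eapply Rle_lt_trans; [apply Cmod_triangle|].
eapply Rle_lt_trans; [apply Rplus_le_compat_l, Cmod_triangle|].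
rewrite !Cmod_mult.
pose proof (Cmod_ge_0 (f i - l)%C); pose proof (Cmod_ge_0 (g i - m)%C).
pose proof (Cmod_ge_0 l); pose proof (Cmod_ge_0 m).
set (p := Cmod (f i - l)%C) in *; set (q := Cmod (g i - m)%C) in *.
set (cl := Cmod l) in *; set (cm := Cmod m) in *.
assert (p * q <= d * 1) by (apply Rmult_le_compat; lra).
assert (p * cm <= d * cm) by (apply Rmult_le_compat_r; lra).
assert (cl * q <= cl * d) by (apply Rmult_le_compat_l; lra).
unfold B in d2; nra.
Qed.

Lemma Clim_opp (f : T -> C) (l : C) : Clim f l -> Clim (fun i => - f i)%C (- l)%C.
Proof.
intros H eps He; generalize (H eps He); apply filter_imp; intros i Hi.
replace (- f i - - l)%C with (- (f i - l))%C by ring; now rewrite Cmod_opp.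
Qed.

Lemma Clim_minus (f g : T -> C) (l m : C) :
  Clim f l -> Clim g m -> Clim (fun i => f i - g i)%C (l - m)%C.
Proof. intros Hf Hg; apply Clim_plus; [exact Hf|now apply Clim_opp]. Qed.

Lemma Clim_inv (f : T -> C) (l : C) : l <> 0 -> Clim f l -> Clim (fun i => / f i)%C (/ l)%C.
Proof.
intros Hl Hf eps He.
assert (L0 : 0 < Cmod l) by now apply Cmod_gt_0.
set (d := Rmin (Cmod l / 2) (eps * Cmod l ^ 2 / 2)).
assert (P : 0 < eps * Cmod l ^ 2 / 2) by (assert (0 < Cmod l ^ 2) by nra; nra).
assert (d0 : 0 < d) by (apply Rmin_glb_lt; lra).
generalize (Hf d d0); apply filter_imp; intros i Hi.
assert (d1 : d <= Cmod l / 2) by apply Rmin_l.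
assert (d2 : d <= eps * Cmod l ^ 2 / 2) by apply Rmin_r.
assert (H1 : Cmod l / 2 < Cmod (f i)).
{ assert (Cmod l <= Cmod (f i) + Cmod (f i - l)%C); [|lra].
  replace l with (f i + - (f i - l))%C at 1 by ring.
  eapply Rle_trans; [apply Cmod_triangle|]; rewrite Cmod_opp; lra. }
assert (Hfi : f i <> 0) by (apply Cmod_gt_0; lra).
replace (/ f i - / l)%C with (- (f i - l) / (f i * l))%C by (field; auto).
rewrite Cmod_div, Cmod_opp, Cmod_mult by now apply Cmult_neq_0.
apply Rmult_lt_reg_r with (Cmod (f i) * Cmod l); [nra|].
unfold Rdiv; rewrite Rmult_assoc, Rinv_l, Rmult_1_r by nra.
eapply Rlt_le_trans; [exact Hi|]. nra.
Qed.

Lemma Clim_div (f g : T -> C) (l m : C) : m <> 0 ->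
  Clim f l -> Clim g m -> Clim (fun i => f i / g i)%C (l / m)%C.
Proof. intros Hm Hf Hg; apply Clim_mult; [exact Hf|now apply Clim_inv]. Qed.

Lemma Clim_Cmod_lt (f : T -> C) (l : C) (M : R) : Clim f l -> Cmod l < M ->
  F (fun i => Cmod (f i) < M).
Proof.
intros H HM; assert (H2 : 0 < M - Cmod l) by lra; generalize (H _ H2); apply filter_imp; intros i Hi.
replace (f i) with (l + (f i - l))%C by ring.
eapply Rle_lt_trans; [apply Cmod_triangle|lra].
Qed.

Lemma Clim_Cmod_gt (f : T -> C) (l : C) (M : R) : Clim f l -> M < Cmod l ->
  F (fun i => M < Cmod (f i)).
Proof.
intros H HM; assert (H2 : 0 < Cmod l - M) by lra; generalize (H _ H2); apply filter_imp; intros i Hi.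
assert (Cmod l <= Cmod (f i) + Cmod (f i - l)%C); [|lra].
replace l with (f i + - (f i - l))%C at 1 by ring.
eapply Rle_trans; [apply Cmod_triangle|]; rewrite Cmod_opp; lra.
Qed.

Lemma Clim_dist (f g : T -> C) (l : C) : Clim (fun i => g i - f i)%C 0 -> Clim f l -> Clim g l.
Proof.
intros H Hf; replace l with (0 + l)%C by ring.
eapply Clim_ext; [|exact (Clim_plus _ _ _ _ H Hf)]; intros i; simpl; ring.
Qed.

Lemma Clim_0_le (f : T -> C) (b : T -> R) :
  F (fun i => Cmod (f i) <= b i) -> (forall eps, 0 < eps -> F (fun i => b i < eps)) -> Clim f 0.
Proof.
intros H Hb eps He; generalize (filter_and _ _ H (Hb eps He)); apply filter_imp.
intros i [H1 H2]; replace (f i - 0)%C with (f i) by ring; lra.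
Qed.

Lemma Clim_cexp (f : T -> C) (l : C) : Clim f l -> Clim (fun i => cexp (f i)) (cexp l).
Proof.
intros H; apply Clim_ext with (fun i => cexp l * cexp (f i - l))%C.
{ intros i; rewrite <- cexp_plus; f_equal; ring. }
rewrite <- (Cmult_1_r (cexp l)); apply Clim_mult; [rewrite Cmult_1_r; apply Clim_const|].
apply Clim_dist with (fun _ => RtoC 1); [|apply Clim_const].
apply Clim_0_le with (fun i => (1 + 5 * exp 1) * Cmod (f i - l)%C).
- generalize (H 1 Rlt_0_1); apply filter_imp; intros i Hi.
  set (z := (f i - l)%C) in *.
  replace (cexp z - 1)%C with (z + (cexp z - 1 - z))%C by ring.
  eapply Rle_trans; [apply Cmod_triangle|].
  pose proof (cexp_taylor2 z) as H1; pose proof (Cmod_ge_0 z).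
  assert (H2 : exp (Rabs (Re z)) <= exp 1).
  { left; apply exp_increasing; eapply Rle_lt_trans; [apply re_le_Cmod|exact Hi]. }
  assert (5 * Cmod z ^ 2 * exp (Rabs (Re z)) <= 5 * Cmod z * exp 1).
  { apply Rmult_le_compat; [|left; apply exp_pos| |exact H2].
    - assert (0 <= Cmod z ^ 2) by apply pow2_ge_0; lra.
    - nra. }
  lra.
- intros eps He; pose proof (exp_pos 1).
  assert (H2 : 0 < eps / (1 + 5 * exp 1)) by (apply Rdiv_lt_0_compat; lra).
  generalize (H _ H2); clear H2.
  apply filter_imp; intros i Hi.
  replace eps with ((1 + 5 * exp 1) * (eps / (1 + 5 * exp 1))) by (field; lra).
  apply Rmult_lt_compat_l; [lra|exact Hi].
Qed.

End Limits.

(** Solution, started from 0, of the unperturbed recursion for [1 / E_h]. At a fixed starting height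
    the true value differs from it by a bounded amount, negligible against the main order. *)
Fixpoint ph (w : C) (h : nat) : C :=
  match h with O => RtoC 0 | S h => ((1 + w) * ph w h + / 2)%C end.

Lemma C2_neq0 : RtoC 2 <> 0.
Proof. intros E; apply RtoC_inj in E; lra. Qed.

Lemma ph_closed (w : C) (h : nat) : (2 * w * ph w h = (1 + w) ^ h - 1)%C.
Proof.
induction h; [simpl; ring|].
simpl ph; rewrite Cpow_S.
replace (2 * w * ((1 + w) * ph w h + / 2))%C with ((1 + w) * (2 * w * ph w h) + w)%C
  by (field; exact C2_neq0).
rewrite IHh; ring.
Qed.

Lemma Cmod_ph (w : C) (h : nat) : Cmod (ph w h) <= INR h * (1 + Cmod w) ^ h.
Proof.
pose proof (Cmod_ge_0 w).
induction h; [simpl; rewrite Cmod_0; lra|].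
rewrite S_INR; simpl ph; eapply Rle_trans; [apply Cmod_triangle|].
rewrite Cmod_mult, Cmod_inv, Cmod_R, Rabs_pos_eq by (try exact C2_neq0; lra).
assert (H1 : Cmod (1 + w)%C <= 1 + Cmod w).
{ eapply Rle_trans; [apply Cmod_triangle|]; rewrite Cmod_1; lra. }
assert (H2 : 1 <= (1 + Cmod w) ^ S h) by (apply pow_R1_Rle; lra).
assert (H3 : Cmod (1 + w)%C * Cmod (ph w h) <= (1 + Cmod w) * (INR h * (1 + Cmod w) ^ h)).
{ apply Rmult_le_compat; auto using Cmod_ge_0. }
simpl in *; lra.
Qed.

(** A square root instead of a logarithm is wasteful but sufficient: the sum only has to be
    negligible against its number of terms. *)
Lemma sum_inv_sqrt (j k : nat) : (j <= k)%nat ->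
  sum_f_R0 (fun i => / INR (S i)) k <= 2 * sqrt (INR (S k)).
Proof.
intros _; induction k.
- simpl; rewrite sqrt_1; lra.
- rewrite tech5.
  set (a := sqrt (INR (S k))); set (b := sqrt (INR (S (S k)))) in *.
  assert (b2 : b * b = INR (S (S k))) by (apply sqrt_sqrt, pos_INR).
  assert (a2 : a * a = INR (S k)) by (apply sqrt_sqrt, pos_INR).
  assert (b0 : 0 < b) by (apply sqrt_lt_R0, lt_0_INR; lia).
  assert (a0 : 0 <= a) by apply sqrt_pos.
  fold a in IHk; rewrite <- b2.
  assert (E : b * b = a * a + 1) by (rewrite a2, b2, <- S_INR; reflexivity).
  enough (/ (b * b) <= 2 * (b - a)) by lra.
  apply Rmult_le_reg_l with (b * b); [nra|]; rewrite Rinv_r by nra.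
  assert (b1 : 1 <= b) by nra.
  assert (ab : a <= b) by nra.
  assert (1 = (b - a) * (b + a)) by nra.
  assert ((b - a) * (b + a) <= (b - a) * (2 * b)) by (apply Rmult_le_compat_l; lra).
  nra.
Qed.

Lemma one_plus_pow_le (q : R) (n : nat) : 0 <= q -> (1 + q) ^ n <= exp (q * INR n).
Proof.
intros Hq.
induction n; [simpl; rewrite Rmult_0_r, exp_0; lra|].
rewrite S_INR, Rmult_plus_distr_l, Rmult_1_r, exp_plus; simpl.
rewrite Rmult_comm; apply Rmult_le_compat; [apply pow_le; lra|lra|exact IHn|].
apply exp_ineq1_le.
Qed.

Lemma Cmod_1_minus (d : C) : 1 <= Cmod (1 - d)%C + Cmod d.
Proof.
pose proof (Cmod_triangle (1 - d) d) as H.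
replace (1 - d + d)%C with (RtoC 1) in H by ring; now rewrite Cmod_1 in H.
Qed.

(** * The perturbed affine recursion for [1 / E_h] *)

Section Core.
Variables (A K : R).
Hypothesis A0 : 0 < A.
Hypothesis HA : forall h, eh h <= A / INR (S h).
Hypothesis K0 : 0 < K.
Hypothesis HK : forall n, INR (S n) ^ 4 * rho ^ n <= K.

(* One step of the recursion for [u = 1 / E_h]: it is affine up to an error that
   is summable against [sqrt n]. *)
Lemma inv_step (B W : R) (z : C) (j : nat) :
  0 < B -> Cmod z <= rho -> Ef j z <> 0 -> Cmod (wf z) <= / 8 ->
  4 * A <= INR (S j) -> 8 * A * B * K <= INR (S j) ->
  Cmod (/ Ef j z)%C <= B * INR (S j) ->
  Ef (S j) z <> 0 /\
  Cmod (/ Ef (S j) z - ((1 + wf z) * / Ef j z + / 2))%C <=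
    6 * Cmod (/ Ef j z)%C * Cmod (wf z) ^ 2
    + (A * B ^ 2 * K + 2 * A + 6 * A ^ 2 * B ^ 3 * K ^ 2) / INR (S j).
Proof.
intros B0 Hz HE Hw HJ1 HJ2 Hu.
pose proof rho_pos; pose proof rho_lt1.
set (u := (/ Ef j z)%C) in *; set (w := wf z) in *; set (e := Ef j z) in *.
set (eta := (Ef j (z ^ 2) / 2)%C).
set (s := INR (S j)) in *.
assert (s0 : 1 <= s) by (unfold s; change 1 with (INR 1); apply le_INR; lia).
set (g := rho ^ j).
assert (g0 : 0 <= g) by (apply pow_le; lra).
assert (Hg : s ^ 4 * g <= K) by apply HK.
assert (He : Cmod e <= A / s) by (eapply Rle_trans; [now apply Ef_Cmod_le|apply HA]).
assert (ue : (u * e = 1)%C) by (unfold u; field; exact HE).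
assert (Heta : Cmod eta <= A * g).
{ unfold eta; rewrite Cmod_div, Cmod_R, Rabs_pos_eq by (try exact C2_neq0; lra).
  pose proof (Ef_sqr_Cmod_le j z Hz) as H1; pose proof (eh_le_1 j) as H2.
  assert (H3 : eh j <= A).
  { eapply Rle_trans; [apply HA|]; fold s; apply Rmult_le_reg_r with s; [lra|].
    unfold Rdiv; rewrite Rmult_assoc, Rinv_l by lra; nra. }
  fold g in H1; nra. }
assert (Ge : forall a b : R, a <= b / s -> a * s <= b).
{ intros a b Hab; apply Rmult_le_compat_r with (r := s) in Hab; [|lra].
  unfold Rdiv in Hab; rewrite Rmult_assoc, Rinv_l in Hab; lra. }
assert (eG : forall a b : R, a * s <= b -> a <= b / s).
{ intros a b Hab; apply Rmult_le_reg_r with s; [lra|].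
  unfold Rdiv; rewrite Rmult_assoc, Rinv_l; lra. }
pose proof (Cmod_ge_0 u) as u0; pose proof (Cmod_ge_0 e) as e0.
pose proof (Cmod_ge_0 w) as w0; pose proof (Cmod_ge_0 eta) as eta0.
set (mu := Cmod u) in *; set (me := Cmod e) in *; set (mw := Cmod w) in *; set (mt := Cmod eta) in *.
assert (mume : mu * me = 1) by (unfold mu, me; rewrite <- Cmod_mult, ue; apply Cmod_1).
apply Ge in He.
assert (s2 : s ^ 2 * g * s <= K) by (assert (0 <= s ^ 3 * g) by (apply Rmult_le_pos; [apply pow_le; lra|lra]); nra).
assert (p1 : mt * mu <= A * B * K / s).
{ apply eG. apply Rle_trans with ((A * g) * (B * s) * s).
  - apply Rmult_le_compat_r; [lra|]; apply Rmult_le_compat; lra.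
  - assert (g * s ^ 2 <= K).
    { assert (0 <= g * s ^ 2) by (apply Rmult_le_pos; [lra|apply pow_le; lra]). nra. }
    assert (0 < A * B) by nra. nra. }
assert (p2 : mt * mu ^ 2 <= A * B ^ 2 * K / s).
{ apply eG. apply Rle_trans with ((A * g) * (B * s) ^ 2 * s).
  - apply Rmult_le_compat_r; [lra|]; apply Rmult_le_compat; try lra; [apply pow2_ge_0|].
    apply pow_incr; lra.
  - replace (A * g * (B * s) ^ 2 * s) with (A * B ^ 2 * (s ^ 2 * g * s)) by ring.
    apply Rmult_le_compat_l; [|exact s2]. assert (0 < B ^ 2) by nra. nra. }
assert (p3 : mt ^ 2 * mu ^ 3 <= A ^ 2 * B ^ 3 * K ^ 2 / s).
{ apply eG. apply Rle_trans with ((A * g) ^ 2 * (B * s) ^ 3 * s).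
  - apply Rmult_le_compat_r; [lra|]; apply Rmult_le_compat; try (apply pow_le; lra); apply pow_incr; lra.
  - replace ((A * g) ^ 2 * (B * s) ^ 3 * s) with (A ^ 2 * B ^ 3 * (s ^ 4 * g * g)) by ring.
    apply Rmult_le_compat_l.
    + apply Rmult_le_pos; apply pow_le; lra.
    + assert (g <= K).
      { assert (1 <= s ^ 4) by (apply pow_R1_Rle; lra); nra. }
      assert (0 <= s ^ 4 * g) by (apply Rmult_le_pos; [apply pow_le; lra|lra]). nra. }
assert (Gd : forall b : R, 8 * b <= s -> b / s <= / 8).
{ intros b Hb; apply Rmult_le_reg_r with s; [lra|].
  unfold Rdiv; rewrite Rmult_assoc, Rinv_l; lra. }
assert (d1 : mt * mu <= / 8) by (eapply Rle_trans; [exact p1|apply Gd; nra]).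
assert (d2 : me / 2 <= / 8).
{ assert (me * s <= s / 4) by lra. nra. }
(* Chosen so that [E_(j+1) = e (1 - d)]. Its three contributions are at most [1/8] each, hence
   [|1 - d| >= 1/2]. *)
set (d := (w + e / 2 - eta * u)%C).
assert (Hd0 : Cmod d <= mw + me / 2 + mt * mu).
{ unfold d; replace (w + e / 2 - eta * u)%C with ((w + e / 2) + - (eta * u))%C by ring.
  eapply Rle_trans; [apply Cmod_triangle|].
  rewrite Cmod_opp, Cmod_mult; apply Rplus_le_compat_r.
  eapply Rle_trans; [apply Cmod_triangle|].
  rewrite Cmod_div, Cmod_R, Rabs_pos_eq by (try exact C2_neq0; lra).
  apply Rle_refl. }
pose proof (Cmod_ge_0 d) as dd0.
assert (Hd : / 2 <= Cmod (1 - d)%C).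
{ pose proof (Cmod_1_minus d); lra. }
assert (D0 : (1 - d)%C <> 0) by (apply Cmod_gt_0; lra).
assert (ES : (Ef (S j) z = e * (1 - d))%C).
{ rewrite Ef_S by exact Hz; fold e w.
  replace (Ef j (z ^ 2) / 2)%C with (eta * (u * e))%C by (rewrite ue; unfold eta; ring).
  unfold d; field; exact C2_neq0. }
split; [rewrite ES; now apply Cmult_neq_0|].
(* From [1 / (1 - d) = 1 + d + d^2 / (1 - d)]: since [u e = 1], the term [u d] equals
   [u w + 1/2 - eta u^2], so that only [eta u^2] and the quadratic term remain as error. *)
assert (EX : (/ Ef (S j) z - ((1 + w) * u + / 2) = - (eta * (u * u)) + u * (d * d) / (1 - d))%C).
{ rewrite ES.
  replace (/ (e * (1 - d)))%C with (u / (1 - d))%C by (unfold u; field; auto).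
  replace (u / (1 - d))%C with (u + u * d + u * (d * d) / (1 - d))%C by (field; exact D0).
  replace (u * d)%C with (u * w + (u * e) / 2 - eta * (u * u))%C
    by (unfold d; field; exact C2_neq0).
  rewrite ue; field; auto using C2_neq0. }
rewrite EX; eapply Rle_trans; [apply Cmod_triangle|].
rewrite Cmod_opp, Cmod_div, !Cmod_mult by exact D0; fold mu mt.
assert (Q : mu * (Cmod d * Cmod d) / Cmod (1 - d)%C <= 2 * (mu * (Cmod d * Cmod d))).
{ apply Rmult_le_reg_r with (Cmod (1 - d)%C); [lra|].
  unfold Rdiv; rewrite Rmult_assoc, Rinv_l, Rmult_1_r by lra.
  assert (0 <= mu * (Cmod d * Cmod d)) by (apply Rmult_le_pos; nra). nra. }
assert (Q2 : Cmod d * Cmod d <= 3 * (mw ^ 2 + me ^ 2 / 4 + (mt * mu) ^ 2)).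
{ assert (0 <= mt * mu) by nra.
  apply Rle_trans with ((mw + me / 2 + mt * mu) * (mw + me / 2 + mt * mu)).
  - apply Rmult_le_compat; lra.
  - pose proof (pow2_ge_0 (mw - me / 2)); pose proof (pow2_ge_0 (mw - mt * mu));
      pose proof (pow2_ge_0 (me / 2 - mt * mu)); nra. }
assert (Q3 : mu * me ^ 2 <= A / s).
{ replace (mu * me ^ 2) with (mu * me * me) by ring; rewrite mume; apply eG; lra. }
assert (Q4 : mu * (Cmod d * Cmod d) <= mu * (3 * (mw ^ 2 + me ^ 2 / 4 + (mt * mu) ^ 2)))
  by (apply Rmult_le_compat_l; lra).
replace (mu * (3 * (mw ^ 2 + me ^ 2 / 4 + (mt * mu) ^ 2))) with
  (3 * mu * mw ^ 2 + 3 / 4 * (mu * me ^ 2) + 3 * (mt ^ 2 * mu ^ 3)) in Q4 by field.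
replace ((A * B ^ 2 * K + 2 * A + 6 * A ^ 2 * B ^ 3 * K ^ 2) / s) with
  (A * B ^ 2 * K / s + 2 * (A / s) + 6 * (A ^ 2 * B ^ 3 * K ^ 2 / s)) by (field; lra).
assert (0 < A / s) by (apply Rdiv_lt_0_compat; lra).
replace (mt * (mu * mu)) with (mt * mu ^ 2) by ring.
lra.
Qed.

(** A bootstrap in two inductions. [inv_step] presupposes a linear bound [B (j + 1)] on [1 / E_j];
    the first induction ([G]) proves it with the crude growth factor [1 + q], the second ([G2]) then
    compares with [ph]. [B] depends on [C0] but not on [J], so [J0] can be chosen after it, and [Q]
    may depend on [J]. *)
Lemma inner_core (W X C0 : R) : 0 < W -> 0 < X -> 0 < C0 ->
  exists (J0 : nat), forall J, (J0 <= J)%nat -> exists Q : R, 0 < Q /\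
  forall (N : R) (z : C) (h : nat),
    8 * W <= N -> 1 <= N -> Cmod z <= rho -> Cmod (wf z) <= W / N -> INR h <= X * N ->
    (J <= h)%nat -> Ef J z <> 0 -> Cmod (/ Ef J z)%C <= C0 * INR (S J) ->
    Ef h z <> 0 /\ Cmod (/ Ef h z - ph (wf z) h)%C <= Q * (1 + sqrt N).
Proof.
intros W0 X0 C00.
set (B := exp (7 * W * X) * (C0 + 2)).
assert (ex0 := exp_pos (7 * W * X)).
assert (B0 : 0 < B) by (unfold B; nra).
set (C1 := A * B ^ 2 * K + 2 * A + 6 * A ^ 2 * B ^ 3 * K ^ 2).
assert (C10 : 0 < C1).
{ assert (0 < B ^ 2) by nra. assert (0 < B ^ 3) by (apply pow_lt; lra).
  assert (0 < A * B ^ 2 * K) by (apply Rmult_lt_0_compat; nra).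
  assert (0 < A ^ 2) by nra. assert (0 < K ^ 2) by nra.
  assert (0 < 6 * A ^ 2 * B ^ 3 * K ^ 2).
  { apply Rmult_lt_0_compat; [apply Rmult_lt_0_compat; [lra|assumption]|assumption]. }
  unfold C1; lra. }
destruct (INR_unbounded (4 * A + 8 * A * B * K + C1)) as [J0 HJ0].
exists J0; intros J HJ.
assert (ABK : 0 < A * B * K) by (apply Rmult_lt_0_compat; nra).
(* The summands are the discrepancy at [J], the terms [6 |u| |w|^2] accumulated over at most [X N]
   steps, and the sum of [C1 / (j + 1)]; the outer exponential bounds the amplification. *)
set (Q := exp (7 * W * X) * (C0 * INR (S J) + INR J * exp (7 * W * X)
   + 6 * B * W ^ 2 * X ^ 2 + C1 * (2 * sqrt X) + 1)).
exists Q.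
assert (sX := sqrt_pos X).
assert (SJ : 1 <= INR (S J)) by (change 1 with (INR 1); apply le_INR; lia).
assert (BWX : 0 <= 6 * B * W ^ 2 * X ^ 2).
{ assert (0 < W ^ 2) by nra; assert (0 < X ^ 2) by nra.
  apply Rmult_le_pos; [|lra]; apply Rmult_le_pos; lra. }
assert (R0 : 0 < C0 * INR (S J) + INR J * exp (7 * W * X)
   + 6 * B * W ^ 2 * X ^ 2 + C1 * (2 * sqrt X) + 1).
{ assert (0 <= INR J * exp (7 * W * X)) by (apply Rmult_le_pos; [apply pos_INR|lra]).
  assert (0 < C0 * INR (S J)) by nra.
  assert (0 <= C1 * (2 * sqrt X)) by nra. lra. }
split; [unfold Q; apply Rmult_lt_0_compat; lra|].
intros N z h HN HN1 Hz Hw Hh HJh HEJ HuJ.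
(* One [|w|] comes from the linear growth and six from [6 |w|^2 <= 6 |w|] in the error of
   [inv_step]; over [h <= X N] steps the powers of [1 + q] stay bounded. *)
set (q := 7 * W / N).
assert (q0 : 0 <= q) by (apply Rmult_le_pos; [lra|left; apply Rinv_0_lt_compat; lra]).
assert (WN : W / N <= / 8).
{ apply Rmult_le_reg_r with N; [lra|]; unfold Rdiv; rewrite Rmult_assoc, Rinv_l; lra. }
assert (wq : 7 * Cmod (wf z) <= q) by (unfold q, Rdiv in *; lra).
pose proof (Cmod_ge_0 (wf z)) as w0.
assert (qpow : forall j, (j <= h)%nat -> (1 + q) ^ j <= exp (7 * W * X)).
{ intros j Hj; eapply Rle_trans; [now apply one_plus_pow_le|].
  assert (Hq : q * INR j <= 7 * W * X).
  { apply le_INR in Hj. unfold q, Rdiv; apply Rle_trans with (7 * W * / N * (X * N)).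
    - apply Rmult_le_compat_l; [exact q0|lra].
    - right; field; lra. }
  destruct Hq as [Hq|Hq]; [left; now apply exp_increasing|right; now rewrite Hq]. }
assert (Jbig : forall j, (J <= j)%nat -> 4 * A <= INR (S j) /\ 8 * A * B * K <= INR (S j) /\ C1 <= INR (S j)).
{ intros j Hj; assert (INR J0 <= INR (S j)) by (apply le_INR; lia).
  pose proof A0; repeat split; nra. }
assert (G : forall j, (J <= j)%nat -> (j <= h)%nat -> Ef j z <> 0 /\
  Cmod (/ Ef j z)%C <= (1 + q) ^ j * (C0 * INR (S J) + 2 * (INR j - INR J))).
{ intros j Hj; induction Hj as [|j Hj IH]; intros Hjh.
  - split; [exact HEJ|]; assert (P0 : 1 <= (1 + q) ^ J) by (apply pow_R1_Rle; lra).
    rewrite Rminus_diag, Rmult_0_r, Rplus_0_r.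
    eapply Rle_trans; [exact HuJ|].
    rewrite <- (Rmult_1_l (C0 * INR (S J))) at 1; apply Rmult_le_compat_r; [nra|exact P0].
  - destruct IH as [IH1 IH2]; [lia|].
    assert (jJ : INR J <= INR j) by (now apply le_INR).
    assert (P0 : 1 <= (1 + q) ^ j) by (apply pow_R1_Rle; lra).
    assert (HB : Cmod (/ Ef j z)%C <= B * INR (S j)).
    { eapply Rle_trans; [exact IH2|]; unfold B; rewrite Rmult_assoc.
      apply Rmult_le_compat; [lra| |apply qpow; lia|].
      - assert (0 < C0 * INR (S J)) by nra; lra.
      - assert (C0 * INR J <= C0 * INR j) by (apply Rmult_le_compat_l; lra).
        rewrite !S_INR; pose proof (pos_INR J); lra. }
    destruct (Jbig j Hj) as [b1 [b2 b3]].
    destruct (inv_step B W z j B0 Hz IH1 ltac:(lra) b1 b2 HB) as [S1 S2].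
    split; [exact S1|].
    fold C1 in S2.
    assert (C1 / INR (S j) <= 1).
    { apply Rmult_le_reg_r with (INR (S j)); [lra|]; unfold Rdiv; rewrite Rmult_assoc, Rinv_l; lra. }
    set (u := (/ Ef j z)%C) in *; pose proof (Cmod_ge_0 u) as u0.
    assert (T : Cmod (/ Ef (S j) z)%C <= (1 + Cmod (wf z)) * Cmod u + / 2
        + (6 * Cmod u * Cmod (wf z) ^ 2 + 1)).
    { replace (/ Ef (S j) z)%C with ((1 + wf z) * u + / 2 + (/ Ef (S j) z - ((1 + wf z) * u + / 2)))%C by ring.
      eapply Rle_trans; [apply Cmod_triangle|]; apply Rplus_le_compat; [|lra].
      eapply Rle_trans; [apply Cmod_triangle|].
      rewrite Cmod_mult, Cmod_inv, Cmod_R, (Rabs_pos_eq 2) by (try exact C2_neq0; lra).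
      apply Rplus_le_compat_r, Rmult_le_compat_r; [exact u0|].
      eapply Rle_trans; [apply Cmod_triangle|]; rewrite Cmod_1; lra. }
    assert (T2 : Cmod u * Cmod (wf z) ^ 2 <= Cmod u * Cmod (wf z)).
    { apply Rmult_le_compat_l; [exact u0|]; nra. }
    assert (T3 : Cmod u * (7 * Cmod (wf z)) <= Cmod u * q) by (apply Rmult_le_compat_l; lra).
    assert (T4 : Cmod (/ Ef (S j) z)%C <= (1 + q) * Cmod u + 2) by lra.
    eapply Rle_trans; [exact T4|].
    rewrite (S_INR j); change ((1 + q) ^ S j) with ((1 + q) * (1 + q) ^ j).
    assert ((1 + q) * Cmod u <= (1 + q) * ((1 + q) ^ j * (C0 * INR (S J) + 2 * (INR j - INR J))))
      by (apply Rmult_le_compat_l; lra).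
    assert (1 <= (1 + q) * (1 + q) ^ j) by nra.
    lra. }
set (sm := fun k => sum_f_R0 (fun i => / INR (S i)) k).
assert (G2 : forall j, (J <= j)%nat -> (j <= h)%nat ->
  Cmod (/ Ef j z - ph (wf z) j)%C <= (1 + q) ^ j * (C0 * INR (S J) + INR J * exp (7 * W * X)
    + INR j * (6 * B * X * W ^ 2 / N) + C1 * match j with O => 0 | S i => sm i end)).
{ intros j Hj; induction Hj as [|j Hj IH]; intros Hjh.
  - assert (P0 : 1 <= (1 + q) ^ J) by (apply pow_R1_Rle; lra).
    assert (Hp : Cmod (ph (wf z) J) <= INR J * exp (7 * W * X)).
    { eapply Rle_trans; [apply Cmod_ph|]; apply Rmult_le_compat_l; [apply pos_INR|].
      eapply Rle_trans; [|apply (qpow J); lia]; apply pow_incr; lra. }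
    eapply Rle_trans; [apply Cmod_triangle|]; rewrite Cmod_opp.
    assert (0 <= INR J * (6 * B * X * W ^ 2 / N)).
    { apply Rmult_le_pos; [apply pos_INR|]; apply Rmult_le_pos; [|left; apply Rinv_0_lt_compat; lra].
      assert (0 < W ^ 2) by nra. assert (0 < B * X) by nra. nra. }
    assert (0 <= C1 * match J with O => 0 | S i => sm i end).
    { apply Rmult_le_pos; [lra|]; destruct J; [lra|]; apply cond_pos_sum; intros i.
      left; apply Rinv_0_lt_compat, lt_0_INR; lia. }
    assert (0 <= C0 * INR (S J)) by nra.
    pose proof (Cmod_ge_0 (ph (wf z) J)). nra.
  - destruct (G j Hj ltac:(lia)) as [G1 G3].
    specialize (IH ltac:(lia)).
    destruct (Jbig j Hj) as [b1 [b2 b3]].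
    assert (HB : Cmod (/ Ef j z)%C <= B * INR (S j)).
    { eapply Rle_trans; [exact G3|]; unfold B; rewrite Rmult_assoc.
      assert (jJ : INR J <= INR j) by (now apply le_INR).
      assert (P0 : 1 <= (1 + q) ^ j) by (apply pow_R1_Rle; lra).
      apply Rmult_le_compat; [lra| |apply qpow; lia|].
      - assert (0 < C0 * INR (S J)) by nra; lra.
      - assert (C0 * INR J <= C0 * INR j) by (apply Rmult_le_compat_l; lra).
        rewrite !S_INR; pose proof (pos_INR J); lra. }
    destruct (inv_step B W z j B0 Hz G1 ltac:(lra) b1 b2 HB) as [_ S2].
    fold C1 in S2.
    set (u := (/ Ef j z)%C) in *; pose proof (Cmod_ge_0 u) as u0.
    assert (N1 : 6 * Cmod u * Cmod (wf z) ^ 2 <= 6 * B * X * W ^ 2 / N).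
    { assert (Cmod u <= B * (X * N)).
      { eapply Rle_trans; [exact HB|]; apply Rmult_le_compat_l; [lra|].
        eapply Rle_trans; [|exact Hh]; now apply le_INR. }
      assert (Cmod (wf z) ^ 2 <= (W / N) ^ 2) by (apply pow_incr; lra).
      replace (6 * B * X * W ^ 2 / N) with (6 * (B * (X * N)) * (W / N) ^ 2) by (field; lra).
      apply Rmult_le_compat; try lra; apply pow2_ge_0. }
    assert (T : Cmod (/ Ef (S j) z - ph (wf z) (S j))%C <=
       (1 + q) * Cmod (u - ph (wf z) j)%C + (6 * B * X * W ^ 2 / N + C1 / INR (S j))).
    { simpl ph.
      replace (/ Ef (S j) z - ((1 + wf z) * ph (wf z) j + / 2))%C with
        ((1 + wf z) * (u - ph (wf z) j) + (/ Ef (S j) z - ((1 + wf z) * u + / 2)))%C by ring.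
      eapply Rle_trans; [apply Cmod_triangle|]; apply Rplus_le_compat; [|lra].
      rewrite Cmod_mult; apply Rmult_le_compat_r; [apply Cmod_ge_0|].
      eapply Rle_trans; [apply Cmod_triangle|]; rewrite Cmod_1; lra. }
    eapply Rle_trans; [exact T|].
    set (D := C0 * INR (S J) + INR J * exp (7 * W * X)) in *.
    set (al := 6 * B * X * W ^ 2 / N) in *.
    assert (al0 : 0 <= al).
    { unfold al; apply Rmult_le_pos; [|left; apply Rinv_0_lt_compat; lra].
      assert (0 < W ^ 2) by nra. assert (0 < B * X) by nra. nra. }
    assert (Es : match S j with O => 0 | S i => sm i end =
      match j with O => 0 | S i => sm i end + / INR (S j)).
    { destruct j; [unfold sm; simpl; ring|unfold sm; now rewrite tech5]. }
    rewrite Es, (S_INR j).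
    assert (i0 : 0 < / (INR j + 1)) by (apply Rinv_0_lt_compat; pose proof (pos_INR j); lra).
    assert (P1 : 1 <= (1 + q) ^ S j) by (apply pow_R1_Rle; lra).
    set (M := D + INR j * al + C1 * match j with O => 0 | S i => sm i end) in *.
    replace (D + (INR j + 1) * al + C1 * (match j with O => 0 | S i => sm i end + / (INR j + 1)))
      with (M + (al + C1 * / (INR j + 1))) by (unfold M; ring).
    assert ((1 + q) * Cmod (u - ph (wf z) j)%C <= (1 + q) ^ S j * M).
    { simpl; rewrite Rmult_assoc; apply Rmult_le_compat_l; [lra|exact IH]. }
    unfold Rdiv; assert (0 < al + C1 * / (INR j + 1)) by nra. nra. }
destruct (G h HJh (le_n _)) as [G1 _]; split; [exact G1|].
eapply Rle_trans; [apply (G2 h HJh (le_n _))|].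
assert (sN : 0 <= sqrt N) by apply sqrt_pos.
assert (E1 : INR h * (6 * B * X * W ^ 2 / N) <= 6 * B * W ^ 2 * X ^ 2).
{ replace (6 * B * W ^ 2 * X ^ 2) with ((X * N) * (6 * B * X * W ^ 2 / N)) by (field; lra).
  apply Rmult_le_compat_r; [|exact Hh].
  apply Rmult_le_pos; [|left; apply Rinv_0_lt_compat; lra].
  assert (0 < W ^ 2) by nra. assert (0 < B * X) by nra. nra. }
assert (E2 : match h with O => 0 | S i => sm i end <= 2 * sqrt X * sqrt N).
{ rewrite Rmult_assoc, <- sqrt_mult by lra.
  destruct h; [pose proof (sqrt_pos (X * N)); lra|].
  eapply Rle_trans; [apply (sum_inv_sqrt 0); lia|].
  apply Rmult_le_compat_l; [lra|]; apply sqrt_le_1_alt; exact Hh. }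
assert (E3 : C1 * match h with O => 0 | S i => sm i end <= C1 * (2 * sqrt X * sqrt N))
  by (apply Rmult_le_compat_l; lra).
unfold Q; rewrite (Rmult_assoc (exp (7 * W * X))).
assert (0 <= C0 * INR (S J)) by nra.
assert (0 <= INR J * exp (7 * W * X)) by (apply Rmult_le_pos; [apply pos_INR|lra]).
assert (0 <= C1 * match h with O => 0 | S i => sm i end).
{ apply Rmult_le_pos; [lra|]; destruct h; [lra|]; apply cond_pos_sum; intros i.
  left; apply Rinv_0_lt_compat, lt_0_INR; lia. }
assert (0 <= INR h * (6 * B * X * W ^ 2 / N)).
{ apply Rmult_le_pos; [apply pos_INR|]; apply Rmult_le_pos; [|left; apply Rinv_0_lt_compat; lra].
  assert (0 < W ^ 2) by nra. assert (0 < B * X) by nra. nra. }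
apply Rmult_le_compat; [apply pow_le; lra|lra|now apply qpow|].
assert (0 <= C1 * (2 * sqrt X)) by nra.
assert (0 <= (C0 * INR (S J) + INR J * exp (7 * W * X) + 6 * B * W ^ 2 * X ^ 2 + 1) * sqrt N)
  by (apply Rmult_le_pos; lra).
nra.
Qed.

End Core.

Lemma Cpow_diff_le (a b : C) (M : R) (h : nat) : 1 <= M -> Cmod a <= M -> Cmod b <= M ->
  Cmod (a ^ h - b ^ h)%C <= INR h * Cmod (a - b)%C * M ^ h.
Proof.
intros HM Ha Hb; induction h.
- simpl; replace (1 - 1)%C with (RtoC 0) by ring; rewrite Cmod_0; lra.
- rewrite !Cpow_S, S_INR.
  replace (a * a ^ h - b * b ^ h)%C with (a * (a ^ h - b ^ h) + (a - b) * b ^ h)%C by ring.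
  eapply Rle_trans; [apply Cmod_triangle|]; rewrite !Cmod_mult, Cmod_pow; simpl.
  assert (Cmod b ^ h <= M ^ h) by (apply pow_incr; split; [apply Cmod_ge_0|exact Hb]).
  pose proof (Cmod_ge_0 (a - b)%C).
  assert (0 < M ^ h) by (apply pow_lt; lra).
  assert (Cmod a * Cmod (a ^ h - b ^ h)%C <= M * (INR h * Cmod (a - b)%C * M ^ h))
    by (apply Rmult_le_compat; auto using Cmod_ge_0).
  assert (Cmod (a - b)%C * Cmod b ^ h <= Cmod (a - b)%C * (M * M ^ h)).
  { apply Rmult_le_compat_l; [assumption|]; nra. }
  nra.
Qed.

Lemma one_plus_pow_cexp (w : C) (h : nat) :
  Cmod ((1 + w) ^ h - cexp (RtoC (INR h) * w))%C <=
  5 * INR h * Cmod w ^ 2 * exp (Cmod w) * exp (INR h * Cmod w).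
Proof.
pose proof (Cmod_ge_0 w) as w0.
rewrite cexp_INR.
assert (M1 : 1 <= exp (Cmod w)) by (pose proof (exp_ineq1_le (Cmod w)); lra).
assert (Hre : Rabs (Re w) <= Cmod w) by apply re_le_Cmod.
assert (em : forall a b, a <= b -> exp a <= exp b).
{ intros a b [H|H]; [left; now apply exp_increasing|right; now rewrite H]. }
eapply Rle_trans; [apply (Cpow_diff_le _ _ (exp (Cmod w))); [exact M1| |]|].
- eapply Rle_trans; [apply Cmod_triangle|]; rewrite Cmod_1; apply exp_ineq1_le.
- rewrite Cmod_cexp; apply em; eapply Rle_trans; [apply Rle_abs|exact Hre].
- assert (E : exp (Cmod w) ^ h = exp (INR h * Cmod w)).
  { clear; induction h; [simpl; rewrite Rmult_0_l, exp_0; reflexivity|].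
    rewrite S_INR; simpl; rewrite IHh, <- exp_plus; f_equal; ring. }
  rewrite E; apply Rmult_le_compat_r; [left; apply exp_pos|].
  replace (5 * INR h * Cmod w ^ 2 * exp (Cmod w)) with (INR h * (5 * Cmod w ^ 2 * exp (Cmod w))) by ring.
  apply Rmult_le_compat_l; [apply pos_INR|].
  replace (1 + w - cexp w)%C with (- (cexp w - 1 - w))%C by ring; rewrite Cmod_opp.
  eapply Rle_trans; [apply cexp_taylor2|].
  apply Rmult_le_compat_l; [pose proof (pow2_ge_0 (Cmod w)); lra|]; now apply em.
Qed.

(** * Height differences in the scaling limit at [rho] *)

Section Inner.
Context {T : Type} (F : (T -> Prop) -> Prop) {FF : Filter F}.

(** These series are polynomials; their continuity is obtained through the recursion in [J], with
    [z^2] as a second argument, rather than from the coefficients. *)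
Lemma Clim_CPS_ycoef_le (J : nat) (z : T -> C) (l : C) :
  F (fun i => Cmod (z i) <= rho) -> Cmod l <= rho -> Clim F z l ->
  Clim F (fun i => CPS (ycoef_le J) (z i)) (CPS (ycoef_le J) l).
Proof.
revert z l; induction J; intros z l Hz Hl H.
- assert (E : forall u, CPS (ycoef_le 0) u = u).
  { intros u; rewrite (CPS_ext _ ind1) by apply ycoef_le_0; apply CPS_ind1. }
  rewrite E; eapply Clim_ext; [exact FF| |exact H]; intros i; now rewrite E.
- assert (E : forall u, Cmod u <= rho -> (CPS (ycoef_le (S J)) u =
    u + / 2 * (CPS (ycoef_le J) u * CPS (ycoef_le J) u) + / 2 * CPS (ycoef_le J) (u ^ 2))%C).
  { intros u Hu; pose proof (CPS_ycoef_le_rec J u Hu) as R.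
    replace (CPS (ycoef_le (S J)) u) with (/ 2 * (2 * CPS (ycoef_le (S J)) u))%C
      by (field; exact C2_neq0).
    rewrite R; field; exact C2_neq0. }
  rewrite E by exact Hl.
  apply (Clim_ext_loc F (fun i => z i + / 2 * (CPS (ycoef_le J) (z i) * CPS (ycoef_le J) (z i))
    + / 2 * CPS (ycoef_le J) (z i ^ 2))%C);
    [generalize Hz; apply filter_imp; intros i Hi; symmetry; apply E, Hi|].
  assert (H2 : Clim F (fun i => z i ^ 2)%C (l ^ 2)%C).
  { simpl; apply Clim_mult; [exact FF|exact H|]; apply Clim_mult; [exact FF|exact H|apply Clim_const; exact FF]. }
  repeat apply Clim_plus; try exact FF; try exact H;
    (apply Clim_mult; [exact FF|apply Clim_const; exact FF|]).
  + apply Clim_mult; [exact FF| |]; now apply IHJ.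
  + apply IHJ; [|apply (Cmod_sqr_le l Hl)|exact H2].
    generalize Hz; apply filter_imp; intros i Hi; apply (Cmod_sqr_le (z i) Hi).
Qed.

Variables (N : T -> R) (h : T -> nat) (z : T -> C) (kap : C) (x : R).
Hypothesis kap_pos : 0 < Re kap.
Hypothesis x_pos : 0 < x.
Hypothesis HN : forall M, F (fun i => M < N i).
Hypothesis Hz : F (fun i => Cmod (z i) <= rho).
Hypothesis Hzl : Clim F z (RtoC rho).
Hypothesis Hw : Clim F (fun i => RtoC (N i) * wf (z i))%C kap.
Hypothesis Hh : Clim F (fun i => RtoC (INR (h i) / N i)) (RtoC x).

Lemma Clim_inv_N : Clim F (fun i => / RtoC (N i))%C 0.
Proof.
apply Clim_0_le with (fun i => / N i); [exact FF| |].
- generalize (HN 0); apply filter_imp; intros i Hi.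
  rewrite Cmod_inv, Cmod_R, Rabs_pos_eq by (try lra; intros E; apply RtoC_inj in E; lra); lra.
- intros eps He; generalize (filter_and _ _ (HN 0) (HN (/ eps))); apply filter_imp; intros i [H0 Hi].
  rewrite <- (Rinv_inv eps); apply Rinv_lt_contravar; [|exact Hi].
  apply Rmult_lt_0_compat; [now apply Rinv_0_lt_compat|lra].
Qed.

Lemma RtoC_neq0 (r : R) : 0 < r -> RtoC r <> 0.
Proof. intros Hr E; apply RtoC_inj in E; lra. Qed.

Lemma Clim_wf : Clim F (fun i => wf (z i)) 0.
Proof.
replace (RtoC 0) with (kap * 0)%C by ring.
eapply Clim_ext_loc; [exact FF| |exact (Clim_mult F _ _ _ _ Hw Clim_inv_N)].
generalize (HN 0); apply filter_imp; intros i Hi; cbv beta; field; now apply RtoC_neq0.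
Qed.

(** At a fixed height the remainder tends to a positive number; this provides the starting value for
    [inner_core]. *)
Lemma Clim_Ef (J : nat) : Clim F (fun i => Ef J (z i)) (RtoC (eh J)).
Proof.
pose proof rho_pos.
assert (Hr : Cmod (RtoC rho) <= rho) by (rewrite Cmod_R, Rabs_pos_eq; lra).
assert (E : RtoC (eh J) = (1 - 0 - CPS (ycoef_le J) (RtoC rho))%C).
{ assert (E0 : Ef J (RtoC rho) = RtoC (eh J)) by apply CPS_RtoC.
  rewrite <- E0, Ef_minus by exact Hr; unfold Yf; rewrite CPS_y_RtoC, y_rho; ring. }
rewrite E; eapply Clim_ext_loc; [exact FF| |].
2:{ apply Clim_minus; [exact FF|apply Clim_minus; [exact FF|apply Clim_const; exact FF|exact Clim_wf]|].
    now apply (Clim_CPS_ycoef_le J z). }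
generalize Hz; apply filter_imp; intros i Hi; cbv beta.
rewrite Ef_minus by exact Hi; unfold wf; ring.
Qed.

Let W := Cmod kap + 1.
Let X := x + 1.

Lemma W_pos : 0 < W. Proof. unfold W; pose proof (Cmod_ge_0 kap); lra. Qed.

Lemma inner_eventually (M : R) : F (fun i => M < N i /\ 1 < N i /\ Cmod (z i) <= rho /\
  Cmod (wf (z i)) <= W / N i /\ INR (h i) <= X * N i /\ x / 2 * N i <= INR (h i)).
Proof.
assert (H1 : F (fun i => Cmod (RtoC (N i) * wf (z i))%C < W)).
{ apply (Clim_Cmod_lt F _ _ _ Hw); unfold W; lra. }
assert (H2 : F (fun i => Cmod (RtoC (INR (h i) / N i)) < X)).
{ apply (Clim_Cmod_lt F _ _ _ Hh); rewrite Cmod_R, Rabs_pos_eq; unfold X; lra. }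
assert (H3 : F (fun i => x / 2 < Cmod (RtoC (INR (h i) / N i)))).
{ apply (Clim_Cmod_gt F _ _ _ Hh); rewrite Cmod_R, Rabs_pos_eq; lra. }
generalize (filter_and _ _ (filter_and _ _ H1 (filter_and _ _ H2 H3))
  (filter_and _ _ (filter_and _ _ (HN M) (HN 1)) Hz)).
apply filter_imp; intros i [[K1 [K2 K3]] [[K4 K5] K6]].
rewrite Cmod_mult, Cmod_R, (Rabs_pos_eq (N i)) in K1 by lra.
assert (P : 0 <= INR (h i) / N i) by (apply Rdiv_le_0_compat; [apply pos_INR|lra]).
rewrite Cmod_R, Rabs_pos_eq in K2, K3 by exact P.
assert (E : INR (h i) = INR (h i) / N i * N i) by (field; lra).
repeat split; try lra.
- apply Rmult_le_reg_r with (N i); [lra|]; unfold Rdiv; rewrite Rmult_assoc, Rinv_l; lra.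
- rewrite E; apply Rmult_le_compat_r; lra.
- rewrite E; apply Rmult_le_compat_r; lra.
Qed.

Lemma small_over_N (Q eps : R) : 0 < Q -> 0 < eps -> F (fun i => Q / N i < eps).
Proof.
intros HQ He; generalize (filter_and _ _ (HN 0) (HN (Q / eps))); apply filter_imp; intros i [H0 Hi].
apply Rmult_lt_reg_r with (N i); [lra|].
unfold Rdiv; rewrite Rmult_assoc, Rinv_l, Rmult_1_r by lra.
apply Rmult_lt_reg_r with (/ eps); [now apply Rinv_0_lt_compat|].
unfold Rdiv in Hi; replace (eps * N i * / eps) with (N i) by (field; lra); exact Hi.
Qed.

Lemma Clim_one_plus_pow : Clim F (fun i => (1 + wf (z i)) ^ h i)%C (cexp (kap * x)).
Proof.
pose proof W_pos as W0.
apply Clim_dist with (fun i => cexp (RtoC (INR (h i)) * wf (z i))); [exact FF| |].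
- apply Clim_0_le with (fun i => (5 * X * W ^ 2 * exp W * exp (X * W)) / N i); [exact FF| |].
  + generalize (inner_eventually 0); apply filter_imp; intros i [H1 [H2 [H3 [H4 [H5 H6]]]]].
    eapply Rle_trans; [apply one_plus_pow_cexp|].
    set (w := Cmod (wf (z i))) in *; assert (w0 : 0 <= w) by apply Cmod_ge_0.
    set (n := N i) in *; set (k := INR (h i)) in *; assert (k0 : 0 <= k) by apply pos_INR.
    assert (em : forall a b, a <= b -> exp a <= exp b).
    { intros a b [H|H]; [left; now apply exp_increasing|right; now rewrite H]. }
    assert (W1 : W / n <= W).
    { apply Rmult_le_reg_r with n; [lra|]; unfold Rdiv; rewrite Rmult_assoc, Rinv_l; nra. }
    assert (e1 : exp w <= exp W) by (apply em; lra).
    assert (X0 : 0 < X) by (unfold X; lra).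
    assert (e2 : exp (k * w) <= exp (X * W)).
    { apply em; apply Rle_trans with (X * n * (W / n)).
      - apply Rmult_le_compat; lra.
      - right; field; lra. }
    replace (5 * X * W ^ 2 * exp W * exp (X * W) / n) with
      (5 * (X * n) * (W / n) ^ 2 * exp W * exp (X * W)) by (field; lra).
    assert (w ^ 2 <= (W / n) ^ 2) by (apply pow_incr; lra).
    pose proof (exp_pos w); pose proof (exp_pos (k * w)); pose proof (pow2_ge_0 w).
    apply Rmult_le_compat; [|lra| |exact e2].
    * apply Rmult_le_pos; [|lra]; apply Rmult_le_pos; lra.
    * apply Rmult_le_compat; [|lra| |exact e1].
      -- apply Rmult_le_pos; lra.
      -- apply Rmult_le_compat; lra.
  + intros eps He; apply small_over_N; [|exact He].
    assert (0 < X) by (unfold X; lra).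
    pose proof (exp_pos W); pose proof (exp_pos (X * W)).
    assert (0 < W ^ 2) by nra.
    repeat apply Rmult_lt_0_compat; lra.
- apply Clim_cexp; [exact FF|].
  eapply Clim_ext_loc; [exact FF| |exact (Clim_mult F _ _ _ _ Hw Hh)].
  generalize (HN 0); apply filter_imp; intros i Hi; cbv beta.
  rewrite RtoC_div by lra; field; now apply RtoC_neq0.
Qed.

Let E := cexp (kap * x).

Lemma E_neq1 : (E - 1)%C <> 0.
Proof.
intros H; assert (E1 : E = 1) by (replace E with (E - 1 + 1)%C by ring; rewrite H; ring).
apply (f_equal Cmod) in E1; unfold E in E1; rewrite Cmod_cexp, re_scal_r, Cmod_1 in E1.
pose proof (exp_ineq1 (Re kap * x)); assert (0 < Re kap * x) by nra; lra.
Qed.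

Lemma kap_neq0 : kap <> 0.
Proof. intros H; rewrite H in kap_pos; simpl in kap_pos; lra. Qed.

Lemma Clim_inv_Ef :
  F (fun i => Ef (h i) (z i) <> 0) /\
  Clim F (fun i => / Ef (h i) (z i) / RtoC (N i))%C ((E - 1) / (2 * kap))%C.
Proof.
pose proof W_pos as W0.
destruct eh_le as [A [A0 HA]].
destruct (poly_geom rho) as [K [K0 HK]]; [pose proof rho_pos; pose proof rho_lt1; lra|].
assert (e0 : 0 < / eh 0) by (apply Rinv_0_lt_compat, eh_pos).
(* [C0] must not depend on [J], which is chosen after it; the linear bound [eh_inv_le] allows the
   same [C0] for every starting height. *)
set (C0 := 2 * (/ eh 0 + 1)).
assert (C00 : 0 < C0) by (unfold C0; lra).
assert (X0 : 0 < X) by (unfold X; lra).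
destruct (inner_core A K A0 HA K0 HK W X C0 W0 X0 C00) as [J HJ].
destruct (HJ J (le_n _)) as [Q [Q0 HQ]]; clear HJ.
assert (eJ : eh J <> 0) by (pose proof (eh_pos J); lra).
assert (eJC : RtoC (eh J) <> 0) by (intros H; now apply RtoC_inj in H).
assert (H1 : F (fun i => Cmod (/ Ef J (z i))%C < C0 * INR (S J))).
{ apply Clim_Cmod_lt with (/ RtoC (eh J))%C; [exact FF|apply Clim_inv; [exact FF|exact eJC|apply Clim_Ef]|].
  rewrite Cmod_inv, Cmod_R, Rabs_pos_eq by (try exact eJC; left; apply eh_pos).
  pose proof (eh_inv_le J); rewrite S_INR; pose proof (pos_INR J); unfold C0; nra. }
assert (H2 : F (fun i => 0 < Cmod (Ef J (z i)))).
{ apply Clim_Cmod_gt with (RtoC (eh J)); [exact FF|apply Clim_Ef|now apply Cmod_gt_0]. }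
(* The first part meets the requirement [8 W <= N], the second ensures [J <= h] since eventually
   [h >= x N / 2]. *)
set (M := 8 * W + 2 * INR J / x).
assert (Core : F (fun i => Ef (h i) (z i) <> 0 /\
  Cmod (/ Ef (h i) (z i) - ph (wf (z i)) (h i))%C <= Q * (1 + sqrt (N i)) /\ 1 < N i)).
{ generalize (filter_and _ _ (filter_and _ _ H1 H2) (inner_eventually M)); apply filter_imp.
  intros i [[K1 K2] [K3 [K4 [K5 [K6 [K7 K8]]]]]].
  assert (J2 : 0 <= 2 * INR J / x) by (apply Rdiv_le_0_compat; [pose proof (pos_INR J); lra|lra]).
  assert (Jh : (J <= h i)%nat).
  { apply INR_le; eapply Rle_trans; [|exact K8].
    replace (INR J) with (x / 2 * (2 * INR J / x)) by (field; lra).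
    apply Rmult_le_compat_l; [lra|]; unfold M in K3; lra. }
  destruct (HQ (N i) (z i) (h i)) as [R1 R2]; try assumption; try (unfold M in K3; lra).
  - now apply Cmod_gt_0.
  - auto. }
split; [generalize Core; apply filter_imp; tauto|].
apply Clim_dist with (fun i => ph (wf (z i)) (h i) / RtoC (N i))%C; [exact FF| |].
- apply Clim_0_le with (fun i => 2 * Q / sqrt (N i)); [exact FF| |].
  + generalize Core; apply filter_imp; intros i [_ [H3 H4]].
    assert (s1 : 1 < sqrt (N i)) by (rewrite <- sqrt_1; apply sqrt_lt_1_alt; lra).
    assert (s2 : sqrt (N i) * sqrt (N i) = N i) by (apply sqrt_sqrt; lra).
    replace (/ Ef (h i) (z i) / RtoC (N i) - ph (wf (z i)) (h i) / RtoC (N i))%C with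
      ((/ Ef (h i) (z i) - ph (wf (z i)) (h i)) / RtoC (N i))%C
      by (unfold Cdiv; ring).
    rewrite Cmod_div, Cmod_R, Rabs_pos_eq by (try apply RtoC_neq0; lra).
    rewrite <- s2 at 1.
    apply Rmult_le_reg_r with (sqrt (N i) * sqrt (N i)); [nra|].
    unfold Rdiv; rewrite Rmult_assoc, Rinv_l, Rmult_1_r by nra.
    replace (2 * Q * / sqrt (N i) * (sqrt (N i) * sqrt (N i))) with (2 * Q * sqrt (N i)) by (field; lra).
    nra.
  + intros eps He; generalize (filter_and _ _ (HN 0) (HN ((2 * Q / eps) ^ 2))); apply filter_imp.
    intros i [K1 K2].
    assert (P : 0 < 2 * Q / eps) by (apply Rdiv_lt_0_compat; lra).
    assert (S1 : 2 * Q / eps < sqrt (N i)).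
    { rewrite <- (sqrt_pow2 (2 * Q / eps)) by lra; apply sqrt_lt_1_alt; split; [apply pow2_ge_0|exact K2]. }
    apply Rmult_lt_reg_r with (sqrt (N i)); [lra|].
    unfold Rdiv; rewrite Rmult_assoc, Rinv_l, Rmult_1_r by lra.
    replace (2 * Q) with (eps * (2 * Q / eps)) by (field; lra).
    apply Rmult_lt_compat_l; assumption.
- pose proof kap_neq0 as k0.
  eapply Clim_ext_loc; [exact FF| |].
  2:{ apply (Clim_div F (fun i => (1 + wf (z i)) ^ h i - 1)%C (fun i => 2 * (RtoC (N i) * wf (z i)))%C).
      - apply Cmult_neq_0; [exact C2_neq0|exact k0].
      - apply Clim_minus; [exact FF|exact Clim_one_plus_pow|apply Clim_const; exact FF].
      - apply Clim_mult; [exact FF|apply Clim_const; exact FF|exact Hw]. }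
  assert (Hk : F (fun i => 0 < Cmod (RtoC (N i) * wf (z i))%C)).
  { apply Clim_Cmod_gt with kap; [exact FF|exact Hw|now apply Cmod_gt_0]. }
  generalize (filter_and _ _ Hk (HN 0)); apply filter_imp; intros i [K1 K2]; cbv beta.
  assert (n0 := RtoC_neq0 _ K2).
  assert (w0 : wf (z i) <> 0).
  { intros H; rewrite H, Cmult_0_r, Cmod_0 in K1; lra. }
  rewrite <- ph_closed; field; repeat split; auto using C2_neq0.
Qed.

(** The recursion gives [E_h - E_(h+1) = w E_h + E_h^2 / 2 - E_h(z^2) / 2]. With [N E_h] tending to
    [1 / L], the first two terms give [kap / L + 1 / (2 L^2)], and the last is killed by [rho^h]
    with [h] of order [N]. *)
Lemma inner_limit : Clim F
  (fun i => RtoC (N i ^ 2) * (Ef (h i) (z i) - Ef (S (h i)) (z i)))%C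
  (2 * (kap * kap) * E / ((E - 1) * (E - 1)))%C.
Proof.
pose proof W_pos as W0; pose proof kap_neq0 as k0; pose proof E_neq1 as E1.
pose proof C2_neq0 as c2.
destruct (poly_geom rho) as [K [K0 HK]]; [pose proof rho_pos; pose proof rho_lt1; lra|].
destruct Clim_inv_Ef as [H1 H2].
set (L := ((E - 1) / (2 * kap))%C) in *.
assert (L0 : L <> 0).
{ intros H; apply E1; replace (E - 1)%C with (L * (2 * kap))%C by (unfold L; field; auto).
  rewrite H; ring. }
apply (Clim_inv F) in H2; [|exact L0].
set (NE := fun i => (/ (/ Ef (h i) (z i) / RtoC (N i)))%C) in H2.
replace (2 * (kap * kap) * E / ((E - 1) * (E - 1)))%C
  with (kap * / L + / 2 * (/ L * / L) - 0)%C by (unfold L; field; auto).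
eapply Clim_ext_loc; [exact FF| |].
2:{ apply Clim_minus; [exact FF| |].
    - apply Clim_plus; [exact FF|apply Clim_mult; [exact FF|exact Hw|exact H2]|].
      apply Clim_mult; [exact FF|apply Clim_const; exact FF|].
      apply Clim_mult; [exact FF|exact H2|exact H2].
    - apply (Clim_0_le F (fun i => RtoC (N i ^ 2) * (Ef (h i) (z i ^ 2) / 2))%C
        (fun i => (16 * K / x ^ 4) / N i)).
      + generalize (inner_eventually 1); apply filter_imp; intros i [K1 [K2 [K3 [K4 [K5 K6]]]]].
        rewrite Cmod_mult, Cmod_R, Rabs_pos_eq by apply pow2_ge_0.
        rewrite Cmod_div, Cmod_R, (Rabs_pos_eq 2) by (try exact c2; lra).
        pose proof (Ef_sqr_Cmod_le (h i) (z i) K3) as K7.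
        pose proof (eh_le_1 (h i)) as K8; pose proof (HK (h i)) as K9.
        pose proof rho_pos; assert (g0 : 0 <= rho ^ h i) by (apply pow_le; lra).
        set (n := N i) in *; set (g := rho ^ h i) in *.
        assert (K10 : (x / 2 * n) ^ 4 <= INR (S (h i)) ^ 4).
        { apply pow_incr; rewrite S_INR; split; [|lra]. nra. }
        assert (K11 : (x / 2 * n) ^ 4 * g <= K) by nra.
        assert (P : 0 < x ^ 4 * n) by (apply Rmult_lt_0_compat; [apply pow_lt; lra|lra]).
        apply Rmult_le_reg_r with (x ^ 4 * n); [exact P|].
        replace (16 * K / x ^ 4 / n * (x ^ 4 * n)) with (16 * K) by (field; lra).
        assert (n ^ 2 * (x ^ 4 * n) * g <= 16 * K).
        { replace (16 * K) with (16 * K) by ring.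
          assert (n ^ 3 <= n ^ 4) by (simpl; nra).
          replace (n ^ 2 * (x ^ 4 * n) * g) with (x ^ 4 * g * n ^ 3) by ring.
          replace ((x / 2 * n) ^ 4 * g) with (x ^ 4 * g * n ^ 4 / 16) in K11 by field.
          assert (0 <= x ^ 4 * g) by (apply Rmult_le_pos; [apply pow_le; lra|lra]). nra. }
        assert (Cmod (Ef (h i) (z i ^ 2)) <= g) by nra.
        assert (0 <= n ^ 2 * (x ^ 4 * n)) by (apply Rmult_le_pos; [apply pow2_ge_0|lra]).
        pose proof (Cmod_ge_0 (Ef (h i) (z i ^ 2))). nra.
      + intros eps He; apply small_over_N; [|exact He].
        apply Rdiv_lt_0_compat; [lra|apply pow_lt; lra]. }
generalize (filter_and _ _ H1 (inner_eventually 0)); apply filter_imp; intros i [K1 [K2 [K3 [K4 _]]]].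
cbv beta; unfold NE.
rewrite Ef_S by exact K4.
assert (n0 := RtoC_neq0 _ K2).
simpl (N i ^ 2); rewrite !RtoC_mult; field; auto.
Qed.

End Inner.

(** * Estimates on the whole circle *)

Definition sc (t : R) : C := (1, t).
Definition zc (n : nat) (t : R) : C := (RtoC rho * cexp (- (sc t / RtoC (INR n))))%C.

Lemma Cmod_zc (n : nat) (t : R) : (0 < n)%nat -> Cmod (zc n t) = rho * exp (- / INR n).
Proof.
intros Hn; assert (n0 : 0 < INR n) by (now apply lt_0_INR).
unfold zc; rewrite Cmod_mult, Cmod_R, Rabs_pos_eq by (left; apply rho_pos).
rewrite Cmod_cexp; do 2 f_equal; unfold sc; simpl; field; lra.
Qed.

Lemma exp_neg_inv_bounds (n : nat) : (0 < n)%nat ->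
  1 - / INR n <= exp (- / INR n) <= 1 - / (2 * INR n) /\ / 3 <= exp (- / INR n).
Proof.
intros Hn.
assert (n1 : 1 <= INR n) by (change 1 with (INR 1); apply le_INR; lia).
set (u := / INR n); assert (u1 : 0 < u <= 1).
{ unfold u; split; [apply Rinv_0_lt_compat; lra|rewrite <- Rinv_1; apply Rinv_le_contravar; lra]. }
pose proof (exp_ineq1_le (- u)); pose proof (exp_ineq1_le u).
pose proof (exp_pos (- u)); pose proof (exp_pos u).
assert (E : exp u * exp (- u) = 1) by (rewrite <- exp_plus, Rplus_opp_r; apply exp_0).
replace (/ (2 * INR n)) with (u / 2) by (unfold u; field; lra).
repeat split; [lra|nra|].
assert (exp u <= 3).
{ eapply Rle_trans; [|exact exp_le_3]; destruct (Req_dec u 1) as [->|]; [lra|].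
  left; apply exp_increasing; lra. }
nra.
Qed.

Lemma Cmod_zc_lt (n : nat) (t : R) : (0 < n)%nat -> 0 <= Cmod (zc n t) < rho.
Proof.
intros Hn; split; [apply Cmod_ge_0|].
rewrite Cmod_zc by exact Hn; pose proof rho_pos.
destruct (exp_neg_inv_bounds n Hn) as [[H1 H2] H3].
assert (0 < / (2 * INR n)) by (apply Rinv_0_lt_compat; apply lt_0_INR in Hn; lra).
nra.
Qed.

Lemma delta_zc (n : nat) (t : R) : (0 < n)%nat ->
  delta (zc n t) ^ 2 = (1 - exp (- / INR n)) ^ 2 + 2 * exp (- / INR n) * (1 - cos (t / INR n)).
Proof.
intros Hn; assert (n0 : 0 < INR n) by (now apply lt_0_INR).
unfold delta, zc.
replace (1 - RtoC rho * cexp (- (sc t / RtoC (INR n))) / RtoC rho)%C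
  with (1 - cexp (- (sc t / RtoC (INR n))))%C by (field; exact RtoC_rho_neq0).
assert (E : (- (sc t / RtoC (INR n)))%C = (- / INR n, - (t / INR n))).
{ unfold sc, Cdiv; rewrite <- RtoC_inv by lra; unfold Cmult, Copp, RtoC; simpl; f_equal; field; lra. }
rewrite E, Cmod_sqr; unfold cexp; simpl; rewrite cos_neg, sin_neg.
pose proof (sin2_cos2 (t / INR n)) as H; unfold Rsqr in H.
set (q := exp (- / INR n)); set (c := cos (t / INR n)) in *; set (s := sin (t / INR n)) in *.
nra.
Qed.

(** By [sin u >= u - u^3 / 6], and [u^2 / 6 <= 2/3] on the interval. *)
Lemma sin_ge_third (u : R) : 0 <= u <= 2 -> u / 3 <= sin u.
Proof.
intros Hu; destruct (Req_dec u 0) as [->|H]; [rewrite sin_0; lra|].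
destruct (MVT_cor2 (fun v => sin v - v + v ^ 3 / 6) (fun v => cos v - 1 + v ^ 2 / 2) 0 u) as [c [E Hc]];
  [lra| |].
- intros c _; apply is_derive_Reals; auto_derive; [exact I|]; field.
- rewrite sin_0 in E; pose proof (cos_ge_quad c); nra.
Qed.

Lemma one_sub_cos_ge (x : R) : Rabs x <= PI -> x ^ 2 / 18 <= 1 - cos x.
Proof.
intros Hx; pose proof PI_4.
replace (cos x) with (cos (Rabs x)).
- replace (x ^ 2) with (Rabs x ^ 2) by (rewrite RPow_abs; apply Rabs_pos_eq, pow2_ge_0).
  set (v := Rabs x) in *; assert (0 <= v) by apply Rabs_pos.
  replace v with (2 * (v / 2)) at 2 by field; rewrite cos_2a_sin.
  pose proof (sin_ge_third (v / 2) ltac:(lra)); nra.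
- unfold Rabs; destruct (Rcase_abs x); [apply cos_neg|reflexivity].
Qed.

(** The chord has a radial part of order [1 / n] and an angular part of order [|t| / n];
    [one_sub_cos_ge] makes the latter estimate valid up to the full half-turn. *)
Lemma delta_zc_bounds (n : nat) (t : R) : (0 < n)%nat -> Rabs t <= PI * INR n ->
  (1 + Rabs t) / (12 * INR n) <= delta (zc n t) <= (1 + Rabs t) / INR n.
Proof.
intros Hn Ht; assert (n0 : 0 < INR n) by (now apply lt_0_INR).
pose proof (delta_zc n t Hn) as E.
destruct (exp_neg_inv_bounds n Hn) as [[H1 H2] H3].
set (q := exp (- / INR n)) in *.
set (m := / INR n) in *; assert (m0 : 0 < m) by (now apply Rinv_0_lt_compat).
assert (q1 : q <= 1) by (replace (/ (2 * INR n)) with (m / 2) in H2 by (unfold m; field; lra); lra).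
assert (Hphi : Rabs (t / INR n) <= PI).
{ unfold Rdiv; rewrite Rabs_mult, (Rabs_pos_eq (/ INR n)) by (left; exact m0).
  apply Rmult_le_reg_r with (INR n); [exact n0|]; rewrite Rmult_assoc, Rinv_l; lra. }
pose proof (one_sub_cos_ge _ Hphi) as H4; pose proof (cos_ge_quad (t / INR n)) as H5.
set (phi := t / INR n) in *.
assert (Ep : Rabs phi = Rabs t * m).
{ unfold phi, Rdiv; rewrite Rabs_mult, (Rabs_pos_eq (/ INR n)) by (left; exact m0); reflexivity. }
assert (phi2 : phi ^ 2 = (Rabs t * m) ^ 2).
{ rewrite <- Ep, RPow_abs; symmetry; apply Rabs_pos_eq, pow2_ge_0. }
assert (D0 : 0 <= delta (zc n t)) by apply Cmod_ge_0.
pose proof (Rabs_pos t) as t0.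
replace (/ (2 * INR n)) with (m / 2) in H2 by (unfold m; field; lra).
replace ((1 + Rabs t) / (12 * INR n)) with ((m + Rabs t * m) / 12) by (unfold m; field; lra).
replace ((1 + Rabs t) / INR n) with (m + Rabs t * m) by (unfold m; field; lra).
set (a := Rabs t * m) in *; assert (a0 : 0 <= a) by (unfold a; nra).
set (d := delta (zc n t)) in *.
assert (L1 : m / 2 <= d).
{ assert (0 <= 2 * q * (1 - cos phi)) by (apply Rmult_le_pos; lra). nra. }
assert (L2 : a / 6 <= d).
{ assert (2 * q * (1 - cos phi) >= 2 * / 3 * (phi ^ 2 / 18)) by (apply Rle_ge, Rmult_le_compat; nra).
  assert (a ^ 2 / 27 <= d ^ 2) by nra. nra. }
split; [lra|].
assert ((1 - q) ^ 2 <= m ^ 2) by (apply pow_incr; lra).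
assert (2 * q * (1 - cos phi) <= 2 * 1 * (phi ^ 2 / 2)) by (apply Rmult_le_compat; nra).
assert (d ^ 2 <= m ^ 2 + a ^ 2) by lra.
nra.
Qed.

(** The dominating function [(1 + |t|)^(-3/2)], as an integer power of a square root. *)
Definition gd (t : R) : R := / sqrt (1 + Rabs t) ^ 3.

Lemma gd_pos (t : R) : 0 < gd t.
Proof. apply Rinv_0_lt_compat, pow_lt, sqrt_lt_R0; pose proof (Rabs_pos t); lra. Qed.

Lemma exp_ge_pow4 (u : R) : 0 <= u -> (u / 4) ^ 4 <= exp u.
Proof.
intros Hu; replace u with (4 * (u / 4)) at 2 by field.
assert (E : exp (4 * (u / 4)) = exp (u / 4) ^ 4).
{ replace (4 * (u / 4)) with (u / 4 + (u / 4 + (u / 4 + u / 4))) by field; rewrite !exp_plus; ring. }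
rewrite E; apply pow_incr; pose proof (exp_ineq1_le (u / 4)); lra.
Qed.

(** The exponential is traded for the inverse fourth power of [sqrt (1 + |t|)]: one factor
    compensates the growing prefactor and three are required by [gd]. *)
Lemma exp_sqrt_le_gd (k : R) : 0 < k -> exists B, 0 < B /\ forall t,
  sqrt (1 + Rabs t) * exp (- k * sqrt (Rabs t)) <= B * gd t.
Proof.
intros Hk; exists (exp k * (4 / k) ^ 4); pose proof (exp_pos k).
split; [apply Rmult_lt_0_compat; [lra|]; apply pow_lt, Rdiv_lt_0_compat; lra|].
intros t; pose proof (Rabs_pos t); unfold gd.
set (v := sqrt (1 + Rabs t)); assert (v1 : 1 <= v).
{ unfold v; rewrite <- sqrt_1 at 1; apply sqrt_le_1_alt; lra. }
set (s := sqrt (Rabs t)); assert (s0 : 0 <= s) by apply sqrt_pos.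
assert (vs : v <= 1 + s).
{ apply Rsqr_incr_0_var; [|lra]; unfold Rsqr, v, s.
  rewrite sqrt_sqrt by lra; pose proof (sqrt_sqrt (Rabs t) ltac:(lra)); fold s in H1 |- *; nra. }
assert (E : exp (- k * s) <= exp k * exp (- (k * v))).
{ rewrite <- exp_plus; destruct (Req_dec v (1 + s)) as [->|].
  - right; f_equal; ring.
  - left; apply exp_increasing; nra. }
pose proof (exp_ge_pow4 (k * v) ltac:(nra)) as P.
assert (P2 : exp (- (k * v)) <= (4 / k) ^ 4 * / v ^ 4).
{ rewrite exp_Ropp.
  replace ((4 / k) ^ 4 * / v ^ 4) with (/ (k * v / 4) ^ 4) by (field; lra).
  apply Rinv_le_contravar; [|exact P]; apply pow_lt; nra. }
apply Rle_trans with (v * (exp k * ((4 / k) ^ 4 * / v ^ 4))).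
- apply Rmult_le_compat_l; [lra|]; eapply Rle_trans; [exact E|]; apply Rmult_le_compat_l; lra.
- right; field; split; lra.
Qed.

(** The recursion is run only over the second half of the heights, where [|E_j| <= 2 A / h] already
    holds. Each step multiplies by at most [exp (- b) + A / h], and the corrections [A / h] cost a
    bounded factor in total. The forcing terms are at most [rho^j], summable and exponentially
    small. Bounding [rho^h] by a square matches the quadratic terms of [outer_bound]. *)
Lemma Ef_decay : exists A' nu, 0 < A' /\ 0 < nu /\ forall (b : R) (z : C) (h : nat),
  (0 < h)%nat -> 0 <= b <= 2 -> Cmod z <= rho -> Cmod (Yf z) <= exp (- b) ->
  Cmod (Ef h z) <= A' / INR h * (exp (- b * (INR h / 2)) + exp (- nu * INR h)) /\
  rho ^ h <= (A' / INR h * exp (- nu * INR h)) ^ 2.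
Proof.
destruct eh_le as [A [A0 HA]].
pose proof rho_pos as R0; pose proof rho_lt1 as R1.
set (sr := sqrt rho).
assert (sr1 : 0 < sr < 1).
{ unfold sr; split; [now apply sqrt_lt_R0|rewrite <- sqrt_1; apply sqrt_lt_1_alt; lra]. }
assert (sr2 : sr * sr = rho) by (apply sqrt_sqrt; lra).
set (nu := - ln sr).
assert (nu0 : 0 < nu).
{ unfold nu; pose proof (ln_increasing sr 1 (proj1 sr1) (proj2 sr1)) as H.
  rewrite ln_1 in H; lra. }
assert (sre : sr = exp (- nu)) by (unfold nu; rewrite Ropp_involutive, exp_ln; lra).
set (G := A * exp 2).
assert (G0 : 0 < G) by (unfold G; pose proof (exp_pos 2); nra).
set (S := 2 * / (1 - sr) * exp nu).
assert (S0 : 0 < S).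
{ unfold S; apply Rmult_lt_0_compat; [|apply exp_pos].
  apply Rmult_lt_0_compat; [lra|apply Rinv_0_lt_compat; lra]. }
assert (i1 : 0 < / (1 - rho)) by (apply Rinv_0_lt_compat; lra).
set (A' := exp G * (2 * A * exp 2 + S * / (1 - rho)) + S).
assert (eG : 1 <= exp G) by (pose proof (exp_ineq1_le G); lra).
assert (A'0 : S <= A' /\ exp G * (2 * A * exp 2) <= A' /\ exp G * (S * / (1 - rho)) <= A').
{ unfold A'; pose proof (exp_pos 2).
  assert (0 < S * / (1 - rho)) by nra. assert (0 < 2 * A * exp 2) by nra. repeat split; nra. }
exists A', (nu / 2); split; [lra|split; [lra|]].
intros b z h Hh Hb Hz HY.
assert (h1 : 1 <= INR h) by (change 1 with (INR 1); apply le_INR; lia).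
set (j0 := Nat.div2 h).
assert (J0 : (2 * j0 <= h)%nat /\ (h <= 2 * j0 + 1)%nat).
{ unfold j0; pose proof (Nat.div2_odd h); destruct (Nat.odd h); simpl in *; lia. }
assert (J1 : INR h <= 2 * INR j0 + 1 /\ 2 * INR j0 <= INR h).
{ destruct J0 as [a1 a2]; apply le_INR in a1, a2; rewrite plus_INR, !mult_INR in *; simpl in *; lra. }
set (ih := / INR h); assert (ih0 : 0 < ih) by (apply Rinv_0_lt_compat; lra).
(* sqrt(rho)^j0 is both O(1/h) and exponentially small *)
assert (P1 : sr ^ j0 <= 2 * / (1 - sr) * ih).
{ pose proof (succ_mul_pow_le sr j0 ltac:(lra)) as H; rewrite S_INR in H.
  assert (0 < sr ^ j0) by (apply pow_lt; lra).
  apply Rmult_le_reg_l with (INR h); [lra|].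
  replace (INR h * (2 * / (1 - sr) * ih)) with (2 * / (1 - sr)) by (unfold ih; field; lra). nra. }
assert (P2 : sr ^ j0 <= exp nu * exp (- (nu / 2) * INR h)).
{ rewrite sre.
  assert (E : exp (- nu) ^ j0 = exp (- nu * INR j0)).
  { clear; induction j0; [simpl; rewrite Rmult_0_r, exp_0; reflexivity|].
    rewrite S_INR; simpl; rewrite IHj0, <- exp_plus; f_equal; ring. }
  rewrite E, <- exp_plus.
  destruct (Rle_lt_or_eq_dec (- nu * INR j0) (nu + - (nu / 2) * INR h)) as [H|H]; [nra| |].
  - left; now apply exp_increasing.
  - right; now rewrite H. }
assert (P3 : rho ^ j0 <= S * ih * exp (- (nu / 2) * INR h)).
{ rewrite <- sr2, Rpow_mult_distr.
  replace (S * ih * exp (- (nu / 2) * INR h)) with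
    ((2 * / (1 - sr) * ih) * (exp nu * exp (- (nu / 2) * INR h))) by (unfold S; ring).
  apply Rmult_le_compat; try exact P1; try exact P2; apply pow_le; lra. }
assert (X0 := exp_pos (- (nu / 2) * INR h)).
split.
2:{ apply Rle_trans with (rho ^ j0 * rho ^ j0).
    - rewrite <- pow_add; replace h with ((j0 + j0) + (h - (j0 + j0)))%nat by lia; rewrite pow_add.
      assert (rho ^ (h - (j0 + j0)) <= 1 ^ (h - (j0 + j0))) by (apply pow_incr; lra).
      rewrite pow1 in *; assert (0 < rho ^ (j0 + j0)) by (apply pow_lt; lra); nra.
    - simpl; rewrite Rmult_1_r; assert (0 <= rho ^ j0) by (apply pow_le; lra).
      assert (S * ih * exp (- (nu / 2) * INR h) <= A' / INR h * exp (- (nu / 2) * INR h)).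
      { apply Rmult_le_compat_r; [lra|]; apply Rmult_le_compat_r; [fold ih; lra|lra]. }
      apply Rmult_le_compat; lra. }
assert (eb : exp b * exp (- b) = 1) by (rewrite <- exp_plus, Rplus_opp_r; apply exp_0).
assert (eb2 : exp b <= exp 2).
{ destruct (Req_dec b 2) as [->|]; [lra|left; apply exp_increasing; lra]. }
assert (ebp := exp_pos (- b)).
(* Since [exp (- b) >= exp (- 2)] and [G = A exp 2], the correction [A / h] is at most
   [exp (- b) * (G / h)] and can be moved into the exponent. *)
set (m := exp (- b + G * ih)).
assert (Hm : exp (- b) + A * ih <= m).
{ unfold m; rewrite exp_plus; pose proof (exp_ineq1_le (G * ih)).
  assert (A * ih <= exp (- b) * (G * ih)).
  { unfold G; replace (exp (- b) * (A * exp 2 * ih)) with (A * ih * (exp (- b) * exp 2)) by ring.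
    assert (1 <= exp (- b) * exp 2) by nra. assert (0 < A * ih) by nra. nra. }
  nra. }
assert (m0 : 0 < m) by apply exp_pos.
(* For the forcing terms the decay in [b] is given up: [rho^j0] is small enough. *)
set (m' := exp (G * ih)).
assert (mm' : m <= m').
{ unfold m, m'; destruct (Req_dec b 0) as [->|]; [right; f_equal; ring|left; apply exp_increasing; lra]. }
assert (m'1 : 1 <= m') by (unfold m'; pose proof (exp_ineq1_le (G * ih)); assert (0 < G * ih) by nra; lra).
assert (R : forall k, Cmod (Ef (j0 + k) z) <=
  m ^ k * (2 * A * ih) + m' ^ k * (rho ^ j0 * ((1 - rho ^ k) * / (1 - rho)))).
{ assert (Small : forall j, (j0 <= j)%nat -> Cmod (Ef j z) <= 2 * A * ih).
  { intros j Hj; eapply Rle_trans; [now apply Ef_Cmod_le|]; eapply Rle_trans; [apply HA|].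
    assert (Hs : INR h <= 2 * INR (Datatypes.S j)) by (rewrite S_INR; apply le_INR in Hj; lra).
    apply Rmult_le_reg_r with (INR (Datatypes.S j) * INR h); [nra|].
    replace (A / INR (Datatypes.S j) * (INR (Datatypes.S j) * INR h)) with (A * INR h) by (field; lra).
    replace (2 * A * ih * (INR (Datatypes.S j) * INR h)) with (A * (2 * INR (Datatypes.S j)))
      by (unfold ih; field; lra).
    apply Rmult_le_compat_l; lra. }
  induction k.
  - rewrite Nat.add_0_r; simpl.
    pose proof (Small j0 (le_n _)).
    replace (1 - 1) with 0 by ring; lra.
  - replace (j0 + Datatypes.S k)%nat with (Datatypes.S (j0 + k)) by lia.
    rewrite Ef_S by exact Hz.
    replace (1 - wf z - Ef (j0 + k) z / 2)%C with (Yf z - Ef (j0 + k) z / 2)%C by (unfold wf; ring).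
    eapply Rle_trans; [apply Cmod_triangle|].
    assert (Q1 : Cmod (Ef (j0 + k) (z ^ 2) / 2)%C <= rho ^ j0 * rho ^ k).
    { rewrite Cmod_div, Cmod_R, Rabs_pos_eq by (try exact C2_neq0; lra).
      pose proof (Ef_sqr_Cmod_le (j0 + k) z Hz); pose proof (eh_le_1 (j0 + k)).
      rewrite <- pow_add; assert (0 < rho ^ (j0 + k)) by (apply pow_lt; lra). nra. }
    assert (Q2 : Cmod (Ef (j0 + k) z * (Yf z - Ef (j0 + k) z / 2))%C <= m * Cmod (Ef (j0 + k) z)).
    { rewrite Cmod_mult, Rmult_comm; apply Rmult_le_compat_r; [apply Cmod_ge_0|].
      eapply Rle_trans; [apply Cmod_triangle|]; rewrite Cmod_opp, Cmod_div, Cmod_R, Rabs_pos_eq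
        by (try exact C2_neq0; lra).
      pose proof (Small (j0 + k)%nat ltac:(lia)); lra. }
    set (r := rho ^ j0) in *; assert (r0 : 0 < r) by (apply pow_lt; lra).
    assert (rk : 0 < rho ^ k <= 1).
    { split; [apply pow_lt; lra|]; rewrite <- (pow1 k); apply pow_incr; lra. }
    set (y := (1 - rho ^ k) * / (1 - rho)) in *.
    assert (y0 : 0 <= y) by (unfold y; nra).
    assert (yS : (1 - rho ^ Datatypes.S k) * / (1 - rho) = y + rho ^ k).
    { unfold y; simpl; field; lra. }
    rewrite yS.
    assert (mk : 1 <= m' ^ Datatypes.S k) by (apply pow_R1_Rle; lra).
    assert (T1 : m * Cmod (Ef (j0 + k) z) <= m * (m ^ k * (2 * A * ih) + m' ^ k * (r * y)))
      by (apply Rmult_le_compat_l; lra).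
    assert (T2 : m * (m' ^ k * (r * y)) <= m' * (m' ^ k * (r * y))).
    { apply Rmult_le_compat_r; [|lra]; apply Rmult_le_pos; [apply pow_le; lra|nra]. }
    assert (T3 : r * rho ^ k <= m' ^ Datatypes.S k * (r * rho ^ k)).
    { rewrite <- (Rmult_1_l (r * rho ^ k)) at 1; apply Rmult_le_compat_r; [nra|exact mk]. }
    change (m' ^ Datatypes.S k) with (m' * m' ^ k) in *.
    change (m ^ Datatypes.S k) with (m * m ^ k). lra. }
specialize (R (h - j0)%nat); replace (j0 + (h - j0))%nat with h in R by lia.
eapply Rle_trans; [exact R|].
assert (Ek : forall u k, exp u ^ k = exp (u * INR k)).
{ clear; intros u k; induction k; [simpl; rewrite Rmult_0_r, exp_0; reflexivity|].
  rewrite S_INR; simpl; rewrite IHk, <- exp_plus; f_equal; ring. }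
assert (em : forall a c, a <= c -> exp a <= exp c).
{ intros a c [H|H]; [left; now apply exp_increasing|right; now rewrite H]. }
assert (Hk : INR (h - j0) = INR h - INR j0) by (apply minus_INR; lia).
pose proof (pos_INR j0).
assert (M1 : m ^ (h - j0) <= exp (- b * (INR h / 2)) * exp G).
{ unfold m; rewrite Ek, <- exp_plus; apply em; rewrite Hk.
  assert (G * ih * (INR h - INR j0) <= G).
  { replace G with (G * ih * INR h) at 2 by (unfold ih; field; lra).
    apply Rmult_le_compat_l; [nra|lra]. }
  nra. }
assert (M2 : m' ^ (h - j0) <= exp G).
{ unfold m'; rewrite Ek; apply em; rewrite Hk.
  replace G with (G * ih * INR h) at 2 by (unfold ih; field; lra).
  apply Rmult_le_compat_l; [nra|lra]. }
set (k := (h - j0)%nat) in *.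
assert (rk : 0 < rho ^ k <= 1).
{ split; [apply pow_lt; lra|]; rewrite <- (pow1 k); apply pow_incr; lra. }
assert (r0 : 0 < rho ^ j0) by (apply pow_lt; lra).
set (X := exp (- b * (INR h / 2))) in *; assert (Xp : 0 < X) by apply exp_pos.
set (V := exp (- (nu / 2) * INR h)) in *.
assert (e2 : 1 <= exp 2) by (pose proof (exp_ineq1_le 2); lra).
assert (F1 : m ^ k * (2 * A * ih) <= A' * ih * X).
{ apply Rle_trans with (X * exp G * (2 * A * ih)).
  - apply Rmult_le_compat_r; [nra|exact M1].
  - assert (exp G * (2 * A) <= A').
    { eapply Rle_trans; [|exact (proj1 (proj2 A'0))]; apply Rmult_le_compat_l; nra. }
    assert (0 < X * ih) by nra. nra. }
assert (F2 : m' ^ k * (rho ^ j0 * ((1 - rho ^ k) * / (1 - rho))) <= A' * ih * V).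
{ apply Rle_trans with (exp G * (S * ih * V * / (1 - rho))).
  - apply Rmult_le_compat; [apply pow_le; lra| |exact M2|].
    + apply Rmult_le_pos; [lra|]; apply Rmult_le_pos; lra.
    + apply Rmult_le_compat; [lra| |exact P3|].
      * apply Rmult_le_pos; lra.
      * rewrite <- (Rmult_1_l (/ (1 - rho))) at 2; apply Rmult_le_compat_r; lra.
  - replace (exp G * (S * ih * V * / (1 - rho))) with (exp G * (S * / (1 - rho)) * (ih * V)) by ring.
    replace (A' * ih * V) with (A' * (ih * V)) by ring.
    apply Rmult_le_compat_r; [nra|exact (proj2 (proj2 A'0))]. }
unfold Rdiv; fold ih; lra.
Qed.

Lemma circle_bounds : exists c K n0, 0 < c <= 1 /\ 0 < K /\ (0 < n0)%nat /\
  forall n t, (n0 <= n)%nat -> Rabs t <= PI * INR n ->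
    Cmod (Yf (zc n t)) <= exp (- (c * sqrt (delta (zc n t)))) /\
    c * ((1 + Rabs t) / INR n) <= Cmod (wf (zc n t)) ^ 2 <= K * ((1 + Rabs t) / INR n).
Proof.
destruct Yf_wf_bounds as [c [K [r0 [c0 [K0 [Hr H]]]]]].
destruct (INR_unbounded (/ (1 - r0))) as [n0 Hn0].
exists (Rmin (c / 12) 1), K, (S n0).
assert (c1 : 0 < Rmin (c / 12) 1) by (apply Rmin_glb_lt; lra).
assert (c2 : Rmin (c / 12) 1 <= c / 12) by apply Rmin_l.
split; [split; [exact c1|apply Rmin_r]|split; [exact K0|split; [lia|]]].
intros n t Hn Ht.
assert (Hn1 : (0 < n)%nat) by lia; assert (n1 : 0 < INR n) by (now apply lt_0_INR).
destruct (exp_neg_inv_bounds n Hn1) as [[E1 E2] E3].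
assert (Hz : rho * r0 <= Cmod (zc n t) <= rho).
{ split; [|left; now apply Cmod_zc_lt].
  rewrite Cmod_zc by exact Hn1; apply Rmult_le_compat_l; [left; apply rho_pos|].
  assert (/ INR n <= 1 - r0); [|lra].
  rewrite <- (Rinv_inv (1 - r0)); apply Rinv_le_contravar; [apply Rinv_0_lt_compat; lra|].
  apply Rle_trans with (INR n0); [lra|]; apply le_INR; lia. }
destruct (H _ Hz) as [H1 [H2 H3]].
destruct (delta_zc_bounds n t Hn1 Ht) as [D1 D2].
assert (D0 : 0 <= delta (zc n t)) by apply Cmod_ge_0.
assert (Dp : 0 <= (1 + Rabs t) / INR n).
{ apply Rdiv_le_0_compat; [pose proof (Rabs_pos t); lra|lra]. }
replace ((1 + Rabs t) / (12 * INR n)) with ((1 + Rabs t) / INR n / 12) in D1 by (field; lra).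
split; [|split].
- eapply Rle_trans; [exact H1|].
  pose proof (sqrt_pos (delta (zc n t))).
  destruct (Rle_lt_or_eq_dec (- c * sqrt (delta (zc n t))) (- (Rmin (c / 12) 1 * sqrt (delta (zc n t)))))
    as [Hl|Hl]; [nra|left; now apply exp_increasing|right; now rewrite Hl].
- nra.
- eapply Rle_trans; [exact H3|]; apply Rmult_le_compat_l; lra.
Qed.

(** In [w E_h + E_h^2 / 2 - E_h(z^2) / 2] every [E_h] supplies a factor [1 / sqrt n] and an
    exponential in [- sqrt |t|], while [w] is of order [sqrt ((1 + |t|) / n)]; [exp_sqrt_le_gd]
    absorbs the growth of [w]. *)
Lemma outer_bound (x0 : R) : 0 < x0 -> exists B n0, 0 < B /\ (0 < n0)%nat /\
  forall n h t, (n0 <= n)%nat -> x0 * sqrt (INR n) <= INR h -> Rabs t <= PI * INR n ->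
  INR n * Cmod (Ef h (zc n t) - Ef (S h) (zc n t))%C <= B * gd t.
Proof.
intros Hx0.
destruct circle_bounds as [c [K [n0 [c0 [K0 [n00 HC]]]]]].
destruct Ef_decay as [A' [nu [A0 [nu0 HE]]]].
(* The slower of the rates of the two exponentials of [Ef_decay]. The second one depends on [h]
   alone and is converted into a decay in [t] through [|t| <= PI n]. *)
set (k := Rmin (c * x0 / 8) (nu * x0 / 2)).
assert (k0 : 0 < k) by (apply Rmin_glb_lt; nra).
assert (k1 : k <= c * x0 / 8) by apply Rmin_l.
assert (k2 : k <= nu * x0 / 2) by apply Rmin_r.
destruct (exp_sqrt_le_gd k k0) as [B0 [B00 HB]].
set (a := A' / x0); assert (a0 : 0 < a) by (apply Rdiv_lt_0_compat; lra).
set (sK := sqrt K); assert (sK0 : 0 < sK) by (now apply sqrt_lt_R0).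
exists ((2 * a * sK + 3 * a ^ 2) * B0), n0.
split; [apply Rmult_lt_0_compat; [|exact B00]; assert (0 < a * sK) by nra; nra|split; [exact n00|]].
intros n h t Hn Hh Ht.
destruct (HC n t Hn Ht) as [C1 [_ C3]].
assert (n1 : 1 <= INR n) by (change 1 with (INR 1); apply le_INR; lia).
set (N := sqrt (INR n)) in *; assert (N1 : 1 <= N) by (unfold N; rewrite <- sqrt_1 at 1; apply sqrt_le_1_alt; lra).
assert (NN : N * N = INR n) by (apply sqrt_sqrt; lra).
assert (h1 : (0 < h)%nat) by (apply INR_lt; simpl; nra).
assert (hp : 0 < INR h) by (now apply lt_0_INR).
set (z := zc n t) in *.
assert (Hz : Cmod z <= rho) by (left; apply Cmod_zc_lt; lia).
assert (t0 := Rabs_pos t).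
set (d := delta z) in *; assert (d0 : 0 <= d) by apply Cmod_ge_0.
destruct (delta_zc_bounds n t ltac:(lia) Ht) as [D1 _]; fold z d in D1.
assert (d2 := delta_le_2 z Hz); fold d in d2.
assert (sd : 0 <= sqrt d <= 2).
{ split; [apply sqrt_pos|]; rewrite <- (sqrt_pow2 2) by lra; apply sqrt_le_1_alt; lra. }
set (T := sqrt (Rabs t)) in *; assert (T0 : 0 <= T) by apply sqrt_pos.
assert (TT : T * T = Rabs t) by (now apply sqrt_sqrt).
assert (sdT : T <= 4 * N * sqrt d).
{ apply Rsqr_incr_0_var; [|nra]; unfold Rsqr.
  replace (4 * N * sqrt d * (4 * N * sqrt d)) with (16 * (N * N) * (sqrt d * sqrt d)) by ring.
  rewrite NN, TT, sqrt_sqrt by exact d0.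
  apply Rmult_le_compat_l with (r := 12 * INR n) in D1; [|lra].
  replace (12 * INR n * ((1 + Rabs t) / (12 * INR n))) with (1 + Rabs t) in D1 by (field; lra). nra. }
assert (TN : T <= 2 * N).
{ apply Rsqr_incr_0_var; [|lra]; unfold Rsqr; pose proof PI_4; nra. }
destruct (HE (c * sqrt d) z h h1 ltac:(nra) Hz C1) as [E1 E2].
assert (em : forall u v, u <= v -> exp u <= exp v).
{ intros u v [H|H]; [left; now apply exp_increasing|right; now rewrite H]. }
set (e := exp (- k * T)).
assert (e0 : 0 < e) by apply exp_pos.
assert (e1 : e <= 1) by (rewrite <- exp_0; apply em; nra).
assert (X1 : exp (- (c * sqrt d) * (INR h / 2)) <= e).
{ apply em. assert (k * T <= c * sqrt d * (INR h / 2)); [|lra].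
  apply Rle_trans with (c * x0 / 8 * (4 * N * sqrt d)).
  - apply Rmult_le_compat; lra.
  - replace (c * x0 / 8 * (4 * N * sqrt d)) with (c * sqrt d * (x0 * N / 2)) by field.
    apply Rmult_le_compat_l; [nra|lra]. }
assert (X2 : exp (- nu * INR h) <= e).
{ apply em. assert (k * T <= nu * INR h); [|lra].
  apply Rle_trans with (nu * x0 / 2 * (2 * N)).
  - apply Rmult_le_compat; lra.
  - replace (nu * x0 / 2 * (2 * N)) with (nu * (x0 * N)) by field.
    apply Rmult_le_compat_l; lra. }
assert (Ah : A' / INR h <= a / N).
{ unfold a; replace (A' / x0 / N) with (A' / (x0 * N)) by (field; lra).
  apply Rmult_le_compat_l; [lra|]; apply Rinv_le_contravar; nra. }
assert (Ah0 : 0 < A' / INR h) by (apply Rdiv_lt_0_compat; lra).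
assert (F1 : Cmod (Ef h z) <= a / N * (2 * e)).
{ eapply Rle_trans; [exact E1|]; apply Rmult_le_compat; try lra.
  pose proof (exp_pos (- (c * sqrt d) * (INR h / 2))); pose proof (exp_pos (- nu * INR h)); lra. }
assert (F2 : rho ^ h <= (a / N * e) ^ 2).
{ eapply Rle_trans; [exact E2|]; apply pow_incr.
  pose proof (exp_pos (- nu * INR h)); split; [nra|]; apply Rmult_le_compat; lra. }
set (v := sqrt (1 + Rabs t)); assert (v1 : 1 <= v).
{ unfold v; rewrite <- sqrt_1 at 1; apply sqrt_le_1_alt; lra. }
assert (vv : v * v = 1 + Rabs t) by (apply sqrt_sqrt; lra).
assert (F3 : Cmod (wf z) <= sK * v / N).
{ apply Rsqr_incr_0_var; [|apply Rdiv_le_0_compat; nra]; unfold Rsqr.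
  replace (sK * v / N * (sK * v / N)) with ((sK * sK) * ((v * v) / (N * N))) by (field; lra).
  unfold sK; rewrite sqrt_sqrt, vv, NN by lra; simpl in C3; lra. }
rewrite Ef_S by exact Hz.
replace (Ef h z - (Ef h z * (1 - wf z - Ef h z / 2) + Ef h (z ^ 2) / 2))%C with
  (wf z * Ef h z + (Ef h z * Ef h z / 2 - Ef h (z ^ 2) / 2))%C by (unfold Cdiv; ring).
assert (F4 : Cmod (Ef h (z ^ 2) / 2)%C <= rho ^ h).
{ rewrite Cmod_div, Cmod_R, Rabs_pos_eq by (try exact C2_neq0; lra).
  pose proof (Ef_sqr_Cmod_le h z Hz); pose proof (eh_le_1 h).
  assert (0 < rho ^ h) by (apply pow_lt, rho_pos). nra. }
assert (iN : 0 < / N) by (apply Rinv_0_lt_compat; lra).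
assert (aN : 0 < a / N) by (apply Rdiv_lt_0_compat; lra).
assert (F5 : Cmod (wf z * Ef h z + (Ef h z * Ef h z / 2 - Ef h (z ^ 2) / 2))%C <=
  (sK * v / N) * (a / N * (2 * e)) + ((a / N * (2 * e)) * (a / N * (2 * e)) / 2 + (a / N * e) ^ 2)).
{ eapply Rle_trans; [apply Cmod_triangle|]; apply Rplus_le_compat.
  - rewrite Cmod_mult; apply Rmult_le_compat; auto using Cmod_ge_0.
  - eapply Rle_trans; [apply Cmod_triangle|]; rewrite Cmod_opp; apply Rplus_le_compat; [|lra].
    rewrite Cmod_div, Cmod_R, Rabs_pos_eq, Cmod_mult by (try exact C2_neq0; lra).
    apply Rmult_le_compat_r; [lra|]; apply Rmult_le_compat; auto using Cmod_ge_0. }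
apply Rle_trans with ((2 * a * sK + 3 * a ^ 2) * (v * e)).
2:{ rewrite (Rmult_assoc _ B0); apply Rmult_le_compat_l; [|apply HB]. assert (0 < a * sK) by nra; nra. }
rewrite <- NN.
apply Rmult_le_compat_l with (r := N * N) in F5; [|nra].
eapply Rle_trans; [exact F5|].
replace (N * N * (sK * v / N * (a / N * (2 * e)) +
   (a / N * (2 * e) * (a / N * (2 * e)) / 2 + (a / N * e) ^ 2)))
  with (2 * a * sK * (v * e) + 3 * a ^ 2 * (e * e)) by (field; lra).
rewrite Rmult_plus_distr_r; apply Rplus_le_compat_l, Rmult_le_compat_l; nra.
Qed.

(** * The operator [z d/dz] applied to the functional equation *)

Lemma conv_deriv (a b : nat -> R) (n : nat) :
  INR n * conv a b n = conv (fun k => INR k * a k) b n + conv a (fun k => INR k * b k) n.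
Proof.
unfold conv; rewrite scal_sum, <- plus_sum; apply sum_eq; intros k Hk.
assert (E : INR n = INR k + INR (n - k)) by (rewrite <- plus_INR; f_equal; lia).
rewrite E; ring.
Qed.

Lemma dil_deriv (a : nat -> R) (n : nat) : INR n * dil a n = 2 * dil (fun k => INR k * a k) n.
Proof.
rewrite Rmult_comm, (dil_mult a INR (fun m => 2 * INR m)).
- unfold dil; destruct (Nat.even n); ring.
- intros m; rewrite mult_INR; simpl; ring.
Qed.

Lemma ycoef1_rec (n : nat) :
  2 * ycoef1 n = 2 * ind1 n + (conv ycoef1 y_coef n + conv y_coef ycoef1 n) + 2 * dil ycoef1 n.
Proof.
unfold ycoef1 at 1; replace (2 * (INR n * y_coef n)) with (INR n * (2 * y_coef n)) by ring.
rewrite y_coef_rec, !Rmult_plus_distr_l, conv_deriv, dil_deriv.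
replace (INR n * (2 * ind1 n)) with (2 * ind1 n); [reflexivity|].
unfold ind1; destruct (Nat.eqb n 1) eqn:E; [apply Nat.eqb_eq in E; subst; simpl|]; ring.
Qed.

Lemma ycoef2_rec (n : nat) :
  2 * ycoef2 n = 2 * ind1 n + (conv ycoef2 y_coef n + 2 * conv ycoef1 ycoef1 n + conv y_coef ycoef2 n)
    + 4 * dil ycoef2 n.
Proof.
unfold ycoef2 at 1; replace (2 * (INR n * ycoef1 n)) with (INR n * (2 * ycoef1 n)) by ring.
rewrite ycoef1_rec, !Rmult_plus_distr_l, !conv_deriv.
replace (INR n * (2 * dil ycoef1 n)) with (2 * (INR n * dil ycoef1 n)) by ring; rewrite dil_deriv.
fold ycoef1.
replace (INR n * (2 * ind1 n)) with (2 * ind1 n).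
- change (fun k => INR k * ycoef1 k) with ycoef2; change (fun k => INR k * y_coef k) with ycoef1; ring.
- unfold ind1; destruct (Nat.eqb n 1) eqn:E; [apply Nat.eqb_eq in E; subst; simpl|]; ring.
Qed.

Lemma acv_plus (a b : nat -> R) (r : R) : 0 <= r -> acv a r -> acv b r -> acv (fun n => a n + b n) r.
Proof.
intros Hr Ha Hb.
apply ex_series_Rle with (fun n => Rabs (a n) * r ^ n + Rabs (b n) * r ^ n).
- intros n; rewrite Rabs_mult, Rabs_Rabsolu, (Rabs_pos_eq (r ^ n)) by now apply pow_le.
  rewrite <- Rmult_plus_distr_r; apply Rmult_le_compat_r; [now apply pow_le|apply Rabs_triang].
- exact (ex_series_plus _ _ Ha Hb).
Qed.

Lemma acv_scal (k : R) (a : nat -> R) (r : R) : acv a r -> acv (fun n => k * a n) r.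
Proof.
intros [l Hl]; exists (Rabs k * l).
eapply is_series_ext; [|exact (is_series_scal (K := R_AbsRing) (V := R_NormedModule) (Rabs k) _ _ Hl)].
intros n; cbv beta; rewrite Rabs_mult, Rmult_assoc; reflexivity.
Qed.

Definition Y1f (z : C) : C := CPS ycoef1 z.
Definition Y2f (z : C) : C := CPS ycoef2 z.

(** Apply [z d/dz] to the functional equation and move the product of [y] and [z y'] to the left;
    the chain rule turns the factor [1/2] of [y(z^2)] into 1. *)
Lemma Y1f_eq (z : C) : Cmod z < rho -> (wf z * Y1f z = z + Y1f (z ^ 2))%C.
Proof.
intros H; pose proof (Cmod_ge_0 z) as z0.
destruct (Cmod_sqr_le z (Rlt_le _ _ H)) as [H1 H2].
assert (H3 : 0 <= Cmod (z ^ 2)%C < rho).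
{ rewrite Cmod_pow in *; pose proof rho_lt1; nra. }
assert (Ay := acv_upto_rho _ H1); assert (A1 := acv_ycoef1 _ (conj z0 H)).
assert (Ad : acv (dil ycoef1) (Cmod z)) by (apply acv_dil; rewrite <- Cmod_pow; now apply acv_ycoef1).
assert (Ac1 := acv_conv _ _ _ z0 A1 Ay); assert (Ac2 := acv_conv _ _ _ z0 Ay A1).
assert (E : (2 * Y1f z = 2 * z + (Y1f z * Yf z + Yf z * Y1f z) + 2 * Y1f (z ^ 2))%C).
{ transitivity (CPS (fun n => 2 * ycoef1 n) z); [symmetry; now apply CPS_scal|].
  rewrite (CPS_ext _ (fun n => (2 * ind1 n + (conv ycoef1 y_coef n + conv y_coef ycoef1 n)) + 2 * dil ycoef1 n))
    by apply ycoef1_rec.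
  assert (B1 := acv_scal 2 _ _ (acv_ind1 (Cmod z))); assert (B2 := acv_plus _ _ _ z0 Ac1 Ac2).
  assert (B3 := acv_plus _ _ _ z0 B1 B2); assert (B4 := acv_scal 2 _ _ Ad).
  rewrite (CPS_plus _ _ _ B3 B4), (CPS_plus _ _ _ B1 B2), (CPS_plus _ _ _ Ac1 Ac2).
  rewrite (CPS_scal 2 _ _ (acv_ind1 _)), (CPS_scal 2 _ _ Ad), CPS_ind1.
  rewrite !CPS_conv by assumption.
  rewrite CPS_dil by (now apply acv_ycoef1); reflexivity. }
unfold wf.
replace ((1 - Yf z) * Y1f z)%C with ((2 * Y1f z - (Y1f z * Yf z + Yf z * Y1f z)) / 2)%C
  by (field; exact C2_neq0).
rewrite E; field; exact C2_neq0.
Qed.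

Lemma Y2f_eq (z : C) : Cmod z < rho ->
  (wf z * Y2f z = z + Y1f z * Y1f z + 2 * Y2f (z ^ 2))%C.
Proof.
intros H; pose proof (Cmod_ge_0 z) as z0.
destruct (Cmod_sqr_le z (Rlt_le _ _ H)) as [H1 H2].
assert (H3 : 0 <= Cmod (z ^ 2)%C < rho).
{ rewrite Cmod_pow in *; pose proof rho_lt1; nra. }
assert (Ay := acv_upto_rho _ H1); assert (A1 := acv_ycoef1 _ (conj z0 H)).
assert (A2 := acv_ycoef2 _ (conj z0 H)).
assert (Ad : acv (dil ycoef2) (Cmod z)) by (apply acv_dil; rewrite <- Cmod_pow; now apply acv_ycoef2).
assert (Ac1 := acv_conv _ _ _ z0 A2 Ay); assert (Ac2 := acv_conv _ _ _ z0 Ay A2).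
assert (Ac3 := acv_conv _ _ _ z0 A1 A1).
assert (E : (2 * Y2f z = 2 * z + (Y2f z * Yf z + 2 * (Y1f z * Y1f z) + Yf z * Y2f z) + 4 * Y2f (z ^ 2))%C).
{ transitivity (CPS (fun n => 2 * ycoef2 n) z); [symmetry; now apply CPS_scal|].
  rewrite (CPS_ext _ (fun n => (2 * ind1 n + ((conv ycoef2 y_coef n + 2 * conv ycoef1 ycoef1 n)
    + conv y_coef ycoef2 n)) + 4 * dil ycoef2 n)) by apply ycoef2_rec.
  assert (B1 := acv_scal 2 _ _ (acv_ind1 (Cmod z))); assert (Bc := acv_scal 2 _ _ Ac3).
  assert (B2 := acv_plus _ _ _ z0 Ac1 Bc); assert (B2' := acv_plus _ _ _ z0 B2 Ac2).
  assert (B3 := acv_plus _ _ _ z0 B1 B2'); assert (B4 := acv_scal 4 _ _ Ad).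
  rewrite (CPS_plus _ _ _ B3 B4), (CPS_plus _ _ _ B1 B2'), (CPS_plus _ _ _ B2 Ac2), (CPS_plus _ _ _ Ac1 Bc).
  rewrite (CPS_scal 2 _ _ (acv_ind1 _)), (CPS_scal 4 _ _ Ad), (CPS_scal 2 _ _ Ac3), CPS_ind1.
  rewrite !CPS_conv by assumption.
  rewrite CPS_dil by (now apply acv_ycoef2); reflexivity. }
unfold wf.
replace ((1 - Yf z) * Y2f z)%C with ((2 * Y2f z - (Y2f z * Yf z + Yf z * Y2f z)) / 2)%C
  by (field; exact C2_neq0).
rewrite E; field; exact C2_neq0.
Qed.

Lemma CPS_sqr_bound (a : nat -> R) (z : C) : (forall n, 0 <= a n) -> acv a (rho ^ 2) ->
  Cmod z <= rho -> Cmod (CPS a (z ^ 2)) <= PSeries a (rho ^ 2).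
Proof.
intros Ha H Hz; eapply Rle_trans; [apply CPS_Cmod_le with (r := rho ^ 2); [exact H|]|].
- rewrite Cmod_pow; apply pow_incr; split; [apply Cmod_ge_0|exact Hz].
- right; apply Series_ext; intros n; rewrite Rabs_pos_eq; auto.
Qed.

(** The two differential identities express [Y2f] as a bounded numerator over [w^3], because the
    series left in the numerator are evaluated at [z^2]; the lower bound on [|w|] then gives exactly
    the power in [gd]. *)
Lemma Y2f_bound : exists B n0, 0 < B /\ (0 < n0)%nat /\
  forall n t, (n0 <= n)%nat -> Rabs t <= PI * INR n ->
  / sqrt (INR n) ^ 3 * Cmod (Y2f (zc n t)) <= B * gd t.
Proof.
destruct circle_bounds as [c [K [n0 [c0 [K0 [n00 HC]]]]]].
pose proof rho_pos as R0; pose proof rho_lt1 as R1; pose proof rho_sqr as R2.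
pose proof s1_ge0 as S1; pose proof s2_ge0 as S2.
set (Q := (1 + s1) ^ 2 + 4 * (1 + 2 * s2)).
assert (Q0 : 0 < Q) by (unfold Q; nra).
set (sc0 := sqrt c); assert (sc1 : 0 < sc0) by (apply sqrt_lt_R0; lra).
exists (Q / sc0 ^ 3), n0.
split; [apply Rdiv_lt_0_compat; [exact Q0|now apply pow_lt]|split; [exact n00|]].
intros n t Hn Ht; destruct (HC n t Hn Ht) as [_ [C2 _]].
assert (n1 : 1 <= INR n) by (change 1 with (INR 1); apply le_INR; lia).
set (N := sqrt (INR n)) in *; assert (N1 : 1 <= N) by (unfold N; rewrite <- sqrt_1 at 1; apply sqrt_le_1_alt; lra).
assert (NN : N * N = INR n) by (apply sqrt_sqrt; lra).
assert (Hz : Cmod (zc n t) < rho) by (apply Cmod_zc_lt; lia).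
set (z := zc n t) in *.
assert (t0 := Rabs_pos t).
set (v := sqrt (1 + Rabs t)); assert (v1 : 1 <= v).
{ unfold v; rewrite <- sqrt_1 at 1; apply sqrt_le_1_alt; lra. }
assert (vv : v * v = 1 + Rabs t) by (apply sqrt_sqrt; lra).
set (W := Cmod (wf z)) in *; assert (W0 : 0 <= W) by apply Cmod_ge_0.
assert (W1 : sc0 * v / N <= W).
{ apply Rsqr_incr_0_var; [|exact W0]; unfold Rsqr.
  replace (sc0 * v / N * (sc0 * v / N)) with ((sc0 * sc0) * ((v * v) / (N * N))) by (field; lra).
  unfold sc0; rewrite sqrt_sqrt, vv, NN by lra; simpl in C2; lra. }
assert (Wp : 0 < sc0 * v / N) by (apply Rdiv_lt_0_compat; nra).
assert (W2 : W <= 2).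
{ unfold W, wf; eapply Rle_trans; [apply Cmod_triangle|]; rewrite Cmod_opp, Cmod_1.
  pose proof (Yf_Cmod_le1 z (Rlt_le _ _ Hz)); lra. }
assert (w0 : wf z <> 0) by (apply Cmod_gt_0; fold W; lra).
set (P1 := (z + Y1f (z ^ 2))%C); set (P2 := (z + 2 * Y2f (z ^ 2))%C).
assert (E : (Y2f z = (P1 * P1 + P2 * (wf z * wf z)) / (wf z * (wf z * wf z)))%C).
{ unfold P1; rewrite <- Y1f_eq by exact Hz.
  assert (E2 : P2 = (wf z * Y2f z - Y1f z * Y1f z)%C) by (rewrite Y2f_eq by exact Hz; unfold P2; ring).
  rewrite E2; field; exact w0. }
assert (HP1 : Cmod P1 <= 1 + s1).
{ unfold P1; eapply Rle_trans; [apply Cmod_triangle|]; apply Rplus_le_compat; [lra|].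
  apply CPS_sqr_bound; [apply ycoef1_ge0|apply acv_ycoef1; lra|lra]. }
assert (HP2 : Cmod P2 <= 1 + 2 * s2).
{ unfold P2; eapply Rle_trans; [apply Cmod_triangle|]; apply Rplus_le_compat; [lra|].
  rewrite Cmod_mult, Cmod_R, Rabs_pos_eq by lra; apply Rmult_le_compat_l; [lra|].
  apply CPS_sqr_bound; [apply ycoef2_ge0|apply acv_ycoef2; lra|lra]. }
assert (HY : Cmod (Y2f z) <= Q / W ^ 3).
{ rewrite E, Cmod_div, !Cmod_mult by (repeat apply Cmult_neq_0; exact w0); fold W.
  replace (W ^ 3) with (W * (W * W)) by ring.
  apply Rmult_le_compat_r; [left; apply Rinv_0_lt_compat; repeat apply Rmult_lt_0_compat; lra|].
  eapply Rle_trans; [apply Cmod_triangle|]; rewrite !Cmod_mult; fold W; unfold Q.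
  pose proof (Cmod_ge_0 P1); pose proof (Cmod_ge_0 P2).
  apply Rplus_le_compat; [nra|].
  replace (4 * (1 + 2 * s2)) with ((1 + 2 * s2) * 4) by ring.
  apply Rmult_le_compat; try nra; lra. }
assert (W3 : (sc0 * v / N) ^ 3 <= W ^ 3) by (apply pow_incr; lra).
assert (Wp3 : 0 < (sc0 * v / N) ^ 3) by (now apply pow_lt).
apply Rle_trans with (/ N ^ 3 * (Q / (sc0 * v / N) ^ 3)).
- apply Rmult_le_compat_l; [left; apply Rinv_0_lt_compat, pow_lt; lra|].
  eapply Rle_trans; [exact HY|]; apply Rmult_le_compat_l; [lra|]; now apply Rinv_le_contravar.
- right; unfold gd; fold v; field; repeat split; lra.
Qed.

(** Real part of the principal root of [s = 1 + i t], from [2 (Re sqrt s)^2 = |s| + Re s]. *)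
Definition rtp (t : R) : R := sqrt ((sqrt (1 + t ^ 2) + 1) / 2).

(* The square root of [1 + i t] with positive real part. *)
Definition rt (t : R) : C := (rtp t, t / (2 * rtp t)).

Lemma sqrt_1_sqr_ge (t : R) : 1 <= sqrt (1 + t ^ 2).
Proof. rewrite <- sqrt_1 at 1; apply sqrt_le_1_alt; pose proof (pow2_ge_0 t); lra. Qed.

Lemma rtp_sqr (t : R) : rtp t * rtp t = (sqrt (1 + t ^ 2) + 1) / 2.
Proof. apply sqrt_sqrt; pose proof (sqrt_1_sqr_ge t); lra. Qed.

Lemma rtp_ge1 (t : R) : 1 <= rtp t.
Proof.
unfold rtp; rewrite <- sqrt_1 at 1; apply sqrt_le_1_alt; pose proof (sqrt_1_sqr_ge t); lra.
Qed.

Lemma rt_sqr (t : R) : (rt t * rt t)%C = sc t.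
Proof.
pose proof (rtp_ge1 t) as H1; pose proof (rtp_sqr t) as H2.
assert (H3 : sqrt (1 + t ^ 2) * sqrt (1 + t ^ 2) = 1 + t ^ 2)
  by (apply sqrt_sqrt; pose proof (pow2_ge_0 t); lra).
unfold rt, sc, Cmult; simpl; f_equal.
- replace (t / (2 * rtp t) * (t / (2 * rtp t))) with (t ^ 2 / (4 * (rtp t * rtp t))) by (field; lra).
  rewrite H2; set (S := sqrt (1 + t ^ 2)) in *.
  assert (S1 : 1 <= S) by apply sqrt_1_sqr_ge.
  replace (t ^ 2) with (S * S - 1) by lra; field; lra.
- field; lra.
Qed.

Lemma rt_neq0 (t : R) : rt t <> 0.
Proof. intros H; apply (f_equal Re) in H; pose proof (rtp_ge1 t); simpl in H; lra. Qed.

Lemma Cmod_rt_sqr (t : R) : Cmod (rt t) * Cmod (rt t) = sqrt (1 + t ^ 2).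
Proof.
rewrite <- Cmod_mult, rt_sqr; unfold Cmod, sc; simpl; f_equal; ring.
Qed.

Lemma Cmod_rt_ge1 (t : R) : 1 <= Cmod (rt t).
Proof.
pose proof (Cmod_rt_sqr t); pose proof (sqrt_1_sqr_ge t); pose proof (Cmod_ge_0 (rt t)); nra.
Qed.

Lemma rtp_ge_half (t : R) : Cmod (rt t) / 2 <= rtp t.
Proof.
pose proof (Cmod_rt_sqr t); pose proof (rtp_sqr t); pose proof (rtp_ge1 t).
pose proof (sqrt_1_sqr_ge t); pose proof (Cmod_ge_0 (rt t)); nra.
Qed.

Lemma CPS_ycoef1_lip (u : C) (r : R) : 0 < r < rho -> Cmod u <= r ->
  r * Cmod (Y1f u - RtoC (PSeries ycoef1 r))%C <= PSeries ycoef2 r * Cmod (u - RtoC r)%C.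
Proof.
intros Hr Hu.
assert (Hp : forall n, r * Cmod (u ^ n - RtoC (r ^ n))%C <= INR n * r ^ n * Cmod (u - RtoC r)%C).
{ induction n.
  - simpl; replace (1 - 1)%C with (RtoC 0) by ring; rewrite Cmod_0; lra.
  - rewrite Cpow_S, S_INR; simpl (r ^ S n); rewrite RtoC_mult.
    replace (u * u ^ n - RtoC r * RtoC (r ^ n))%C with
      (u * (u ^ n - RtoC (r ^ n)) + RtoC (r ^ n) * (u - RtoC r))%C by ring.
    assert (0 <= r ^ n) by (apply pow_le; lra).
    eapply Rle_trans; [apply Rmult_le_compat_l; [lra|apply Cmod_triangle]|].
    rewrite !Cmod_mult, Cmod_R, (Rabs_pos_eq (r ^ n)) by assumption.
    assert (Cmod u * (r * Cmod (u ^ n - RtoC (r ^ n))%C) <=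
      r * (INR n * r ^ n * Cmod (u - RtoC r)%C)).
    { apply Rmult_le_compat; [apply Cmod_ge_0| |exact Hu|exact IHn].
      apply Rmult_le_pos; [lra|apply Cmod_ge_0]. }
    nra. }
assert (Hr' : Cmod (RtoC r) = r) by (rewrite Cmod_R, Rabs_pos_eq; lra).
pose proof (Cmod_ge_0 u) as u0.
pose proof (CPS_correct ycoef1 u ltac:(apply acv_ycoef1; lra)) as L1.
pose proof (CPS_correct ycoef1 (RtoC r) ltac:(rewrite Hr'; apply acv_ycoef1; lra)) as L2.
rewrite CPS_RtoC in L2.
apply (is_CS_scal (- (1))%C) in L2.
pose proof (is_CS_scal (RtoC r) _ _ (is_CS_plus _ _ _ _ L1 L2)) as L.
replace (r * Cmod (Y1f u - RtoC (PSeries ycoef1 r))%C)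
  with (Cmod (RtoC r * (CPS ycoef1 u + - (1) * RtoC (PSeries ycoef1 r)))%C).
2:{ rewrite Cmod_mult, Hr'; do 2 f_equal; unfold Y1f; ring. }
eapply is_CS_Cmod_le; [exact L| |].
- rewrite Rmult_comm.
  apply (is_series_scal (K := R_AbsRing) (V := R_NormedModule) (Cmod (u - RtoC r)%C)).
  apply Series_correct; eapply ex_series_ext; [|exact (acv_ycoef2 r ltac:(lra))].
  intros n; cbv beta; rewrite Rabs_pos_eq; [reflexivity|apply ycoef2_ge0].
- intros n; cbv beta; unfold pterm.
  replace (RtoC r * (RtoC (ycoef1 n) * u ^ n + - (1) * (RtoC (ycoef1 n) * RtoC r ^ n)))%C
    with (RtoC (ycoef1 n) * (RtoC r * (u ^ n - RtoC r ^ n)))%C by ring.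
  rewrite Cpow_RtoC, !Cmod_mult, Hr', Cmod_R, Rabs_pos_eq by apply ycoef1_ge0.
  unfold scal; simpl; unfold mult; simpl.
  eapply Rle_trans; [apply Rmult_le_compat_l; [apply ycoef1_ge0|apply Hp]|].
  right; unfold ycoef2; ring.
Qed.

Lemma mult_div_cancel (a b : R) : 0 < b -> b * (a / b) = a.
Proof. intros H; field; lra. Qed.

(** * Pointwise limits on the circle *)

Section CircleLimits.
Context {T : Type} (F : (T -> Prop) -> Prop) {FF : Filter F}.
Variables (n : T -> nat) (t : T -> R) (t0 : R).
Hypothesis Hn : forall M, F (fun i => M < INR (n i)).
Hypothesis Ht : Clim F (fun i => RtoC (t i)) (RtoC t0).

Lemma eventually_sqrt_gt (M : R) : F (fun i => M < sqrt (INR (n i))).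
Proof.
generalize (Hn (Rmax 0 M ^ 2)); apply filter_imp; intros i Hi.
apply Rle_lt_trans with (Rmax 0 M); [apply Rmax_r|].
rewrite <- (sqrt_pow2 (Rmax 0 M)) by apply Rmax_l; apply sqrt_lt_1_alt; split; [apply pow2_ge_0|exact Hi].
Qed.

Lemma eventually_pos : F (fun i => (0 < n i)%nat).
Proof. generalize (Hn 0); apply filter_imp; intros i Hi; apply INR_lt; exact Hi. Qed.

Lemma Clim_sc : Clim F (fun i => sc (t i)) (sc t0).
Proof.
assert (E : forall u, sc u = (1 + RtoC u * Ci)%C).
{ intros u; unfold sc, RtoC, Ci, Cplus, Cmult; simpl; f_equal; ring. }
rewrite E; eapply (Clim_ext F); [intros i; symmetry; apply E|].
apply Clim_plus; [exact FF|apply Clim_const; exact FF|].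
apply Clim_mult; [exact FF|exact Ht|apply Clim_const; exact FF].
Qed.

Lemma Clim_inv_n : Clim F (fun i => / RtoC (INR (n i)))%C 0.
Proof. exact (Clim_inv_N F (fun i => INR (n i)) Hn). Qed.

Lemma Clim_sc_n : Clim F (fun i => - (sc (t i) / RtoC (INR (n i))))%C 0.
Proof.
replace (RtoC 0) with (- (sc t0 * 0))%C by ring.
apply Clim_opp; [exact FF|]; apply Clim_mult; [exact FF|exact Clim_sc|exact Clim_inv_n].
Qed.

Lemma Clim_zc : Clim F (fun i => zc (n i) (t i)) (RtoC rho).
Proof.
replace (RtoC rho) with (RtoC rho * cexp 0)%C by (rewrite cexp_0; ring).
apply Clim_mult; [exact FF|apply Clim_const; exact FF|].
apply Clim_cexp; [exact FF|exact Clim_sc_n].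
Qed.

Lemma Clim_n_delta : Clim F (fun i => RtoC (INR (n i)) * (1 - zc (n i) (t i) / RtoC rho))%C (sc t0).
Proof.
set (u := fun i => (- (sc (t i) / RtoC (INR (n i))))%C).
apply Clim_dist with (fun i => sc (t i)); [exact FF| |exact Clim_sc].
assert (B0 : 0 <= Cmod (sc t0)) by apply Cmod_ge_0.
set (B := Cmod (sc t0) + 1).
apply Clim_0_le with (fun i => (5 * B * exp 1) * Cmod (u i)); [exact FF| |].
- assert (H1 : F (fun i => Cmod (u i) < 1)).
  { apply Clim_Cmod_lt with (RtoC 0); [exact FF|exact Clim_sc_n|rewrite Cmod_0; lra]. }
  assert (H2 : F (fun i => Cmod (sc (t i)) < B)).
  { apply Clim_Cmod_lt with (sc t0); [exact FF|exact Clim_sc|unfold B; lra]. }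
  generalize (filter_and _ _ (filter_and _ _ H1 H2) (Hn 0)); apply filter_imp.
  intros i [[K1 K2] K3].
  assert (n0 := RtoC_neq0 _ K3).
  assert (E : (RtoC (INR (n i)) * (1 - zc (n i) (t i) / RtoC rho) - sc (t i))%C =
    (- (RtoC (INR (n i)) * (cexp (u i) - 1 - u i)))%C).
  { unfold zc; fold (u i); replace (RtoC rho * cexp (u i) / RtoC rho)%C with (cexp (u i))
      by (field; exact RtoC_rho_neq0).
    unfold u at 3; field; exact n0. }
  rewrite E, Cmod_opp, Cmod_mult, Cmod_R, Rabs_pos_eq by lra.
  pose proof (cexp_taylor2 (u i)) as H.
  assert (Hex : exp (Rabs (Re (u i))) <= exp 1).
  { left; apply exp_increasing; eapply Rle_lt_trans; [apply re_le_Cmod|exact K1]. }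
  pose proof (Cmod_ge_0 (u i)) as u0.
  assert (Eu : INR (n i) * Cmod (u i) = Cmod (sc (t i))).
  { unfold u; rewrite Cmod_opp, Cmod_div, Cmod_R, Rabs_pos_eq by (try exact n0; lra); field; lra. }
  apply Rle_trans with (INR (n i) * (5 * Cmod (u i) ^ 2 * exp 1)).
  + apply Rmult_le_compat_l; [lra|]; eapply Rle_trans; [exact H|].
    apply Rmult_le_compat_l; [pose proof (pow2_ge_0 (Cmod (u i))); lra|exact Hex].
  + replace (INR (n i) * (5 * Cmod (u i) ^ 2 * exp 1)) with
      (5 * (INR (n i) * Cmod (u i)) * exp 1 * Cmod (u i)) by ring.
    rewrite Eu; apply Rmult_le_compat_r; [exact u0|]; pose proof (exp_pos 1); nra.
- intros eps He; pose proof (exp_pos 1).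
  assert (P : 0 < 5 * B * exp 1) by (unfold B; apply Rmult_lt_0_compat; lra).
  assert (P2 : 0 < eps / (5 * B * exp 1)) by (now apply Rdiv_lt_0_compat).
  generalize (Clim_sc_n _ P2); apply filter_imp; intros i Hi.
  change (- (sc (t i) / RtoC (INR (n i))))%C with (u i) in Hi.
  replace (u i - 0)%C with (u i) in Hi by ring.
  rewrite <- (mult_div_cancel eps _ P).
  apply Rmult_lt_compat_l; [exact P|exact Hi].
Qed.

Lemma Clim_n_wf_sqr : Clim F
  (fun i => RtoC (INR (n i)) * (wf (zc (n i) (t i)) * wf (zc (n i) (t i))))%C
  (RtoC (lambda ^ 2) * sc t0)%C.
Proof.
apply Clim_dist with
  (fun i => RtoC (lambda ^ 2) * (RtoC (INR (n i)) * (1 - zc (n i) (t i) / RtoC rho)))%C; [exact FF| |].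
2:{ apply Clim_mult; [exact FF|apply Clim_const; exact FF|exact Clim_n_delta]. }
set (B := Cmod (sc t0) + 1).
assert (B1 : 1 <= B) by (unfold B; pose proof (Cmod_ge_0 (sc t0)); lra).
pose proof s2_ge0 as S0.
apply Clim_0_le with (fun i => (4 * (s2 + 1) * B ^ 2) / INR (n i)); [exact FF| |].
- assert (H1 : F (fun i => Cmod (RtoC (INR (n i)) * (1 - zc (n i) (t i) / RtoC rho))%C < B)).
  { apply Clim_Cmod_lt with (sc t0); [exact FF|exact Clim_n_delta|unfold B; lra]. }
  generalize (filter_and _ _ H1 (filter_and _ _ eventually_pos (Hn 0))); apply filter_imp.
  intros i [K1 [K2 K3]].
  rewrite Cmod_mult, Cmod_R, Rabs_pos_eq in K1 by lra.
  change (Cmod (1 - zc (n i) (t i) / RtoC rho)%C) with (delta (zc (n i) (t i))) in K1.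
  pose proof (wf_sqr_expansion (zc (n i) (t i)) (Rlt_le _ _ (proj2 (Cmod_zc_lt _ (t i) K2)))) as H.
  set (z := zc (n i) (t i)) in *; set (m := INR (n i)) in *.
  replace (RtoC m * (wf z * wf z) - RtoC (lambda ^ 2) * (RtoC m * (1 - z / RtoC rho)))%C
    with (RtoC m * (wf z * wf z - RtoC (lambda ^ 2) * (1 - z / RtoC rho)))%C by ring.
  rewrite Cmod_mult, Cmod_R, Rabs_pos_eq by lra.
  assert (D0 : 0 <= delta z) by apply Cmod_ge_0.
  apply Rmult_le_reg_r with m; [exact K3|].
  unfold Rdiv; rewrite (Rmult_assoc _ (/ m)), Rinv_l, Rmult_1_r by lra.
  apply Rle_trans with (m * (4 * s2 * delta z ^ 2) * m).
  + apply Rmult_le_compat_r; [lra|]; apply Rmult_le_compat_l; lra.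
  + replace (m * (4 * s2 * delta z ^ 2) * m) with (4 * s2 * (m * delta z) ^ 2) by ring.
    assert ((m * delta z) ^ 2 <= B ^ 2) by (apply pow_incr; nra).
    pose proof (pow2_ge_0 (m * delta z)). apply Rmult_le_compat; lra.
- intros eps He; apply small_over_N; [exact FF|exact Hn| |exact He].
  assert (0 < B ^ 2) by nra. apply Rmult_lt_0_compat; lra.
Qed.

Definition kapf (u : R) : C := (RtoC lambda * rt u)%C.

Lemma Re_kapf_pos (u : R) : 0 < Re (kapf u).
Proof.
unfold kapf; rewrite re_scal_l; apply Rmult_lt_0_compat; [apply lambda_pos|].
pose proof (rtp_ge1 u); simpl; lra.
Qed.

Lemma kapf_sqr (u : R) : (kapf u * kapf u = RtoC (lambda ^ 2) * sc u)%C.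
Proof.
unfold kapf; rewrite <- rt_sqr; simpl (lambda ^ 2); rewrite !RtoC_mult; ring.
Qed.

(** The squares converge by [Clim_n_wf_sqr]. Since [q + k] has real part at least [Re k > 0], no
    sign ambiguity is left: [|q - k| <= |q^2 - k^2| / Re k]. *)
Lemma Clim_sqrt_n_wf : Clim F
  (fun i => RtoC (sqrt (INR (n i))) * wf (zc (n i) (t i)))%C (kapf t0).
Proof.
set (q := fun i => (RtoC (sqrt (INR (n i))) * wf (zc (n i) (t i)))%C).
pose proof (Re_kapf_pos t0) as K0; set (k := kapf t0) in *.
apply Clim_dist with (fun _ => k); [exact FF| |apply Clim_const; exact FF].
assert (H1 : Clim F (fun i => q i * q i - k * k)%C 0).
{ replace (RtoC 0) with (k * k - k * k)%C by ring.
  apply Clim_minus; [exact FF| |apply Clim_const; exact FF].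
  unfold k; rewrite kapf_sqr; eapply Clim_ext_loc; [exact FF| |exact Clim_n_wf_sqr].
  generalize (Hn 0); apply filter_imp; intros i Hi; unfold q; cbv beta.
  rewrite <- (sqrt_sqrt (INR (n i))) at 1 by lra; rewrite RtoC_mult; ring. }
apply Clim_0_le with (fun i => / Re k * Cmod (q i * q i - k * k)%C); [exact FF| |].
- generalize (filter_and _ _ eventually_pos (Hn 0)); apply filter_imp; intros i [Hp Hi].
  replace (q i * q i - k * k)%C with ((q i - k) * (q i + k))%C by ring; rewrite Cmod_mult.
  assert (H2 : Re k <= Cmod (q i + k)%C).
  { eapply Rle_trans; [|eapply Rle_trans; [apply Rle_abs|apply re_le_Cmod]].
    rewrite re_plus; enough (0 <= Re (q i)) by lra.
    unfold q; rewrite re_scal_l; apply Rmult_le_pos; [apply sqrt_pos|].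
    apply Re_wf_ge0; left; now apply Cmod_zc_lt. }
  apply Rmult_le_reg_l with (Re k); [exact K0|].
  rewrite <- Rmult_assoc, Rinv_r, Rmult_1_l by lra.
  pose proof (Cmod_ge_0 (q i - k)%C); nra.
- intros eps He; assert (P : 0 < eps * Re k) by nra.
  generalize (H1 _ P); apply filter_imp; intros i Hi.
  replace (q i * q i - k * k - 0)%C with (q i * q i - k * k)%C in Hi by ring.
  apply Rmult_lt_reg_l with (Re k); [exact K0|].
  rewrite <- Rmult_assoc, Rinv_r, Rmult_1_l by lra; lra.
Qed.

Lemma Clim_height (h : T -> nat) (x : R) : 0 < x ->
  Clim F (fun i => RtoC (INR (h i) / sqrt (INR (n i)))) (RtoC x) ->
  Clim F (fun i => RtoC (INR (n i)) * (Ef (h i) (zc (n i) (t i)) - Ef (S (h i)) (zc (n i) (t i))))%C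
    (2 * (kapf t0 * kapf t0) * cexp (kapf t0 * RtoC x) /
      ((cexp (kapf t0 * RtoC x) - 1) * (cexp (kapf t0 * RtoC x) - 1)))%C.
Proof.
intros Hx Hh.
assert (Hz : F (fun i => Cmod (zc (n i) (t i)) <= rho)).
{ generalize eventually_pos; apply filter_imp; intros i Hi; left; now apply Cmod_zc_lt. }
pose proof (inner_limit F (fun i => sqrt (INR (n i))) h (fun i => zc (n i) (t i)) (kapf t0) x
  (Re_kapf_pos t0) Hx eventually_sqrt_gt Hz Clim_zc Clim_sqrt_n_wf Hh) as H.
eapply Clim_ext_loc; [exact FF| |exact H].
generalize (Hn 0); apply filter_imp; intros i Hi; cbv beta.
rewrite pow2_sqrt by lra; reflexivity.
Qed.

(** By [Y1f_eq] and [Y2f_eq], [Y2f] is [P1^2 / w^3 + P2 / w], where [P1 = z + Y1f (z^2)] tends to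
    [rho + s1 = lambda^2 / 2] and [P2 = z + 2 Y2f (z^2)] is bounded; with [kappa = lambda rt] the
    first term gives [(lambda^2 / 2)^2 / kappa^3 = (lambda / 4) / rt^3]. *)
Lemma Clim_Y2f : Clim F
  (fun i => RtoC (/ sqrt (INR (n i)) ^ 3) * Y2f (zc (n i) (t i)))%C
  (RtoC (lambda / 4) * / (rt t0 * (rt t0 * rt t0)))%C.
Proof.
pose proof rho_pos as R0; pose proof rho_lt1 as R1; pose proof rho_sqr as R2.
pose proof s1_ge0 as S1; pose proof s2_ge0 as S2; pose proof lambda_pos as L0.
set (z := fun i => zc (n i) (t i)).
set (q := fun i => (RtoC (sqrt (INR (n i))) * wf (z i))%C).
assert (Hz : F (fun i => Cmod (z i) < rho)).
{ generalize eventually_pos; apply filter_imp; intros i Hi; now apply Cmod_zc_lt. }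
assert (P1 : Clim F (fun i => z i + Y1f (z i ^ 2))%C (RtoC (lambda ^ 2 / 2))).
{ replace (RtoC (lambda ^ 2 / 2)) with (RtoC rho + RtoC s1)%C
    by (rewrite <- RtoC_plus, lambda_sqr; f_equal; field).
  apply Clim_plus; [exact FF|exact Clim_zc|].
  assert (Z2 : Clim F (fun i => z i ^ 2 - RtoC (rho ^ 2))%C 0).
  { replace (RtoC 0) with (RtoC rho * (RtoC rho * 1) - RtoC (rho ^ 2))%C
      by (simpl; rewrite !RtoC_mult; ring).
    apply Clim_minus; [exact FF| |apply Clim_const; exact FF]; simpl.
    apply Clim_mult; [exact FF|exact Clim_zc|].
    apply Clim_mult; [exact FF|exact Clim_zc|apply Clim_const; exact FF]. }
  apply Clim_dist with (fun _ => RtoC s1); [exact FF| |apply Clim_const; exact FF].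
  apply Clim_0_le with (fun i => (/ rho ^ 2 * (s2 + 1)) * Cmod (z i ^ 2 - RtoC (rho ^ 2))%C); [exact FF| |].
  - generalize Hz; apply filter_imp; intros i Hi.
    assert (Hz2 : Cmod (z i ^ 2)%C <= rho ^ 2).
    { rewrite Cmod_pow; apply pow_incr; split; [apply Cmod_ge_0|lra]. }
    pose proof (CPS_ycoef1_lip (z i ^ 2)%C (rho ^ 2) ltac:(lra) Hz2) as H.
    fold s1 s2 in H; pose proof (Cmod_ge_0 (z i ^ 2 - RtoC (rho ^ 2))%C).
    apply Rmult_le_reg_l with (rho ^ 2); [lra|].
    rewrite <- !Rmult_assoc, Rinv_r, Rmult_1_l by lra. nra.
  - intros eps He.
    assert (P : 0 < / rho ^ 2 * (s2 + 1)) by (apply Rmult_lt_0_compat; [apply Rinv_0_lt_compat|]; lra).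
    assert (P' : 0 < eps / (/ rho ^ 2 * (s2 + 1))) by (now apply Rdiv_lt_0_compat).
    generalize (Z2 _ P'); apply filter_imp; intros i Hi.
    replace (z i ^ 2 - RtoC (rho ^ 2) - 0)%C with (z i ^ 2 - RtoC (rho ^ 2))%C in Hi by ring.
    rewrite <- (mult_div_cancel eps _ P).
    now apply Rmult_lt_compat_l. }
assert (P2 : Clim F (fun i => / RtoC (INR (n i)) * (z i + 2 * Y2f (z i ^ 2)))%C 0).
{ apply Clim_0_le with (fun i => (1 + 2 * s2) / INR (n i)); [exact FF| |].
  - generalize (filter_and _ _ Hz (Hn 0)); apply filter_imp; intros i [K1 K2].
    rewrite Cmod_mult, Cmod_inv, Cmod_R, Rabs_pos_eq by (try (now apply RtoC_neq0); lra).
    rewrite Rmult_comm; apply Rmult_le_compat_r; [left; now apply Rinv_0_lt_compat|].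
    eapply Rle_trans; [apply Cmod_triangle|]; apply Rplus_le_compat; [lra|].
    rewrite Cmod_mult, Cmod_R, Rabs_pos_eq by lra; apply Rmult_le_compat_l; [lra|].
    apply CPS_sqr_bound; [apply ycoef2_ge0|apply acv_ycoef2; lra|lra].
  - intros eps He; apply small_over_N; [exact FF|exact Hn|lra|exact He]. }
pose proof Clim_sqrt_n_wf as Q; fold (z) in Q.
set (k := kapf t0) in *.
assert (k0 : k <> 0).
{ intros H; pose proof (Re_kapf_pos t0) as H1; fold k in H1; rewrite H in H1; simpl in H1; lra. }
assert (r0 := rt_neq0 t0).
replace (RtoC (lambda / 4) * / (rt t0 * (rt t0 * rt t0)))%C with
  (RtoC (lambda ^ 2 / 2) * RtoC (lambda ^ 2 / 2) / (k * (k * k)) + 0 / k)%C.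
2:{ unfold k, kapf; simpl (lambda ^ 2).
    assert (l0 : RtoC lambda <> 0) by (now apply RtoC_neq0).
    rewrite !RtoC_div, !RtoC_mult by lra; field; repeat split; auto; intros E; apply RtoC_inj in E; lra. }
assert (Qw : F (fun i => 0 < Cmod (RtoC (sqrt (INR (n i))) * wf (zc (n i) (t i)))%C)).
{ apply Clim_Cmod_gt with k; [exact FF|exact Q|now apply Cmod_gt_0]. }
eapply Clim_ext_loc; [exact FF| |].
2:{ apply Clim_plus; [exact FF| |].
    - apply Clim_div; [exact FF|exact (Cmult_neq_0 _ _ k0 (Cmult_neq_0 _ _ k0 k0))| |].
      + apply Clim_mult; [exact FF|exact P1|exact P1].
      + apply Clim_mult; [exact FF|exact Q|apply Clim_mult; [exact FF|exact Q|exact Q]].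
    - apply Clim_div; [exact FF|exact k0|exact P2|exact Q]. }
generalize (filter_and _ _ Qw (filter_and _ _ Hz (Hn 0))); apply filter_imp; intros i [K1 [K2 K3]].
cbv beta; unfold z in *; set (u := zc (n i) (t i)) in *.
assert (w0 : wf u <> 0) by (intros H; rewrite H, Cmult_0_r, Cmod_0 in K1; lra).
assert (sn : 0 < sqrt (INR (n i))) by (now apply sqrt_lt_R0).
set (N := sqrt (INR (n i))) in *.
assert (NN : INR (n i) = N * N) by (symmetry; apply sqrt_sqrt; lra).
assert (N0 := RtoC_neq0 _ sn).
rewrite NN, <- Y1f_eq by exact K2.
assert (E : (u + 2 * Y2f (u ^ 2) = wf u * Y2f u - Y1f u * Y1f u)%C).
{ rewrite Y2f_eq by exact K2; ring. }
rewrite E; rewrite RtoC_inv by (assert (0 < N ^ 3) by (now apply pow_lt); lra).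
simpl (N ^ 3); rewrite !RtoC_mult; field; auto.
Qed.

End CircleLimits.

(** * Dominated integrals over the line *)

Lemma is_RInt_gd (M A : R) : 0 <= M <= A ->
  is_RInt gd M A (2 / sqrt (1 + M) - 2 / sqrt (1 + A)).
Proof.
intros H.
apply is_RInt_ext with (fun t => / sqrt (1 + t) ^ 3).
{ intros t Ht; rewrite Rmin_left in Ht by lra; unfold gd; rewrite (Rabs_pos_eq t) by lra; reflexivity. }
assert (P : is_RInt (fun t => / sqrt (1 + t) ^ 3) M A
  (minus ((fun t => - 2 / sqrt (1 + t)) A) ((fun t => - 2 / sqrt (1 + t)) M))).
2:{ replace (2 / sqrt (1 + M) - 2 / sqrt (1 + A)) with (- 2 / sqrt (1 + A) - - 2 / sqrt (1 + M))
      by (unfold Rdiv; ring); exact P. }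
apply (is_RInt_derive (V := R_CompleteNormedModule) (fun t => - 2 / sqrt (1 + t)));
  intros t Ht; rewrite Rmin_left, Rmax_right in Ht by lra;
  assert (s0 : 0 < sqrt (1 + t)) by (apply sqrt_lt_R0; lra).
- auto_derive; [repeat split; try lra|].
  field; lra.
- apply (ex_derive_continuous (V := R_NormedModule)); auto_derive; repeat split; try lra.
  assert (0 < sqrt (1 + t) * (sqrt (1 + t) * (sqrt (1 + t) * 1)))
    by (repeat apply Rmult_lt_0_compat; lra); lra.
Qed.

Lemma tail_bound (f : R -> R) (B M A : R) : 0 <= M <= A -> 0 <= B -> ex_RInt f M A ->
  (forall t, M <= t <= A -> Rabs (f t) <= B * gd t) -> Rabs (RInt f M A) <= 2 * B / sqrt (1 + M).
Proof.
intros H HB [l Hl] Hf; rewrite (is_RInt_unique _ _ _ _ Hl).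
assert (sM : 0 < sqrt (1 + M)) by (apply sqrt_lt_R0; lra).
assert (sA : 0 < sqrt (1 + A)) by (apply sqrt_lt_R0; lra).
pose proof (norm_RInt_le (V := R_NormedModule) f (fun t => B * gd t) M A l
  (B * (2 / sqrt (1 + M) - 2 / sqrt (1 + A))) (proj2 H) Hf Hl
  (is_RInt_scal (V := R_NormedModule) gd M A B _ (is_RInt_gd M A H))) as P.
change (norm l) with (Rabs l) in P.
assert (0 < / sqrt (1 + A)) by (now apply Rinv_0_lt_compat).
unfold Rdiv in *; nra.
Qed.

Lemma gd_opp (t : R) : gd (- t) = gd t.
Proof. unfold gd; now rewrite Rabs_Ropp. Qed.

Lemma tail_bound_neg (f : R -> R) (B M A : R) : 0 <= M <= A -> 0 <= B -> ex_RInt f (- A) (- M) ->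
  (forall t, M <= t <= A -> Rabs (f (- t)) <= B * gd t) ->
  Rabs (RInt f (- A) (- M)) <= 2 * B / sqrt (1 + M).
Proof.
intros H HB Hl Hf.
assert (E : is_RInt (fun t => f (- t)) M A (RInt f (- A) (- M))).
{ apply ex_RInt_swap in Hl; pose proof (RInt_correct _ _ _ Hl) as P.
  apply (is_RInt_comp_opp (V := R_NormedModule)) in P.
  replace (RInt f (- A) (- M)) with (opp (RInt f (- M) (- A))) by (rewrite opp_RInt_swap; auto).
  apply (is_RInt_opp (V := R_NormedModule)) in P.
  eapply is_RInt_ext; [|exact P]; intros t _; cbv beta; apply opp_opp. }
rewrite <- (is_RInt_unique _ _ _ _ E); apply (tail_bound _ B M A); auto.
now exists (RInt f (- A) (- M)).
Qed.

(** Domination by a multiple of the fixed function [gd] bounds the tails beyond [M] by a constant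
    times [B / sqrt (1 + M)], uniformly in the function. *)
Definition dom (B : R) (f : R -> R) : Prop :=
  0 <= B /\ (forall t, continuous f t) /\ forall t, Rabs (f t) <= B * gd t.

(** Integral over the line as a limit over symmetric integer intervals. The definition is total; it
    is meaningful for functions satisfying [dom]. *)
Definition IntR (f : R -> R) : R := real (Lim_seq (fun k => RInt f (- INR k) (INR k))).

Lemma dom_ex_RInt (B : R) (f : R -> R) (a b : R) : dom B f -> ex_RInt f a b.
Proof. intros [_ [H _]]; apply (ex_RInt_continuous (V := R_CompleteNormedModule)); auto. Qed.

Lemma RInt_split3 (f : R -> R) (M A : R) : 0 <= M <= A -> ex_RInt f (- A) A ->
  ex_RInt f (- A) (- M) /\ ex_RInt f (- M) M /\ ex_RInt f M A /\
  RInt f (- A) A = RInt f (- A) (- M) + RInt f (- M) M + RInt f M A.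
Proof.
intros H Hf.
assert (H1 : ex_RInt f (- A) M) by (apply (ex_RInt_Chasles_1 (V := R_CompleteNormedModule)) with A; [lra|exact Hf]).
assert (H2 : ex_RInt f M A) by (apply (ex_RInt_Chasles_2 (V := R_CompleteNormedModule)) with (- A); [lra|exact Hf]).
assert (H3 : ex_RInt f (- A) (- M)) by (apply (ex_RInt_Chasles_1 (V := R_CompleteNormedModule)) with M; [lra|exact H1]).
assert (H4 : ex_RInt f (- M) M) by (apply (ex_RInt_Chasles_2 (V := R_CompleteNormedModule)) with (- A); [lra|exact H1]).
repeat split; auto.
rewrite <- (RInt_Chasles f (- A) M A) by auto; rewrite <- (RInt_Chasles f (- A) (- M) M) by auto.
reflexivity.
Qed.

Lemma RInt_tails (f : R -> R) (B M A : R) : 0 <= M <= A -> 0 <= B -> ex_RInt f (- A) A ->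
  (forall t, Rabs t <= A -> Rabs (f t) <= B * gd t) ->
  Rabs (RInt f (- A) A - RInt f (- M) M) <= 4 * B / sqrt (1 + M).
Proof.
intros H HB Hf Hb; destruct (RInt_split3 f M A H Hf) as [H1 [H2 [H3 E]]]; rewrite E.
assert (T1 : Rabs (RInt f M A) <= 2 * B / sqrt (1 + M)).
{ apply tail_bound with (A := A); auto; intros t Ht; apply Hb; rewrite Rabs_pos_eq; lra. }
assert (T2 : Rabs (RInt f (- A) (- M)) <= 2 * B / sqrt (1 + M)).
{ apply tail_bound_neg with (A := A); auto; intros t Ht; rewrite <- gd_opp; apply Hb.
  rewrite Rabs_Ropp, Rabs_pos_eq; lra. }
replace (RInt f (- A) (- M) + RInt f (- M) M + RInt f M A - RInt f (- M) M)
  with (RInt f (- A) (- M) + RInt f M A) by ring.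
eapply Rle_trans; [apply Rabs_triang|]; unfold Rdiv in *; lra.
Qed.

Lemma inv_sqrt_small (B eps : R) : 0 <= B -> 0 < eps ->
  exists M0, 0 <= M0 /\ forall M, M0 <= M -> B / sqrt (1 + M) < eps.
Proof.
intros HB He; exists ((B / eps) ^ 2); split; [apply pow2_ge_0|].
intros M HM.
assert (P : 0 <= B / eps) by (apply Rdiv_le_0_compat; lra).
assert (S1 : B / eps < sqrt (1 + M)).
{ rewrite <- (sqrt_pow2 (B / eps)) by exact P; apply sqrt_lt_1_alt.
  split; [apply pow2_ge_0|lra]. }
apply Rmult_lt_reg_r with (sqrt (1 + M)); [lra|].
unfold Rdiv; rewrite Rmult_assoc, Rinv_l, Rmult_1_r by lra.
rewrite <- (mult_div_cancel B eps He); apply Rmult_lt_compat_l; assumption.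
Qed.

Lemma IntR_lim (B : R) (f : R -> R) : dom B f ->
  is_lim_seq (fun k => RInt f (- INR k) (INR k)) (IntR f).
Proof.
intros D; pose proof D as [HB [Hc Hb]].
apply Lim_seq_correct', ex_lim_seq_cauchy_corr; intros eps.
destruct (inv_sqrt_small (4 * B) eps ltac:(lra) (cond_pos eps)) as [M0 [HM0 HM]].
destruct (INR_unbounded M0) as [N HN]; exists N.
assert (W : forall n m, (N <= n)%nat -> (n <= m)%nat ->
  Rabs (RInt f (- INR m) (INR m) - RInt f (- INR n) (INR n)) < eps).
{ intros n m Hn Hm; eapply Rle_lt_trans; [apply RInt_tails with (B := B)|].
  - split; [apply pos_INR|now apply le_INR].
  - exact HB.
  - now apply dom_ex_RInt with B.
  - intros t _; apply Hb.
  - apply HM; apply le_INR in Hn; lra. }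
intros n m Hn Hm; destruct (le_ge_dec n m).
- rewrite Rabs_minus_sym; now apply W.
- now apply W.
Qed.

Lemma IntR_approx (B : R) (f : R -> R) (A : R) : dom B f -> 0 <= A ->
  Rabs (RInt f (- A) A - IntR f) <= 4 * B / sqrt (1 + A).
Proof.
intros D HA; pose proof D as [HB [Hc Hb]].
pose proof (IntR_lim B f D) as L.
assert (L2 : is_lim_seq (fun k => Rabs (RInt f (- A) A - RInt f (- INR k) (INR k)))
  (Rabs (RInt f (- A) A - IntR f))).
{ apply is_lim_seq_continuous with (f := Rabs) (l := RInt f (- A) A - IntR f);
    [apply Rcontinuity_abs|]. apply is_lim_seq_minus'; [apply is_lim_seq_const|exact L]. }
destruct (INR_unbounded A) as [N HN].
apply (is_lim_seq_le_loc _ (fun _ => 4 * B / sqrt (1 + A)) _ (4 * B / sqrt (1 + A))) with (2 := L2);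
  [|apply is_lim_seq_const].
exists N; intros n Hn; rewrite Rabs_minus_sym; apply RInt_tails; auto.
- split; [exact HA|]; apply le_INR in Hn; lra.
- now apply dom_ex_RInt with B.
Qed.

Lemma RInt_close (f g : R -> R) (M eps : R) : 0 <= M -> ex_RInt f (- M) M -> ex_RInt g (- M) M ->
  (forall t, Rabs t <= M -> Rabs (f t - g t) <= eps) ->
  Rabs (RInt f (- M) M - RInt g (- M) M) <= 2 * M * eps.
Proof.
intros HM Hf Hg H.
pose proof (norm_RInt_le_const (V := R_NormedModule) (fun t => f t - g t) (- M) M
  (RInt f (- M) M - RInt g (- M) M) eps ltac:(lra)) as P.
replace (2 * M * eps) with ((M - - M) * eps) by ring; apply P.
- intros t Ht; apply H; apply Rabs_le; lra.
- apply (is_RInt_minus (V := R_NormedModule)); apply (RInt_correct (V := R_CompleteNormedModule)); assumption.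
Qed.

(** Quantitative dominated convergence: [f] is integrated over [[-A, A]] and [g] over the line,
    closeness is used on [[-M, M]] only, and [gd] pays for both tails. *)
Lemma int_close (f g : R -> R) (B A M eps : R) : dom B g -> 0 <= M <= A -> ex_RInt f (- A) A ->
  (forall t, Rabs t <= A -> Rabs (f t) <= B * gd t) ->
  (forall t, Rabs t <= M -> Rabs (f t - g t) <= eps) ->
  Rabs (RInt f (- A) A - IntR g) <= 2 * M * eps + 8 * B / sqrt (1 + M).
Proof.
intros D HM Hf Hb Hc; pose proof D as [HB _].
pose proof (RInt_tails f B M A HM HB Hf Hb) as T1.
pose proof (IntR_approx B g M D (proj1 HM)) as T2.
destruct (RInt_split3 f M A HM Hf) as [_ [Hf2 _]].
pose proof (RInt_close f g M eps (proj1 HM) Hf2 (dom_ex_RInt B g _ _ D) Hc) as T3.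
replace (RInt f (- A) A - IntR g) with ((RInt f (- A) A - RInt f (- M) M)
  + ((RInt f (- M) M - RInt g (- M) M) + (RInt g (- M) M - IntR g))) by ring.
eapply Rle_trans; [apply Rabs_triang|].
eapply Rle_trans; [apply Rplus_le_compat_l, Rabs_triang|].
replace (8 * B / sqrt (1 + M)) with (4 * B / sqrt (1 + M) + 4 * B / sqrt (1 + M)) by (unfold Rdiv; ring).
lra.
Qed.

Lemma IntR_unique (B : R) (f : R -> R) (l : R) : dom B f ->
  is_lim_seq (fun k => RInt f (- INR k) (INR k)) l -> IntR f = l.
Proof. intros D H; unfold IntR; now rewrite (is_lim_seq_unique _ _ H). Qed.

Lemma IntR_bound (B : R) (f : R -> R) : dom B f -> Rabs (IntR f) <= 4 * B.
Proof.
intros D; pose proof (IntR_approx B f 0 D ltac:(lra)) as H.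
rewrite Ropp_0, RInt_point in H; change zero with 0 in H.
rewrite Rplus_0_r, sqrt_1 in H; unfold Rminus in H; rewrite Rplus_0_l, Rabs_Ropp in H; lra.
Qed.

Lemma dom_plus (B1 B2 : R) (f g : R -> R) : dom B1 f -> dom B2 g -> dom (B1 + B2) (fun t => f t + g t).
Proof.
intros [a1 [a2 a3]] [b1 [b2 b3]]; split; [lra|split].
- intros t; apply (continuous_plus (V := R_NormedModule)); auto.
- intros t; eapply Rle_trans; [apply Rabs_triang|]; specialize (a3 t); specialize (b3 t); lra.
Qed.

Lemma dom_scal (k B : R) (f : R -> R) : dom B f -> dom (Rabs k * B) (fun t => k * f t).
Proof.
intros [a1 [a2 a3]]; split; [pose proof (Rabs_pos k); nra|split].
- intros t; apply (continuous_scal_r (V := R_NormedModule)); auto.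
- intros t; rewrite Rabs_mult, Rmult_assoc; apply Rmult_le_compat_l; [apply Rabs_pos|auto].
Qed.

Lemma dom_ext (B : R) (f g : R -> R) : (forall t, f t = g t) -> dom B f -> dom B g.
Proof.
intros E [a1 [a2 a3]]; split; [exact a1|split].
- intros t; apply continuous_ext with f; auto.
- intros t; rewrite <- E; auto.
Qed.

Lemma IntR_ext (f g : R -> R) : (forall t, f t = g t) -> IntR f = IntR g.
Proof.
intros E; unfold IntR; f_equal; apply Lim_seq_ext; intros k; apply RInt_ext; intros; apply E.
Qed.

Lemma IntR_plus (B1 B2 : R) (f g : R -> R) : dom B1 f -> dom B2 g ->
  IntR (fun t => f t + g t) = IntR f + IntR g.
Proof.
intros D1 D2; apply (IntR_unique _ _ _ (dom_plus _ _ _ _ D1 D2)).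
eapply is_lim_seq_ext; [|apply (is_lim_seq_plus' _ _ _ _ (IntR_lim _ _ D1) (IntR_lim _ _ D2))].
intros k; cbv beta; symmetry; apply (RInt_plus (V := R_CompleteNormedModule));
  [now apply dom_ex_RInt with B1|now apply dom_ex_RInt with B2].
Qed.

Lemma IntR_scal (k B : R) (f : R -> R) : dom B f -> IntR (fun t => k * f t) = k * IntR f.
Proof.
intros D; apply (IntR_unique _ _ _ (dom_scal k _ _ D)).
eapply is_lim_seq_ext; [|apply (is_lim_seq_mult' _ _ k _ (is_lim_seq_const k) (IntR_lim _ _ D))].
intros m; cbv beta; symmetry; apply (RInt_scal (V := R_CompleteNormedModule));
  now apply dom_ex_RInt with B.
Qed.

Lemma IntR_close (f g : R -> R) (B M eps : R) : dom B f -> dom B g -> 0 <= M ->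
  (forall t, Rabs t <= M -> Rabs (f t - g t) <= eps) ->
  Rabs (IntR f - IntR g) <= 2 * M * eps + 8 * B / sqrt (1 + M).
Proof.
intros Df Dg HM H.
pose proof (IntR_approx B f M Df HM) as T1; pose proof (IntR_approx B g M Dg HM) as T2.
pose proof (RInt_close f g M eps HM (dom_ex_RInt B f _ _ Df) (dom_ex_RInt B g _ _ Dg) H) as T3.
rewrite Rabs_minus_sym in T1.
replace (IntR f - IntR g) with ((IntR f - RInt f (- M) M)
  + ((RInt f (- M) M - RInt g (- M) M) + (RInt g (- M) M - IntR g))) by ring.
eapply Rle_trans; [apply Rabs_triang|].
eapply Rle_trans; [apply Rplus_le_compat_l, Rabs_triang|].
replace (8 * B / sqrt (1 + M)) with (4 * B / sqrt (1 + M) + 4 * B / sqrt (1 + M)) by (unfold Rdiv; ring).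
lra.
Qed.

Lemma gd_le_inv_sqrt (t : R) : gd t <= / sqrt (1 + Rabs t).
Proof.
unfold gd; pose proof (Rabs_pos t).
assert (s1 : 1 <= sqrt (1 + Rabs t)) by (rewrite <- sqrt_1 at 1; apply sqrt_le_1_alt; lra).
apply Rinv_le_contravar; [lra|]; simpl; nra.
Qed.

(** The boundary terms vanish because the primitive is dominated too. This is integration by parts
    on the line and takes the place of contour deformation. *)
Lemma IntR_FTC (F f : R -> R) (B B' : R) : dom B f -> 0 <= B' ->
  (forall t, is_derive F t (f t)) -> (forall t, Rabs (F t) <= B' * gd t) -> IntR f = 0.
Proof.
intros D HB' HF Hb; pose proof D as [HB [Hc _]].
apply (IntR_unique _ _ _ D).
apply is_lim_seq_ext with (fun k => F (INR k) - F (- INR k)).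
{ intros k; symmetry; apply is_RInt_unique.
  apply (is_RInt_derive (V := R_CompleteNormedModule) F); intros; auto. }
apply is_lim_seq_spec; intros eps; simpl.
destruct (inv_sqrt_small (2 * B') eps ltac:(lra) (cond_pos eps)) as [M0 [HM0 HM]].
destruct (INR_unbounded M0) as [N HN]; exists N; intros n Hn.
apply le_INR in Hn; rewrite Rminus_0_r.
eapply Rle_lt_trans; [|apply (HM (INR n)); lra].
unfold Rminus; eapply Rle_trans; [apply Rabs_triang|]; rewrite Rabs_Ropp.
pose proof (Hb (INR n)) as H1; pose proof (Hb (- INR n)) as H2; rewrite gd_opp in H2.
pose proof (gd_le_inv_sqrt (INR n)) as H3; rewrite (Rabs_pos_eq (INR n)) in H3 by apply pos_INR.
unfold Rdiv; nra.
Qed.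

(** * The limiting integrals *)

(** Derivative of a complex function of a real variable, taken by components so that the real
    fundamental theorem of calculus applies. *)
Definition cder (f : R -> C) (t : R) (l : C) : Prop :=
  is_derive (fun u => Re (f u)) t (Re l) /\ is_derive (fun u => Im (f u)) t (Im l).

Lemma is_derive_eq (f : R -> R) (x a b : R) : a = b -> is_derive f x a -> is_derive f x b.
Proof. now intros ->. Qed.

Lemma is_derive_Rext (f g : R -> R) (x a : R) :
  (forall u, f u = g u) -> is_derive f x a -> is_derive g x a.
Proof. exact (is_derive_ext (V := R_NormedModule) f g x a). Qed.

Lemma is_derive_Ropp (f : R -> R) (x a : R) : is_derive f x a -> is_derive (fun u => - f u) x (- a).
Proof. exact (is_derive_opp (V := R_NormedModule) f x a). Qed.

Ltac derive_subst H :=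
  match type of H with is_derive ?p ?t ?l =>
    replace (Derive (fun x => p x) t) with l by (symmetry; exact (is_derive_unique _ _ _ H)) end.

Lemma cder_mult (f g : R -> C) (t : R) (a b : C) : cder f t a -> cder g t b ->
  cder (fun u => f u * g u)%C t (a * g t + f t * b)%C.
Proof.
assert (Aux : forall (p q r s : R -> R) p' q' r' s', is_derive p t p' -> is_derive q t q' ->
  is_derive r t r' -> is_derive s t s' ->
  is_derive (fun u => p u * q u + r u * s u) t (p' * q t + p t * q' + (r' * s t + r t * s'))).
{ intros p q r s p' q' r' s' Hp Hq Hr Hs; eapply is_derive_eq.
  2:{ auto_derive; [repeat split; eexists; eassumption|reflexivity]. }
  derive_subst Hp; derive_subst Hq; derive_subst Hr; derive_subst Hs; ring. }
intros [f1 f2] [g1 g2]; split.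
- apply is_derive_Rext with (fun u => Re (f u) * Re (g u) + (- Im (f u)) * Im (g u)).
  { intros u; rewrite re_mult; ring. }
  eapply is_derive_eq;
    [|exact (Aux _ _ _ _ _ _ _ _ f1 g1 (is_derive_Ropp _ _ _ f2) g2)].
  rewrite re_plus, !re_mult; ring.
- apply is_derive_Rext with (fun u => Re (f u) * Im (g u) + Im (f u) * Re (g u)).
  { intros u; rewrite im_mult; ring. }
  eapply is_derive_eq; [|exact (Aux _ _ _ _ _ _ _ _ f1 g2 f2 g1)].
  rewrite im_plus, !im_mult; ring.
Qed.

Lemma cder_inv (f : R -> C) (t : R) (a : C) : f t <> 0 -> cder f t a ->
  cder (fun u => / f u)%C t (- (a / (f t * f t)))%C.
Proof.
assert (Aux : forall (p q : R -> R) p' q', is_derive p t p' -> is_derive q t q' ->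
  p t ^ 2 + q t ^ 2 <> 0 ->
  is_derive (fun u => p u / (p u ^ 2 + q u ^ 2)) t
    ((p' * (p t ^ 2 + q t ^ 2) - p t * (2 * p t * p' + 2 * q t * q')) / (p t ^ 2 + q t ^ 2) ^ 2)).
{ intros p q p' q' Hp Hq N; eapply is_derive_eq.
  2:{ auto_derive; [repeat split; try (eexists; eassumption); exact N|reflexivity]. }
  derive_subst Hp; derive_subst Hq; field; exact N. }
intros H [f1 f2].
assert (N : Re (f t) ^ 2 + Im (f t) ^ 2 <> 0).
{ rewrite <- Cmod_sqr; apply Cmod_gt_0 in H; nra. }
assert (E : (- (a / (f t * f t)))%C =
  (RtoC (- / (Re (f t) ^ 2 + Im (f t) ^ 2) ^ 2) * (a * (Cconj (f t) * Cconj (f t))))%C).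
{ assert (Ez : (f t * Cconj (f t))%C = RtoC (Re (f t) ^ 2 + Im (f t) ^ 2)).
  { destruct (f t); unfold Cconj, Cmult, RtoC; simpl; f_equal; ring. }
  assert (Hc : Cconj (f t) <> 0).
  { intros E0; rewrite E0, Cmult_0_r in Ez; apply RtoC_inj in Ez; now apply N. }
  rewrite RtoC_opp, RtoC_inv by (now apply pow_nonzero).
  set (m := Re (f t) ^ 2 + Im (f t) ^ 2) in *; simpl (m ^ 2); rewrite !RtoC_mult, <- Ez.
  field; auto. }
rewrite E; split.
- apply is_derive_Rext with (fun u => Re (f u) / (Re (f u) ^ 2 + Im (f u) ^ 2)).
  { intros u; reflexivity. }
  eapply is_derive_eq; [|exact (Aux _ _ _ _ f1 f2 N)].
  cbv beta in *; destruct (f t) as [x v]; destruct a as [a b]; unfold Cconj in *; simpl in *; field; intros E0; apply N; rewrite <- E0; ring.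
- apply is_derive_Rext with (fun u => - (Im (f u) / (Im (f u) ^ 2 + Re (f u) ^ 2))).
  { intros u; unfold Cinv; simpl; unfold Rdiv.
    rewrite Ropp_mult_distr_l, (Rplus_comm (fst (f u) * _)); reflexivity. }
  rewrite Rplus_comm in N.
  eapply is_derive_eq; [|exact (is_derive_Ropp _ _ _ (Aux _ _ _ _ f2 f1 N))].
  cbv beta in *; destruct (f t) as [x v]; destruct a as [a b]; unfold Cconj in *; simpl in *; field.
  intros E0; apply N; rewrite <- E0; ring.
Qed.

Lemma cder_cexp (f : R -> C) (t : R) (a : C) : cder f t a ->
  cder (fun u => cexp (f u)) t (a * cexp (f t))%C.
Proof.
assert (Aux1 : forall (p q : R -> R) p' q', is_derive p t p' -> is_derive q t q' ->
  is_derive (fun u => exp (p u) * cos (q u)) t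
    (p' * (exp (p t) * cos (q t)) - q' * (exp (p t) * sin (q t)))).
{ intros p q p' q' Hp Hq; eapply is_derive_eq.
  2:{ auto_derive; [repeat split; eexists; eassumption|reflexivity]. }
  derive_subst Hp; derive_subst Hq; ring. }
assert (Aux2 : forall (p q : R -> R) p' q', is_derive p t p' -> is_derive q t q' ->
  is_derive (fun u => exp (p u) * sin (q u)) t
    (p' * (exp (p t) * sin (q t)) + q' * (exp (p t) * cos (q t)))).
{ intros p q p' q' Hp Hq; eapply is_derive_eq.
  2:{ auto_derive; [repeat split; eexists; eassumption|reflexivity]. }
  derive_subst Hp; derive_subst Hq; ring. }
intros [f1 f2]; split.
- exact (Aux1 _ _ _ _ f1 f2).
- exact (Aux2 _ _ _ _ f1 f2).
Qed.

Lemma cder_rt (t : R) : cder rt t (Ci / (2 * rt t))%C.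
Proof.
pose proof (rtp_ge1 t) as H1; pose proof (rtp_sqr t) as H2; pose proof (sqrt_1_sqr_ge t) as H4.
assert (H3 : sqrt (1 + t ^ 2) * sqrt (1 + t ^ 2) = 1 + t ^ 2)
  by (apply sqrt_sqrt; pose proof (pow2_ge_0 t); lra).
set (S := sqrt (1 + t ^ 2)) in *; set (p := rtp t) in *.
assert (E : (Ci / (2 * rt t))%C = (t / (4 * p * S), p / (2 * S))).
{ set (l := (t / (4 * p * S), p / (2 * S)) : C).
  assert (r2 : (rt t * (2 * l))%C = Ci).
  { unfold l; unfold rt; fold p; unfold Cmult, Ci, RtoC; simpl; f_equal.
    - field; lra.
    - replace (p * (2 * (p / (2 * S)) + 0 * (t / (4 * p * S)))) with (p * p / S) by (field; lra).
      replace (t / (2 * p) * (2 * (t / (4 * p * S)) - 0 * (p / (2 * S)))) with (t ^ 2 / (4 * (p * p) * S))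
        by (field; lra).
      rewrite H2; replace (t ^ 2) with (S * S - 1) by lra; field; lra. }
  rewrite <- r2 at 1; field; apply rt_neq0. }
rewrite E.
assert (D1 : is_derive rtp t (t / (4 * p * S))).
{ unfold rtp; pose proof (pow2_ge_0 t).
  eapply is_derive_eq.
  2:{ auto_derive; [repeat split; try lra|reflexivity].
      replace (t * (t * 1)) with (t ^ 2) by ring; fold S; lra. }
  simpl; replace (t * (t * 1)) with (t ^ 2) by ring; fold S.
  change (sqrt ((S + 1) * / 2)) with p; field; lra. }
split; simpl.
- exact D1.
- apply is_derive_Rext with (fun u => u / (2 * rtp u)); [reflexivity|].
  eapply is_derive_eq.
  2:{ auto_derive; [repeat split; [eexists; exact D1|fold p; lra]|reflexivity]. }
  derive_subst D1; fold p.
  transitivity ((4 * (p * p) * S - t ^ 2) / (8 * (p * p) * p * S)); [field; lra|].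
  transitivity (4 * (p * p) * (p * p) / (8 * (p * p) * p * S)); [|field; lra].
  replace (4 * (p * p) * S - t ^ 2) with (4 * (p * p) * (p * p)); [reflexivity|].
  rewrite H2; replace (t ^ 2) with (S * S - 1) by lra; field.
Qed.

Lemma cder_sc (t : R) : cder sc t Ci.
Proof. split; simpl; auto_derive; auto. Qed.

Lemma cder_const (z : C) (t : R) : cder (fun _ => z) t 0.
Proof. split; simpl; auto_derive; auto. Qed.

Lemma cder_minus (f g : R -> C) (t : R) (a b : C) : cder f t a -> cder g t b ->
  cder (fun u => f u - g u)%C t (a - b)%C.
Proof.
intros [f1 f2] [g1 g2]; split.
- apply (is_derive_minus (V := R_NormedModule) (fun u => Re (f u)) (fun u => Re (g u))); assumption.
- apply (is_derive_minus (V := R_NormedModule) (fun u => Im (f u)) (fun u => Im (g u))); assumption.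
Qed.

Lemma cder_eq (f : R -> C) (t : R) (a b : C) : a = b -> cder f t a -> cder f t b.
Proof. now intros ->. Qed.

Lemma cder_rt_pow (k : nat) (t : R) :
  cder (fun u => rt u ^ k)%C t (Ci * (RtoC (INR k) / 2) * (rt t ^ k / (rt t * rt t)))%C.
Proof.
induction k.
- eapply cder_eq; [|apply (cder_const 1)]; change (INR 0) with 0; unfold Cdiv; ring.
- eapply cder_eq; [|exact (cder_mult _ _ _ _ _ (cder_rt t) IHk)].
  rewrite S_INR, RtoC_plus, Cpow_S; field; auto using C2_neq0, rt_neq0.
Qed.

(* [phik k] is the power [s^{(k-3)/2}] with [s = 1 + i t]: the offset 3 makes all
   the exponents that occur natural numbers. *)
Definition phik (k : nat) (t : R) : C := (rt t ^ k * / (rt t ^ 3))%C.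

(** With [s = 1 + i t], the integrand [s^((k-3)/2) exp (s - a sqrt s)] of an inverse Laplace
    transform along [Re s = 1], taken at time 1. *)
Definition fk (k : nat) (a : R) (t : R) : C := (phik k t * cexp (sc t - RtoC a * rt t))%C.

Lemma phik_S (k : nat) (t : R) : phik (S k) t = (rt t * phik k t)%C.
Proof. unfold phik; rewrite Cpow_S; ring. Qed.

Lemma fk_S (k : nat) (a t : R) : fk (S k) a t = (rt t * fk k a t)%C.
Proof. unfold fk; rewrite phik_S; ring. Qed.

Lemma cder_fk (k : nat) (a t : R) : cder (fk k a) t
  (Ci * (RtoC ((INR k - 3) / 2) * fk k a t / (rt t * rt t) + fk k a t - RtoC (a / 2) * fk k a t / rt t))%C.
Proof.
assert (r0 := rt_neq0 t); assert (r3 : (rt t ^ 3)%C <> 0) by (now apply Cpow_nz).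
assert (D1 := cder_inv _ _ _ r3 (cder_rt_pow 3 t)).
assert (D2 := cder_mult _ _ _ _ _ (cder_rt_pow k t) D1).
assert (D3 := cder_minus _ _ _ _ _ (cder_sc t) (cder_mult _ _ _ _ _ (cder_const (RtoC a) t) (cder_rt t))).
assert (D4 := cder_mult _ _ _ _ _ D2 (cder_cexp _ _ _ D3)).
eapply cder_eq; [|exact D4].
unfold fk, phik; simpl (INR 3); rewrite !RtoC_div, RtoC_minus by lra.
set (X := cexp _); set (P := (rt t ^ k)%C).
replace (RtoC (1 + 1 + 1)) with (RtoC 3) by (f_equal; ring).
set (r := rt t) in *.
replace (r ^ 3)%C with (r * (r * r))%C by ring.
field; auto using C2_neq0.
Qed.

Lemma Cmod_rt_inv3 (t : R) : / Cmod (rt t) ^ 3 <= 3 * gd t.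
Proof.
pose proof (Cmod_rt_sqr t) as H; pose proof (Cmod_rt_ge1 t) as H1.
pose proof (Rabs_pos t) as t0.
set (r := Cmod (rt t)) in *; unfold gd.
set (v := sqrt (1 + Rabs t)); assert (v1 : 1 <= v).
{ unfold v; rewrite <- sqrt_1 at 1; apply sqrt_le_1_alt; lra. }
assert (vv : v * v = 1 + Rabs t) by (apply sqrt_sqrt; lra).
assert (S2 : (v * v) / 2 <= r * r).
{ rewrite H, vv; apply Rsqr_incr_0_var; [|apply sqrt_pos]; unfold Rsqr.
  rewrite sqrt_sqrt by (pose proof (pow2_ge_0 t); lra).
  assert (Rabs t * Rabs t = t ^ 2) by (rewrite <- Rabs_mult, Rabs_pos_eq; nra).
  pose proof (pow2_ge_0 (Rabs t - 1)); nra. }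
assert (rv : 7 / 10 * v <= r) by nra.
assert (P : (7 / 10 * v) ^ 3 <= r ^ 3) by (apply pow_incr; lra).
assert (v3 : 0 < v ^ 3) by (apply pow_lt; lra).
assert (P2 : v ^ 3 / 3 <= r ^ 3) by (simpl in *; nra).
replace (3 * / v ^ 3) with (/ (v ^ 3 / 3)) by (field; lra).
apply Rinv_le_contravar; lra.
Qed.

Lemma pow_le_exp (c u : R) (k : nat) : 0 < c -> 0 <= u -> u ^ k <= (INR k / c) ^ k * exp (c * u).
Proof.
intros Hc Hu; destruct k.
- simpl; pose proof (exp_ineq1_le (c * u)); nra.
- assert (k0 : 0 < INR (S k)) by (apply lt_0_INR; lia).
  set (m := INR (S k)) in *.
  assert (E : exp (c * u) = exp (c * u / m) ^ S k).
  { assert (H : forall x j, exp x ^ j = exp (INR j * x)).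
    { intros x j; induction j; [simpl; rewrite Rmult_0_l, exp_0; reflexivity|].
      rewrite S_INR; simpl; rewrite IHj, <- exp_plus; f_equal; ring. }
    rewrite H; fold m; f_equal; field; lra. }
  rewrite E, <- Rpow_mult_distr; apply pow_incr; split; [exact Hu|].
  pose proof (exp_ineq1_le (c * u / m)) as H.
  replace u with (m / c * (c * u / m)) at 1 by (field; lra).
  apply Rmult_le_compat_l; [apply Rdiv_le_0_compat; lra|lra].
Qed.

(** The power comes from [r^k exp (- a0 r / 2)] through [pow_le_exp], the 3 from [Cmod_rt_inv3] and
    [exp 1] from [Re s = 1]. *)
Definition Bk (k : nat) (a0 : R) : R := 3 * exp 1 * (2 * INR k / a0) ^ k.

Lemma Cmod_fk (k : nat) (a t : R) :
  Cmod (fk k a t) = Cmod (rt t) ^ k * / Cmod (rt t) ^ 3 * (exp 1 * exp (- (a * rtp t))).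
Proof.
unfold fk, phik; rewrite !Cmod_mult, Cmod_inv, !Cmod_pow by (apply Cpow_nz, rt_neq0).
f_equal; rewrite Cmod_cexp, <- exp_plus; f_equal; simpl; ring.
Qed.

Lemma fk_bound (k : nat) (a0 a t : R) : 0 < a0 <= a -> Cmod (fk k a t) <= Bk k a0 * gd t.
Proof.
intros Ha; rewrite Cmod_fk.
pose proof (Cmod_rt_ge1 t) as r1; pose proof (rtp_ge_half t) as H; pose proof (Cmod_rt_inv3 t) as H3.
set (r := Cmod (rt t)) in *; set (p := rtp t) in *.
assert (E : exp (- (a * p)) <= exp (- (a0 / 2 * r))).
{ destruct (Rle_lt_or_eq_dec (- (a * p)) (- (a0 / 2 * r))) as [H0|H0]; [nra| |].
  - left; now apply exp_increasing.
  - right; now rewrite H0. }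
pose proof (pow_le_exp (a0 / 2) r k ltac:(lra) ltac:(lra)) as P.
assert (P2 : r ^ k * exp (- (a * p)) <= (INR k / (a0 / 2)) ^ k).
{ apply Rle_trans with ((INR k / (a0 / 2)) ^ k * exp (a0 / 2 * r) * exp (- (a0 / 2 * r))).
  - apply Rmult_le_compat; [apply pow_le; lra|left; apply exp_pos|exact P|exact E].
  - rewrite Rmult_assoc, <- exp_plus, Rplus_opp_r, exp_0; lra. }
unfold Bk.
replace (r ^ k * / r ^ 3 * (exp 1 * exp (- (a * p)))) with
  ((r ^ k * exp (- (a * p))) * exp 1 * / r ^ 3) by ring.
replace (3 * exp 1 * (2 * INR k / a0) ^ k * gd t) with
  ((INR k / (a0 / 2)) ^ k * exp 1 * (3 * gd t)).
2:{ replace (INR k / (a0 / 2)) with (2 * INR k / a0) by (field; lra); ring. }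
pose proof (exp_pos 1); pose proof (exp_pos (- (a * p))).
assert (0 <= r ^ k) by (apply pow_le; lra).
apply Rmult_le_compat; [|left; apply Rinv_0_lt_compat, pow_lt; lra| |exact H3].
- apply Rmult_le_pos; nra.
- apply Rmult_le_compat_r; lra.
Qed.

Lemma Bk_ge0 (k : nat) (a0 : R) : 0 < a0 -> 0 <= Bk k a0.
Proof.
intros H; unfold Bk; apply Rmult_le_pos; [pose proof (exp_pos 1); lra|].
apply pow_le, Rdiv_le_0_compat; [pose proof (pos_INR k); lra|exact H].
Qed.

Lemma fk_continuous (k : nat) (a t : R) : continuous (fun u => Re (fk k a u)) t.
Proof.
destruct (cder_fk k a t) as [H _].
apply (ex_derive_continuous (V := R_NormedModule)); eexists; exact H.
Qed.

Lemma dom_fk (k : nat) (a0 a : R) : 0 < a0 <= a -> dom (Bk k a0) (fun t => Re (fk k a t)).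
Proof.
intros Ha; split; [apply Bk_ge0; lra|split].
- intros t; apply fk_continuous.
- intros t; eapply Rle_trans; [apply re_le_Cmod|now apply fk_bound].
Qed.

(** For [k = 0] the power [s^(-3/2)] is integrable without the help of the exponential, so the bound
    holds down to [a = 0]. *)
Lemma fk0_bound (a t : R) : 0 <= a -> Cmod (fk 0 a t) <= 3 * exp 1 * gd t.
Proof.
intros Ha; rewrite Cmod_fk; simpl (_ ^ 0); rewrite Rmult_1_l.
pose proof (Cmod_rt_inv3 t) as H3; pose proof (rtp_ge1 t); pose proof (exp_pos 1).
assert (E : exp (- (a * rtp t)) <= 1).
{ rewrite <- exp_0; destruct (Rle_lt_or_eq_dec (- (a * rtp t)) 0) as [Hl|Hl]; [nra| |].
  - left; now apply exp_increasing.
  - right; now rewrite Hl. }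
pose proof (exp_pos (- (a * rtp t))); pose proof (gd_pos t).
assert (0 < / Cmod (rt t) ^ 3) by (apply Rinv_0_lt_compat, pow_lt; pose proof (Cmod_rt_ge1 t); lra).
replace (3 * exp 1 * gd t) with ((3 * gd t) * (exp 1 * 1)) by ring.
apply Rmult_le_compat; nra.
Qed.

Lemma dom_fk0 (a : R) : 0 <= a -> dom (3 * exp 1) (fun t => Re (fk 0 a t)).
Proof.
intros Ha; split; [pose proof (exp_pos 1); lra|split].
- intros t; apply fk_continuous.
- intros t; eapply Rle_trans; [apply re_le_Cmod|now apply fk0_bound].
Qed.

Definition Ik (k : nat) (a : R) : R := IntR (fun t => Re (fk k a t)).

(** The derivative of [Im (fk (k + 2) a)] has integral 0. Its factor [Ci] turns imaginary into real
    parts, and division by [rt] or [rt^2] lowers the index. *)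
Lemma Ik_rel (k : nat) (a : R) : 0 < a ->
  (INR k - 1) / 2 * Ik k a + Ik (S (S k)) a - a / 2 * Ik (S k) a = 0.
Proof.
intros Ha; assert (Ha' : 0 < a <= a) by lra.
set (f := fun t => (INR k - 1) / 2 * Re (fk k a t) + (Re (fk (S (S k)) a t) + - (a / 2) * Re (fk (S k) a t))).
pose proof (dom_scal ((INR k - 1) / 2) _ _ (dom_fk k a a Ha')) as D1.
pose proof (dom_scal (- (a / 2)) _ _ (dom_fk (S k) a a Ha')) as D2.
pose proof (dom_plus _ _ _ _ (dom_fk (S (S k)) a a Ha') D2) as D3.
assert (E : IntR f = (INR k - 1) / 2 * Ik k a + (Ik (S (S k)) a + - (a / 2) * Ik (S k) a)).
{ unfold f; rewrite (IntR_plus _ _ _ _ D1 D3), (IntR_scal _ _ _ (dom_fk k a a Ha')).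
  rewrite (IntR_plus _ _ _ _ (dom_fk (S (S k)) a a Ha') D2), (IntR_scal _ _ _ (dom_fk (S k) a a Ha')).
  reflexivity. }
replace ((INR k - 1) / 2 * Ik k a + Ik (S (S k)) a - a / 2 * Ik (S k) a) with (IntR f) by (rewrite E; ring).
apply (IntR_FTC (fun t => Im (fk (S (S k)) a t)) f _ (Bk (S (S k)) a) (dom_plus _ _ _ _ D1 D3)).
- now apply Bk_ge0.
- intros t; destruct (cder_fk (S (S k)) a t) as [_ H].
  eapply is_derive_eq; [|exact H].
  assert (r0 := rt_neq0 t).
  replace (RtoC ((INR (S (S k)) - 3) / 2) * fk (S (S k)) a t / (rt t * rt t))%C
    with (RtoC ((INR k - 1) / 2) * fk k a t)%C.
  2:{ rewrite !fk_S; replace (INR (S (S k)) - 3) with (INR k - 1) by (rewrite !S_INR; ring).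
      field; exact r0. }
  replace (RtoC (a / 2) * fk (S (S k)) a t / rt t)%C with (RtoC (a / 2) * fk (S k) a t)%C.
  2:{ rewrite (fk_S (S k)); field; exact r0. }
  rewrite im_mult; unfold f.
  unfold Cminus; rewrite !re_plus, re_opp, !re_scal_l; simpl; ring.
- intros t; eapply Rle_trans; [apply im_le_Cmod|now apply fk_bound].
Qed.

(** Differentiating in [a] multiplies the integrand by [- rt], which raises the index by one. The
    second-order remainder is dominated by [fk 4 (a / 2)]: two factors [rt] raise the index to 4,
    and half of the decay pays for the exponential in the Taylor bound. *)
Lemma Ik2_derive (a : R) : 0 < a -> is_derive (Ik 2) a (- Ik 3 a).
Proof.
intros Ha.
set (Q := 4 * (5 * Bk 4 (a / 2))).
assert (B0 : 0 <= Bk 4 (a / 2)) by (apply Bk_ge0; lra).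
assert (K : forall b, Rabs (b - a) <= a / 2 ->
  Rabs (Ik 2 b - Ik 2 a + (b - a) * Ik 3 a) <= Q * (b - a) ^ 2).
{ intros b Hb; assert (Hb' := Hb); apply Rabs_le_between in Hb'.
  assert (Db : 0 < a / 2 <= b) by lra. assert (Da : 0 < a / 2 <= a) by lra.
  set (f := fun t => Re (fk 2 b t) + (-1 * Re (fk 2 a t) + (b - a) * Re (fk 3 a t))).
  pose proof (dom_scal (-1) _ _ (dom_fk 2 _ _ Da)) as D1.
  pose proof (dom_scal (b - a) _ _ (dom_fk 3 _ _ Da)) as D2.
  pose proof (dom_plus _ _ _ _ D1 D2) as D3.
  pose proof (dom_plus _ _ _ _ (dom_fk 2 _ _ Db) D3) as D4.
  assert (E : Ik 2 b - Ik 2 a + (b - a) * Ik 3 a = IntR f).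
  { unfold f; rewrite (IntR_plus _ _ _ _ (dom_fk 2 _ _ Db) D3), (IntR_plus _ _ _ _ D1 D2).
    rewrite (IntR_scal _ _ _ (dom_fk 2 _ _ Da)), (IntR_scal _ _ _ (dom_fk 3 _ _ Da)).
    unfold Ik; ring. }
  rewrite E.
  assert (D : dom (5 * Bk 4 (a / 2) * (b - a) ^ 2) f).
  { split; [apply Rmult_le_pos; [lra|apply pow2_ge_0]|split; [apply D4|]].
    intros t.
    assert (Ef : f t = Re (fk 2 a t * (cexp (- (RtoC (b - a) * rt t)) - 1 - - (RtoC (b - a) * rt t)))%C).
    { unfold f; rewrite (fk_S 2 a).
      replace (fk 2 b t) with (fk 2 a t * cexp (- (RtoC (b - a) * rt t)))%C.
      2:{ unfold fk; rewrite <- Cmult_assoc, <- cexp_plus; do 2 f_equal; rewrite RtoC_minus; ring. }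
      rewrite <- !re_scal_l, <- !re_plus; f_equal.
      replace (RtoC (-1)) with (- (1))%C by (rewrite <- RtoC_opp; f_equal; ring).
      ring. }
    rewrite Ef; eapply Rle_trans; [apply re_le_Cmod|].
    rewrite Cmod_mult.
    pose proof (cexp_taylor2 (- (RtoC (b - a) * rt t))%C) as T.
    rewrite Cmod_opp, Cmod_mult, Cmod_R in T.
    assert (Hre : Rabs (Re (- (RtoC (b - a) * rt t))%C) <= a / 2 * rtp t).
    { rewrite re_opp, re_scal_l, Rabs_Ropp, Rabs_mult.
      pose proof (rtp_ge1 t); change (Re (rt t)) with (rtp t).
      rewrite (Rabs_pos_eq (rtp t)) by lra; apply Rmult_le_compat_r; lra. }
    assert (Ex : exp (Rabs (Re (- (RtoC (b - a) * rt t))%C)) <= exp (a / 2 * rtp t)).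
    { destruct Hre as [Hre|Hre]; [left; now apply exp_increasing|right; now rewrite Hre]. }
    assert (M : Cmod (fk 2 a t) * (Cmod (rt t) ^ 2 * exp (a / 2 * rtp t)) = Cmod (fk 4 (a / 2) t)).
    { rewrite !Cmod_fk.
      replace (exp (- (a * rtp t))) with (exp (- (a / 2 * rtp t)) * exp (- (a / 2 * rtp t)))
        by (rewrite <- exp_plus; f_equal; field).
      assert (X : exp (- (a / 2 * rtp t)) * exp (a / 2 * rtp t) = 1)
        by (rewrite <- exp_plus, Rplus_opp_l; apply exp_0).
      set (u := exp (- (a / 2 * rtp t))) in *; set (v := exp (a / 2 * rtp t)) in *.
      replace (Cmod (rt t) ^ 4) with (Cmod (rt t) ^ 2 * Cmod (rt t) ^ 2) by ring.
      transitivity (Cmod (rt t) ^ 2 * / Cmod (rt t) ^ 3 * (exp 1 * u) * Cmod (rt t) ^ 2 * (u * v)); [ring|].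
      rewrite X; ring. }
    apply Rle_trans with (Cmod (fk 2 a t) * (5 * (Rabs (b - a) * Cmod (rt t)) ^ 2 * exp (a / 2 * rtp t))).
    - apply Rmult_le_compat_l; [apply Cmod_ge_0|]; eapply Rle_trans; [exact T|].
      apply Rmult_le_compat_l; [|exact Ex].
      pose proof (pow2_ge_0 (Rabs (b - a) * Cmod (rt t))); lra.
    - replace (Cmod (fk 2 a t) * (5 * (Rabs (b - a) * Cmod (rt t)) ^ 2 * exp (a / 2 * rtp t)))
        with (5 * Rabs (b - a) ^ 2 * (Cmod (fk 2 a t) * (Cmod (rt t) ^ 2 * exp (a / 2 * rtp t)))) by ring.
      rewrite M, pow2_abs.
      replace (5 * Bk 4 (a / 2) * (b - a) ^ 2 * gd t) with (5 * (b - a) ^ 2 * (Bk 4 (a / 2) * gd t)) by ring.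
      apply Rmult_le_compat_l; [pose proof (pow2_ge_0 (b - a)); lra|].
      apply fk_bound; lra. }
  eapply Rle_trans; [exact (IntR_bound _ _ D)|]; unfold Q; right; ring. }
apply is_derive_Reals; intros eps He.
assert (Q1 : 0 < Q + 1) by (unfold Q; lra).
assert (P : 0 < Rmin (a / 2) (eps / (Q + 1))).
{ apply Rmin_glb_lt; [lra|now apply Rdiv_lt_0_compat]. }
exists (mkposreal _ P); intros h Hh Hd; simpl in Hd.
assert (H1 : Rabs h <= a / 2) by (left; eapply Rlt_le_trans; [exact Hd|apply Rmin_l]).
assert (H2 : Rabs h < eps / (Q + 1)) by (eapply Rlt_le_trans; [exact Hd|apply Rmin_r]).
specialize (K (a + h)); replace (a + h - a) with h in K by ring; specialize (K H1).
replace ((Ik 2 (a + h) - Ik 2 a) / h - - Ik 3 a) with ((Ik 2 (a + h) - Ik 2 a + h * Ik 3 a) / h) by (field; exact Hh).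
unfold Rdiv; rewrite Rabs_mult, Rabs_inv.
assert (h0 : 0 < Rabs h) by (now apply Rabs_pos_lt).
apply Rmult_lt_reg_r with (Rabs h); [exact h0|].
rewrite Rmult_assoc, Rinv_l, Rmult_1_r by lra.
eapply Rle_lt_trans; [exact K|].
rewrite <- pow2_abs; simpl; rewrite Rmult_1_r, <- Rmult_assoc; apply Rmult_lt_compat_r; [exact h0|].
apply Rle_lt_trans with ((Q + 1) * Rabs h); [nra|].
rewrite <- (mult_div_cancel eps (Q + 1) Q1); now apply Rmult_lt_compat_l.
Qed.

(** For [k = 1] the first term of [Ik_rel] vanishes. Together with [Ik2_derive] this is the
    differential equation of a Gaussian in [a]. *)
Lemma Ik3_eq (a : R) : 0 < a -> Ik 3 a = a / 2 * Ik 2 a.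
Proof. intros Ha; pose proof (Ik_rel 1 a Ha) as H; simpl in H; lra. Qed.

(** The value of [Ik 2] extrapolated from [a = 1] to [a = 0] along the Gaussian. *)
Definition Cg : R := Ik 2 1 * exp (/ 4).

Lemma Ik2_eq (a : R) : 0 < a -> Ik 2 a = Cg * exp (- (a ^ 2 / 4)).
Proof.
intros Ha.
set (G := fun a => Ik 2 a * exp (a ^ 2 / 4)).
assert (DG : forall u, 0 < u -> is_derive G u 0).
{ intros u Hu; unfold G; pose proof (Ik2_derive u Hu) as H.
  eapply is_derive_eq.
  2:{ auto_derive; [repeat split; eexists; exact H|reflexivity]. }
  derive_subst H; rewrite Ik3_eq by exact Hu; field. }
assert (E : G a = G 1).
{ destruct (MVT_gen G 1 a (fun _ => 0)) as [c [_ Hc]].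
  - intros u Hu; apply DG; revert Hu; unfold Rmin; destruct (Rle_dec 1 a); lra.
  - intros u Hu; apply continuity_pt_filterlim.
    apply (ex_derive_continuous (V := R_NormedModule)); exists 0; apply DG.
    revert Hu; unfold Rmin; destruct (Rle_dec 1 a); lra.
  - lra. }
unfold G in E; unfold Cg.
replace (1 ^ 2 / 4) with (/ 4) in E by field; rewrite <- E, Rmult_assoc, <- exp_plus.
replace (a ^ 2 / 4 + - (a ^ 2 / 4)) with 0 by ring; rewrite exp_0; ring.
Qed.

(** Two further uses of [Ik_rel] raise the index to 5. The polynomial is [(a^3 - 6 a) / 8]; at
    [a = k lambda x] it is the source of the polynomial in the theorem. *)
Lemma Ik5_eq (a : R) : 0 < a ->
  Ik 5 a = Cg * (a / 2 * (a ^ 2 / 4 - 3 / 2)) * exp (- (a ^ 2 / 4)).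
Proof.
intros Ha; pose proof (Ik_rel 2 a Ha) as H2; pose proof (Ik_rel 3 a Ha) as H3.
pose proof (Ik3_eq a Ha) as H1; pose proof (Ik2_eq a Ha) as H0.
simpl in H2, H3.
assert (H4 : Ik 4 a = a / 2 * Ik 3 a - / 2 * Ik 2 a) by lra.
assert (H5 : Ik 5 a = a / 2 * Ik 4 a - Ik 3 a) by lra.
rewrite H5, H4, H1, H0; field.
Qed.

Lemma gd_le_1 (t : R) : gd t <= 1.
Proof.
eapply Rle_trans; [apply gd_le_inv_sqrt|]; rewrite <- Rinv_1; apply Rinv_le_contravar; [lra|].
rewrite <- sqrt_1 at 1; apply sqrt_le_1_alt; pose proof (Rabs_pos t); lra.
Qed.

Lemma Cmod_rt_le (t : R) : Cmod (rt t) <= 1 + Rabs t.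
Proof.
pose proof (Cmod_rt_sqr t) as H; pose proof (Cmod_rt_ge1 t); pose proof (Rabs_pos t).
assert (sqrt (1 + t ^ 2) <= 1 + Rabs t).
{ apply Rsqr_incr_0_var; [|lra]; unfold Rsqr.
  rewrite sqrt_sqrt by (pose proof (pow2_ge_0 t); lra).
  assert (Rabs t * Rabs t = t ^ 2) by (rewrite <- Rabs_mult, Rabs_pos_eq; nra). nra. }
nra.
Qed.

Lemma Rabs_le_eps (x : R) : (forall eps, 0 < eps -> Rabs x <= eps) -> x = 0.
Proof.
intros H; destruct (Req_dec x 0) as [E|E]; [exact E|].
apply Rabs_pos_lt in E; specialize (H (Rabs x / 2) ltac:(lra)); lra.
Qed.

Lemma dom_0 (B : R) : 0 <= B -> dom B (fun _ => 0).
Proof.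
intros H; split; [exact H|split].
- intros t; apply continuous_const.
- intros t; rewrite Rabs_R0; pose proof (gd_pos t); nra.
Qed.

Lemma IntR_0 : IntR (fun _ => 0) = 0.
Proof.
pose proof (IntR_bound 0 _ (dom_0 0 (Rle_refl 0))) as H.
rewrite Rmult_0_r in H; apply Rabs_le_between in H; lra.
Qed.

(** [Ik_rel] at [k = 0] reads [Ik 0 a = 2 Ik 2 a - a Ik 1 a], and [a] tends to 0. The integrand of
    [Ik 2 a] is not dominated uniformly there, but its integral is known from [Ik2_eq], and
    [a Ik 1 a] tends to 0. The constant of the size count is thus expressed by the same [Cg]. *)
Lemma Ik0_0 : Ik 0 0 = 2 * Cg.
Proof.
enough (Ik 0 0 - 2 * Cg = 0) by lra.
pose proof (exp_pos 1) as e0; set (e := exp 1) in *.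
apply Rabs_le_eps; intros eps He.
destruct (inv_sqrt_small (72 * e) (eps / 2) ltac:(lra) ltac:(lra)) as [M [HM0 HM]].
specialize (HM M (Rle_refl M)).
set (c := 2 * M * (3 * e * (1 + M) * (1 + 5 * e)) + Rabs Cg + 2 * M * (3 * e * (1 + M)) + 1).
pose proof (Rabs_pos Cg).
assert (c0 : 0 < c).
{ assert (0 <= 2 * M * (3 * e * (1 + M) * (1 + 5 * e))) by (repeat apply Rmult_le_pos; lra).
  assert (0 <= 2 * M * (3 * e * (1 + M))) by (repeat apply Rmult_le_pos; lra). unfold c; lra. }
(* The first bound keeps [|a rt t| <= 1] for [|t| <= M], the second makes all errors other than the
   tails add up to at most [eps / 2]. *)
set (a := Rmin (/ (1 + M)) (eps / 2 / c)).
assert (a0 : 0 < a).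
{ apply Rmin_glb_lt; [apply Rinv_0_lt_compat; lra|apply Rdiv_lt_0_compat; lra]. }
assert (a1 : a * (1 + M) <= 1).
{ apply Rle_trans with (/ (1 + M) * (1 + M)); [apply Rmult_le_compat_r; [lra|apply Rmin_l]|].
  rewrite Rinv_l; lra. }
assert (a2 : c * a <= eps / 2).
{ rewrite <- (mult_div_cancel (eps / 2) c c0); apply Rmult_le_compat_l; [lra|apply Rmin_r]. }
assert (a3 : a <= 1) by nra.
pose proof (Ik_rel 0 a a0) as R; simpl INR in R.
assert (K1 : Rabs (Ik 0 a - Ik 0 0) <= 2 * M * (3 * e * (a * (1 + M) * (1 + 5 * e))) + 24 * e / sqrt (1 + M)).
{ replace (24 * e) with (8 * (3 * e)) by ring.
  apply IntR_close; [apply dom_fk0; lra|apply dom_fk0; lra|exact HM0|].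
  intros t Ht.
  replace (Re (fk 0 a t) - Re (fk 0 0 t)) with
    (Re (fk 0 0 t * (cexp (- (RtoC a * rt t)) - 1))%C).
  2:{ replace (fk 0 a t) with (fk 0 0 t * cexp (- (RtoC a * rt t)))%C.
      - replace (fk 0 0 t * (cexp (- (RtoC a * rt t)) - 1))%C
          with (fk 0 0 t * cexp (- (RtoC a * rt t)) + - fk 0 0 t)%C by ring.
        rewrite re_plus, re_opp; ring.
      - unfold fk; rewrite <- Cmult_assoc, <- cexp_plus; do 2 f_equal; ring. }
  eapply Rle_trans; [apply re_le_Cmod|]; rewrite Cmod_mult.
  apply Rmult_le_compat; [apply Cmod_ge_0|apply Cmod_ge_0| |].
  - eapply Rle_trans; [apply fk0_bound; lra|]; fold e; pose proof (gd_le_1 t); pose proof (gd_pos t); nra.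
  - set (u := (- (RtoC a * rt t))%C).
    assert (Hu : Cmod u <= a * (1 + M)).
    { unfold u; rewrite Cmod_opp, Cmod_mult, Cmod_R, Rabs_pos_eq by lra.
      apply Rmult_le_compat_l; [lra|]; pose proof (Cmod_rt_le t); lra. }
    replace (cexp u - 1)%C with (u + (cexp u - 1 - u))%C by ring.
    eapply Rle_trans; [apply Cmod_triangle|].
    pose proof (cexp_taylor2 u) as T; pose proof (Cmod_ge_0 u).
    assert (Ex : exp (Rabs (Re u)) <= e).
    { pose proof (re_le_Cmod u) as Hr; assert (Hr' : Rabs (Re u) <= 1) by lra.
      destruct Hr' as [Hr'|Hr']; [left; now apply exp_increasing|right; now rewrite Hr']. }
    assert (5 * Cmod u ^ 2 * exp (Rabs (Re u)) <= 5 * (a * (1 + M)) * e).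
    { apply Rmult_le_compat; [|left; apply exp_pos| |exact Ex].
      - pose proof (pow2_ge_0 (Cmod u)); lra.
      - nra. }
    nra. }
(* Uniform in [a]: [a r exp (- a p) <= 2] because [r <= 2 p] and [a p <= exp (a p)], so the factor
   [a] compensates the extra [rt] of index 1. *)
assert (D1 : dom (6 * e) (fun t => a * Re (fk 1 a t))).
{ split; [lra|split].
  - apply (dom_scal a _ _ (dom_fk 1 a a ltac:(lra))).
  - intros t; rewrite Rabs_mult, (Rabs_pos_eq a) by lra.
    apply Rle_trans with (a * Cmod (fk 1 a t)); [apply Rmult_le_compat_l; [lra|apply re_le_Cmod]|].
    rewrite Cmod_fk; fold e; simpl (_ ^ 1); rewrite Rmult_1_r.
    pose proof (Cmod_rt_inv3 t) as I3; pose proof (Cmod_rt_ge1 t); pose proof (rtp_ge_half t).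
    set (r := Cmod (rt t)) in *; set (p := rtp t) in *.
    assert (Y : a * r * exp (- (a * p)) <= 2).
    { pose proof (exp_ineq1_le (a * p)) as X; rewrite exp_Ropp.
      apply Rmult_le_reg_r with (exp (a * p)); [apply exp_pos|].
      rewrite Rmult_assoc, Rinv_l, Rmult_1_r by (pose proof (exp_pos (a * p)); lra). nra. }
    assert (0 < / r ^ 3) by (apply Rinv_0_lt_compat, pow_lt; lra).
    pose proof (exp_pos (- (a * p))).
    replace (a * (r * / r ^ 3 * (e * exp (- (a * p))))) with ((a * r * exp (- (a * p))) * (e * / r ^ 3)) by ring.
    apply Rle_trans with (2 * (e * (3 * gd t))); [|lra].
    apply Rmult_le_compat; [|nra|exact Y|nra].
    apply Rmult_le_pos; [nra|lra]. }
assert (K2 : Rabs (a * Ik 1 a) <= 2 * M * (3 * e * (a * (1 + M))) + 48 * e / sqrt (1 + M)).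
{ unfold Ik; rewrite <- (IntR_scal a _ _ (dom_fk 1 a a ltac:(lra))).
  replace (IntR (fun t => a * Re (fk 1 a t))) with (IntR (fun t => a * Re (fk 1 a t)) - IntR (fun _ => 0))
    by (rewrite IntR_0; ring).
  replace (48 * e) with (8 * (6 * e)) by ring.
  apply IntR_close; [exact D1|apply dom_0; lra|exact HM0|].
  intros t Ht; rewrite Rminus_0_r, Rabs_mult, (Rabs_pos_eq a) by lra.
  rewrite fk_S.
  apply Rle_trans with (a * (Cmod (rt t) * Cmod (fk 0 a t))).
  - apply Rmult_le_compat_l; [lra|]; rewrite <- Cmod_mult; apply re_le_Cmod.
  - pose proof (fk0_bound a t ltac:(lra)) as X; fold e in X.
    pose proof (gd_le_1 t); pose proof (gd_pos t); pose proof (Cmod_rt_le t).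
    replace (3 * e * (a * (1 + M))) with (a * ((1 + M) * (3 * e))) by ring.
    apply Rmult_le_compat_l; [lra|]; apply Rmult_le_compat; try apply Cmod_ge_0; [lra|nra]. }
assert (K3 : Rabs (2 * Ik 2 a - 2 * Cg) <= Rabs Cg * a).
{ rewrite Ik2_eq by exact a0.
  replace (2 * (Cg * exp (- (a ^ 2 / 4))) - 2 * Cg) with (Cg * (2 * (exp (- (a ^ 2 / 4)) - 1))) by ring.
  rewrite Rabs_mult; apply Rmult_le_compat_l; [apply Rabs_pos|].
  pose proof (exp_ineq1_le (- (a ^ 2 / 4))) as X.
  assert (exp (- (a ^ 2 / 4)) <= 1).
  { rewrite <- exp_0; left; apply exp_increasing; nra. }
  rewrite Rabs_left1 by lra; nra. }
replace (Ik 0 0 - 2 * Cg) with (- (Ik 0 a - Ik 0 0) + ((2 * Ik 2 a - 2 * Cg) + - (a * Ik 1 a))) by lra.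
eapply Rle_trans; [apply Rabs_triang|]; rewrite Rabs_Ropp.
eapply Rle_trans; [apply Rplus_le_compat_l, Rabs_triang|]; rewrite Rabs_Ropp.
replace (72 * e / sqrt (1 + M)) with (24 * e / sqrt (1 + M) + 48 * e / sqrt (1 + M)) in HM by (unfold Rdiv; ring).
unfold c in a2. nra.
Qed.

(** * The limiting integrand for the height and its integral *)

Definition gE (x t : R) : C :=
  (2 * (kapf t * kapf t) * cexp (kapf t * RtoC x) /
    ((cexp (kapf t * RtoC x) - 1) * (cexp (kapf t * RtoC x) - 1)) * cexp (sc t))%C.

Lemma Re_kapf_x (x t : R) : Re (kapf t * RtoC x)%C = lambda * x * rtp t.
Proof. rewrite re_scal_r; unfold kapf; rewrite re_scal_l; simpl; ring. Qed.

Lemma cexp_kapf_bounds (x0 x t : R) : 0 < x0 <= x ->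
  let u := cexp (- (kapf t * RtoC x)) in
  Cmod u = exp (- (lambda * x * rtp t)) /\ Cmod u <= exp (- (lambda * x0)) /\
  exp (- (lambda * x0)) < 1 /\ 1 - exp (- (lambda * x0)) <= Cmod (1 - u)%C.
Proof.
intros Hx u; pose proof lambda_pos as L0; pose proof (rtp_ge1 t) as p1.
assert (E : Cmod u = exp (- (lambda * x * rtp t))).
{ unfold u; rewrite Cmod_cexp, re_opp, Re_kapf_x; reflexivity. }
assert (H2 : Cmod u <= exp (- (lambda * x0))).
{ rewrite E; assert (lambda * x0 * 1 <= lambda * x * rtp t) by (apply Rmult_le_compat; nra).
  destruct (Rle_lt_or_eq_dec (- (lambda * x * rtp t)) (- (lambda * x0))) as [Hl|Hl]; [lra| |].
  - left; now apply exp_increasing.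
  - right; now rewrite Hl. }
repeat split; [exact E|exact H2| |].
- rewrite <- exp_0; apply exp_increasing; nra.
- pose proof (Cmod_1_minus u); lra.
Qed.

(** Written in [u = exp (- kappa x)] the quotient becomes [u / (1 - u)^2], the sum of [k u^k], with
    [|u|] bounded away from 1. *)
Lemma gE_alt (x t : R) : 0 < x ->
  gE x t = (RtoC (2 * lambda ^ 2) * (rt t * rt t) * cexp (sc t) *
    (cexp (- (kapf t * RtoC x)) / ((1 - cexp (- (kapf t * RtoC x))) * (1 - cexp (- (kapf t * RtoC x))))))%C.
Proof.
intros Hx; destruct (cexp_kapf_bounds x x t ltac:(lra)) as [_ [_ [H3 H4]]].
assert (E0 := cexp_neq0 (kapf t * RtoC x)).
assert (N : (1 - cexp (- (kapf t * RtoC x)))%C <> 0) by (apply Cmod_gt_0; lra).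
rewrite cexp_opp in *; unfold gE.
set (X := cexp (kapf t * RtoC x)) in *.
assert (N2 : (X - 1)%C <> 0).
{ intros E; apply N; replace (1 - / X)%C with ((X - 1) / X)%C by (field; exact E0).
  rewrite E; unfold Cdiv; ring. }
rewrite kapf_sqr, <- rt_sqr, RtoC_mult; field; auto.
Qed.

Lemma gE_continuous (x t : R) : 0 < x -> continuous (fun u => Re (gE x u)) t.
Proof.
intros Hx.
destruct (cexp_kapf_bounds x x t ltac:(lra)) as [_ [_ [H3 H4]]].
assert (N : (1 - cexp (- (1) * (RtoC lambda * rt t * RtoC x)))%C <> 0).
{ apply Cmod_gt_0.
  replace (- (1) * (RtoC lambda * rt t * RtoC x))%C with (- (kapf t * RtoC x))%C by (unfold kapf; ring); lra. }
set (U := fun v => cexp (- (1) * (RtoC lambda * rt v * RtoC x))).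
assert (D1 := cder_cexp _ _ _ (cder_mult _ _ _ _ _ (cder_const (- (1))%C t) (cder_mult _ _ _ _ _ (cder_mult _ _ _ _ _
  (cder_const (RtoC lambda) t) (cder_rt t)) (cder_const (RtoC x) t)))).
assert (D2 := cder_minus _ _ _ _ _ (cder_const 1 t) D1).
assert (D3 := cder_mult _ _ _ _ _ D2 D2).
assert (D4 := cder_inv _ _ _ (Cmult_neq_0 _ _ N N) D3).
assert (D5 := cder_mult _ _ _ _ _ (cder_mult _ _ _ _ _ (cder_mult _ _ _ _ _ (cder_const (RtoC (2 * lambda ^ 2)) t)
  (cder_mult _ _ _ _ _ (cder_rt t) (cder_rt t))) (cder_cexp _ _ _ (cder_sc t)))
  (cder_mult _ _ _ _ _ D1 D4)).
destruct D5 as [D5 _].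
apply (ex_derive_continuous (V := R_NormedModule)); eexists.
eapply is_derive_Rext; [|exact D5].
intros v; cbv beta; rewrite gE_alt by exact Hx.
replace (- (1) * (RtoC lambda * rt v * RtoC x))%C with (- (kapf v * RtoC x))%C by (unfold kapf; ring).
reflexivity.
Qed.

Lemma Cmod_fk5 (x t : R) : Cmod (rt t * rt t)%C * (exp 1 * exp (- (lambda * x * rtp t))) = Cmod (fk 5 (lambda * x) t).
Proof.
rewrite Cmod_fk, Cmod_mult; pose proof (Cmod_rt_ge1 t); field; lra.
Qed.

Lemma Cmod_cexp_sc (t : R) : Cmod (cexp (sc t)) = exp 1.
Proof. rewrite Cmod_cexp; reflexivity. Qed.

(** The bound depends on [x0] only, as uniformity in [x] requires: [1 / (1 - u)^2] is bounded, and
    the remaining factor [u] dampens the growth of [rt^2]. *)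
Lemma dom_gE (x0 : R) : 0 < x0 -> exists B, forall x, x0 <= x -> dom B (fun t => Re (gE x t)).
Proof.
intros Hx0; pose proof lambda_pos as L0.
set (q0 := exp (- (lambda * x0))).
assert (Hq : 0 < q0 < 1).
{ split; [apply exp_pos|]; unfold q0; rewrite <- exp_0; apply exp_increasing; nra. }
assert (l2 : 0 < 2 * lambda ^ 2) by nra.
assert (iq : 0 < / (1 - q0) ^ 2) by (apply Rinv_0_lt_compat, pow_lt; lra).
assert (Bp : 0 <= Bk 5 (lambda * x0)) by (apply Bk_ge0; nra).
exists (2 * lambda ^ 2 * / (1 - q0) ^ 2 * Bk 5 (lambda * x0)).
intros x Hx; split; [|split].
- apply Rmult_le_pos; [apply Rmult_le_pos; lra|exact Bp].
- intros t; apply gE_continuous; lra.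
- intros t; eapply Rle_trans; [apply re_le_Cmod|].
  rewrite gE_alt by lra.
  destruct (cexp_kapf_bounds x0 x t ltac:(lra)) as [H1 [H2 [H3 H4]]]; fold q0 in H2, H3, H4.
  set (u := cexp (- (kapf t * RtoC x))) in *.
  assert (N : (1 - u)%C <> 0) by (apply Cmod_gt_0; lra).
  rewrite !(Cmod_mult _ (_ / _)%C), Cmod_div by (now apply Cmult_neq_0).
  rewrite !(Cmod_mult _ (cexp _)), Cmod_cexp_sc, (Cmod_mult (RtoC _)), Cmod_R, Rabs_pos_eq by lra.
  rewrite (Cmod_mult (1 - u)%C), H1.
  assert (I : / (Cmod (1 - u)%C * Cmod (1 - u)%C) <= / (1 - q0) ^ 2).
  { apply Rinv_le_contravar; [apply pow_lt; lra|]; simpl; rewrite Rmult_1_r; apply Rmult_le_compat; lra. }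
  assert (I0 : 0 < / (Cmod (1 - u)%C * Cmod (1 - u)%C)) by (apply Rinv_0_lt_compat; nra).
  replace (2 * lambda ^ 2 * Cmod (rt t * rt t) * exp 1 *
    (exp (- (lambda * x * rtp t)) / (Cmod (1 - u) * Cmod (1 - u)))) with
    (2 * lambda ^ 2 * / (Cmod (1 - u)%C * Cmod (1 - u)%C) *
       (Cmod (rt t * rt t)%C * (exp 1 * exp (- (lambda * x * rtp t))))) by (unfold Rdiv; ring).
  rewrite Cmod_fk5.
  pose proof (fk_bound 5 (lambda * x0) (lambda * x) t ltac:(nra)) as FB.
  replace (2 * lambda ^ 2 * / (1 - q0) ^ 2 * Bk 5 (lambda * x0) * gd t) with
    (2 * lambda ^ 2 * / (1 - q0) ^ 2 * (Bk 5 (lambda * x0) * gd t)) by ring.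
  apply Rmult_le_compat; [nra|apply Cmod_ge_0|apply Rmult_le_compat_l; lra|exact FB].
Qed.

(** Finite form of the sum of [k u^k] with explicit remainder. The existential isolates the complex
    partial sum, so that it can be multiplied by any [a] before real parts are taken. *)
Lemma geom_deriv_sum (u : C) (N : nat) : (1 - u)%C <> 0 -> exists sg : C,
  sg = (u / ((1 - u) * (1 - u)) -
      u ^ S N * (RtoC (INR (S N)) - RtoC (INR N) * u) / ((1 - u) * (1 - u)))%C /\
  forall (a : C), Re (a * sg)%C = sum_f_R0 (fun k => INR k * Re (a * u ^ k)%C) N.
Proof.
intros H; eexists; split; [reflexivity|]; intros a; induction N.
- unfold sum_f_R0; change (INR 0) with 0; change (INR 1) with 1; rewrite Rmult_0_l, Cpow_1_r.
  replace (a * _)%C with (RtoC 0) by (field; exact H); reflexivity.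
- rewrite tech5, <- IHN, <- re_scal_l, <- re_plus; f_equal.
  rewrite !S_INR, !RtoC_plus, !Cpow_S; field; exact H.
Qed.

Definition theta_term (x : R) (j : nat) : R :=
  (INR (S j) ^ 4 * lambda ^ 4 * x ^ 4 - 6 * INR (S j) ^ 2 * lambda ^ 2 * x ^ 2) *
  exp (- (INR (S j) ^ 2 * lambda ^ 2 * x ^ 2 / 4)).

(** Termwise integration of the expansion in powers of [u]: the [k]-th term is
    [2 lambda^2 k Ik 5 (k lambda x)], evaluated by [Ik5_eq]. The remainder after [N] terms is
    controlled through [dom], and [IntR_bound] carries this over to the integral. *)
Lemma IntR_gE (x : R) : 0 < x ->
  is_series (fun j => Cg * lambda / (4 * x) * theta_term x j) (IntR (fun t => Re (gE x t))).
Proof.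
intros Hx; pose proof lambda_pos as L0.
destruct (dom_gE x Hx) as [B HB]; assert (D := HB x (Rle_refl x)).
set (q0 := exp (- (lambda * x))).
assert (Hq : 0 < q0 < 1).
{ split; [apply exp_pos|]; unfold q0; rewrite <- exp_0; apply exp_increasing; nra. }
assert (l2 : 0 < 2 * lambda ^ 2) by nra.
assert (lx : 0 < lambda * x) by nra.
assert (iq : 0 < / (1 - q0) ^ 2) by (apply Rinv_0_lt_compat, pow_lt; lra).
assert (Bp : 0 <= Bk 5 (lambda * x)) by (now apply Bk_ge0).
set (part := fun N t => sum_f_R0 (fun k => 2 * lambda ^ 2 * INR k * Re (fk 5 (INR k * (lambda * x)) t)) N).
assert (dk : forall k, (0 < k)%nat -> 0 < lambda * x <= INR k * (lambda * x)).
{ intros k Hk; assert (1 <= INR k) by (change 1 with (INR 1); apply le_INR; lia); nra. }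
assert (Dp : forall N, exists b, dom b (part N) /\
   IntR (part N) = sum_f_R0 (fun k => 2 * lambda ^ 2 * INR k * Ik 5 (INR k * (lambda * x))) N).
{ induction N.
  - exists 0; unfold part; simpl; split.
    + eapply dom_ext; [|exact (dom_0 0 (Rle_refl 0))]; intros t; simpl; ring.
    + rewrite (IntR_ext _ (fun _ => 0)) by (intros t; ring); rewrite IntR_0; ring.
  - destruct IHN as [b [IH1 IH2]].
    assert (D1 := dom_fk 5 _ _ (dk (S N) ltac:(lia))).
    assert (D2 := dom_scal (2 * lambda ^ 2 * INR (S N)) _ _ D1).
    eexists; split.
    + eapply dom_ext; [|exact (dom_plus _ _ _ _ IH1 D2)]; intros t; reflexivity.
    + rewrite tech5, <- IH2; unfold Ik at 1; rewrite <- (IntR_scal _ _ _ D1), <- (IntR_plus _ _ _ _ IH1 D2).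
      apply IntR_ext; intros t; reflexivity. }
(* One factor [u] of [u^(N+1)] is kept to produce the decaying [fk 5]; the other [N] are bounded by
   [q0^N]. *)
set (err := fun N => 2 * lambda ^ 2 * / (1 - q0) ^ 2 * Bk 5 (lambda * x) * (2 * (INR (S N) * q0 ^ N))).
assert (Herr : forall N, Rabs (IntR (fun t => Re (gE x t)) - IntR (part N)) <= 4 * err N).
{ intros N; destruct (Dp N) as [b [D1 _]].
  assert (D2 := dom_scal (-1) _ _ D1).
  replace (IntR (fun t => Re (gE x t)) - IntR (part N)) with
    (IntR (fun t => Re (gE x t) + -1 * part N t)).
  2:{ rewrite (IntR_plus _ _ _ _ D D2), (IntR_scal _ _ _ D1); ring. }
  apply IntR_bound; split; [|split].
  - unfold err; apply Rmult_le_pos; [apply Rmult_le_pos; [apply Rmult_le_pos; lra|exact Bp]|].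
    apply Rmult_le_pos; [lra|]; apply Rmult_le_pos; [apply pos_INR|apply pow_le; lra].
  - apply (dom_plus _ _ _ _ D D2).
  - intros t.
    destruct (cexp_kapf_bounds x x t ltac:(lra)) as [H1 [H2 [H3 H4]]]; fold q0 in H2, H3, H4.
    set (u := cexp (- (kapf t * RtoC x))) in *.
    assert (N0 : (1 - u)%C <> 0) by (apply Cmod_gt_0; lra).
    set (al := (RtoC (2 * lambda ^ 2) * (rt t * rt t) * cexp (sc t))%C).
    destruct (geom_deriv_sum u N N0) as [Sg [ES HS]].
    assert (Ep : part N t = Re (al * Sg)%C).
    { rewrite HS; apply sum_eq; intros k _.
      assert (Hk : (al * u ^ k)%C = (RtoC (2 * lambda ^ 2) * fk 5 (INR k * (lambda * x)) t)%C).
      { unfold al, fk, phik, u; rewrite <- cexp_INR.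
        assert (r0 := rt_neq0 t).
        replace (sc t - RtoC (INR k * (lambda * x)) * rt t)%C with
          (sc t + RtoC (INR k) * - (kapf t * RtoC x))%C by (unfold kapf; rewrite !RtoC_mult; ring).
        rewrite cexp_plus; field; exact r0. }
      rewrite Hk, re_scal_l; ring. }
    assert (Eg : gE x t = (al * (u / ((1 - u) * (1 - u))))%C) by (rewrite gE_alt by exact Hx; reflexivity).
    assert (Ed : Re (gE x t) + -1 * part N t =
      Re (al * (u ^ S N * (RtoC (INR (S N)) - RtoC (INR N) * u) / ((1 - u) * (1 - u))))%C).
    { rewrite Ep, Eg.
      replace (al * (u ^ S N * (RtoC (INR (S N)) - RtoC (INR N) * u) / ((1 - u) * (1 - u))))%C
        with (al * (u / ((1 - u) * (1 - u))) + - (al * Sg))%C by (rewrite ES; ring).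
      rewrite re_plus, re_opp; ring. }
    rewrite Ed; eapply Rle_trans; [apply re_le_Cmod|].
    rewrite Cmod_mult, Cmod_div, !(Cmod_mult (u ^ S N)%C), (Cmod_mult (1 - u)%C), Cmod_pow
      by (now apply Cmult_neq_0).
    unfold al; rewrite !(Cmod_mult _ (cexp _)), Cmod_cexp_sc, (Cmod_mult (RtoC _)), Cmod_R, Rabs_pos_eq by lra.
    set (m := Cmod u) in *; assert (m0 : 0 <= m) by apply Cmod_ge_0.
    assert (I : / (Cmod (1 - u)%C * Cmod (1 - u)%C) <= / (1 - q0) ^ 2).
    { apply Rinv_le_contravar; [apply pow_lt; lra|]; simpl; rewrite Rmult_1_r; apply Rmult_le_compat; lra. }
    assert (I0 : 0 < / (Cmod (1 - u)%C * Cmod (1 - u)%C)) by (apply Rinv_0_lt_compat; nra).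
    assert (P1 : Cmod (RtoC (INR (S N)) - RtoC (INR N) * u)%C <= 2 * INR (S N)).
    { eapply Rle_trans; [apply Cmod_triangle|]; rewrite Cmod_opp, Cmod_mult, !Cmod_R.
      rewrite !Rabs_pos_eq by apply pos_INR; fold m; rewrite S_INR; pose proof (pos_INR N); nra. }
    assert (P2 : m ^ S N <= m * q0 ^ N).
    { simpl; apply Rmult_le_compat_l; [exact m0|]; apply pow_incr; lra. }
    pose proof (fk_bound 5 (lambda * x) (lambda * x) t ltac:(lra)) as FB.
    rewrite <- Cmod_fk5, <- H1 in FB.
    pose proof (exp_pos 1); pose proof (Cmod_ge_0 (rt t * rt t)%C) as rr0.
    assert (qN : 0 <= q0 ^ N) by (apply pow_le; lra).
    assert (sN : 0 <= INR (S N)) by apply pos_INR.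
    apply Rle_trans with (2 * lambda ^ 2 * Cmod (rt t * rt t)%C * exp 1 *
      (m * q0 ^ N * (2 * INR (S N)) * / (1 - q0) ^ 2)).
    + apply Rmult_le_compat_l; [repeat apply Rmult_le_pos; lra|].
      apply Rmult_le_compat; [|lra| |exact I].
      * apply Rmult_le_pos; [apply pow_le; lra|apply Cmod_ge_0].
      * apply Rmult_le_compat; [apply pow_le; lra|apply Cmod_ge_0|exact P2|exact P1].
    + replace (2 * lambda ^ 2 * Cmod (rt t * rt t)%C * exp 1 * (m * q0 ^ N * (2 * INR (S N)) * / (1 - q0) ^ 2))
        with ((2 * lambda ^ 2 * / (1 - q0) ^ 2 * (2 * (INR (S N) * q0 ^ N))) *
          (Cmod (rt t * rt t)%C * (exp 1 * m))) by ring.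
      unfold err.
      replace (2 * lambda ^ 2 * / (1 - q0) ^ 2 * Bk 5 (lambda * x) * (2 * (INR (S N) * q0 ^ N)) * gd t)
        with ((2 * lambda ^ 2 * / (1 - q0) ^ 2 * (2 * (INR (S N) * q0 ^ N))) * (Bk 5 (lambda * x) * gd t)) by ring.
      apply Rmult_le_compat_l; [|exact FB].
      apply Rmult_le_pos; [nra|]; apply Rmult_le_pos; [lra|]; now apply Rmult_le_pos. }
assert (Hsum : forall N, sum_f_R0 (fun j => Cg * lambda / (4 * x) * theta_term x j) N = IntR (part (S N))).
{ intros N; destruct (Dp (S N)) as [_ [_ E]]; rewrite E.
  rewrite (decomp_sum _ (S N)) by lia; simpl (INR 0); rewrite Rmult_0_r, Rmult_0_l, Rplus_0_l.
  simpl pred; apply sum_eq; intros j _.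
  assert (j0 : 0 < INR (S j)) by (apply lt_0_INR; lia).
  rewrite Ik5_eq by nra; unfold theta_term.
  replace (- ((INR (S j) * (lambda * x)) ^ 2 / 4)) with (- (INR (S j) ^ 2 * lambda ^ 2 * x ^ 2 / 4)) by field.
  field; lra. }
apply is_series_Reals; intros eps He.
assert (Lim : is_lim_seq err 0).
{ unfold err.
  replace (Finite 0) with (Finite (2 * lambda ^ 2 * / (1 - q0) ^ 2 * Bk 5 (lambda * x) * (2 * 0))) by (f_equal; ring).
  apply is_lim_seq_mult'; [apply is_lim_seq_const|]; apply is_lim_seq_mult'; [apply is_lim_seq_const|].
  destruct (poly_geom q0) as [K [K0 HK]]; [lra|].
  apply (is_lim_seq_le_le (fun _ => 0) _ (fun N => K * / INR (S N))).
  - intros N; assert (s1 : 1 <= INR (S N)) by (change 1 with (INR 1); apply le_INR; lia).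
    assert (g0 : 0 <= q0 ^ N) by (apply pow_le; lra).
    split; [apply Rmult_le_pos; lra|].
    apply Rmult_le_reg_r with (INR (S N)); [lra|]; replace (K * / INR (S N) * INR (S N)) with K by (field; lra).
    eapply Rle_trans; [|apply (HK N)].
    replace (INR (S N) * q0 ^ N * INR (S N)) with (INR (S N) ^ 2 * q0 ^ N) by ring.
    apply Rmult_le_compat_r; [exact g0|]; apply Rle_pow; [exact s1|lia].
  - apply is_lim_seq_const.
  - replace (Finite 0) with (Finite (K * 0)) by (f_equal; ring).
    apply is_lim_seq_mult'; [apply is_lim_seq_const|].
    apply (is_lim_seq_inv _ p_infty); [|discriminate].
    apply (is_lim_seq_incr_1 INR), is_lim_seq_INR. }
apply is_lim_seq_spec in Lim; destruct (Lim (mkposreal (eps / 4) ltac:(lra))) as [N0 HN0]; simpl in HN0.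
exists N0; intros N HN; rewrite Hsum; unfold Rdist; rewrite Rabs_minus_sym.
eapply Rle_lt_trans; [apply Herr|].
specialize (HN0 (S N) ltac:(lia)); rewrite Rminus_0_r in HN0; apply Rabs_def2 in HN0; lra.
Qed.

(** * Fourier coefficients on the circle *)

Lemma sin_IZR_PI (z : Z) : sin (IZR z * PI) = 0.
Proof. apply sin_eq_0_1; now exists z. Qed.

Lemma is_RInt_cos_full (n k : nat) : (0 < n)%nat ->
  is_RInt (fun t => cos ((INR n - INR k) / INR n * t)) (- (PI * INR n)) (PI * INR n)
    (if Nat.eqb k n then 2 * PI * INR n else 0).
Proof.
intros Hn; assert (n0 : 0 < INR n) by (now apply lt_0_INR).
destruct (Nat.eqb k n) eqn:E.
- apply Nat.eqb_eq in E; subst k.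
  apply is_RInt_ext with (fun _ => 1).
  { intros t _; replace ((INR n - INR n) / INR n * t) with 0 by (field; lra); now rewrite cos_0. }
  replace (2 * PI * INR n) with (scal (PI * INR n - - (PI * INR n)) 1)
    by (unfold scal; simpl; unfold mult; simpl; ring).
  apply (is_RInt_const (V := R_NormedModule)).
- apply Nat.eqb_neq in E.
  set (c := (INR n - INR k) / INR n).
  assert (c0 : c <> 0).
  { unfold c; intros H; apply E, INR_eq.
    assert (H1 : (INR n - INR k) / INR n * INR n = 0) by (rewrite H; ring).
    replace ((INR n - INR k) / INR n * INR n) with (INR n - INR k) in H1 by (field; lra); lra. }
  assert (P : is_RInt (fun t => cos (c * t)) (- (PI * INR n)) (PI * INR n)
    (minus ((fun t => sin (c * t) / c) (PI * INR n)) ((fun t => sin (c * t) / c) (- (PI * INR n))))).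
  { apply (is_RInt_derive (V := R_CompleteNormedModule) (fun t => sin (c * t) / c)); intros t _.
    - auto_derive; [exact I|]; field; exact c0.
    - apply (ex_derive_continuous (V := R_NormedModule)); auto_derive; exact I. }
  match type of P with is_RInt _ _ _ ?v => replace 0 with v; [exact P|] end.
  assert (Hs : c * (PI * INR n) = IZR (Z.of_nat n - Z.of_nat k) * PI).
  { rewrite minus_IZR, <- !INR_IZR_INZ; unfold c; field; lra. }
  replace (c * - (PI * INR n)) with (- (c * (PI * INR n))) by ring.
  rewrite sin_neg, Hs, sin_IZR_PI; unfold minus, plus, opp; simpl; field; exact c0.
Qed.

(** Cauchy's formula with the angle stretched to [[-PI n, PI n]]: on the circle
    [z^n = rho^n exp (- s)], so [exp s] plays the part of [z^(-n)]. The power series converges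
    uniformly on the circle, which permits termwise integration. *)
Lemma fourier_coef (a : nat -> R) (n : nat) : (0 < n)%nat -> acv a (rho * exp (- / INR n)) ->
  is_RInt (fun t => Re (CPS a (zc n t) * cexp (sc t))%C) (- (PI * INR n)) (PI * INR n)
    (2 * PI * INR n * (a n * rho ^ n)).
Proof.
intros Hn Ha; assert (n0 : 0 < INR n) by (now apply lt_0_INR).
set (R := rho * exp (- / INR n)) in *.
assert (R0 : 0 < R) by (apply Rmult_lt_0_compat; [apply rho_pos|apply exp_pos]).
set (g := fun k t => a k * (R ^ k * exp 1) * cos ((INR n - INR k) / INR n * t)).
assert (Eg : forall k t, Re (pterm a (zc n t) k * cexp (sc t))%C = g k t).
{ intros k t; unfold pterm, g, zc.
  rewrite Cpow_mult_l, Cpow_RtoC, <- cexp_INR.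
  rewrite <- !Cmult_assoc, <- cexp_plus, !re_scal_l.
  unfold R; rewrite Rpow_mult_distr.
  assert (Ee : exp (- / INR n) ^ k * exp 1 = exp (1 - INR k / INR n)).
  { rewrite exp_pow, <- exp_plus; f_equal; field; lra. }
  replace (rho ^ k * exp (- / INR n) ^ k * exp 1) with (rho ^ k * (exp (- / INR n) ^ k * exp 1)) by ring.
  rewrite Ee.
  assert (Es : (RtoC (INR k) * - (sc t / RtoC (INR n)) + sc t)%C =
    (1 - INR k / INR n, (INR n - INR k) / INR n * t)).
  { unfold sc, Cdiv; rewrite <- RtoC_inv by lra; unfold Cmult, Copp, Cplus, RtoC; simpl; f_equal; field; lra. }
  rewrite Es; unfold cexp; simpl; ring. }
set (f := fun (N : nat) t => sum_f_R0 (fun k => g k t) N).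
assert (Hf : forall N, is_RInt (f N) (- (PI * INR n)) (PI * INR n)
  (sum_f_R0 (fun k => a k * (R ^ k * exp 1) * (if Nat.eqb k n then 2 * PI * INR n else 0)) N)).
{ assert (H1 : forall k, is_RInt (g k) (- (PI * INR n)) (PI * INR n)
     (a k * (R ^ k * exp 1) * (if Nat.eqb k n then 2 * PI * INR n else 0))).
  { intros k; apply (is_RInt_scal (V := R_NormedModule)), is_RInt_cos_full, Hn. }
  induction N; [apply H1|].
  apply (is_RInt_plus (V := R_NormedModule)); [exact IHN|apply H1]. }
destruct (filterlim_RInt (V := R_CompleteNormedModule) f (- (PI * INR n)) (PI * INR n) eventually eventually_filter
  (fun t => Re (CPS a (zc n t) * cexp (sc t))%C) _ Hf) as [If [H1 H2]].
- apply filterlim_locally; intros eps.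
  pose proof Ha as Hs; unfold acv in Hs.
  assert (e1 := exp_pos 1).
  destruct (Cauchy_ex_series (K := R_AbsRing) (V := R_CompleteNormedModule) _ Hs
    (mkposreal (eps / (2 * exp 1)) ltac:(apply Rdiv_lt_0_compat; [apply cond_pos|lra]))) as [N HN].
  exists N; intros M HM t.
  assert (Hm : Cmod (zc n t) = R) by (apply Cmod_zc, Hn).
  assert (Hc : is_series (fun k => g k t) (Re (CPS a (zc n t) * cexp (sc t))%C)).
  { assert (L := CPS_correct a (zc n t) ltac:(rewrite Hm; exact Ha)).
    apply (is_CS_scal (cexp (sc t))) in L; destruct L as [L _].
    rewrite Cmult_comm in L; eapply is_series_ext; [|exact L].
    intros k; cbv beta; rewrite Cmult_comm; apply Eg. }
  assert (Bd : forall P, (M <= P)%nat ->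
    Rabs (sum_f_R0 (fun k => g k t) P - sum_f_R0 (fun k => g k t) M) <= eps / 2).
  { intros P HP; destruct (Nat.eq_dec M P) as [->|Hne].
    - rewrite Rminus_diag, Rabs_R0; pose proof (cond_pos eps); lra.
    - specialize (HN (S M) P ltac:(lia) ltac:(lia)); simpl in HN.
      rewrite <- !sum_n_Reals.
      replace (sum_n (fun k => g k t) P - sum_n (fun k => g k t) M) with (sum_n_m (fun k => g k t) (S M) P)
        by (rewrite (sum_n_m_sum_n (G := R_AbelianGroup)) by lia; reflexivity).
      apply Rle_trans with (exp 1 * Rabs (sum_n_m (fun k => Rabs (a k) * R ^ k) (S M) P)).
      + apply Rle_trans with (sum_n_m (fun k => exp 1 * (Rabs (a k) * R ^ k)) (S M) P).
        * eapply Rle_trans; [apply (norm_sum_n_m (V := R_NormedModule))|].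
          apply sum_n_m_le; intros k; unfold g.
          rewrite !Rabs_mult, (Rabs_pos_eq (R ^ k)), (Rabs_pos_eq (exp 1)) by (try (apply pow_le; lra); lra).
          pose proof (COS_bound ((INR n - INR k) / INR n * t)) as Cb.
          assert (Rabs (cos ((INR n - INR k) / INR n * t)) <= 1) by (apply Rabs_le; lra).
          assert (0 <= Rabs (a k) * (R ^ k * exp 1)).
          { apply Rmult_le_pos; [apply Rabs_pos|]; apply Rmult_le_pos; [apply pow_le; lra|lra]. }
          nra.
        * assert (Em : sum_n_m (fun k => exp 1 * (Rabs (a k) * R ^ k)) (S M) P =
            exp 1 * sum_n_m (fun k => Rabs (a k) * R ^ k) (S M) P)
            by exact (sum_n_m_mult_l (K := R_Ring) (exp 1) _ _ _).
          rewrite Em; apply Rmult_le_compat_l; [lra|apply Rle_abs].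
      + apply Rle_trans with (exp 1 * (eps / (2 * exp 1))).
        * apply Rmult_le_compat_l; [lra|]; left; exact HN.
        * right; field; lra. }
  assert (Fin : Rabs (Re (CPS a (zc n t) * cexp (sc t))%C - f M t) <= eps / 2).
  { assert (L2 : is_lim_seq (fun P => Rabs (sum_n (fun k => g k t) P - f M t))
      (Rabs (Re (CPS a (zc n t) * cexp (sc t))%C - f M t))).
    { apply is_lim_seq_continuous with (f := Rabs) (l := Re (CPS a (zc n t) * cexp (sc t))%C - f M t);
        [apply Rcontinuity_abs|]. apply is_lim_seq_minus'; [exact Hc|apply is_lim_seq_const]. }
    apply (is_lim_seq_le_loc _ (fun _ => eps / 2) _ (eps / 2)) with (2 := L2); [|apply is_lim_seq_const].
    exists M; intros P HP; rewrite sum_n_Reals; apply Bd, HP. }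
  rewrite Rabs_minus_sym in Fin; pose proof (cond_pos eps).
  apply (Rle_lt_trans _ (eps / 2)); [exact Fin|lra].
- replace (2 * PI * INR n * (a n * rho ^ n)) with If; [exact H2|].
  assert (E : is_lim_seq (fun N => sum_f_R0 (fun k => a k * (R ^ k * exp 1) *
     (if Nat.eqb k n then 2 * PI * INR n else 0)) N) (2 * PI * INR n * (a n * rho ^ n))).
  { apply is_lim_seq_ext_loc with (fun _ => 2 * PI * INR n * (a n * rho ^ n)); [|apply is_lim_seq_const].
    exists n; intros N HN.
    assert (Ev : a n * (R ^ n * exp 1) * (2 * PI * INR n) = 2 * PI * INR n * (a n * rho ^ n)).
    { unfold R; rewrite Rpow_mult_distr.
      assert (H : exp (- / INR n) ^ n * exp 1 = 1).
      { rewrite exp_pow, <- exp_plus; replace (INR n * - / INR n + 1) with 0 by (field; lra); apply exp_0. }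
      replace (rho ^ n * exp (- / INR n) ^ n * exp 1) with (rho ^ n * (exp (- / INR n) ^ n * exp 1)) by ring.
      rewrite H; ring. }
    rewrite <- Ev; clear - HN Hn; induction HN.
    - destruct n as [|n]; [lia|]; rewrite tech5, Nat.eqb_refl.
      rewrite (sum_eq_R0 _ n); [ring|].
      intros k Hk; replace (Nat.eqb k (S n)) with false by (symmetry; apply Nat.eqb_neq; lia); ring.
    - rewrite tech5, <- IHHN.
      replace (Nat.eqb (S m) n) with false by (symmetry; apply Nat.eqb_neq; lia); ring. }
  apply is_lim_seq_unique in E.
  assert (H1' : is_lim_seq (fun N => sum_f_R0 (fun k => a k * (R ^ k * exp 1) *
     (if Nat.eqb k n then 2 * PI * INR n else 0)) N) If) by exact H1.
  apply is_lim_seq_unique in H1'; rewrite H1' in E; now injection E.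
Qed.

(** * Coefficient asymptotics *)

Lemma rt_lip (s t : R) : Cmod (rt s - rt t)%C <= Rabs (s - t).
Proof.
assert (E : ((rt s - rt t) * (rt s + rt t))%C = (RtoC (s - t) * Ci)%C).
{ replace ((rt s - rt t) * (rt s + rt t))%C with (rt s * rt s - rt t * rt t)%C by ring.
  rewrite !rt_sqr; unfold sc, RtoC, Ci, Cminus, Cplus, Copp, Cmult; simpl; f_equal; ring. }
assert (E2 : Cmod (rt s - rt t)%C * Cmod (rt s + rt t)%C = Rabs (s - t)).
{ rewrite <- Cmod_mult, E, Cmod_mult, Cmod_R.
  replace (Cmod Ci) with 1; [ring|]. unfold Cmod, Ci; simpl.
  replace (0 * (0 * 1) + 1 * (1 * 1)) with 1 by ring; now rewrite sqrt_1. }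
assert (1 <= Cmod (rt s + rt t)%C).
{ eapply Rle_trans; [|eapply Rle_trans; [apply Rle_abs|apply re_le_Cmod]].
  rewrite re_plus; simpl; pose proof (rtp_ge1 s); pose proof (rtp_ge1 t); lra. }
pose proof (Cmod_ge_0 (rt s - rt t)%C); nra.
Qed.

(* Neighbourhoods of [n = oo, x = x0, t = t0], where [n], [h] and [x] are tied by [Q]. *)
Definition near_inf (Q : nat -> nat -> R -> Prop) (x0 t0 : R) (P : nat * nat * (R * R) -> Prop) : Prop :=
  exists d : posreal, forall n h x t, Q n h x -> / d < INR n -> Rabs (x - x0) < d -> Rabs (t - t0) < d ->
    P ((n, h), (x, t)).

Global Instance near_inf_filter Q x0 t0 : Filter (near_inf Q x0 t0).
Proof.
constructor.
- exists (mkposreal 1 Rlt_0_1); auto.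
- intros P P' [d H] [d' H'].
  assert (m0 : 0 < Rmin d d') by (apply Rmin_glb_lt; apply cond_pos).
  exists (mkposreal _ m0); simpl; intros n h x t HQ Hn Hx Ht.
  pose proof (Rmin_l d d'); pose proof (Rmin_r d d').
  pose proof (cond_pos d); pose proof (cond_pos d').
  split; [apply H|apply H']; auto; try lra; eapply Rle_lt_trans; [|exact Hn| |exact Hn];
    apply Rinv_le_contravar; assumption.
- intros P P' HP [d H]; exists d; intros; apply HP; auto.
Qed.

Lemma near_inf_n Q x0 t0 (M : R) : near_inf Q x0 t0 (fun i => M < INR (fst (fst i))).
Proof.
assert (p : 0 < / (Rabs M + 1)) by (apply Rinv_0_lt_compat; pose proof (Rabs_pos M); lra).
exists (mkposreal _ p); simpl; intros n h x t _ Hn _ _; rewrite Rinv_inv in Hn.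
pose proof (Rle_abs M); lra.
Qed.

Lemma near_inf_x Q x0 t0 : Clim (near_inf Q x0 t0) (fun i => RtoC (fst (snd i))) (RtoC x0).
Proof.
intros eps He; exists (mkposreal _ He); simpl; intros n h x t _ _ Hx _.
rewrite <- RtoC_minus, Cmod_R; exact Hx.
Qed.

Lemma near_inf_t Q x0 t0 : Clim (near_inf Q x0 t0) (fun i => RtoC (snd (snd i))) (RtoC t0).
Proof.
intros eps He; exists (mkposreal _ He); simpl; intros n h x t _ _ _ Ht.
rewrite <- RtoC_minus, Cmod_R; exact Ht.
Qed.

Lemma near_inf_rt Q x0 t0 : Clim (near_inf Q x0 t0) (fun i => rt (snd (snd i))) (rt t0).
Proof.
intros eps He; exists (mkposreal _ He); simpl; intros n h x t _ _ _ Ht.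
eapply Rle_lt_trans; [apply rt_lip|exact Ht].
Qed.

(** Pointwise limits become uniform by compactness of the rectangle: around each of its points [f]
    and [g] are both close to the common limit, and [dl] is the resulting gauge. Taking the limit
    function itself for [g] yields uniform convergence. *)
Lemma near_inf_compact Q (a b M : R) (f g : nat * nat * (R * R) -> C) (l : R -> R -> C) (eps : R) : 0 < eps ->
  (forall x0 t0, a <= x0 <= b -> Rabs t0 <= M ->
    Clim (near_inf Q x0 t0) f (l x0 t0) /\ Clim (near_inf Q x0 t0) g (l x0 t0)) ->
  exists N, forall n h x t, (N <= n)%nat -> Q n h x -> a <= x <= b -> Rabs t <= M ->
    Cmod (f ((n, h), (x, t)) - g ((n, h), (x, t)))%C < eps.
Proof.
intros He H.
assert (H1 : forall x0 t0, exists d : posreal, a <= x0 <= b -> Rabs t0 <= M ->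
  forall n h x t, Q n h x -> / d < INR n -> Rabs (x - x0) < d -> Rabs (t - t0) < d ->
   Cmod (f ((n, h), (x, t)) - g ((n, h), (x, t)))%C < eps).
{ intros x0 t0; destruct (classic (a <= x0 <= b /\ Rabs t0 <= M)) as [[C1 C2]|C].
  - destruct (H x0 t0 C1 C2) as [L1 L2].
    destruct (Clim_minus _ _ _ _ _ L1 L2 eps He) as [d Hd].
    exists d; intros _ _ n h x t K1 K2 K3 K4; specialize (Hd n h x t K1 K2 K3 K4); cbv beta in Hd.
    match type of Hd with Cmod ?u < _ => replace u with (f ((n, h), (x, t)) - g ((n, h), (x, t)))%C in Hd
      by ring end; exact Hd.
  - exists (mkposreal 1 Rlt_0_1); intros K1 K2; tauto. }
set (dl := fun x0 t0 => proj1_sig (constructive_indefinite_description _ (H1 x0 t0))).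
destruct (compactness_value_2d a b (- M) M dl) as [d Hd].
assert (P : exists N, / d < INR N).
{ destruct (archimed (/ d)) as [A _]; exists (Z.to_nat (up (/ d))).
  assert (0 < / d) by (apply Rinv_0_lt_compat, cond_pos).
  rewrite INR_IZR_INZ, Z2Nat.id; [exact A|]; apply le_IZR; lra. }
destruct P as [N HN]; exists N; intros n h x t Hn HQ Hx Ht.
assert (Ht' : - M <= t <= M) by (apply Rabs_le_between; exact Ht).
(* The compactness lemma provides a covering point only under a double negation. *)
apply NNPP; intros K; apply (Hd x t Hx Ht'); intros [u [v [U [V [D1 [D2 D3]]]]]]; apply K.
unfold dl in D1, D2, D3; destruct (constructive_indefinite_description _ (H1 u v)) as [e Ee]; simpl in *.
apply (Ee U ltac:(apply Rabs_le; exact V)); auto.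
eapply Rle_lt_trans; [apply Rinv_le_contravar; [apply cond_pos|exact D3]|].
eapply Rlt_le_trans; [exact HN|apply le_INR, Hn].
Qed.

Lemma PI_INR_ge (M : R) : exists N, forall n, (N <= n)%nat -> M <= PI * INR n.
Proof.
destruct (archimed M) as [A _]; exists (Z.to_nat (up M)); intros n Hn.
apply le_INR in Hn; pose proof PI2_3_2; unfold PI2 in *.
assert (M <= INR (Z.to_nat (up M))).
{ destruct (Z_le_dec 0 (up M)) as [Hz|Hz].
  - rewrite INR_IZR_INZ, Z2Nat.id by exact Hz; lra.
  - pose proof (pos_INR (Z.to_nat (up M))).
    assert (up M <= 0)%Z by lia. apply IZR_le in H1; lra. }
pose proof (pos_INR n); nra.
Qed.

(* Dominated convergence for the Fourier integrals, uniformly in [x]. *)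
Lemma fourier_limit Q (a b B : R) (f : nat * nat * (R * R) -> C) (l : R -> R -> C) (n0 : nat) (eps : R) : 0 < eps ->
  0 <= B ->
  (forall x, a <= x <= b -> dom B (fun t => Re (l x t))) ->
  (forall n h x, (n0 <= n)%nat -> Q n h x -> a <= x <= b ->
     ex_RInt (fun t => Re (f ((n, h), (x, t)))) (- (PI * INR n)) (PI * INR n)) ->
  (forall n h x t, (n0 <= n)%nat -> Q n h x -> a <= x <= b -> Rabs t <= PI * INR n ->
     Cmod (f ((n, h), (x, t))) <= B * gd t) ->
  (forall x0 t0, a <= x0 <= b -> 
    Clim (near_inf Q x0 t0) f (l x0 t0) /\ Clim (near_inf Q x0 t0) (fun i => l (fst (snd i)) (snd (snd i))) (l x0 t0)) ->
  exists N, forall n h x, (N <= n)%nat -> Q n h x -> a <= x <= b ->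
    Rabs (RInt (fun t => Re (f ((n, h), (x, t)))) (- (PI * INR n)) (PI * INR n) - IntR (fun t => Re (l x t))) <= eps.
Proof.
intros He B0 Hdom Hex Hbd Hlim.
destruct (inv_sqrt_small (8 * B) (eps / 2) ltac:(lra) ltac:(lra)) as [M [M0 HM]].
assert (e' : 0 < eps / 2 / (2 * M + 1)) by (apply Rdiv_lt_0_compat; lra).
destruct (near_inf_compact Q a b M f (fun i => l (fst (snd i)) (snd (snd i))) l _ e'
  (fun x0 t0 Hx _ => Hlim x0 t0 Hx)) as [N1 HN1].
destruct (PI_INR_ge M) as [N2 HN2].
exists (n0 + (N1 + N2))%nat; intros n h x Hn HQ Hx.
eapply Rle_trans.
{ apply (int_close _ _ B (PI * INR n) M (eps / 2 / (2 * M + 1))).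
  - now apply Hdom.
  - split; [exact M0|apply HN2; lia].
  - apply Hex; auto; lia.
  - intros t Ht; eapply Rle_trans; [apply re_le_Cmod|]; apply Hbd; auto; lia.
  - intros t Ht; left; replace (Re (f (n, h, (x, t))) - Re (l x t)) with (Re (f (n, h, (x, t)) - l x t)%C) by (unfold Cminus; rewrite re_plus, re_opp; ring).
    eapply Rle_lt_trans; [apply re_le_Cmod|].
    exact (HN1 n h x t ltac:(lia) HQ Hx Ht). }
assert (2 * M * (eps / 2 / (2 * M + 1)) <= eps / 2).
{ apply Rmult_le_reg_r with (2 * M + 1); [lra|].
  replace (2 * M * (eps / 2 / (2 * M + 1)) * (2 * M + 1)) with (2 * M * (eps / 2)) by (field; lra). nra. }
specialize (HM M (Rle_refl _)). lra.
Qed.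

Lemma cexp_kapf_neq1 (x t : R) : 0 < x -> (cexp (kapf t * RtoC x) - 1)%C <> 0.
Proof.
intros Hx E; destruct (cexp_kapf_bounds x x t ltac:(lra)) as [_ [_ [H3 H4]]].
rewrite cexp_opp in H4; replace (cexp (kapf t * RtoC x)) with (cexp (kapf t * RtoC x) - 1 + 1)%C in H4 by ring; rewrite E, Cplus_0_l in H4.
replace (1 - / 1)%C with (RtoC 0) in H4 by (field; apply RtoC_neq0; lra).
rewrite Cmod_0 in H4; lra.
Qed.

Lemma near_inf_gE Q x0 t0 : 0 < x0 ->
  Clim (near_inf Q x0 t0) (fun i => gE (fst (snd i)) (snd (snd i))) (gE x0 t0).
Proof.
intros Hx.
assert (FF := near_inf_filter Q x0 t0).
pose proof (near_inf_x Q x0 t0) as Lx; pose proof (near_inf_t Q x0 t0) as Lt; pose proof (near_inf_rt Q x0 t0) as Lr.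
assert (Lk : Clim (near_inf Q x0 t0) (fun i => kapf (snd (snd i))) (kapf t0)).
{ apply Clim_mult; [exact FF|apply Clim_const; exact FF|exact Lr]. }
assert (LE : Clim (near_inf Q x0 t0) (fun i => cexp (kapf (snd (snd i)) * RtoC (fst (snd i)))) (cexp (kapf t0 * RtoC x0))).
{ apply Clim_cexp; [exact FF|]; apply Clim_mult; [exact FF|exact Lk|exact Lx]. }
assert (L1 : Clim (near_inf Q x0 t0) (fun i => cexp (kapf (snd (snd i)) * RtoC (fst (snd i))) - 1)%C (cexp (kapf t0 * RtoC x0) - 1)%C).
{ apply Clim_minus; [exact FF|exact LE|apply Clim_const; exact FF]. }
assert (N := cexp_kapf_neq1 x0 t0 Hx).
unfold gE; apply Clim_mult; [exact FF| |].
- apply Clim_div; [exact FF|exact (Cmult_neq_0 _ _ N N)| |].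
  + apply Clim_mult; [exact FF| |exact LE].
    apply Clim_mult; [exact FF|apply Clim_const; exact FF|apply Clim_mult; [exact FF|exact Lk|exact Lk]].
  + apply Clim_mult; [exact FF|exact L1|exact L1].
- apply Clim_cexp; [exact FF|]; apply Clim_sc; [exact FF|exact Lt].
Qed.

Lemma rho_exp_lt (n : nat) : (0 < n)%nat -> 0 <= rho * exp (- / INR n) < rho.
Proof.
intros Hn; pose proof rho_pos as R0; apply lt_INR in Hn; simpl in Hn.
assert (0 < / INR n) by (now apply Rinv_0_lt_compat).
pose proof (exp_pos (- / INR n)).
assert (exp (- / INR n) < 1) by (rewrite <- exp_0; apply exp_increasing; lra).
split; nra.
Qed.

Lemma dom_le (B B' : R) (f : R -> R) : B <= B' -> dom B f -> dom B' f.
Proof.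
intros HB [H0 [HC Hd]]; split; [lra|split; [exact HC|]].
intros t; eapply Rle_trans; [apply Hd|]; apply Rmult_le_compat_r; [left; apply gd_pos|exact HB].
Qed.

(** The difference [e_h - e_(h+1)] counts trees of height exactly [h + 1], hence the successor. *)
Definition tied (n h : nat) (x : R) : Prop := INR (S h) = x * sqrt (INR n).

Lemma near_inf_h x0 t0 : Clim (near_inf tied x0 t0)
  (fun i => RtoC (INR (snd (fst i)) / sqrt (INR (fst (fst i))))) (RtoC x0).
Proof.
assert (FF := near_inf_filter tied x0 t0).
assert (Hn := near_inf_n tied x0 t0).
eapply Clim_ext_loc; [exact FF| |].
2:{ replace (RtoC x0) with (RtoC x0 - 0)%C by ring.
    apply Clim_minus; [exact FF|apply near_inf_x|].
    apply (Clim_inv_N (near_inf tied x0 t0) (fun i => sqrt (INR (fst (fst i))))).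
    intros M; apply (eventually_sqrt_gt (near_inf tied x0 t0) _ Hn). }
destruct (Hn 0) as [d Hd]; exists d; intros n h x t HQ Hn' Hx Ht; specialize (Hd n h x t HQ Hn' Hx Ht); simpl in *.
assert (sn : 0 < sqrt (INR n)) by (now apply sqrt_lt_R0).
unfold tied in HQ; rewrite S_INR in HQ.
rewrite <- RtoC_inv, <- RtoC_minus by lra; f_equal.
replace (INR h) with (x * sqrt (INR n) - 1) by lra; field; lra.
Qed.

Lemma height_coef_limit (x0 x1 eps : R) : 0 < x0 -> 0 < eps -> exists N, forall n h x, (N <= n)%nat -> tied n h x ->
  x0 <= x <= x1 ->
  Rabs (2 * PI * INR n * (INR n * (ecoef h n - ecoef (S h) n) * rho ^ n) - IntR (fun t => Re (gE x t))) <= eps.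
Proof.
intros Hx0 He.
(* Because of the shift by one in [tied], only [h >= (x0 / 2) sqrt n] is available, and that once
   [x0 sqrt n >= 2]; this explains the threshold [4 / x0^2] below. *)
destruct (outer_bound (x0 / 2) ltac:(lra)) as [B1 [n1 [B10 [n10 HB1]]]].
destruct (dom_gE x0 Hx0) as [B2 HB2].
set (f := fun i : nat * nat * (R * R) => let n := fst (fst i) in let h := snd (fst i) in
   let t := snd (snd i) in (RtoC (INR n) * (Ef h (zc n t) - Ef (S h) (zc n t)) * cexp (sc t))%C).
pose proof (exp_pos 1) as e1.
set (B := Rmax (B1 * exp 1) B2).
assert (HBl : B1 * exp 1 <= B) by apply Rmax_l.
assert (HBr : B2 <= B) by apply Rmax_r.
destruct (archimed (4 / x0 ^ 2)) as [Ar _].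
set (n0 := (n1 + Z.to_nat (up (4 / x0 ^ 2)))%nat).
assert (Hn0 : forall n, (n0 <= n)%nat -> (0 < n)%nat /\ (n1 <= n)%nat /\ 4 / x0 ^ 2 <= INR n).
{ intros n Hn; repeat split; try (unfold n0 in Hn; lia).
  assert (H : (Z.to_nat (up (4 / x0 ^ 2)) <= n)%nat) by (unfold n0 in Hn; lia).
  apply le_INR in H; assert (0 < 4 / x0 ^ 2) by (apply Rdiv_lt_0_compat; [lra|now apply pow_lt]).
  rewrite INR_IZR_INZ, Z2Nat.id in H by (apply le_IZR; lra); lra. }
assert (Four : forall n h x, (n0 <= n)%nat ->
   is_RInt (fun t => Re (f ((n, h), (x, t)))) (- (PI * INR n)) (PI * INR n)
     (2 * PI * INR n * (INR n * (ecoef h n - ecoef (S h) n) * rho ^ n))).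
{ intros n h x Hn; destruct (Hn0 n Hn) as [n00 _].
  pose proof (rho_exp_lt n n00) as Hr.
  assert (A1 := acv_ecoef h _ (conj (proj1 Hr) (Rlt_le _ _ (proj2 Hr)))).
  assert (A2 := acv_ecoef (S h) _ (conj (proj1 Hr) (Rlt_le _ _ (proj2 Hr)))).
  pose proof (is_RInt_minus _ _ _ _ _ _ (fourier_coef _ n n00 A1) (fourier_coef _ n n00 A2)) as H.
  apply (is_RInt_scal (V := R_NormedModule) _ _ _ (INR n)) in H.
  match type of H with is_RInt _ _ _ ?v => replace (2 * PI * INR n * (INR n * (ecoef h n - ecoef (S h) n) * rho ^ n))
    with v by (unfold scal, minus, plus, opp; simpl; unfold mult; simpl; ring) end.
  eapply is_RInt_ext; [|exact H]; intros t _; unfold f; cbv beta; cbn [fst snd].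
  change (INR n * (Re (CPS (ecoef h) (zc n t) * cexp (sc t))%C + - Re (CPS (ecoef (S h)) (zc n t) * cexp (sc t))%C) =
    Re (RtoC (INR n) * (Ef h (zc n t) - Ef (S h) (zc n t)) * cexp (sc t))%C).
  rewrite <- !Cmult_assoc, re_scal_l; unfold Ef.
  replace ((CPS (ecoef h) (zc n t) - CPS (ecoef (S h)) (zc n t)) * cexp (sc t))%C with
   (CPS (ecoef h) (zc n t) * cexp (sc t) - CPS (ecoef (S h)) (zc n t) * cexp (sc t))%C by ring.
  unfold Cminus; rewrite re_plus, re_opp; reflexivity. }
destruct (fourier_limit tied x0 x1 B f gE n0 eps He) as [N HN].
- assert (0 < B1 * exp 1) by nra; lra.
- intros x Hx; apply (dom_le B2); [exact HBr|apply HB2; lra].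
- intros n h x Hn _ _; eexists; exact (Four n h x Hn).
- intros n h x t Hn Hq Hx Ht; destruct (Hn0 n Hn) as [n00 [n01 n02]]; unfold f; cbn [fst snd].
  rewrite Cmod_mult, Cmod_cexp_sc, Cmod_mult, Cmod_R, Rabs_pos_eq by apply pos_INR.
  assert (Hb := HB1 n h t n01).
  assert (sn : 2 / x0 <= sqrt (INR n)).
  { rewrite <- (sqrt_pow2 (2 / x0)) by (apply Rdiv_le_0_compat; lra).
    apply sqrt_le_1_alt; replace ((2 / x0) ^ 2) with (4 / x0 ^ 2) by (field; lra); exact n02. }
  assert (sn2 : 2 <= x0 * sqrt (INR n)).
  { replace 2 with (x0 * (2 / x0)) by (field; lra); apply Rmult_le_compat_l; lra. }
  unfold tied in Hq; rewrite S_INR in Hq.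
  assert (x0 * sqrt (INR n) <= x * sqrt (INR n)) by (apply Rmult_le_compat_r; [apply sqrt_pos|lra]).
  specialize (Hb ltac:(lra) Ht); pose proof (gd_pos t).
  apply Rle_trans with (B1 * gd t * exp 1); [apply Rmult_le_compat_r; lra|].
  replace (B1 * gd t * exp 1) with (B1 * exp 1 * gd t) by ring; apply Rmult_le_compat_r; lra.
- intros y t0 Hy; split; [|apply near_inf_gE; lra].
  assert (FF := near_inf_filter tied y t0).
  unfold f, gE; apply Clim_mult; [exact FF| |].
  + apply (Clim_height (near_inf tied y t0) (fun i => fst (fst i)) (fun i => snd (snd i)) t0
      (near_inf_n tied y t0) (near_inf_t tied y t0) (fun i => snd (fst i)) y); [lra|apply near_inf_h].
  + apply Clim_cexp; [exact FF|]; apply Clim_sc; [exact FF|apply near_inf_t].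
- exists (N + n0)%nat; intros n h x Hn Hq Hx.
  specialize (HN n h x ltac:(lia) Hq Hx).
  rewrite (is_RInt_unique _ _ _ _ (Four n h x ltac:(lia))) in HN; exact HN.
Qed.

(** [fourier_limit] with a trivial constraint and the parameter [x] frozen at 0. The limit integral
    is [lambda / 4] times [Ik 0 0 = 2 Cg]. *)
Lemma size_coef_limit (eps : R) : 0 < eps -> exists N, forall n, (N <= n)%nat ->
  Rabs (2 * PI * INR n * (/ sqrt (INR n) ^ 3 * ycoef2 n * rho ^ n) - lambda / 2 * Cg) <= eps.
Proof.
intros He.
destruct Y2f_bound as [B1 [n1 [B10 [n10 HB1]]]].
set (f := fun i : nat * nat * (R * R) => let n := fst (fst i) in
   let t := snd (snd i) in (RtoC (/ sqrt (INR n) ^ 3) * Y2f (zc n t) * cexp (sc t))%C).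
set (l := fun (x t : R) => (RtoC (lambda / 4) * fk 0 0 t)%C).
pose proof (exp_pos 1) as e1; pose proof lambda_pos as L0.
set (Q := fun (n h : nat) (x : R) => True).
assert (D0 := dom_fk0 0 (Rle_refl 0)).
assert (D1 := dom_scal (lambda / 4) _ _ D0).
assert (El : forall x t, lambda / 4 * Re (fk 0 0 t) = Re (l x t)).
{ intros x t; unfold l; now rewrite re_scal_l. }
set (B := Rmax (B1 * exp 1) (Rabs (lambda / 4) * (3 * exp 1))).
assert (HBl : B1 * exp 1 <= B) by apply Rmax_l.
assert (HBr : Rabs (lambda / 4) * (3 * exp 1) <= B) by apply Rmax_r.
assert (Four : forall n h x, (n1 <= n)%nat ->
   is_RInt (fun t => Re (f ((n, h), (x, t)))) (- (PI * INR n)) (PI * INR n)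
     (2 * PI * INR n * (/ sqrt (INR n) ^ 3 * ycoef2 n * rho ^ n))).
{ intros n h x Hn; pose proof (fourier_coef ycoef2 n ltac:(lia) (acv_ycoef2 _ (rho_exp_lt n ltac:(lia)))) as H.
  apply (is_RInt_scal (V := R_NormedModule) _ _ _ (/ sqrt (INR n) ^ 3)) in H.
  match type of H with is_RInt _ _ _ ?v => replace (2 * PI * INR n * (/ sqrt (INR n) ^ 3 * ycoef2 n * rho ^ n))
    with v by (unfold scal; simpl; unfold mult; simpl; ring) end.
  eapply is_RInt_ext; [|exact H]; intros t _; unfold f; cbv beta; cbn [fst snd].
  rewrite <- Cmult_assoc, re_scal_l; reflexivity. }
destruct (fourier_limit Q 0 0 B f l n1 eps He) as [N HN].
- assert (0 < B1 * exp 1) by nra; lra.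
- intros x Hx; apply (dom_le _ _ _ HBr); exact (dom_ext _ _ _ (El x) D1).
- intros n h x Hn _ _; eexists; exact (Four n h x Hn).
- intros n h x t Hn _ Hx Ht; unfold f; cbn [fst snd].
  rewrite Cmod_mult, Cmod_cexp_sc, Cmod_mult, Cmod_R, Rabs_pos_eq.
  2:{ left; apply Rinv_0_lt_compat, pow_lt, sqrt_lt_R0, lt_0_INR; lia. }
  assert (Hb := HB1 n t Hn Ht); pose proof (gd_pos t).
  apply Rle_trans with (B1 * gd t * exp 1); [apply Rmult_le_compat_r; lra|].
  replace (B1 * gd t * exp 1) with (B1 * exp 1 * gd t) by ring; apply Rmult_le_compat_r; lra.
- intros y t0 Hy; assert (FF := near_inf_filter Q y t0).
  assert (r0 := rt_neq0 t0).
  assert (E : forall x t, l x t = (RtoC (lambda / 4) * / (rt t * (rt t * rt t)) * cexp (sc t))%C).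
  { intros x t; unfold l, fk, phik.
    replace (sc t - RtoC 0 * rt t)%C with (sc t) by ring; simpl; field; exact (rt_neq0 t). }
  assert (Ls : Clim (near_inf Q y t0) (fun i => cexp (sc (snd (snd i)))) (cexp (sc t0))).
  { apply Clim_cexp; [exact FF|]; apply Clim_sc; [exact FF|apply near_inf_t]. }
  rewrite E; split.
  + unfold f; apply Clim_mult; [exact FF| |exact Ls].
    apply (Clim_Y2f (near_inf Q y t0) (fun i => fst (fst i)) (fun i => snd (snd i)) t0
      (near_inf_n Q y t0) (near_inf_t Q y t0)).
  + eapply Clim_ext; [exact FF|intros i; symmetry; apply E|].
    apply Clim_mult; [exact FF| |exact Ls].
    apply Clim_mult; [exact FF|apply Clim_const; exact FF|].
    pose proof (near_inf_rt Q y t0) as Lr.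
    apply Clim_inv; [exact FF|exact (Cmult_neq_0 _ _ r0 (Cmult_neq_0 _ _ r0 r0))|].
    apply Clim_mult; [exact FF|exact Lr|apply Clim_mult; [exact FF|exact Lr|exact Lr]].
- exists (N + n1)%nat; intros n Hn.
  specialize (HN n 0%nat 0 ltac:(lia) I ltac:(lra)).
  rewrite (is_RInt_unique _ _ _ _ (Four n 0%nat 0 ltac:(lia))) in HN.
  rewrite <- (IntR_ext _ _ (El 0)), (IntR_scal _ _ _ D0) in HN.
  change (IntR (fun t => Re (fk 0 0 t))) with (Ik 0 0) in HN; rewrite Ik0_0 in HN.
  replace (lambda / 2 * Cg) with (lambda / 4 * (2 * Cg)) by field; exact HN.
Qed.

Lemma sum_succ_pow_le (q : R) (M : nat) : 0 <= q < 1 ->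
  sum_f_R0 (fun m => INR (S m) * q ^ m) M <= / (1 - q) ^ 2.
Proof.
intros Hq.
assert (E : sum_f_R0 (fun m => INR (S m) * q ^ m) M * (1 - q) ^ 2 =
  1 - INR (S (S M)) * q ^ S M + INR (S M) * q ^ S (S M)).
{ induction M; [simpl; ring|]. rewrite tech5, Rmult_plus_distr_r, IHM, !S_INR; simpl; ring. }
assert (P : 0 < (1 - q) ^ 2) by (apply pow_lt; lra).
apply Rmult_le_reg_r with ((1 - q) ^ 2); [exact P|].
rewrite E, Rinv_l by lra.
replace (INR (S (S M)) * q ^ S M) with (INR (S M) * q ^ S M + q ^ S M) by (rewrite (S_INR (S M)); ring).
assert (0 <= q ^ S M) by (apply pow_le; lra).
assert (INR (S M) * q ^ S (S M) <= INR (S M) * q ^ S M).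
{ apply Rmult_le_compat_l; [apply pos_INR|]; change (q ^ S (S M)) with (q * q ^ S M); nra. }
lra.
Qed.

Lemma sqrt_le_half_sum (a b : R) : 0 <= a -> 0 < b -> sqrt a <= sqrt b * (1 + a / b).
Proof.
intros Ha Hb; assert (sb := sqrt_lt_R0 b Hb).
assert (Hx : 0 <= a / b) by (apply Rdiv_le_0_compat; lra).
replace a with (b * (a / b)) at 1 by (field; lra).
rewrite sqrt_mult by lra; apply Rmult_le_compat_l; [lra|].
pose proof (sqrt_pos (a / b)); pose proof (sqrt_sqrt (a / b) Hx); nra.
Qed.

(* If [Cg] vanished, the coefficients of [Y2f] would be o(sqrt m), hence [Y2f (zc n 0)] would be o(n^(3/2)),
   against [Clim_Y2f] at [t = 0]. *)
Lemma Cg_pos : 0 < Cg.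
Proof.
pose proof lambda_pos as L0; pose proof PI2_3_2 as Hpi; unfold PI2 in Hpi.
apply Rnot_le_lt; intros HC.
(* In the end [6 / 100] from the bound [Up] and [1 / 100] from its term [2 A n] must stay below the
   [1/8] obtained from [Clim_Y2f]. *)
set (eps := lambda / 100).
destruct (size_coef_limit eps ltac:(unfold eps; lra)) as [N HN].
set (c := fun m => ycoef2 m * rho ^ m).
assert (c0 : forall m, 0 <= c m).
{ intros m; apply Rmult_le_pos; [apply ycoef2_ge0|apply pow_le; left; apply rho_pos]. }
set (A := sum_f_R0 c N).
assert (A0 : 0 <= A) by (apply cond_pos_sum, c0).
(* [A] absorbs the finitely many small indices; for the others [Cg <= 0] leaves only the error of
   [size_coef_limit]. *)
assert (Hc : forall m, c m <= A + eps * sqrt (INR m)).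
{ intros m; pose proof (sqrt_pos (INR m)) as sm.
  destruct (le_lt_dec m N) as [Hm|Hm].
  - assert (c m <= A); [|unfold eps; nra].
    clear HN; unfold A; induction N; [replace m with 0%nat by lia; simpl; lra|].
    rewrite tech5; destruct (Nat.eq_dec m (S N)) as [->|Hne].
    + pose proof (cond_pos_sum c N c0); lra.
    + assert (m <= N)%nat by lia. pose proof (c0 (S N)); specialize (IHN (cond_pos_sum c N c0) H); lra.
  - specialize (HN m ltac:(lia)).
    assert (m0 : 0 < INR m) by (apply lt_0_INR; lia).
    assert (s0 : 0 < sqrt (INR m)) by (now apply sqrt_lt_R0).
    assert (E : 2 * PI * INR m * (/ sqrt (INR m) ^ 3 * ycoef2 m * rho ^ m) = 2 * PI * (c m / sqrt (INR m))).
    { unfold c; rewrite <- (sqrt_sqrt (INR m)) at 1 by lra; field; lra. }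
    rewrite E in HN.
    pose proof (Rle_abs (2 * PI * (c m / sqrt (INR m)) - lambda / 2 * Cg)).
    assert (H1 : c m / sqrt (INR m) <= eps).
    { assert (0 <= c m / sqrt (INR m)) by (apply Rdiv_le_0_compat; [apply c0|lra]). nra. }
    apply (Rmult_le_compat_r (sqrt (INR m))) in H1; [|lra].
    unfold Rdiv in H1; rewrite Rmult_assoc, Rinv_l, Rmult_1_r in H1 by lra; lra. }
(* [sqrt m <= sqrt n (1 + m / n)] reduces the sum to those of [q^m] and [(m + 1) q^m], and
   [1 - q >= 1 / (2 n)] bounds both. *)
assert (Up : forall n, (0 < n)%nat -> Cmod (Y2f (zc n 0)) <= 2 * A * INR n + 6 * eps * (INR n * sqrt (INR n))).
{ intros n Hn; assert (n0 : 0 < INR n) by (now apply lt_0_INR).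
  assert (s0 : 0 < sqrt (INR n)) by (now apply sqrt_lt_R0).
  destruct (exp_neg_inv_bounds n Hn) as [[H1 H2] H3].
  set (q := exp (- / INR n)) in *.
  assert (i0 : 0 < / (2 * INR n)) by (apply Rinv_0_lt_compat; lra).
  assert (iq : / (1 - q) <= 2 * INR n).
  { rewrite <- (Rinv_inv (2 * INR n)); apply Rinv_le_contravar; lra. }
  pose proof (rho_exp_lt n Hn) as Hr; fold q in Hr.
  unfold Y2f; eapply Rle_trans; [apply (CPS_Cmod_le ycoef2 _ (rho * q))|].
  { apply acv_ycoef2, Hr. }
  { right; apply Cmod_zc, Hn. }
  assert (L : is_lim_seq (sum_n (fun m => Rabs (ycoef2 m) * (rho * q) ^ m)) (Series (fun m => Rabs (ycoef2 m) * (rho * q) ^ m))).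
  { apply (Series_correct (fun m => Rabs (ycoef2 m) * (rho * q) ^ m)), acv_ycoef2, Hr. }
  apply (is_lim_seq_le _ (fun _ => 2 * A * INR n + 6 * eps * (INR n * sqrt (INR n)))
     (Series (fun m => Rabs (ycoef2 m) * (rho * q) ^ m)) (2 * A * INR n + 6 * eps * (INR n * sqrt (INR n)))) with (2 := L);
   [|apply is_lim_seq_const].
  intros M; rewrite sum_n_Reals.
  assert (q0 : 0 <= q) by (left; apply exp_pos).
  assert (e0 : 0 < eps) by (unfold eps; lra).
  apply Rle_trans with (sum_f_R0 (fun m => q ^ m * (A + eps * sqrt (INR n)) + INR (S m) * q ^ m * (eps * sqrt (INR n) / INR n)) M).
  { apply sum_Rle; intros m _.
    assert (qm : 0 <= q ^ m) by (now apply pow_le).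
    rewrite Rabs_pos_eq by apply ycoef2_ge0; rewrite Rpow_mult_distr, <- Rmult_assoc; fold (c m).
    pose proof (sqrt_le_half_sum (INR m) (INR n) (pos_INR m) n0) as Hs.
    apply Rle_trans with ((A + eps * (sqrt (INR n) * (1 + INR m / INR n))) * q ^ m).
    - apply Rmult_le_compat_r; [exact qm|]; specialize (Hc m); nra.
    - rewrite S_INR; assert (0 <= q ^ m * (eps * sqrt (INR n) / INR n)).
      { apply Rmult_le_pos; [exact qm|]; apply Rdiv_le_0_compat; nra. }
      replace ((A + eps * (sqrt (INR n) * (1 + INR m / INR n))) * q ^ m) with
       (q ^ m * (A + eps * sqrt (INR n)) + INR m * q ^ m * (eps * sqrt (INR n) / INR n)) by (field; lra). lra. }
  rewrite sum_plus, <- !scal_sum.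
  assert (Q1 : sum_f_R0 (fun m => q ^ m) M <= 2 * INR n).
  { apply Rle_trans with (/ (1 - q)).
    - apply Rmult_le_reg_r with (1 - q); [lra|]; rewrite Rinv_l by lra.
      assert (E : forall M, sum_f_R0 (fun m => q ^ m) M * (1 - q) = 1 - q ^ S M).
      { intros M'; induction M'; [simpl; ring|]; rewrite tech5, Rmult_plus_distr_r, IHM'; simpl; ring. }
      rewrite E; pose proof (pow_le q (S M) q0); lra.
    - exact iq. }
  assert (Q2 : sum_f_R0 (fun m => INR (S m) * q ^ m) M <= 4 * INR n ^ 2).
  { eapply Rle_trans; [apply sum_succ_pow_le; lra|].
    assert (0 < / (1 - q)) by (apply Rinv_0_lt_compat; lra).
    rewrite <- pow_inv; replace (4 * INR n ^ 2) with ((2 * INR n) ^ 2) by ring; apply pow_incr; lra. }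
  assert (es : 0 < eps * sqrt (INR n)) by nra.
  apply Rle_trans with ((A + eps * sqrt (INR n)) * (2 * INR n) + eps * sqrt (INR n) / INR n * (4 * INR n ^ 2)).
  - apply Rplus_le_compat; (apply Rmult_le_compat_l; [|assumption]); [lra|]. apply Rdiv_le_0_compat; lra.
  - right; field; lra. }
assert (Hl : Clim eventually (fun n => RtoC (/ sqrt (INR n) ^ 3) * Y2f (zc n 0))%C
   (RtoC (lambda / 4) * / (rt 0 * (rt 0 * rt 0)))%C).
{ apply (Clim_Y2f eventually (fun n => n) (fun _ => 0) 0).
  - intros M; destruct (nfloor_ex (Rabs M) (Rabs_pos M)) as [k [_ Hk]].
    exists (S k); intros n Hn; apply le_INR in Hn; rewrite S_INR in Hn; pose proof (Rle_abs M); lra.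
  - apply Clim_const; apply eventually_filter. }
assert (Cl : Cmod (RtoC (lambda / 4) * / (rt 0 * (rt 0 * rt 0)))%C = lambda / 4).
{ assert (r1 : Cmod (rt 0) = 1).
  { pose proof (Cmod_rt_sqr 0) as H; replace (1 + 0 ^ 2) with 1 in H by ring; rewrite sqrt_1 in H.
    pose proof (Cmod_ge_0 (rt 0)); nra. }
  assert (r0 := rt_neq0 0).
  rewrite Cmod_mult, Cmod_inv, !Cmod_mult, r1, Cmod_R, Rabs_pos_eq by (try exact (Cmult_neq_0 _ _ r0 (Cmult_neq_0 _ _ r0 r0)); lra).
  field. }
apply (Clim_Cmod_gt _ _ _ (lambda / 8)) in Hl; [|rewrite Cl; lra].
destruct Hl as [N1 Hl].
destruct (nfloor_ex ((200 * A / lambda) ^ 2) (pow2_ge_0 _)) as [k [_ Hk]].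
set (n := (N1 + S k)%nat).
assert (n0 : 0 < INR n) by (apply lt_0_INR; unfold n; lia).
specialize (Hl n ltac:(unfold n; lia)); specialize (Up n ltac:(unfold n; lia)).
assert (s0 : 0 < sqrt (INR n)) by (now apply sqrt_lt_R0).
assert (sn : 200 * A / lambda < sqrt (INR n)).
{ assert (P : 0 <= 200 * A / lambda) by (apply Rdiv_le_0_compat; lra).
  rewrite <- (sqrt_pow2 (200 * A / lambda)) by exact P; apply sqrt_lt_1_alt; split; [apply pow2_ge_0|].
  assert (H : (S k <= n)%nat) by (unfold n; lia); apply le_INR in H; rewrite S_INR in H; lra. }
assert (sn2 : 200 * A < lambda * sqrt (INR n)).
{ replace (200 * A) with (lambda * (200 * A / lambda)) by (field; lra); now apply Rmult_lt_compat_l. }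
rewrite Cmod_mult, Cmod_R, Rabs_pos_eq in Hl by (left; apply Rinv_0_lt_compat, pow_lt; exact s0).
assert (nn := sqrt_sqrt (INR n) (Rlt_le _ _ n0)).
set (s := sqrt (INR n)) in *.
assert (H : lambda / 8 * s ^ 3 < Cmod (Y2f (zc n 0))).
{ apply (Rmult_lt_compat_l (s ^ 3)) in Hl; [|now apply pow_lt].
  rewrite <- Rmult_assoc, Rinv_r, Rmult_1_l in Hl by (apply pow_nonzero; lra); lra. }
rewrite <- nn in Up; unfold eps in Up.
assert (2 * A * (s * s) <= lambda * s / 100 * (s * s)) by (apply Rmult_le_compat_r; nra).
assert (0 < lambda * s ^ 3) by (apply Rmult_lt_0_compat; [lra|now apply pow_lt]).
simpl in *; nra.
Qed.

(** * The theta functional equation *)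

(** Sums over indices below [n], the empty one included, whereas [sum_f_R0] always has at least one
    term. *)
Fixpoint rsum (f : nat -> R) (n : nat) : R :=
  match n with O => 0 | S n => rsum f n + f n end.

Lemma rsum_ext (f g : nat -> R) (n : nat) : (forall i, (i < n)%nat -> f i = g i) -> rsum f n = rsum g n.
Proof. induction n; intros H; [reflexivity|]; simpl; rewrite IHn by (intros; apply H; lia); now rewrite H by lia. Qed.

Lemma rsum_plus (f g : nat -> R) (n : nat) : rsum (fun i => f i + g i) n = rsum f n + rsum g n.
Proof. induction n; simpl; [ring|rewrite IHn; ring]. Qed.

Lemma rsum_scal (c : R) (f : nat -> R) (n : nat) : rsum (fun i => c * f i) n = c * rsum f n.
Proof. induction n; simpl; [ring|rewrite IHn; ring]. Qed.

Lemma rsum_const (c : R) (n : nat) : rsum (fun _ => c) n = INR n * c.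
Proof. induction n; [simpl; ring|]; rewrite S_INR; simpl; rewrite IHn; ring. Qed.

Lemma rsum_swap (f : nat -> nat -> R) (m n : nat) :
  rsum (fun i => rsum (f i) n) m = rsum (fun j => rsum (fun i => f i j) m) n.
Proof.
induction m; simpl; [rewrite rsum_const; ring|].
rewrite IHm, <- rsum_plus; reflexivity.
Qed.

Lemma rsum_add (f : nat -> R) (m n : nat) : rsum f (m + n) = rsum f m + rsum (fun i => f (m + i)%nat) n.
Proof.
induction n; [rewrite Nat.add_0_r; simpl; ring|].
rewrite Nat.add_succ_r; simpl; rewrite IHn; ring.
Qed.

Lemma rsum_multiples (f : nat -> R) (l N : nat) : (0 < l)%nat ->
  (forall k, ~ Nat.divide l k -> f k = 0) ->
  rsum (fun k => f (S k)) (N * l) = rsum (fun r => f (S r * l)%nat) N.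
Proof.
intros Hl H; induction N; [reflexivity|].
replace (S N * l)%nat with (N * l + l)%nat by lia; rewrite rsum_add, IHN; simpl; f_equal.
destruct l as [|l]; [lia|]; simpl.
rewrite (rsum_ext _ (fun _ => 0)), rsum_const.
2:{ intros i Hi; apply H; intros [c Hc].
    assert (N < c < S N)%nat by nia; lia. }
rewrite Rmult_0_r, Rplus_0_l; f_equal; lia.
Qed.

(* [walk m k] is binomial(2m, m+k) / 4^m, the law of the simple random walk at time 2m. *)
Fixpoint walk (m k : nat) : R :=
  match m with
  | O => match k with O => 1 | _ => 0 end
  | S m => match k with
           | O => (walk m 0 + walk m 1) / 2
           | S j => (walk m j + 2 * walk m (S j) + walk m (S (S j))) / 4
           end
  end.

Lemma walk_out (m k : nat) : (m < k)%nat -> walk m k = 0.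
Proof.
revert k; induction m; intros [|k] H; try lia; [reflexivity|]; simpl.
rewrite !IHm by lia; field.
Qed.

(** The ratio of neighbouring binomial coefficients; the Gaussian bounds on [walk] follow from it by
    telescoping products. *)
Lemma walk_ratio (m k : nat) : INR (m + k + 1) * walk m (S k) = (INR m - INR k) * walk m k.
Proof.
revert k; induction m; intros k.
- destruct k; simpl; ring.
- destruct k as [|k].
  + pose proof (IHm 0%nat) as H0; pose proof (IHm 1%nat) as H1; simpl walk.
    rewrite ?plus_INR, ?S_INR in *; simpl INR in *; nra.
  + pose proof (IHm k) as H0; pose proof (IHm (S k)) as H1; pose proof (IHm (S (S k))) as H2.
    simpl walk; rewrite ?plus_INR, ?S_INR in *; simpl INR in *; nra.
Qed.

(** The characteristic function of the walk, folded by symmetry: multiplying by [cos u ^ 2] performs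
    two more steps. *)
Lemma cos_pow_walk (m N : nat) (u : R) : (m < N)%nat ->
  cos u ^ (2 * m) = walk m 0 + 2 * rsum (fun k => walk m (S k) * cos (2 * INR (S k) * u)) N.
Proof.
revert N; induction m; intros N HN.
- simpl walk; rewrite rsum_scal; simpl; ring.
- replace (2 * S m)%nat with (2 + 2 * m)%nat by lia; rewrite pow_add, (IHm N) by lia.
  set (e := fun k => cos (2 * INR k * u)).
  assert (Ec : cos u ^ 2 = (1 + e 1%nat) / 2).
  { unfold e; simpl INR; replace (2 * 1 * u) with (2 * u) by ring; rewrite cos_2a_cos; field. }
  assert (Ek : forall k, cos u ^ 2 * e (S k) = e (S k) / 2 + (e (S (S k)) + e k) / 4).
  { intros k; rewrite Ec; unfold e.
    replace (2 * INR (S (S k)) * u) with (2 * INR (S k) * u + 2 * u) by (rewrite !S_INR; ring).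
    replace (2 * INR k * u) with (2 * INR (S k) * u - 2 * u) by (rewrite !S_INR; ring).
    simpl INR; replace (2 * 1 * u) with (2 * u) by ring.
    rewrite cos_plus, cos_minus; field. }
  (* The truncated sums satisfy the recursion up to a boundary term at [M], which vanishes at [N]
     because the walk has not reached it. *)
  assert (E : forall M, cos u ^ 2 * (walk m 0 + 2 * rsum (fun k => walk m (S k) * e (S k)) M) -
    (walk (S m) 0 + 2 * rsum (fun k => walk (S m) (S k) * e (S k)) M) =
    (walk m M * e (S M) - walk m (S M) * e M) / 2).
  { induction M.
    - simpl rsum; rewrite Ec; simpl walk.
      replace (e 0%nat) with 1 by (unfold e; simpl; rewrite Rmult_0_r, Rmult_0_l, cos_0; reflexivity); field.
    - change (rsum (fun k => walk m (S k) * e (S k)) (S M)) with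
        (rsum (fun k => walk m (S k) * e (S k)) M + walk m (S M) * e (S M)).
      change (rsum (fun k => walk (S m) (S k) * e (S k)) (S M)) with
        (rsum (fun k => walk (S m) (S k) * e (S k)) M + walk (S m) (S M) * e (S M)).
      match goal with |- ?L = _ => replace L with
        ((cos u ^ 2 * (walk m 0 + 2 * rsum (fun k => walk m (S k) * e (S k)) M) -
    (walk (S m) 0 + 2 * rsum (fun k => walk (S m) (S k) * e (S k)) M)) +
     2 * walk m (S M) * (cos u ^ 2 * e (S M)) - 2 * walk (S m) (S M) * e (S M)) by ring end.
      rewrite IHM, Ek; simpl walk; field. }
  specialize (E N); rewrite (walk_out m N), (walk_out m (S N)) in E by lia.
  fold e in E |- *; unfold e in E at 1 2; unfold e; lra.
Qed.

(** Orthogonality over the [(2 L + 1)]-th roots of unity, conjugate roots paired. Multiplied by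
    [sin phi] the sum telescopes to [sin ((2 L + 1) phi) = 0], and [sin phi] vanishes only when
    [2 L + 1] divides [k]. *)
Lemma dirichlet_kernel (L k : nat) :
  1 + 2 * rsum (fun j => cos (2 * INR k * (PI * INR (S j) / INR (2 * L + 1)))) L =
  if Nat.eqb (k mod (2 * L + 1)) 0 then INR (2 * L + 1) else 0.
Proof.
set (l := (2 * L + 1)%nat); assert (l0 : 0 < INR l) by (apply lt_0_INR; unfold l; lia).
destruct (Nat.eqb_spec (k mod l) 0) as [H|H].
- apply Nat.Lcm0.mod_divide in H; destruct H as [c Hc].
  rewrite (rsum_ext _ (fun _ => 1)), rsum_const.
  { unfold l; rewrite plus_INR, mult_INR; simpl; ring. }
  intros i _; rewrite Hc, mult_INR.
  replace (2 * (INR c * INR l) * (PI * INR (S i) / INR l)) with (0 + 2 * INR (c * S i) * PI)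
    by (rewrite mult_INR; field; lra).
  rewrite cos_period; apply cos_0.
- set (phi := INR k * PI / INR l).
  set (f := fun j => cos (2 * INR k * (PI * INR (S j) / INR l))).
  assert (E : forall M, sin phi * (1 + 2 * rsum f M) = sin (INR (2 * M + 1) * phi)).
  { induction M; [simpl; rewrite !Rmult_1_l; ring|].
    change (rsum f (S M)) with (rsum f M + f M); unfold f at 2.
    replace (2 * INR k * (PI * INR (S M) / INR l)) with (INR (2 * S M) * phi)
      by (unfold phi; rewrite mult_INR; simpl (INR 2); field; lra).
    rewrite (Rmult_plus_distr_l 2), <- Rplus_assoc, Rmult_plus_distr_l, IHM.
    replace (INR (2 * M + 1) * phi) with (INR (2 * S M) * phi - phi)
      by (rewrite plus_INR, !mult_INR, (S_INR M); simpl; ring).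
    replace (INR (2 * S M + 1) * phi) with (INR (2 * S M) * phi + phi)
      by (rewrite plus_INR, !mult_INR, (S_INR M); simpl; ring).
    rewrite sin_plus, sin_minus; ring. }
  specialize (E L); fold l in E.
  assert (S0 : sin (INR l * phi) = 0).
  { apply sin_eq_0_1; exists (Z.of_nat k); unfold phi; rewrite <- INR_IZR_INZ; field; lra. }
  rewrite S0 in E; apply Rmult_integral in E; destruct E as [E|E]; [|exact E].
  exfalso; apply sin_eq_0_0 in E; destruct E as [z Hz]; apply H.
  assert (Hz2 : INR k = IZR z * INR l).
  { apply (Rmult_eq_reg_r (PI / INR l)).
    - replace (INR k * (PI / INR l)) with phi by (unfold phi; field; lra); rewrite Hz; field; lra.
    - pose proof PI_RGT_0; apply Rgt_not_eq, Rdiv_lt_0_compat; lra. }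
  rewrite !INR_IZR_INZ, <- mult_IZR in Hz2; apply eq_IZR in Hz2.
  apply Nat.Lcm0.mod_divide; exists (Z.to_nat z); unfold l in *; nia.
Qed.

(* Polya: summing [cos_pow_walk] over the [2 L + 1]-th roots of unity keeps the multiples of [2 L + 1] only;
   with [m ~ tau (2 L + 1)^2] both sides converge and give the theta functional equation. *)
Lemma polya_identity (m L : nat) :
  1 + 2 * rsum (fun j => cos (PI * INR (S j) / INR (2 * L + 1)) ^ (2 * m)) L =
  INR (2 * L + 1) * (walk m 0 + 2 * rsum (fun r => walk m (S r * (2 * L + 1))) (S m)).
Proof.
set (l := (2 * L + 1)%nat); set (N := (S m * l)%nat).
assert (HN : (m < N)%nat) by (unfold N, l; nia).
assert (E1 := cos_pow_walk m N 0 HN); rewrite cos_0, pow1 in E1.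
rewrite (rsum_ext _ (fun k => walk m (S k)) N) in E1 by (intros; rewrite Rmult_0_r, cos_0; ring).
rewrite (rsum_ext _ (fun j => walk m 0 + 2 *
   rsum (fun k => walk m (S k) * cos (2 * INR (S k) * (PI * INR (S j) / INR l))) N) L)
  by (intros; now apply cos_pow_walk).
rewrite rsum_plus, rsum_const, rsum_scal, rsum_swap.
rewrite E1 at 1.
set (g := fun k => walk m k * (if Nat.eqb (k mod l) 0 then INR l else 0)).
assert (E2 : rsum (fun k => g (S k)) N = rsum (fun k => walk m (S k)) N + 2 *
  rsum (fun k => rsum (fun j => walk m (S k) * cos (2 * INR (S k) * (PI * INR (S j) / INR l))) L) N).
{ rewrite <- rsum_scal, <- rsum_plus; apply rsum_ext; intros k _; unfold g.
  rewrite rsum_scal; unfold l; rewrite <- dirichlet_kernel; ring. }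
unfold N in E2 at 1; rewrite (rsum_multiples g) in E2.
2:{ unfold l; lia. }
2:{ intros k Hk; unfold g; destruct (Nat.eqb_spec (k mod l) 0) as [H|H]; [|ring].
    exfalso; apply Hk, Nat.Lcm0.mod_divide, H. }
assert (E3 : rsum (fun r => g (S r * l)%nat) (S m) = INR l * rsum (fun r => walk m (S r * l)) (S m)).
{ rewrite <- rsum_scal; apply rsum_ext; intros r _; unfold g; rewrite Nat.Div0.mod_mul; simpl; ring. }
rewrite E3 in E2.
assert (El : INR l = 2 * INR L + 1) by (unfold l; rewrite plus_INR, mult_INR; simpl; ring).
match goal with |- _ = INR l * (?w + 2 * ?r) =>
  replace (INR l * (w + 2 * r)) with (INR l * w + 2 * (INR l * r)) by ring end.
rewrite E2, El; ring.
Qed.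

Lemma walk_ge0 (m k : nat) : 0 <= walk m k.
Proof.
revert k; induction m; intros [|k]; simpl; try lra.
- pose proof (IHm 0%nat); pose proof (IHm 1%nat); lra.
- pose proof (IHm k); pose proof (IHm (S k)); pose proof (IHm (S (S k))); lra.
Qed.

Lemma walk0_pos (m : nat) : 0 < walk m 0.
Proof. induction m; simpl; [lra|]; pose proof (walk_ge0 m 1); lra. Qed.

Lemma walk0_rec (m : nat) : (2 * INR m + 2) * walk (S m) 0 = (2 * INR m + 1) * walk m 0.
Proof.
pose proof (walk_ratio m 0) as H; simpl walk; rewrite !plus_INR in H; simpl in H; nra.
Qed.

Lemma one_minus_bounds (x : R) : 0 <= x < 1 -> exp (- (x / (1 - x))) <= 1 - x <= exp (- x).
Proof.
intros H; split.
- pose proof (exp_ge_1_plus (x / (1 - x))) as E; rewrite exp_Ropp.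
  replace (1 + x / (1 - x)) with (/ (1 - x)) in E by (field; lra).
  rewrite <- (Rinv_inv (1 - x)) at 2; apply Rinv_le_contravar; [apply Rinv_0_lt_compat; lra|exact E].
- pose proof (exp_ge_1_plus (- x)); lra.
Qed.

Lemma exp_le (x y : R) : x <= y -> exp x <= exp y.
Proof. intros [H| ->]; [left; now apply exp_increasing|lra]. Qed.

(** Passing from [k] to [k + 1] multiplies by [1 - (2 k + 1) / (m + k + 1)], and the odd numbers sum
    to a square. [K] provides a common denominator along the product. *)
Lemma walk_upper (m K k : nat) : (k <= K)%nat -> (0 < m)%nat ->
  walk m k <= walk m 0 * exp (- (INR k ^ 2 / (INR m + INR K))).
Proof.
intros Hk Hm; assert (m0 : 0 < INR m) by (now apply lt_0_INR).
pose proof (pos_INR K) as K0.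
induction k.
- simpl INR; replace (- (0 ^ 2 / (INR m + INR K))) with 0 by (field; lra); rewrite exp_0; lra.
- specialize (IHk ltac:(lia)); pose proof (walk_ratio m k) as H.
  pose proof (pos_INR k) as k0; pose proof (walk_ge0 m k) as w0.
  apply le_INR in Hk; rewrite S_INR in Hk.
  rewrite !plus_INR in H; simpl (INR 1) in H.
  assert (E : walk m (S k) = walk m k * (1 - (2 * INR k + 1) / (INR m + INR k + 1))).
  { apply Rmult_eq_reg_l with (INR m + INR k + 1); [|lra]; rewrite H; field; lra. }
  rewrite E, S_INR.
  replace (exp (- ((INR k + 1) ^ 2 / (INR m + INR K)))) with
    (exp (- (INR k ^ 2 / (INR m + INR K))) * exp (- ((2 * INR k + 1) / (INR m + INR K))))
    by (rewrite <- exp_plus; f_equal; field; lra).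
  rewrite <- Rmult_assoc.
  apply Rle_trans with (walk m k * exp (- ((2 * INR k + 1) / (INR m + INR K)))).
  + apply Rmult_le_compat_l; [exact w0|].
    apply Rle_trans with (exp (- ((2 * INR k + 1) / (INR m + INR k + 1)))).
    * pose proof (exp_ge_1_plus (- ((2 * INR k + 1) / (INR m + INR k + 1)))); lra.
    * apply exp_le, Ropp_le_contravar.
      apply Rmult_le_compat_l; [lra|]; apply Rinv_le_contravar; lra.
  + apply Rmult_le_compat_r; [left; apply exp_pos|exact IHk].
Qed.

Lemma walk_lower (m K k : nat) : (k <= K < m)%nat ->
  walk m 0 * exp (- (INR k ^ 2 / (INR m - INR K))) <= walk m k.
Proof.
intros [Hk Hm]; apply lt_INR in Hm.
induction k.
- simpl INR; replace (- (0 ^ 2 / (INR m - INR K))) with 0 by (field; lra); rewrite exp_0; lra.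
- specialize (IHk ltac:(lia)); pose proof (walk_ratio m k) as H.
  pose proof (pos_INR k) as k0; pose proof (walk_ge0 m k) as w0.
  apply le_INR in Hk; rewrite S_INR in Hk.
  rewrite !plus_INR in H; simpl (INR 1) in H.
  set (v := (2 * INR k + 1) / (INR m + INR k + 1)).
  assert (v0 : 0 <= v < 1).
  { unfold v; split; [apply Rdiv_le_0_compat; lra|]. apply Rmult_lt_reg_r with (INR m + INR k + 1); [lra|].
    unfold Rdiv; rewrite Rmult_assoc, Rinv_l by lra; lra. }
  assert (E : walk m (S k) = walk m k * (1 - v)).
  { apply Rmult_eq_reg_l with (INR m + INR k + 1); [|lra]; rewrite H; unfold v; field; lra. }
  rewrite E, S_INR.
  replace (exp (- ((INR k + 1) ^ 2 / (INR m - INR K)))) with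
    (exp (- (INR k ^ 2 / (INR m - INR K))) * exp (- ((2 * INR k + 1) / (INR m - INR K))))
    by (rewrite <- exp_plus; f_equal; field; lra).
  rewrite <- Rmult_assoc.
  apply Rmult_le_compat; [|left; apply exp_pos|exact IHk|].
  + apply Rmult_le_pos; [apply walk_ge0|left; apply exp_pos].
  + eapply Rle_trans; [|apply (one_minus_bounds v v0)].
    apply exp_le, Ropp_le_contravar.
    replace (v / (1 - v)) with ((2 * INR k + 1) / (INR m - INR k)).
    { apply Rmult_le_compat_l; [lra|]; apply Rinv_le_contravar; lra. }
    unfold v; field; split; [lra|]. intros Hc; apply (Rlt_irrefl 0).
    replace 0 with ((INR m + INR k + 1) - (2 * INR k + 1)) at 2 by lra. lra.
Qed.

(** Finitely many terms converge, and the tail of [M] bounds the rest uniformly. Both sides of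
    [polya_identity] need this exchange of limit and series. *)
Lemma tannery (a : nat -> nat -> R) (b M : nat -> R) (n0 : nat) :
  (forall k, is_lim_seq (fun n => a n k) (b k)) ->
  (forall n k, (n0 <= n)%nat -> Rabs (a n k) <= M k) -> ex_series M ->
  is_lim_seq (fun n => Series (a n)) (Series b).
Proof.
intros Hl Hb HM.
assert (Hbb : forall k, Rabs (b k) <= M k).
{ intros k; assert (L := is_lim_seq_abs _ _ (Hl k)).
  apply (is_lim_seq_le_loc (fun n => Rabs (a n k)) (fun _ => M k) (Rabs (b k)) (M k)) with (2 := L);
    [|apply is_lim_seq_const].
  exists n0; intros n Hn; now apply Hb. }
assert (Ea : forall f, (forall k, Rabs (f k) <= M k) -> ex_series f).
{ intros f Hf; apply (ex_series_le (K := R_AbsRing) (V := R_CompleteNormedModule) f M); [exact Hf|exact HM]. }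
assert (T : forall f K, (forall k, Rabs (f k) <= M k) ->
  Rabs (Series f - sum_n f K) <= Series M - sum_n M K).
{ intros f K Hf.
  assert (D : forall g, ex_series g -> Series g - sum_n g K = Series (fun k => g (S K + k)%nat)).
  { intros g Hg; rewrite (Series_incr_n g (S K)); [|lia|exact Hg]; rewrite sum_n_Reals; simpl pred; ring. }
  eapply Rle_trans; [right; exact (f_equal Rabs (D f (Ea f Hf)))|].
  eapply Rle_trans; [|right; symmetry; exact (D M HM)].
  assert (HM' : ex_series (fun k => M (S K + k)%nat)) by (now apply (ex_series_incr_n (V := R_NormedModule) M (S K))).
  eapply Rle_trans; [apply Series_Rabs|].
  - apply (ex_series_le (K := R_AbsRing) (V := R_CompleteNormedModule) _ (fun k => M (S K + k)%nat)); [|exact HM'].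
    intros k; unfold norm; simpl; unfold abs; simpl; rewrite Rabs_Rabsolu; apply Hf.
  - apply Series_le; [|exact HM']; intros k; split; [apply Rabs_pos|apply Hf]. }
apply is_lim_seq_spec; intros eps; pose proof (cond_pos eps) as e0.
assert (LM : is_lim_seq (sum_n M) (Series M)) by (apply Series_correct in HM; exact HM).
apply is_lim_seq_spec in LM; destruct (LM (mkposreal (eps / 4) ltac:(lra))) as [K HK]; simpl in HK.
specialize (HK K (le_n K)); apply Rabs_def2 in HK.
assert (LS : is_lim_seq (fun n => sum_n (a n) K) (sum_n b K)).
{ clear - Hl; induction K.
  - replace (sum_n b 0) with (b 0%nat) by (symmetry; exact (sum_O b)).
    apply is_lim_seq_ext with (fun n => a n 0%nat); [intros n; symmetry; exact (sum_O (a n))|apply Hl].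
  - replace (sum_n b (S K)) with (sum_n b K + b (S K)) by (symmetry; exact (sum_Sn b K)).
    apply is_lim_seq_ext with (fun n => sum_n (a n) K + a n (S K)); [intros n; symmetry; exact (sum_Sn (a n) K)|].
    apply (is_lim_seq_plus' _ _ _ _ IHK (Hl (S K))). }
apply is_lim_seq_spec in LS; destruct (LS (mkposreal (eps / 4) ltac:(lra))) as [N HN]; simpl in HN.
exists (n0 + N)%nat; intros n Hn.
specialize (HN n ltac:(lia)).
pose proof (T (a n) K (fun k => Hb n k ltac:(lia))) as T1.
pose proof (T b K Hbb) as T2.
apply Rabs_def2 in HN; apply Rabs_le_between in T1; apply Rabs_le_between in T2.
apply Rabs_def1; lra.
Qed.

Lemma sum_n_rsum (f : nat -> R) (n : nat) : sum_n f n = rsum f (S n).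
Proof.
induction n; [eapply eq_trans; [exact (sum_O f)|simpl; ring]|].
eapply eq_trans; [exact (sum_Sn f n)|]; rewrite IHn; reflexivity.
Qed.

Lemma is_series_rsum (f : nat -> R) (N : nat) : (forall k, (N <= k)%nat -> f k = 0) -> is_series f (rsum f N).
Proof.
intros H; enough (L : is_lim_seq (sum_n f) (rsum f N)) by exact L.
apply (is_lim_seq_ext_loc (fun _ => rsum f N)); [|apply is_lim_seq_const].
exists N; intros n Hn; rewrite sum_n_rsum; replace (S n) with (N + (S n - N))%nat by lia.
rewrite rsum_add, (rsum_ext _ (fun _ => 0) (S n - N)) by (intros; apply H; lia).
rewrite rsum_const; ring.
Qed.

Lemma pow_one_minus_lim (x : nat -> R) (N : nat -> nat) (l : R) :
  (forall n, 0 <= x n) -> is_lim_seq x 0 -> is_lim_seq (fun n => INR (N n) * x n) l ->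
  is_lim_seq (fun n => (1 - x n) ^ N n) (exp (- l)).
Proof.
intros H0 H1 H2.
assert (Le : forall u (v : R), is_lim_seq u v -> is_lim_seq (fun n => exp (u n)) (exp v)).
{ intros u v Hu; apply (is_lim_seq_continuous exp u v); [|exact Hu].
  apply derivable_continuous_pt, derivable_pt_exp. }
assert (S1 : exists n1, forall n, (n1 <= n)%nat -> x n < 1).
{ apply is_lim_seq_spec in H1; destruct (H1 (mkposreal 1 Rlt_0_1)) as [n1 Hn1]; exists n1; intros n Hn.
  specialize (Hn1 n Hn); simpl in Hn1; apply Rabs_def2 in Hn1; lra. }
destruct S1 as [n1 Hn1].
apply (is_lim_seq_le_le_loc (fun n => exp (- (INR (N n) * x n / (1 - x n)))) _ (fun n => exp (- (INR (N n) * x n)))).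
- exists n1; intros n Hn; specialize (Hn1 n Hn); specialize (H0 n).
  destruct (one_minus_bounds (x n) ltac:(lra)) as [B1 B2].
  replace (- (INR (N n) * x n / (1 - x n))) with (INR (N n) * - (x n / (1 - x n))) by (field; lra).
  replace (- (INR (N n) * x n)) with (INR (N n) * - x n) by ring.
  rewrite <- !exp_pow; split; apply pow_incr; split; try lra; left; apply exp_pos.
- apply Le. replace (- l) with (- (l / (1 - 0))) by (field; lra).
  apply (is_lim_seq_opp _ (l / (1 - 0))).
  apply is_lim_seq_div'; [exact H2| |lra].
  apply is_lim_seq_minus'; [apply is_lim_seq_const|exact H1].
- apply Le, (is_lim_seq_opp _ l), H2.
Qed.

Definition theta (t : R) : R := 1 + 2 * Series (fun k => exp (- (INR (S k) ^ 2 * t))).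

(** A Wallis-type argument: [m walk(m, 0)^2] increases by [walk0_rec], while
    [(2 m + 1) walk(m, 0)^2] starts at 1 and decreases. *)
Lemma walk0_sqr_lim : exists d, 0 < d /\ is_lim_seq (fun m => INR m * walk m 0 ^ 2) d.
Proof.
set (D := fun m => INR m * walk m 0 ^ 2).
assert (Hr : forall m, walk (S m) 0 = (2 * INR m + 1) / (2 * INR m + 2) * walk m 0).
{ intros m; pose proof (pos_INR m); apply Rmult_eq_reg_l with (2 * INR m + 2); [|lra].
  rewrite walk0_rec; field; lra. }
assert (Hi : forall m, D m <= D (S m)).
{ intros m; unfold D; rewrite Hr, S_INR; pose proof (pos_INR m) as m0.
  pose proof (pow2_ge_0 (walk m 0)) as w0.
  replace ((INR m + 1) * ((2 * INR m + 1) / (2 * INR m + 2) * walk m 0) ^ 2) with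
    ((INR m + / (4 * (INR m + 1))) * walk m 0 ^ 2) by (field; lra).
  apply Rmult_le_compat_r; [exact w0|].
  assert (0 < / (4 * (INR m + 1))) by (apply Rinv_0_lt_compat; lra). lra. }
assert (Hb : forall m, (2 * INR m + 1) * walk m 0 ^ 2 <= 1).
{ induction m; [simpl; lra|]; rewrite Hr, S_INR; pose proof (pos_INR m) as m0.
  pose proof (pow2_ge_0 (walk m 0)) as w0.
  eapply Rle_trans; [|exact IHm].
  replace ((2 * (INR m + 1) + 1) * ((2 * INR m + 1) / (2 * INR m + 2) * walk m 0) ^ 2) with
    ((2 * INR m + 1 - (2 * INR m + 1) / (2 * INR m + 2) ^ 2) * walk m 0 ^ 2) by (field; lra).
  apply Rmult_le_compat_r; [exact w0|].
  assert (0 < (2 * INR m + 1) / (2 * INR m + 2) ^ 2) by (apply Rdiv_lt_0_compat; [lra|apply pow_lt; lra]). lra. }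
destruct (ex_finite_lim_seq_incr D 1 Hi) as [d Hd].
{ intros m; specialize (Hb m); unfold D; pose proof (pow2_ge_0 (walk m 0)); pose proof (pos_INR m); nra. }
exists d; split; [|exact Hd].
apply Rlt_le_trans with (D 1%nat); [unfold D; simpl; lra|].
exact (is_lim_seq_incr_compare D d Hd Hi 1%nat).
Qed.

Lemma ex_series_exp_lin (c : R) : 0 < c -> ex_series (fun k => exp (- (INR (S k) * c))).
Proof.
intros Hc; apply (ex_series_ext (K := R_AbsRing) (V := R_NormedModule) (fun k => exp (- c) * exp (- c) ^ k)).
- intros k; rewrite S_INR.
  rewrite exp_pow, <- exp_plus; f_equal; ring.
- apply (ex_series_scal (V := R_NormedModule)), ex_series_geom.
  rewrite Rabs_pos_eq by (left; apply exp_pos); rewrite <- exp_0; apply exp_increasing; lra.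
Qed.

(** * Scaling limit of Polya's identity *)

Section Scaling.
Variables (tau : R) (tau_pos : 0 < tau).

Let l (L : nat) : nat := (2 * L + 1)%nat.
Let ts (L : nat) : 0 <= tau * INR (l L) ^ 2.
Proof. apply Rmult_le_pos; [lra|apply pow2_ge_0]. Qed.
(** Integer part of [tau l^2], so that the ratio [e L] tends to [tau]. *)
Let m (L : nat) : nat := proj1_sig (nfloor_ex _ (ts L)).
Let e (L : nat) : R := INR (m L) / INR (l L) ^ 2.

Lemma modulus_pos (L : nat) : 0 < INR (l L).
Proof. apply lt_0_INR; unfold l; lia. Qed.

Lemma exponent_bounds (L : nat) : INR (m L) <= tau * INR (l L) ^ 2 < INR (m L) + 1.
Proof. unfold m; destruct (nfloor_ex _ (ts L)); simpl; exact a. Qed.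

Lemma lim_inv_modulus : is_lim_seq (fun L => / INR (l L)) 0.
Proof.
apply is_lim_seq_le_le with (fun _ => 0) (fun L => / INR (S L)).
- intros L; pose proof (modulus_pos L); split; [left; now apply Rinv_0_lt_compat|].
  apply Rinv_le_contravar; [apply lt_0_INR; lia|apply le_INR; unfold l; lia].
- apply is_lim_seq_const.
- apply (is_lim_seq_incr_1 (fun n => / INR n)).
  apply (is_lim_seq_inv _ p_infty); [apply is_lim_seq_INR|discriminate].
Qed.

Lemma exponent_ratio_bounds (L : nat) : tau - / INR (l L) <= e L <= tau.
Proof.
pose proof (modulus_pos L) as l0; pose proof (exponent_bounds L) as [B1 B2]; unfold e.
assert (P : 0 < INR (l L) ^ 2) by now apply pow_lt.
assert (l1 : 1 <= INR (l L)) by (apply (le_INR 1); unfold l; lia).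
split; apply Rmult_le_reg_r with (INR (l L) ^ 2); auto.
- unfold Rdiv at 1; rewrite Rmult_assoc, Rinv_l, Rmult_1_r by lra.
  replace ((tau - / INR (l L)) * INR (l L) ^ 2) with (tau * INR (l L) ^ 2 - INR (l L)) by (field; lra). lra.
- unfold Rdiv; rewrite Rmult_assoc, Rinv_l, Rmult_1_r by lra; lra.
Qed.

Lemma lim_exponent_ratio : is_lim_seq e tau.
Proof.
apply is_lim_seq_le_le with (fun L => tau - / INR (l L)) (fun _ => tau).
- exact exponent_ratio_bounds.
- replace (Finite tau) with (Finite (tau - 0)) by (f_equal; ring).
  apply is_lim_seq_minus'; [apply is_lim_seq_const|apply lim_inv_modulus].
- apply is_lim_seq_const.
Qed.

Lemma exponent_ratio_ge_half : exists L0, forall L, (L0 <= L)%nat -> tau / 2 <= e L.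
Proof.
pose proof lim_exponent_ratio as H; apply is_lim_seq_spec in H.
destruct (H (mkposreal (tau / 2) ltac:(lra))) as [L0 HL]; exists L0; intros L HLL.
specialize (HL L HLL); simpl in HL; apply Rabs_def2 in HL; lra.
Qed.

Let cosum (L k : nat) : R :=
  if Nat.leb (S k) L then cos (PI * INR (S k) / INR (l L)) ^ (2 * m L) else 0.

(** With [u = PI k / l], the term is [(1 - sin^2 u)^m] and [m sin^2 u] tends to [PI^2 tau k^2]. The
    majorant uses [sin u >= u / 3], valid as [u < PI / 2], together with [PI^2 / 9 >= 1]. *)
Lemma lim_cosum : is_lim_seq (fun L => 1 + 2 * Series (cosum L)) (theta (PI ^ 2 * tau)).
Proof.
pose proof PI_RGT_0 as pi0; pose proof PI2_3_2 as pi3; unfold PI2 in pi3; pose proof PI_4 as pi4.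
destruct exponent_ratio_ge_half as [L0 HL0].
apply is_lim_seq_plus'; [apply is_lim_seq_const|].
apply (is_lim_seq_scal_l _ 2 (Series (fun k => exp (- (INR (S k) ^ 2 * (PI ^ 2 * tau)))))).
apply tannery with (M := fun k => exp (- (INR (S k) * (tau / 2)))) (n0 := L0).
- intros k; set (u := fun L => PI * INR (S k) / INR (l L)).
  assert (Lu : is_lim_seq u 0).
  { unfold u, Rdiv; replace (Finite 0) with (Finite (PI * INR (S k) * 0)) by (f_equal; ring).
    apply (is_lim_seq_scal_l _ _ 0), lim_inv_modulus. }
  assert (u0 : forall L, 0 < u L).
  { intros L; unfold u; apply Rdiv_lt_0_compat; [|apply modulus_pos].
    apply Rmult_lt_0_compat; [lra|apply lt_0_INR; lia]. }
  assert (Ls : is_lim_seq (fun L => sin (u L) / u L) 1).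
  { apply (is_lim_comp_seq (fun x => sin x / x) u 0 1); [apply is_lim_sinc_0| |exact Lu].
    exists 0%nat; intros n _; intros H; injection H; pose proof (u0 n); lra. }
  apply is_lim_seq_ext_loc with (fun L => (1 - sin (u L) ^ 2) ^ m L).
  { exists (S k); intros L HL; unfold cosum; replace (Nat.leb (S k) L) with true by (symmetry; apply Nat.leb_le; lia).
    rewrite pow_mult; f_equal; fold (u L); pose proof (sin2_cos2 (u L)); unfold Rsqr in *; simpl; lra. }
  replace (INR (S k) ^ 2 * (PI ^ 2 * tau)) with (INR (S k) ^ 2 * PI ^ 2 * (tau * (1 * 1))) by ring.
  apply pow_one_minus_lim.
  + intros L; apply pow2_ge_0.
  + apply is_lim_seq_le_le with (fun _ => 0) (fun L => u L ^ 2).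
    * intros L; split; [apply pow2_ge_0|]; specialize (u0 L).
      rewrite <- (pow2_abs (sin (u L))), <- (pow2_abs (u L)); apply pow_incr; split; [apply Rabs_pos|].
      rewrite (Rabs_pos_eq (u L)) by lra; apply Rabs_le; split.
      -- pose proof (sin_lt_x (u L) u0). pose proof (SIN_bound (u L)).
         destruct (Rle_lt_dec (u L) PI) as [Hp|Hp]; [pose proof (sin_ge_0 (u L) ltac:(lra) Hp); lra|lra].
      -- left; now apply sin_lt_x.
    * apply is_lim_seq_const.
    * simpl; replace (Finite 0) with (Finite (0 * (0 * 1))) by (f_equal; ring).
      apply is_lim_seq_mult'; [exact Lu|apply is_lim_seq_mult'; [exact Lu|apply is_lim_seq_const]].
  + apply is_lim_seq_ext with (fun L => INR (S k) ^ 2 * PI ^ 2 * (e L * (sin (u L) / u L * (sin (u L) / u L)))).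
    { intros L; pose proof (modulus_pos L) as l0; pose proof (u0 L) as u0'.
      assert (Ee : INR (m L) = e L * (PI * INR (S k) / u L) ^ 2).
      { assert (INR (S k) <> 0) by (apply not_0_INR; lia).
        unfold e, u; field; repeat split; lra || assumption. }
      rewrite Ee; field; lra. }
    apply (is_lim_seq_scal_l _ _ (tau * (1 * 1))).
    apply is_lim_seq_mult'; [exact lim_exponent_ratio|apply is_lim_seq_mult'; exact Ls].
- intros L k HL; specialize (HL0 L HL); unfold cosum.
  destruct (Nat.leb_spec (S k) L) as [H|H].
  2:{ rewrite Rabs_R0; left; apply exp_pos. }
  rewrite pow_mult.
  pose proof (modulus_pos L) as l0; apply le_INR in H.
  assert (k1 : 1 <= INR (S k)) by (apply (le_INR 1); lia).
  assert (El : INR (l L) = 2 * INR L + 1) by (unfold l; rewrite plus_INR, mult_INR; simpl; ring).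
  set (u := PI * INR (S k) / INR (l L)).
  assert (Hu : 0 <= u <= 2).
  { unfold u; split; [apply Rdiv_le_0_compat; nra|].
    apply Rmult_le_reg_r with (INR (l L)); [exact l0|].
    unfold Rdiv at 1; rewrite Rmult_assoc, Rinv_l, Rmult_1_r by lra.
    rewrite El; nra. }
  pose proof (sin_ge_third u Hu) as Hs.
  assert (Ec : cos u ^ 2 = 1 - sin u ^ 2) by (pose proof (sin2_cos2 u); unfold Rsqr in *; simpl; lra).
  rewrite Ec, Rabs_pos_eq by (rewrite <- Ec; apply pow_le, pow2_ge_0).
  assert (B : 1 - sin u ^ 2 <= exp (- (sin u ^ 2))) by (pose proof (exp_ge_1_plus (- sin u ^ 2)); lra).
  apply Rle_trans with (exp (- sin u ^ 2) ^ m L).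
  { apply pow_incr; split; [rewrite <- Ec; apply pow2_ge_0|exact B]. }
  rewrite exp_pow; apply exp_le.
  assert (Hs2 : u ^ 2 / 9 <= sin u ^ 2) by (replace (u ^ 2 / 9) with ((u / 3) ^ 2) by field; apply pow_incr; lra).
  assert (INR (S k) * (tau / 2) <= INR (m L) * (u ^ 2 / 9)).
  { replace (INR (m L) * (u ^ 2 / 9)) with (e L * (PI ^ 2 / 9) * INR (S k) ^ 2) by (unfold e, u; field; lra).
    assert (1 <= PI ^ 2 / 9) by nra.
    assert (INR (S k) <= INR (S k) ^ 2) by nra.
    rewrite (Rmult_comm (INR (S k))); apply Rmult_le_compat; try lra; try nra. }
  pose proof (pos_INR (m L)); nra.
- apply ex_series_exp_lin; lra.
Qed.

Let wsum (L r : nat) : R := walk (m L) (S r * l L) / walk (m L) 0.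

(** At position [r l] the bounds [walk_upper] and [walk_lower] pinch the quotient between Gaussians
    with exponents [r^2 / (e + r / l)] and [r^2 / (e - r / l)]. For the majorant, [K = m] gives one
    bound for all positions up to [m]. *)
Lemma lim_wsum : is_lim_seq (fun L => 1 + 2 * Series (wsum L)) (theta (/ tau)).
Proof.
destruct exponent_ratio_ge_half as [L0 HL0].
apply is_lim_seq_plus'; [apply is_lim_seq_const|].
apply (is_lim_seq_scal_l _ 2 (Series (fun k => exp (- (INR (S k) ^ 2 * / tau))))).
assert (mp : forall L, (L0 <= L)%nat -> (0 < m L)%nat).
{ intros L HL; specialize (HL0 L HL); unfold e in HL0.
  destruct (m L); [|lia]; simpl in HL0; unfold Rdiv in HL0; lra. }
assert (Em : forall L, INR (m L) = e L * INR (l L) ^ 2).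
{ intros L; pose proof (modulus_pos L); unfold e; field; lra. }
assert (Lexp : forall u (v : R), is_lim_seq u v -> is_lim_seq (fun n => exp (- u n)) (exp (- v))).
{ intros u v Hu; apply (is_lim_seq_continuous exp (fun n => - u n) (- v)).
  - apply derivable_continuous_pt, derivable_pt_exp.
  - apply (is_lim_seq_opp _ v), Hu. }
apply tannery with (M := fun k => exp (- (INR (S k) * / (2 * tau)))) (n0 := L0).
- intros r; set (q := INR (S r)).
  assert (q0 : 0 < q) by (apply lt_0_INR; lia).
  assert (Lq : is_lim_seq (fun L => q * / INR (l L)) 0).
  { replace (Finite 0) with (Finite (q * 0)) by (f_equal; ring). apply (is_lim_seq_scal_l _ _ 0), lim_inv_modulus. }
  assert (Big : exists L1, forall L, (L1 <= L)%nat -> q * / INR (l L) < tau / 2).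
  { apply is_lim_seq_spec in Lq; destruct (Lq (mkposreal (tau / 2) ltac:(lra))) as [L1 H1].
    exists L1; intros L HL; specialize (H1 L HL); simpl in H1; apply Rabs_def2 in H1; lra. }
  destruct Big as [L1 HL1].
  apply (is_lim_seq_le_le_loc (fun L => exp (- (q ^ 2 * / (e L - q * / INR (l L))))) _
    (fun L => exp (- (q ^ 2 * / (e L + q * / INR (l L)))))).
  + exists (L0 + L1)%nat; intros L HL; specialize (HL0 L ltac:(lia)); specialize (HL1 L ltac:(lia)).
    specialize (mp L ltac:(lia)); pose proof (modulus_pos L) as l0; pose proof (walk0_pos (m L)) as w0.
    assert (il : 0 < / INR (l L)) by now apply Rinv_0_lt_compat.
    assert (Hk : (S r * l L < m L)%nat).
    { apply INR_lt; rewrite mult_INR, Em; fold q.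
      assert (q * / INR (l L) * INR (l L) ^ 2 < e L * INR (l L) ^ 2) by (apply Rmult_lt_compat_r; [now apply pow_lt|lra]).
      replace (q * / INR (l L) * INR (l L) ^ 2) with (q * INR (l L)) in H by (field; lra); exact H. }
    pose proof (walk_lower (m L) (S r * l L) (S r * l L) (conj (le_n _) Hk)) as W1.
    pose proof (walk_upper (m L) (S r * l L) (S r * l L) (le_n _) mp) as W2.
    rewrite mult_INR, Em in W1, W2; fold q in W1, W2.
    assert (0 < q * / INR (l L)) by nra.
    replace (e L * INR (l L) ^ 2 - q * INR (l L)) with ((e L - q * / INR (l L)) * INR (l L) ^ 2) in W1 by (field; lra).
    replace (e L * INR (l L) ^ 2 + q * INR (l L)) with ((e L + q * / INR (l L)) * INR (l L) ^ 2) in W2 by (field; lra).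
    assert (Eq : forall v, v <> 0 -> (q * INR (l L)) ^ 2 / (v * INR (l L) ^ 2) = q ^ 2 * / v) by (intros v Hv; field; lra).
    rewrite Eq in W1, W2 by lra.
    unfold wsum; split; apply Rmult_le_reg_l with (walk (m L) 0); auto;
      replace (walk (m L) 0 * (walk (m L) (S r * l L) / walk (m L) 0)) with (walk (m L) (S r * l L)) by (field; lra); assumption.
  + apply Lexp; replace (Finite (q ^ 2 * / tau)) with (Finite (q ^ 2 * / (tau - 0))) by (do 3 f_equal; ring).
    apply (is_lim_seq_scal_l _ _ (/ (tau - 0))), (is_lim_seq_inv _ (tau - 0)); [|intros H; injection H; lra].
    apply is_lim_seq_minus'; [exact lim_exponent_ratio|exact Lq].
  + apply Lexp; replace (Finite (q ^ 2 * / tau)) with (Finite (q ^ 2 * / (tau + 0))) by (do 3 f_equal; ring).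
    apply (is_lim_seq_scal_l _ _ (/ (tau + 0))), (is_lim_seq_inv _ (tau + 0)); [|intros H; injection H; lra].
    apply is_lim_seq_plus'; [exact lim_exponent_ratio|exact Lq].
- intros L r HL; specialize (HL0 L HL); specialize (mp L HL); pose proof (modulus_pos L) as l0.
  pose proof (walk0_pos (m L)) as w0; pose proof (exponent_ratio_bounds L) as [_ eb].
  unfold wsum; rewrite Rabs_pos_eq by (apply Rdiv_le_0_compat; [apply walk_ge0|exact w0]).
  set (k := (S r * l L)%nat).
  destruct (le_lt_dec k (m L)) as [Hk|Hk].
  2:{ rewrite walk_out by exact Hk; unfold Rdiv; rewrite Rmult_0_l; left; apply exp_pos. }
  pose proof (walk_upper (m L) (m L) k Hk mp) as W.
  apply Rmult_le_reg_l with (walk (m L) 0); [exact w0|].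
  replace (walk (m L) 0 * (walk (m L) k / walk (m L) 0)) with (walk (m L) k) by (field; lra).
  eapply Rle_trans; [exact W|]; apply Rmult_le_compat_l; [lra|]; apply exp_le, Ropp_le_contravar.
  unfold k; rewrite mult_INR, Em.
  replace (e L * INR (l L) ^ 2 + e L * INR (l L) ^ 2) with (2 * e L * INR (l L) ^ 2) by ring.
  replace ((INR (S r) * INR (l L)) ^ 2 / (2 * e L * INR (l L) ^ 2)) with (INR (S r) ^ 2 * / (2 * e L)) by (field; lra).
  assert (1 <= INR (S r)) by (apply (le_INR 1); lia).
  apply Rmult_le_compat; [lra|left; apply Rinv_0_lt_compat; lra|nra|apply Rinv_le_contravar; lra].
- apply ex_series_exp_lin, Rinv_0_lt_compat; lra.
Qed.

(** Squares are compared because the prefactor [l walk(m, 0)] is controlled through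
    [l^2 walk(m, 0)^2 = m walk(m, 0)^2 / e], which tends to [d / tau]. *)
Lemma jacobi_sqr (d : R) : is_lim_seq (fun m => INR m * walk m 0 ^ 2) d ->
  theta (PI ^ 2 * tau) ^ 2 = d / tau * theta (/ tau) ^ 2.
Proof.
intros Hd.
assert (Id : forall L, 1 + 2 * Series (cosum L) = INR (l L) * walk (m L) 0 * (1 + 2 * Series (wsum L))).
{ intros L; pose proof (walk0_pos (m L)) as w0.
  assert (E1 : Series (cosum L) = rsum (fun j => cos (PI * INR (S j) / INR (l L)) ^ (2 * m L)) L).
  { rewrite (is_series_unique _ _ (is_series_rsum (cosum L) L ltac:(intros k Hk; unfold cosum;
      replace (Nat.leb (S k) L) with false by (symmetry; apply Nat.leb_gt; lia); reflexivity))).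
    apply rsum_ext; intros i Hi; unfold cosum; now replace (Nat.leb (S i) L) with true by (symmetry; apply Nat.leb_le; lia). }
  assert (E2 : Series (wsum L) = rsum (wsum L) (S (m L))).
  { apply is_series_unique, is_series_rsum; intros k Hk; unfold wsum; rewrite walk_out by (unfold l; nia).
    unfold Rdiv; ring. }
  assert (E3 : walk (m L) 0 * rsum (wsum L) (S (m L)) = rsum (fun r => walk (m L) (S r * l L)) (S (m L))).
  { rewrite <- rsum_scal; apply rsum_ext; intros r _; unfold wsum; field; lra. }
  rewrite E1, E2; unfold l at 1; rewrite polya_identity; fold (l L); rewrite <- E3; ring. }
assert (L1 : is_lim_seq (fun L => (1 + 2 * Series (cosum L)) ^ 2) (theta (PI ^ 2 * tau) ^ 2)).
{ simpl; apply is_lim_seq_mult'; [exact lim_cosum|apply is_lim_seq_mult'; [exact lim_cosum|apply is_lim_seq_const]]. }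
destruct exponent_ratio_ge_half as [L0 HL0].
assert (Lm : is_lim_seq (fun L => INR (m L) * walk (m L) 0 ^ 2) d).
{ apply (is_lim_seq_subseq (fun j => INR j * walk j 0 ^ 2) d m); [|exact Hd].
  intros P [N HN]; destruct (nfloor_ex (Rabs (INR (S N) / tau)) (Rabs_pos _)) as [N1 [_ H1]].
  exists (S N1); intros L HL; apply HN.
  apply INR_le, Rlt_le, Rplus_lt_reg_r with 1.
  pose proof (exponent_bounds L) as [_ B]; eapply Rle_lt_trans; [|exact B].
  rewrite <- S_INR; pose proof (Rle_abs (INR (S N) / tau)).
  apply le_INR in HL; rewrite S_INR in HL.
  assert (El : INR (l L) = 2 * INR L + 1) by (unfold l; rewrite plus_INR, mult_INR; simpl; ring).
  assert (0 <= INR N1) by apply pos_INR.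
  assert (INR (S N) / tau <= INR (l L) ^ 2) by nra.
  replace (INR (S N)) with (tau * (INR (S N) / tau)) by (field; lra); apply Rmult_le_compat_l; lra. }
assert (L2 : is_lim_seq (fun L => (1 + 2 * Series (cosum L)) ^ 2) (d / tau * theta (/ tau) ^ 2)).
{ apply is_lim_seq_ext_loc with (fun L => INR (m L) * walk (m L) 0 ^ 2 / e L *
    ((1 + 2 * Series (wsum L)) * ((1 + 2 * Series (wsum L)) * 1))).
  - exists L0; intros L HL; specialize (HL0 L HL); rewrite Id; pose proof (modulus_pos L) as l0.
    replace (INR (m L)) with (e L * INR (l L) ^ 2) by (unfold e; field; lra); field; lra.
  - simpl; apply is_lim_seq_mult'.
    + apply is_lim_seq_div'; [exact Lm|exact lim_exponent_ratio|lra].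
    + apply is_lim_seq_mult'; [exact lim_wsum|apply is_lim_seq_mult'; [exact lim_wsum|apply is_lim_seq_const]]. }
apply is_lim_seq_unique in L1; apply is_lim_seq_unique in L2; rewrite L1 in L2; now injection L2.
Qed.

End Scaling.

Lemma theta_ge1 (t : R) : 0 < t -> 1 <= theta t.
Proof.
intros Ht; unfold theta; enough (0 <= Series (fun k => exp (- (INR (S k) ^ 2 * t)))) by lra.
rewrite <- (is_series_unique _ _ (is_series_rsum (fun _ => 0) 0 (fun _ _ => eq_refl))) at 1.
apply Series_le.
- intros k; split; [lra|left; apply exp_pos].
- apply (ex_series_le (K := R_AbsRing) (V := R_CompleteNormedModule) _ (fun k => exp (- (INR (S k) * t)))).
  + intros k; change (Rabs (exp (- (INR (S k) ^ 2 * t))) <= exp (- (INR (S k) * t))).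
    rewrite Rabs_pos_eq by (left; apply exp_pos); apply exp_le; assert (1 <= INR (S k)) by (apply (le_INR 1); lia).
    assert (INR (S k) * t <= INR (S k) ^ 2 * t) by (apply Rmult_le_compat_r; nra). lra.
  + now apply ex_series_exp_lin.
Qed.

(** Both theta values are at least 1, so square roots may be taken in [jacobi_sqr] with
    [tau = t / PI^2]. *)
Lemma jacobi : exists d, 0 < d /\ forall t, 0 < t -> theta t = d / sqrt t * theta (PI ^ 2 / t).
Proof.
destruct walk0_sqr_lim as [d [d0 Hd]]; pose proof PI_RGT_0 as pi0.
exists (PI * sqrt d); split.
{ apply Rmult_lt_0_compat; [exact pi0|now apply sqrt_lt_R0]. }
intros t Ht.
assert (p2 : 0 < PI ^ 2) by (now apply pow_lt).
assert (tp : 0 < t / PI ^ 2) by (now apply Rdiv_lt_0_compat).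
pose proof (jacobi_sqr _ tp d Hd) as J.
replace (PI ^ 2 * (t / PI ^ 2)) with t in J by (field; lra).
replace (/ (t / PI ^ 2)) with (PI ^ 2 / t) in J by (field; lra).
assert (T1 := theta_ge1 t Ht).
assert (T2 := theta_ge1 (PI ^ 2 / t) (Rdiv_lt_0_compat _ _ p2 Ht)).
assert (st := sqrt_lt_R0 t Ht); assert (sd := sqrt_lt_R0 d d0).
rewrite <- (sqrt_pow2 (theta t)), J by lra.
replace (d / (t / PI ^ 2) * theta (PI ^ 2 / t) ^ 2) with ((PI * sqrt d / sqrt t * theta (PI ^ 2 / t)) ^ 2).
- apply sqrt_pow2; apply Rmult_le_pos; [|lra]; apply Rdiv_le_0_compat; [nra|exact st].
- replace (d / (t / PI ^ 2)) with (sqrt d * sqrt d / (sqrt t * sqrt t / PI ^ 2)) by (rewrite !sqrt_sqrt by lra; reflexivity).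
  field; lra.
Qed.

(** Theta sums as power series in [q = exp (- t)], supported on the positive squares: a factor [n]
    on the coefficient is one application of [q d/dq], so differentiation of power series
    applies. *)
Definition sqcoef (p n : nat) : R :=
  if andb (Nat.ltb 0 n) (Nat.eqb (Nat.sqrt n * Nat.sqrt n) n) then INR n ^ p else 0.

Lemma sqcoef_sqr (p k : nat) : sqcoef p (S k * S k) = INR (S k) ^ (2 * p).
Proof.
unfold sqcoef; rewrite Nat.sqrt_square, Nat.eqb_refl; simpl andb.
rewrite mult_INR, pow_mult; f_equal; ring.
Qed.

Lemma sqcoef_nonsqr (p n : nat) : (forall k, n <> (S k * S k)%nat) -> sqcoef p n = 0.
Proof.
intros H; unfold sqcoef; destruct (Nat.ltb_spec 0 n); simpl; [|reflexivity].
destruct (Nat.eqb_spec (Nat.sqrt n * Nat.sqrt n) n) as [E|E]; [|reflexivity].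
exfalso; destruct (Nat.sqrt n) as [|k]; [lia|]; apply (H k); lia.
Qed.

Lemma rsum_squares (p : nat) (q : R) (K : nat) :
  rsum (fun n => sqcoef p n * q ^ n) (S (K * K)) = rsum (fun k => INR (S k) ^ (2 * p) * q ^ (S k * S k)) K.
Proof.
induction K.
- simpl; rewrite sqcoef_nonsqr by (intros k; lia); ring.
- replace (S (S K * S K)) with (S (K * K) + S (2 * K))%nat by lia.
  rewrite rsum_add, IHK; cbn [rsum]; f_equal.
  rewrite (rsum_ext _ (fun _ => 0)), rsum_const.
  + replace (S (K * K) + 2 * K)%nat with (S K * S K)%nat by lia; rewrite sqcoef_sqr; ring.
  + intros i Hi; rewrite sqcoef_nonsqr; [ring|]; intros k Hk.
    assert (K < S k < S K)%nat by nia; lia.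
Qed.

Lemma acv_sqcoef (p : nat) (r : R) : (p <= 4)%nat -> 0 <= r < 1 -> acv (sqcoef p) r.
Proof.
intros Hp Hr; set (s := sqrt r).
assert (s0 : 0 <= s) by apply sqrt_pos.
assert (ss : s * s = r) by (apply sqrt_sqrt; lra).
assert (s1 : s < 1) by nra.
destruct (poly_geom s ltac:(lra)) as [K [K0 HK]].
unfold acv; apply (ex_series_Rle _ (fun n => K * s ^ n)).
- intros n; assert (P : 0 <= s ^ n) by (now apply pow_le).
  assert (B : 0 <= Rabs (sqcoef p n) <= INR (S n) ^ 4).
  { split; [apply Rabs_pos|]; pose proof (pos_INR n).
    assert (1 <= INR (S n)) by (rewrite S_INR; lra).
    unfold sqcoef; destruct (andb _ _); [|rewrite Rabs_R0; apply pow_le; lra].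
    rewrite Rabs_pos_eq by (now apply pow_le).
    apply Rle_trans with (INR (S n) ^ p); [apply pow_incr; rewrite S_INR; lra|now apply Rle_pow]. }
  rewrite <- ss, Rpow_mult_distr, <- Rmult_assoc; specialize (HK n).
  rewrite Rabs_pos_eq by (repeat apply Rmult_le_pos; lra).
  apply Rmult_le_compat_r; [exact P|]; nra.
- apply (ex_series_scal (V := R_NormedModule)), ex_series_geom; rewrite Rabs_pos_eq; lra.
Qed.

Lemma sqcoef_radius (p : nat) (x : R) : (p <= 4)%nat -> Rabs x < 1 -> Rbar_lt (Rabs x) (CV_radius (sqcoef p)).
Proof.
intros Hp Hx; pose proof (Rabs_pos x).
apply Rbar_lt_le_trans with ((1 + Rabs x) / 2); [simpl; lra|].
apply acv_CV_radius; [lra|]; apply acv_sqcoef; [exact Hp|lra].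
Qed.

(** By [is_series_thU], the sum of [k^(2p) exp (- k^2 t)] over [k >= 1]. *)
Definition thU (p : nat) (t : R) : R := PSeries (sqcoef p) (exp (- t)).

Lemma exp_opp_lt1 (t : R) : 0 < t -> Rabs (exp (- t)) < 1.
Proof.
intros Ht; rewrite Rabs_pos_eq by (left; apply exp_pos); rewrite <- exp_0; apply exp_increasing; lra.
Qed.

Lemma is_series_thU (p : nat) (t : R) : (p <= 4)%nat -> 0 < t ->
  is_series (fun k => INR (S k) ^ (2 * p) * exp (- (INR (S k) ^ 2 * t))) (thU p t).
Proof.
intros Hp Ht; set (q := exp (- t)).
assert (q0 : 0 < q) by apply exp_pos.
assert (A := acv_sqcoef p q Hp ltac:(pose proof (exp_opp_lt1 t Ht) as H; rewrite Rabs_pos_eq in H by (left; apply exp_pos); unfold q; split; [left; apply exp_pos|exact H])).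
assert (E : ex_series (fun n => sqcoef p n * q ^ n)).
{ apply (ex_series_le (K := R_AbsRing) (V := R_CompleteNormedModule) _ (fun n => Rabs (sqcoef p n) * q ^ n)); [|exact A].
  intros n; change (Rabs (sqcoef p n * q ^ n) <= Rabs (sqcoef p n) * q ^ n).
  rewrite Rabs_mult, (Rabs_pos_eq (q ^ n)) by (apply pow_le; lra); lra. }
assert (L : is_lim_seq (sum_n (fun n => sqcoef p n * q ^ n)) (thU p t)).
{ unfold thU, PSeries; fold q; apply Series_correct in E; exact E. }
enough (L2 : is_lim_seq (sum_n (fun k => INR (S k) ^ (2 * p) * exp (- (INR (S k) ^ 2 * t)))) (thU p t)) by exact L2.
apply (is_lim_seq_subseq _ _ (fun K => (S K * S K)%nat)) in L.
- eapply is_lim_seq_ext; [|exact L]; intros K; cbv beta.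
  rewrite !sum_n_rsum, rsum_squares; apply rsum_ext; intros i _; f_equal.
  unfold q; rewrite exp_pow, mult_INR; f_equal; ring.
- intros P [N HN]; exists N; intros n Hn; apply HN; nia.
Qed.

Lemma is_derive_thU (p : nat) (t : R) : (p <= 4)%nat -> 0 < t -> is_derive (thU p) t (- thU (S p) t).
Proof.
intros Hp Ht.
assert (D1 := is_derive_PSeries (sqcoef p) _ (sqcoef_radius p _ Hp (exp_opp_lt1 t Ht))).
assert (D2 : is_derive (fun u => exp (- u)) t (- exp (- t))).
{ auto_derive; [exact I|ring]. }
assert (D3 := is_derive_comp (K := R_AbsRing) (V := R_NormedModule) (PSeries (sqcoef p)) (fun u => exp (- u)) t _ _ D1 D2).
unfold thU; eapply is_derive_eq; [|exact D3].
change (- exp (- t) * PSeries (PS_derive (sqcoef p)) (exp (- t)) = - PSeries (sqcoef (S p)) (exp (- t))).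
rewrite Ropp_mult_distr_l_reverse, <- PSeries_incr_1; f_equal; apply PSeries_ext; intros n.
destruct n as [|n]; [reflexivity|].
unfold PS_incr_1, PS_derive, sqcoef; destruct (andb _ _); [reflexivity|apply Rmult_0_r].
Qed.

Lemma theta_thU (t : R) : 0 < t -> theta t = 1 + 2 * thU 0 t.
Proof.
intros Ht; unfold theta; do 2 f_equal; apply is_series_unique.
eapply is_series_ext; [|apply (is_series_thU 0 t ltac:(lia) Ht)]; intros k; simpl; ring.
Qed.

(** At [t = lambda^2 x^2 / 4] this is one eighth of the series of the theorem, see [theta_series].
    Under [t -> PI^2 / t] this combination transforms without additional terms. *)
Definition thW (t : R) : R := 2 * t ^ 2 * thU 2 t - 3 * t * thU 1 t.

Lemma derive_theta (t : R) : 0 < t -> is_derive theta t (- 2 * thU 1 t).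
Proof.
intros Ht; apply (is_derive_ext_loc (fun t => 1 + 2 * thU 0 t)).
- exists (mkposreal t Ht); intros u Hu; symmetry; apply theta_thU.
  change (Rabs (u - t) < t) in Hu; apply Rabs_def2 in Hu; lra.
- pose proof (is_derive_thU 0 t ltac:(lia) Ht) as H.
  eapply is_derive_eq; [|auto_derive; [eexists; exact H|reflexivity]].
  derive_subst H; ring.
Qed.

Lemma pos_locally (t : R) (P : R -> Prop) : 0 < t -> (forall u, 0 < u -> P u) -> locally t P.
Proof.
intros Ht H; exists (mkposreal t Ht); intros u Hu; apply H.
change (Rabs (u - t) < t) in Hu; apply Rabs_def2 in Hu; lra.
Qed.

Lemma is_derive_dual (c P t : R) (f : R -> R) (f' : R) : 0 < t -> is_derive f (P / t) f' ->
  is_derive (fun t => c / sqrt t * f (P / t)) t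
    (c / sqrt t * (- (/ 2) * f (P / t) - P / t * f') / t).
Proof.
intros Ht H; assert (st := sqrt_lt_R0 t Ht); assert (ss := sqrt_sqrt t (Rlt_le _ _ Ht)).
eapply is_derive_eq; [|auto_derive; [|reflexivity]].
2:{ repeat split; try lra; try exact Ht; eexists; exact H. }
change (P * / t) with (P / t); derive_subst H.
assert (E : t = sqrt t * sqrt t) by (symmetry; exact ss).
set (s := sqrt t) in *.
generalize (f (P / t)); intros y; rewrite E; field; lra.
Qed.

(* With [D = t d/dt], [thW] is [D (2 D + 1) theta / 2], and the substitution [t -> PI^2 / t] turns [D] into [- D]
   while the factor [/ sqrt t] shifts it by [- 1/2]; both effects cancel. *)
Lemma thW_dual : exists d, 0 < d /\ forall t, 0 < t -> thW t = d / sqrt t * thW (PI ^ 2 / t).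
Proof.
destruct jacobi as [d [d0 J]]; exists d; split; [exact d0|].
pose proof PI_RGT_0 as pi0; assert (p2 : 0 < PI ^ 2) by (now apply pow_lt).
assert (up : forall t, 0 < t -> 0 < PI ^ 2 / t) by (intros; now apply Rdiv_lt_0_compat).
(* [- t d/dt] applied to [jacobi]. A further [t d/dt] is applied to this identity below, and [g u]
   is then eliminated between the two. *)
assert (E1 : forall t, 0 < t -> 2 * t * thU 1 t =
  d / sqrt t * (/ 2 * theta (PI ^ 2 / t) - 2 * (PI ^ 2 / t) * thU 1 (PI ^ 2 / t))).
{ intros t Ht.
  assert (D1 := derive_theta t Ht).
  assert (D2 := is_derive_dual d (PI ^ 2) t theta _ Ht (derive_theta _ (up t Ht))).
  apply (is_derive_ext_loc _ theta) in D2; [|apply pos_locally; [exact Ht|intros; symmetry; now apply J]].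
  apply is_derive_unique in D1; apply is_derive_unique in D2; rewrite D1 in D2.
  apply (Rmult_eq_compat_r (- t)) in D2.
  replace (- 2 * thU 1 t * - t) with (2 * t * thU 1 t) in D2 by ring; rewrite D2.
  assert (st := sqrt_lt_R0 t Ht); field; lra. }
intros t Ht.
assert (H1 := is_derive_thU 1 t ltac:(lia) Ht).
assert (D1 : is_derive (fun t => 2 * t * thU 1 t) t (2 * thU 1 t - 2 * t * thU 2 t)).
{ eapply is_derive_eq; [|auto_derive; [eexists; exact H1|reflexivity]]; derive_subst H1; ring. }
set (g := fun u => / 2 * theta u - 2 * u * thU 1 u).
set (u := PI ^ 2 / t) in *.
assert (u0 : 0 < u) by (now apply up).
assert (Dg : is_derive g u (- 3 * thU 1 u + 2 * u * thU 2 u)).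
{ assert (T1 := derive_theta u u0); assert (T2 := is_derive_thU 1 u ltac:(lia) u0).
  unfold g; eapply is_derive_eq; [|auto_derive; [split; [eexists; exact T1|split; [eexists; exact T2|exact I]]|reflexivity]].
  derive_subst T1; derive_subst T2; field. }
assert (D2 := is_derive_dual d (PI ^ 2) t g _ Ht Dg).
apply (is_derive_ext_loc _ (fun t => 2 * t * thU 1 t)) in D2;
  [|apply pos_locally; [exact Ht|intros; symmetry; now apply E1]].
apply is_derive_unique in D1; apply is_derive_unique in D2; rewrite D1 in D2.
apply (Rmult_eq_compat_r t) in D2.
specialize (E1 t Ht); fold u in E1, D2; fold (g u) in E1.
assert (st := sqrt_lt_R0 t Ht).
assert (D3 : (2 * thU 1 t - 2 * t * thU 2 t) * t = - (/ 2) * (d / sqrt t * g u) - d / sqrt t * u * (- 3 * thU 1 u + 2 * u * thU 2 u)).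
{ rewrite D2; field; lra. }
rewrite <- E1 in D3; unfold thW.
replace (d / sqrt t * (2 * u ^ 2 * thU 2 u - 3 * u * thU 1 u)) with (d / sqrt t * u * (- 3 * thU 1 u + 2 * u * thU 2 u)) by ring.
lra.
Qed.

Lemma is_series_thW (t : R) : 0 < t -> is_series (fun k => (2 * t ^ 2 * INR (S k) ^ 4 - 3 * t * INR (S k) ^ 2) *
  exp (- (INR (S k) ^ 2 * t))) (thW t).
Proof.
intros Ht.
pose proof (is_series_scal (K := R_AbsRing) (V := R_NormedModule) (2 * t ^ 2) _ _ (is_series_thU 2 t ltac:(lia) Ht)) as H2.
pose proof (is_series_scal (K := R_AbsRing) (V := R_NormedModule) (- (3 * t)) _ _ (is_series_thU 1 t ltac:(lia) Ht)) as H1.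
pose proof (is_series_plus _ _ _ _ H2 H1) as H.
match type of H with is_series _ ?v => replace (thW t) with v by (unfold thW, scal, plus; simpl; unfold mult; simpl; ring) end.
eapply is_series_ext; [|exact H]; intros k; cbv beta.
change (2 * t ^ 2 * (INR (S k) ^ 4 * exp (- (INR (S k) ^ 2 * t))) + - (3 * t) * (INR (S k) ^ 2 * exp (- (INR (S k) ^ 2 * t))) =
  (2 * t ^ 2 * INR (S k) ^ 4 - 3 * t * INR (S k) ^ 2) * exp (- (INR (S k) ^ 2 * t))); ring.
Qed.

Lemma thW_pos (t : R) : 0 < t -> 0 < thW t.
Proof.
(* Beyond [3/2] every term is positive, its sign being that of [2 t k^2 - 3]. *)
assert (Big : forall t, 3 / 2 < t -> 0 < thW t).
{ intros u Hu; pose proof (is_series_thW u ltac:(lra)) as H.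
  set (f := fun k => (2 * u ^ 2 * INR (S k) ^ 4 - 3 * u * INR (S k) ^ 2) * exp (- (INR (S k) ^ 2 * u))) in *.
  assert (f0 : forall k, 0 < f k).
  { intros k; unfold f; apply Rmult_lt_0_compat; [|apply exp_pos].
    assert (1 <= INR (S k)) by (apply (le_INR 1); lia).
    replace (2 * u ^ 2 * INR (S k) ^ 4 - 3 * u * INR (S k) ^ 2) with (u * INR (S k) ^ 2 * (2 * u * INR (S k) ^ 2 - 3)) by ring.
    assert (1 <= INR (S k) ^ 2) by nra. apply Rmult_lt_0_compat; nra. }
  apply Rlt_le_trans with (f 0%nat); [apply f0|].
  assert (L : is_lim_seq (sum_n f) (thW u)) by exact H.
  replace (f 0%nat) with (sum_n f 0) by exact (sum_O f).
  apply (is_lim_seq_incr_compare (sum_n f) (thW u) L).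
  intros n; eapply Rle_trans; [|right; symmetry; exact (sum_Sn f n)].
  change (sum_n f n <= sum_n f n + f (S n)); pose proof (f0 (S n)); lra. }
intros Ht; destruct (Rlt_le_dec (3 / 2) t) as [H|H]; [now apply Big|].
destruct thW_dual as [d [d0 E]]; rewrite E by exact Ht.
apply Rmult_lt_0_compat; [apply Rdiv_lt_0_compat; [exact d0|now apply sqrt_lt_R0]|].
(* For [t <= 3/2] the dual point is at least [2 PI^2 / 3], well above [3/2]. *)
apply Big; pose proof PI2_3_2 as Hp; unfold PI2 in Hp.
apply Rmult_lt_reg_r with t; [exact Ht|].
unfold Rdiv at 2; rewrite Rmult_assoc, Rinv_l, Rmult_1_r by lra; nra.
Qed.

Lemma theta_series (x : R) : 0 < x -> is_series (theta_term x) (8 * thW (lambda ^ 2 * x ^ 2 / 4)).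
Proof.
intros Hx; pose proof lambda_pos as L0.
assert (P : 0 < lambda ^ 2 * x ^ 2 / 4) by (assert (0 < lambda ^ 2 * x ^ 2) by (apply Rmult_lt_0_compat; now apply pow_lt); lra).
pose proof (is_series_scal (K := R_AbsRing) (V := R_NormedModule) 8 _ _ (is_series_thW _ P)) as H.
eapply is_series_ext; [|exact H]; intros k; unfold theta_term.
change (8 * ((2 * (lambda ^ 2 * x ^ 2 / 4) ^ 2 * INR (S k) ^ 4 - 3 * (lambda ^ 2 * x ^ 2 / 4) * INR (S k) ^ 2) *
  exp (- (INR (S k) ^ 2 * (lambda ^ 2 * x ^ 2 / 4)))) =
  (INR (S k) ^ 4 * lambda ^ 4 * x ^ 4 - 6 * INR (S k) ^ 2 * lambda ^ 2 * x ^ 2) *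
   exp (- (INR (S k) ^ 2 * lambda ^ 2 * x ^ 2 / 4))).
replace (INR (S k) ^ 2 * (lambda ^ 2 * x ^ 2 / 4)) with (INR (S k) ^ 2 * lambda ^ 2 * x ^ 2 / 4) by field; field.
Qed.

(** Continuity on a compact interval turns positivity into a uniform bound; this is what upgrades an
    absolute error to a relative one. *)
Lemma theta_series_lower_bound (x0 x1 : R) : 0 < x0 <= x1 -> exists c, 0 < c /\
  forall x, x0 <= x <= x1 -> c <= Series (theta_term x).
Proof.
intros Hx; pose proof lambda_pos as L0.
set (f := fun x => 8 * thW (lambda ^ 2 * x ^ 2 / 4)).
assert (P : forall x, 0 < x -> 0 < lambda ^ 2 * x ^ 2 / 4).
{ intros x H; assert (0 < lambda ^ 2 * x ^ 2) by (apply Rmult_lt_0_compat; now apply pow_lt); lra. }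
destruct (continuity_ab_min f x0 x1 (proj2 Hx)) as [mx [Hm Hmx]].
{ intros x Hx'; apply continuity_pt_filterlim.
  assert (H1 := is_derive_thU 1 _ ltac:(lia) (P x ltac:(lra))); assert (H2 := is_derive_thU 2 _ ltac:(lia) (P x ltac:(lra))).
  apply (ex_derive_continuous (V := R_NormedModule)); unfold f, thW.
  auto_derive; repeat split; eexists; [exact H2|exact H1]. }
exists (f mx); split; [unfold f; pose proof (thW_pos _ (P mx ltac:(lra))); lra|].
intros x Hx'; rewrite (is_series_unique _ _ (theta_series x ltac:(lra))); now apply Hm.
Qed.

(** * The local limit theorem *)

(** The point 0 lies outside the closed set [K], hence at a positive distance from it. *)
Lemma compact_pos_bounds (K : R -> Prop) : Rtopology.compact K -> (forall x, K x -> 0 < x) ->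
  exists x0 x1, 0 < x0 <= x1 /\ forall x, K x -> x0 <= x <= x1.
Proof.
intros HK Hpos.
destruct (compact_P1 K HK) as [m [M HM]].
assert (N0 : complementary K 0) by (intros H0; specialize (Hpos 0 H0); lra).
destruct (compact_P2 K HK 0 N0) as [d Hd].
exists d, (Rmax d M); pose proof (cond_pos d); pose proof (Rmax_l d M); pose proof (Rmax_r d M).
split; [lra|]; intros x Hx; specialize (HM x Hx); specialize (Hpos x Hx); split; [|lra].
apply Rnot_lt_le; intros Hlt; apply (Hd x); [|exact Hx].
unfold disc; rewrite Rminus_0_r, Rabs_pos_eq; lra.
Qed.

(** The bound on [b - B] has two parts: [B / 2] keeps the denominator away from 0, and [eps B / 4]
    limits its share of the error. *)
Lemma ratio_close (A B a b i0 eps : R) : 0 < eps -> 0 < i0 <= A -> 0 < B ->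
  Rabs (a - A) <= eps * i0 / 4 -> Rabs (b - B) <= Rmin (B / 2) (eps * B / 4) ->
  0 < b /\ Rabs (a / b - A / B) <= eps * (A / B).
Proof.
intros He Hi HB Ha Hb.
assert (Hb1 := Rle_trans _ _ _ Hb (Rmin_l _ _)); assert (Hb2 := Rle_trans _ _ _ Hb (Rmin_r _ _)).
assert (b0 : B / 2 <= b) by (apply Rabs_le_between in Hb1; lra).
split; [lra|].
replace (a / b - A / B) with (((a - A) * B - A * (b - B)) / (b * B)) by (field; lra).
rewrite Rabs_div by nra; rewrite (Rabs_pos_eq (b * B)) by nra.
apply Rmult_le_reg_r with (b * B); [nra|].
unfold Rdiv at 1; rewrite Rmult_assoc, Rinv_l, Rmult_1_r by nra.
replace (eps * (A / B) * (b * B)) with (eps * A * b) by (field; lra).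
apply Rle_trans with (eps * i0 / 4 * B + A * (eps * B / 4)).
- eapply Rle_trans; [apply Rabs_triang|]; rewrite Rabs_Ropp, !Rabs_mult, (Rabs_pos_eq B), (Rabs_pos_eq A) by lra.
  apply Rplus_le_compat; [apply Rmult_le_compat_r; lra|apply Rmult_le_compat_l; lra].
- assert (eps * i0 * B <= eps * A * B) by (apply Rmult_le_compat_r; nra).
  assert (eps * A * (B / 2) <= eps * A * b) by (apply Rmult_le_compat_l; nra). nra.
Qed.

Theorem theorem2 (K : R -> Prop) (K_compact : Rtopology.compact K)
    (K_pos : forall x : R, K x -> 0 < x) (eps : R) (eps_pos : 0 < eps) :
  exists N : nat, forall (n h : nat) (x : R),
    (N <= n)%nat -> K x -> INR h = x * sqrt (INR n) ->
    let approx :=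
      1 / (2 * x * sqrt (INR n)) *
      Series (fun j : nat =>
        let k := INR (S j) in
        (k ^ 4 * lambda ^ 4 * x ^ 4 - 6 * k ^ 2 * lambda ^ 2 * x ^ 2) *
        exp (- (k ^ 2 * lambda ^ 2 * x ^ 2 / 4))) in
    Rabs (prob_height n h - approx) <= eps * Rabs approx.
Proof.
pose proof lambda_pos as L0; pose proof Cg_pos as C0; pose proof PI_RGT_0 as pi0.
destruct (compact_pos_bounds K K_compact K_pos) as [x0 [x1 [Hx HK]]].
destruct (theta_series_lower_bound x0 x1 Hx) as [c [c0 Hc]].
(* A lower bound, uniform on [[x0, x1]], for the limit of the height coefficients; against it
   absolute errors become relative. *)
set (i0 := Cg * lambda / (4 * x1) * c).
assert (I0 : 0 < i0).
{ apply Rmult_lt_0_compat; [|exact c0]; apply Rdiv_lt_0_compat; nra. }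
set (B := lambda / 2 * Cg); assert (B0 : 0 < B) by (apply Rmult_lt_0_compat; lra).
destruct (height_coef_limit x0 x1 (eps * i0 / 4) (proj1 Hx)) as [N1 HN1]; [nra|].
destruct (size_coef_limit (Rmin (B / 2) (eps * B / 4))) as [N2 HN2]; [apply Rmin_glb_lt; nra|].
exists (S (N1 + N2)); intros n h x Hn Kx Hh approx.
specialize (HK x Kx).
assert (n0 : 0 < INR n) by (apply lt_0_INR; lia).
assert (s0 := sqrt_lt_R0 _ n0); assert (ss := sqrt_sqrt (INR n) (Rlt_le _ _ n0)).
(* Height 0 is impossible because [x sqrt n > 0]; the successor puts the height in the form of
   [tied]. *)
destruct h as [|h].
{ simpl in Hh; assert (0 < x * sqrt (INR n)) by (apply Rmult_lt_0_compat; lra); lra. }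
specialize (HN1 n h x ltac:(lia) Hh HK); specialize (HN2 n ltac:(lia)).
set (Th := Series (theta_term x)).
assert (Ea : approx = Th / (2 * x * sqrt (INR n))).
{ unfold approx; change (1 / (2 * x * sqrt (INR n)) * Th = Th / (2 * x * sqrt (INR n))); field; lra. }
assert (HI : IntR (fun t => Re (gE x t)) = Cg * lambda / (4 * x) * Th).
{ assert (S1 := IntR_gE x ltac:(lra)); apply is_series_unique in S1.
  rewrite <- S1; apply (Series_scal_l (Cg * lambda / (4 * x)) (theta_term x)). }
specialize (Hc x HK); fold Th in Hc.
assert (HIb : i0 <= Cg * lambda / (4 * x) * Th).
{ unfold i0; apply Rmult_le_compat; try lra.
  - apply Rdiv_le_0_compat; nra.
  - apply Rmult_le_compat_l; [nra|]; apply Rinv_le_contravar; lra. }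
rewrite HI in HN1.
destruct (ratio_close _ _ _ _ i0 eps eps_pos (conj I0 HIb) B0 HN1 HN2) as [Hb R1].
set (a := ecoef h n - ecoef (S h) n) in *.
assert (Ha : INR (card_Y_height n (S h)) = a).
{ rewrite card_Y_height_ycoef; unfold a, ecoef; ring. }
assert (Ey : 2 * PI * INR n * (/ sqrt (INR n) ^ 3 * ycoef2 n * rho ^ n) = 2 * PI * rho ^ n * (sqrt (INR n) * (INR n * y_coef n))).
{ unfold ycoef2, ycoef1; set (s := sqrt (INR n)) in *; rewrite <- ss; field; lra. }
rewrite Ey in Hb, R1.
assert (rn : 0 < rho ^ n) by (apply pow_lt, rho_pos).
(* Positivity of the scaled count shows that the denominator of the probability is not 0. *)
assert (y0 : y_coef n <> 0) by (intros H; rewrite H, !Rmult_0_r in Hb; lra).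
assert (Ep : prob_height n (S h) = / sqrt (INR n) * (2 * PI * INR n * (INR n * a * rho ^ n) /
   (2 * PI * rho ^ n * (sqrt (INR n) * (INR n * y_coef n))))).
{ unfold prob_height; rewrite Ha; change (INR (card_Y n)) with (y_coef n).
  set (s := sqrt (INR n)) in *; rewrite <- ss; field; repeat split; lra. }
(* Here [Cg] cancels: [(Cg lambda / (4 x)) / (Cg lambda / 2) = 1 / (2 x)]. *)
assert (Ea2 : approx = / sqrt (INR n) * (Cg * lambda / (4 * x) * Th / B)).
{ rewrite Ea; unfold B; field; repeat split; lra. }
assert (is0 : 0 < / sqrt (INR n)) by now apply Rinv_0_lt_compat.
rewrite Ep, Ea2, <- Rmult_minus_distr_l, !(Rabs_mult (/ sqrt (INR n))), (Rabs_pos_eq (/ sqrt (INR n))) by lra.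
rewrite (Rabs_pos_eq (Cg * lambda / (4 * x) * Th / B)) by (apply Rdiv_le_0_compat; lra).
match goal with |- _ <= eps * (?u * ?v) => replace (eps * (u * v)) with (u * (eps * v)) by ring end.
apply Rmult_le_compat_l; [lra|exact R1].
Qed.
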